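(* Let $\theta_1\in\left(\frac{\beta C_A}{1+\beta C_A},1\right)$, $\theta_2\in(0,1)$, and let $v\in W^1_p(\Omega)$ with $|v|_{W^1_p(\Omega)}\neq 0$ satisfy $$|v|_{W^1_p(\Omega)}\le (1-\theta_1)\left(\alpha C_EC_A(1+\beta C_A)\right)^{-1},\qquad |v|_{W^1_p(\Omega)}\le (1-\theta_2)\left(\alpha C_EC_A(1+\beta C_A)^2\right)^{-1}.$$ Let $\mathcal U=\{u\in L^2(I): \|u\|_{L^2(I)}<\theta_1/\alpha\}$. Then for every $u\in\mathcal U$ there exists a unique $(\gamma,y)\in \mathring W^1_\infty(I)\times\mathring W^1_p(\Omega)$ satisfying $|\gamma'|\le 1$ a.e. in $I$ and solving the state equations $$\mathcal B_\Omega[y+v,z;A[\gamma]]=0\quad\forall z\in\mathring W^1_q(\Omega),$$ $$\mathcal B_\Gamma[\gamma,\zeta]+\mathcal B_\Omega[y+v,E\zeta;A[\gamma]]=\int_0^1u\,\zeta\,dx_1\quad\forall \zeta\in\mathring W^1_1(I).$$ Consequently the control-to-state map $G_v:\mathcal U\to\mathring W^1_\infty(I)\times\mathring W^1_p(\Omega)$, $G_v(u):=(\gamma,y)$, is a well-defined one-to-one (nonlinear) operator.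
   Context: Notation: $I=(0,1)$, $\Omega=(0,1)^2$ with points $x=(x_1,x_2)$, $\Gamma=(0,1)\times\{1\}$ (identified with $I$, as are function spaces on them), $\Sigma=\partial\Omega\setminus\Gamma$. $W^1_r$ denotes the usual Sobolev space with integrability exponent $r$, $\mathring W^1_r$ its subspace of functions with zero boundary trace; $|y|_{W^1_r(\Omega)}:=\|\nabla y\|_{L^r(\Omega)}$ and $|\gamma|_{W^1_r(I)}:=\|\gamma'\|_{L^r(I)}$. $\kappa>0$ is a fixed constant. For $\gamma\in\mathring W^1_\infty(I)$ with $|\gamma'|\le1$ a.e. (the state constraint; then $|\gamma|\le 1/2$), $$A[\gamma](x)=\begin{pmatrix}1+\gamma(x_1) & -\gamma'(x_1)x_2\\ -\gamma'(x_1)x_2 & \frac{1+(\gamma'(x_1)x_2)^2}{1+\gamma(x_1)}\end{pmatrix},$$ and $DA[\gamma]\langle h\rangle$, $D^2A[\gamma]\langle h_1,h_2\rangle$ are its first and second directional derivatives with respect to $\gamma$ in directions $h,h_1,h_2\in\mathring W^1_\infty(I)$. Bilinear forms: $\mathcal B_\Gamma[\gamma,\zeta]=\kappa\int_0^1\gamma'\zeta'\,dx_1$, and $\mathcal B_\Omega[y,z;M]=\int_\Omega M\nabla y\cdot\nabla z\,dx$ for a bounded matrix field $M$. Fixed constants: (1) $C_A<\infty$ such that for all $\gamma\in\mathring W^1_\infty(I)$ with $|\gamma'|\le1$ a.e., $\|A[\gamma]\|_{L^\infty}+\sup_{|h|_{W^1_\infty(I)}=1}\|DA[\gamma]\langle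 h\rangle\|_{L^\infty}+\sup_{|h_1|_{W^1_\infty(I)}=|h_2|_{W^1_\infty(I)}=1}\|D^2A[\gamma]\langle h_1,h_2\rangle\|_{L^\infty}\le C_A$ (norms in $L^\infty(\Omega)^{2\times2}$, pointwise Euclidean operator norm). (2) $\alpha>0$ such that $|\gamma|_{W^1_\infty(I)}\le\alpha\sup_{0\ne\zeta\in\mathring W^1_1(I)}\mathcal B_\Gamma[\gamma,\zeta]/|\zeta|_{W^1_1(I)}$ for $\gamma\in\mathring W^1_\infty(I)$ and $|s|_{W^1_1(I)}\le\alpha\sup_{0\ne\zeta\in\mathring W^1_\infty(I)}\mathcal B_\Gamma[\zeta,s]/|\zeta|_{W^1_\infty(I)}$ for $s\in\mathring W^1_1(I)$. (3) $Q<2<P$, Hölder conjugate, and $\beta>0$ such that for every $r\in(Q,P)$ with conjugate $r'$, every $\gamma\in\mathring W^1_\infty(I)$ with $|\gamma'|\le1$ a.e. and every $y\in\mathring W^1_r(\Omega)$: $|y|_{W^1_r(\Omega)}\le\beta\sup_{0\ne z\in\mathring W^1_{r'}(\Omega)}\mathcal B_\Omega[y,z;A[\gamma]]/|z|_{W^1_{r'}(\Omega)}$. (4) $2<p<P$ and $q=p/(p-1)$. (5) $E:\mathring W^1_1(I)\to W^1_q(\Omega)$ is a fixed bounded linear extension with $E\zeta|_\Gamma=\zeta$, $E\zeta|_\Sigma=0$, and $C_E\ge1$ satisfies $|E\zeta|_{W^1_q(\Omega)}\le C_E|\zeta|_{W^1_1(I)}$. *)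

(* Defs.v *)
From HB Require Import structures.
From mathcomp Require Import all_boot all_order all_algebra.
From mathcomp Require Import all_classical all_reals all_analysis.
Import Order.TTheory GRing.Theory Num.Theory.
Import numFieldNormedType.Exports.

Set Implicit Arguments.
Unset Strict Implicit.
Unset Printing Implicit Defensive.

Local Open Scope classical_set_scope.
Local Open Scope ring_scope.

(* Functions on (0,1) and Omega = (0,1)^2 are represented by functions on
   R and R * R, considered up to equality almost everywhere for the measures
   leb_I and leb_Omega below. *)

Section Domains.
Context {R : realType}.

Definition unit_itv : set R := `]0, 1[.
Definition Omega : set (R * R) := unit_itv `*` unit_itv.

Lemma measurable_unit_itv : measurable (unit_itv : set (measurableTypeR R)).
Proof. exact: measurable_itv. Qed.

Lemma measurable_Omega :
  measurable (Omega : set (measurableTypeR R * measurableTypeR R)).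
Proof. by apply: measurableX; exact: measurable_unit_itv. Qed.

Definition leb_I : {measure set (measurableTypeR R) -> \bar R} :=
  mrestr (@lebesgue_measure R) measurable_unit_itv.

Definition leb_Omega :
    {measure set (measurableTypeR R * measurableTypeR R) -> \bar R} :=
  mrestr (@lebesgue_measure R \x @lebesgue_measure R)%E measurable_Omega.

End Domains.

Section EuclideanNorms.
Context {R : realType}.
Implicit Types (a b : 'cV[R]_2) (M : 'M[R]_2).

Definition dotv a b : R := \sum_i a i 0 * b i 0.
Definition enorm a : R := Num.sqrt (dotv a a).
Definition opnorm M : R :=
  sup [set enorm (M *m a) | a in [set a | enorm a <= 1]].

End EuclideanNorms.

Section SobolevInterval.
Context {R : realType}.
Implicit Types (f g c phi : R -> R) (r : \bar R).

Definition smooth1 phi : Prop := forall n x, derivable (derive1n n phi) x 1.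

Definition testfun1 phi : Prop :=
  smooth1 phi /\
  exists K : set R, [/\ compact K, K `<=` unit_itv & forall x, ~ K x -> phi x = 0].

Definition is_wderiv f g : Prop :=
  [/\ f \in Lfun leb_I 1%E, g \in Lfun leb_I 1%E &
      forall phi, testfun1 phi ->
        \int[leb_I]_x (f x * derive1 phi x) = - \int[leb_I]_x (g x * phi x)].

(* a representative of the weak derivative, when there is one *)
Definition wderiv f : R -> R := xget (cst 0) [set g | is_wderiv f g].

Definition W1_I r f : Prop :=
  f \in Lfun leb_I r /\ exists2 g, is_wderiv f g & g \in Lfun leb_I r.

(* boundary values in one dimension are those of the continuous representative *)
Definition W10_I r f : Prop :=
  W1_I r f /\
  exists c, [/\ {within `[0, 1], continuous c}, c = f %[ae leb_I],
                c 0 = 0 & c 1 = 0].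

Definition semi_I r f : \bar R := ('N[leb_I]_r[EFin \o wderiv f])%E.

End SobolevInterval.

Section SobolevSquare.
Context {R : realType}.
Implicit Types (f g phi : R * R -> R) (G : R * R -> 'cV[R]_2) (r : R).

Definition dir (i : 'I_2) : R * R := if i == 0 then (1, 0) else (0, 1).

Definition partial (i : 'I_2) phi : R * R -> R := fun x => derive phi x (dir i).

Definition smooth2 phi : Prop := forall s : seq 'I_2,
  continuous (foldr partial phi s) /\
  forall x i, derivable (foldr partial phi s) x (dir i).

Definition testfun2 phi : Prop :=
  smooth2 phi /\
  exists K : set (R * R),
    [/\ compact K, K `<=` Omega & forall x, ~ K x -> phi x = 0].

Definition is_wgrad f G : Prop :=
  f \in Lfun leb_Omega 1%E /\
  forall i : 'I_2,
    (fun x => G x i 0) \in Lfun leb_Omega 1%E /\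
    forall phi, testfun2 phi ->
      \int[leb_Omega]_x (f x * partial i phi x)
      = - \int[leb_Omega]_x (G x i 0 * phi x).

(* a representative of the weak gradient, when there is one *)
Definition wgrad f : R * R -> 'cV[R]_2 := xget (cst 0) [set G | is_wgrad f G].

Definition W1_Omega r f : Prop :=
  f \in Lfun leb_Omega r%:E /\
  exists2 G, is_wgrad f G & forall i, (fun x => G x i 0) \in Lfun leb_Omega r%:E.

Definition semi_Omega r f : \bar R :=
  ('N[leb_Omega]_r%:E[EFin \o (enorm \o wgrad f)])%E.

Definition sides : seq (R -> R * R) :=
  [:: (fun t => (t, 0)); (fun t => (t, 1)); (fun t => (0, t)); (fun t => (1, t))].

(* [g] is the trace of [f] on the boundary of Omega: the graph of the trace
   operator of W^1_r is the closure in W^1_r(Omega) x L^r(boundary) of the graph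
   of the restriction to the boundary of functions smooth up to the boundary.
   Only the values of [g] on the boundary matter. *)
Definition is_trace r f g : Prop :=
  exists phi : nat -> R * R -> R,
    [/\ forall n, smooth2 (phi n),
        ('N[leb_Omega]_r%:E[EFin \o (phi n \- f)%R])%E @[n --> \oo] --> 0%E,
        forall i, ('N[leb_Omega]_r%:E[EFin \o
          (partial i (phi n) \- (fun x => wgrad f x i 0))%R])%E
          @[n --> \oo] --> 0%E &
        (\sum_(s <- sides) 'N[leb_I]_r%:E[EFin \o (phi n \- g)%R \o s])%E
          @[n --> \oo] --> 0%E].

Definition W10_Omega r f : Prop := W1_Omega r f /\ is_trace r f (cst 0).

End SobolevSquare.

Section StateEquations.
Context {R : realType}.
Implicit Types (gam zeta h u : R -> R) (y z v : R * R -> R).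
Implicit Types (M : R * R -> 'M[R]_2).

Definition coefA gam : R * R -> 'M[R]_2 := fun x =>
  let g := gam x.1 in
  let d := wderiv gam x.1 * x.2 in
  \matrix_(i, j)
    if i != j then - d
    else if i == 0 then 1 + g else (1 + d ^+ 2) / (1 + g).

Definition Linfty_mx M : \bar R :=
  ('N[leb_Omega]_+oo[EFin \o (opnorm \o M)])%E.

Definition is_dirderiv (F : (R -> R) -> R * R -> 'M[R]_2) gam h
    (D : R * R -> 'M[R]_2) : Prop :=
  Linfty_mx (fun x => t^-1 *: (F (gam \+ t \*o h) x - F gam x) - D x)
    @[t --> 0^'] --> 0%E.

(* the directional derivative in L^oo(Omega)^(2 x 2), when there is one *)
Definition dirderiv (F : (R -> R) -> R * R -> 'M[R]_2) h gam :
    R * R -> 'M[R]_2 :=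
  xget (cst 0) [set D | is_dirderiv F gam h D].

Definition DA gam h := dirderiv coefA h gam.
Definition D2A gam h1 h2 := dirderiv (fun gam' => DA gam' h1) h2 gam.

Definition B_Gamma (kappa : R) gam zeta : R :=
  kappa * \int[leb_I]_x (wderiv gam x * wderiv zeta x).

Definition B_Omega y z M : R :=
  \int[leb_Omega]_x dotv (M x *m wgrad y x) (wgrad z x).

Definition feasible gam : Prop :=
  W10_I +oo%E gam /\ {ae leb_I, forall x, `|wderiv gam x| <= 1}.

Definition A_bound (C_A : R) : Prop :=
  forall gam, feasible gam ->
    (Linfty_mx (coefA gam)
     + ereal_sup [set t | exists h, [/\ W10_I +oo h, semi_I +oo h = 1
                                     & t = Linfty_mx (DA gam h)]]
     + ereal_sup [set t | exists h1 h2,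
                    [/\ W10_I +oo h1 /\ W10_I +oo h2,
                        semi_I +oo h1 = 1, semi_I +oo h2 = 1
                      & t = Linfty_mx (D2A gam h1 h2)]]
     <= C_A%:E)%E.

Definition infsup_Gamma (kappa alpha : R) : Prop :=
  (forall gam, W10_I +oo%E gam ->
    (semi_I +oo gam <= alpha%:E * ereal_sup
      [set (B_Gamma kappa gam zeta / fine (semi_I 1 zeta))%:E | zeta in
        [set zeta | W10_I 1 zeta /\ ~ zeta = cst 0%R %[ae leb_I]]])%E) /\
  (forall s, W10_I 1%E s ->
    (semi_I 1 s <= alpha%:E * ereal_sup
      [set (B_Gamma kappa zeta s / fine (semi_I +oo zeta))%:E | zeta in
        [set zeta | W10_I +oo zeta /\ ~ zeta = cst 0%R %[ae leb_I]]])%E).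

Definition infsup_Omega (Q P beta : R) : Prop :=
  forall r r' : R, Q < r < P -> r^-1 + r'^-1 = 1 ->
  forall gam, feasible gam ->
  forall y, W10_Omega r y ->
    (semi_Omega r y <= beta%:E * ereal_sup
      [set (B_Omega y z (coefA gam) / fine (semi_Omega r' z))%:E | z in
        [set z | W10_Omega r' z /\ ~ z = cst 0%R %[ae leb_Omega]]])%E.

(* [E] is a bounded linear operator on classes modulo a.e. equality, extending
   zeta from Gamma = (0,1) x {1} to Omega, with zero trace on the rest of the
   boundary. *)
Definition is_extension (q C_E : R) (E : (R -> R) -> R * R -> R) : Prop :=
  [/\ forall zeta, W10_I 1%E zeta ->
        [/\ W1_Omega q (E zeta),
            is_trace q (E zeta) (fun x => if x.2 == 1 then zeta x.1 else 0) &
            (semi_Omega q (E zeta) <= C_E%:E * semi_I 1 zeta)%E],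
      forall zeta1 zeta2, W10_I 1%E zeta1 -> W10_I 1%E zeta2 ->
        zeta1 = zeta2 %[ae leb_I] -> E zeta1 = E zeta2 %[ae leb_Omega] &
      forall (a : R) zeta1 zeta2, W10_I 1%E zeta1 -> W10_I 1%E zeta2 ->
        E (fun t => a * zeta1 t + zeta2 t)
        = (fun x => a * E zeta1 x + E zeta2 x) %[ae leb_Omega]].

Definition controls (theta1 alpha : R) : set (R -> R) :=
  [set u | u \in Lfun leb_I 2%:E /\
           ('N[leb_I]_2%:E[EFin \o u] < (theta1 / alpha)%:E)%E].

Definition is_state (kappa p q : R) (E : (R -> R) -> R * R -> R) v u
    (gy : (R -> R) * (R * R -> R)) : Prop :=
  let: (gam, y) := gy in
  [/\ feasible gam, W10_Omega p y,
      forall z, W10_Omega q z -> B_Omega (y \+ v) z (coefA gam) = 0 &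
      forall zeta, W10_I 1%E zeta ->
        B_Gamma kappa gam zeta + B_Omega (y \+ v) (E zeta) (coefA gam)
        = \int[leb_I]_x (u x * zeta x)].

Definition same_state (gy1 gy2 : (R -> R) * (R * R -> R)) : Prop :=
  gy1.1 = gy2.1 %[ae leb_I] /\ gy1.2 = gy2.2 %[ae leb_Omega].

Definition control_to_state (kappa p q : R) (E : (R -> R) -> R * R -> R) v u :
    (R -> R) * (R * R -> R) :=
  xget (cst 0, cst 0) [set gy | is_state kappa p q E v u gy].

End StateEquations.

(* Main.v *)
(* For a feasible gamma the equation on Omega has a unique solution y(gamma): the
   inf-sup condition for exponent p makes gradients of solutions closed under
   limits, and the one for the conjugate exponent q makes the attained right-hand
   sides dense (Hahn-Banach and Riesz representation). Since y + v is then bounded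
   by (1 + beta C_A) |v|, the load of the equation on Gamma is a bounded functional
   of zeta' in L^1, hence given by some g in L^oo, whose primitive yields the solution
   T gamma; the bounds on u and v give |(T gamma)'| <= theta1 + (1 - theta1) = 1.

   Telescoping DA along a segment gives |A[g1] - A[g2]| <= C_A |g1 - g2|, so that
   T is a contraction with constant alpha C_E C_A (1 + beta C_A)^2 |v| <= 1 - theta2
   of a complete metric space. Its fixed points are the states. A state determines
   the functional zeta |-> int u zeta, hence u almost everywhere. *)
From HB Require Import structures.
Require Import Defs.
From mathcomp Require Import all_boot all_order all_algebra.
From mathcomp Require Import all_classical all_reals all_analysis.
From mathcomp Require Import measurable_realfun ess_sup_inf ring lra.
Import Order.TTheory GRing.Theory Num.Theory.
Import numFieldNormedType.Exports.

Set Implicit Arguments.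
Unset Strict Implicit.
Unset Printing Implicit Defensive.

Local Open Scope classical_set_scope.
Local Open Scope ring_scope.

(** * Lebesgue spaces of real functions *)

Section RealLebesgueNorms.
Context d (T : measurableType d) (R : realType).
Variable mu : {measure set T -> \bar R}.
Implicit Types (r : \bar R) (f g h : T -> R).

(** The objects are functions, not classes: [wderiv], [wgrad] and [DA] are chosen representatives,
    so identities for them hold only almost everywhere. Along an uncountable family, such as a
    segment, the exceptional sets could not be collected; this is why the segment is discretized,
    and why metric statements end in a [wdist] equal to 0. The inf-sup condition serves both [p] and
    [q] because [Q] and [P] are conjugate, which gives Q < q < 2 < p < P. The symmetry of A[gamma]
    lets the condition for [q] act on the second argument of the form. The zero trace is a closure
    condition on smooth functions. The Poincare inequality is therefore proved for these, by
    integrating along x_2 from the bottom side, and passed to the limit. The square in the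
    contraction constant: one factor 1 + beta C_A bounds y + v; in the other, 1 is the direct effect
    of changing A and beta C_A the effect of the change of y which it causes. *)

Lemma ae_mono (P Q : T -> Prop) : {ae mu, forall x, P x} ->
  (forall x, P x -> Q x) -> {ae mu, forall x, Q x}.
Proof. by move=> aeP PQ; apply: filterS aeP. Qed.

Lemma ae_mono2 (P1 P2 Q : T -> Prop) : {ae mu, forall x, P1 x} ->
  {ae mu, forall x, P2 x} -> (forall x, P1 x -> P2 x -> Q x) -> {ae mu, forall x, Q x}.
Proof. by move=> a1 a2 PQ; apply: filterS2 a1 a2. Qed.

Lemma ae_mono3 (P1 P2 P3 Q : T -> Prop) : {ae mu, forall x, P1 x} ->
  {ae mu, forall x, P2 x} -> {ae mu, forall x, P3 x} ->
  (forall x, P1 x -> P2 x -> P3 x -> Q x) -> {ae mu, forall x, Q x}.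
Proof. by move=> a1 a2 a3 PQ; apply: filterS3 a1 a2 a3. Qed.

Lemma ae_eqP (V : Type) (f g : T -> V) :
  f = g %[ae mu] <-> {ae mu, forall x, f x = g x}.
Proof. by split; apply: filterS => x; [apply|move=> ? _]. Qed.

(** [fine] sends an infinite norm to 0, so a value of [nrm] is informative only together with
    membership in [Lfun]; this is why membership accompanies most estimates. *)
Definition nrm r f : R := fine ('N[mu]_r[EFin \o f])%E.

Lemma LfunP r f : f \in Lfun mu r <->
  measurable_fun [set: T] f /\ ('N[mu]_r[EFin \o f] < +oo)%E.
Proof.
split=> [|[mf Nf]]; first by rewrite !inE => /andP[] /set_mem/= mf /set_mem.
by rewrite inE; apply/andP; split; apply/mem_set.
Qed.

Lemma Lfun_meas r f : f \in Lfun mu r -> measurable_fun [set: T] f.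
Proof. by case/LfunP. Qed.

Lemma nrm_ge0 r f : 0 <= nrm r f.
Proof. by rewrite fine_ge0// Lnorm_ge0. Qed.

Lemma nrmE r f : f \in Lfun mu r -> ('N[mu]_r[EFin \o f])%E = (nrm r f)%:E.
Proof. by case/LfunP => _ Nf; rewrite fineK// ge0_fin_numE// Lnorm_ge0. Qed.

Lemma Lnorm_ae_le r (f g : T -> \bar R) : (0 < r)%E ->
  measurable_fun [set: T] f -> measurable_fun [set: T] g ->
  {ae mu, forall x, (`|f x| <= `|g x|)%E} -> ('N[mu]_r[f] <= 'N[mu]_r[g])%E.
Proof.
move=> r0 mf mg fg; rewrite unlock; case: r r0 => [r||//].
- rewrite lte_fin => r0; apply: gt0_ler_poweR; rewrite ?invr_ge0 ?(ltW r0)//.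
  + by rewrite in_itv/= leey andbT; apply: integral_ge0 => ? _; exact: poweR_ge0.
  + by rewrite in_itv/= leey andbT; apply: integral_ge0 => ? _; exact: poweR_ge0.
  + apply: ae_ge0_le_integral => //.
    *     * by move=> x _; exact: poweR_ge0.
    * apply: (@measurableT_comp _ _ _ _ _ _ (fun x : \bar R => (x `^ r)%E)); first exact: measurable_poweR.
      exact: measurableT_comp.
    *     * by move=> x _; exact: poweR_ge0.
    * apply: (@measurableT_comp _ _ _ _ _ _ (fun x : \bar R => (x `^ r)%E)); first exact: measurable_poweR.
      exact: measurableT_comp.
    * apply: (ae_mono fg) => x fgx _; apply: gt0_ler_poweR => //; first exact: ltW.
      - by rewrite in_itv/= leey andbT.
      - by rewrite in_itv/= leey andbT.
- by move=> _; case: ifPn => // _; exact: le_ess_sup.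
Qed.

Lemma Lnorm_ae_eq r (f g : T -> \bar R) : (0 < r)%E ->
  measurable_fun [set: T] f -> measurable_fun [set: T] g ->
  f = g %[ae mu] -> ('N[mu]_r[f] = 'N[mu]_r[g])%E.
Proof.
move=> r0 mf mg /ae_eqP fg; apply/eqP; rewrite eq_le; apply/andP; split;
  apply: Lnorm_ae_le => //; by apply: (ae_mono fg) => x ->.
Qed.

Lemma Lfun_ae_le r f g : (0 < r)%E -> measurable_fun [set: T] f ->
  g \in Lfun mu r -> {ae mu, forall x, `|f x| <= `|g x|} -> f \in Lfun mu r.
Proof.
move=> r0 mf /LfunP[mg Ng] fg; apply/LfunP; split => //.
apply: le_lt_trans Ng; apply: Lnorm_ae_le => //.
  exact/measurable_EFinP.
exact/measurable_EFinP.
Qed.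

Lemma nrm_ae_le r f g : (0 < r)%E -> measurable_fun [set: T] f ->
  g \in Lfun mu r -> {ae mu, forall x, `|f x| <= `|g x|} -> nrm r f <= nrm r g.
Proof.
move=> r0 mf Lg fg; have Lf := Lfun_ae_le r0 mf Lg fg.
rewrite -lee_fin -!nrmE//; apply: Lnorm_ae_le => //.
- exact/measurable_EFinP.
- exact/measurable_EFinP/(Lfun_meas Lg).
Qed.

Lemma Lfun_ae_eq r f g : (0 < r)%E -> measurable_fun [set: T] f ->
  g \in Lfun mu r -> f = g %[ae mu] -> f \in Lfun mu r.
Proof.
by move=> r0 mf Lg fg; apply: Lfun_ae_le Lg _ => //; apply: (ae_mono fg) => x /(_ I)->.
Qed.

Lemma nrm_ae_eq r f g : (0 < r)%E -> measurable_fun [set: T] f ->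
  measurable_fun [set: T] g -> f = g %[ae mu] -> nrm r f = nrm r g.
Proof.
move=> r0 mf mg fg; congr fine; apply: Lnorm_ae_eq => //.
- exact/measurable_EFinP.
- exact/measurable_EFinP.
- by apply: (ae_mono fg) => x /(_ I) /= ->.
Qed.

Lemma LfunD r f g : (1 <= r)%E -> f \in Lfun mu r -> g \in Lfun mu r ->
  f \+ g \in Lfun mu r.
Proof.
move=> r1 /LfunP[mf Nf] /LfunP[mg Ng]; apply/LfunP; split.
  exact: measurable_funD.
by apply: le_lt_trans (eminkowski mu mf mg r1) _; rewrite lte_add_pinfty.
Qed.

Lemma nrmD r f g : (1 <= r)%E -> f \in Lfun mu r -> g \in Lfun mu r ->
  nrm r (f \+ g) <= nrm r f + nrm r g.
Proof.
move=> r1 Lf Lg; rewrite -lee_fin EFinD -!nrmE//; last exact: LfunD.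
by apply: eminkowski => //; [exact: Lfun_meas Lf|exact: Lfun_meas Lg].
Qed.

Lemma LnormZr r f a : (1 <= r)%E -> f \in Lfun mu r ->
  ('N[mu]_r[EFin \o (fun x => a * f x)%R] = `|a|%:E * 'N[mu]_r[EFin \o f])%E.
Proof. by move=> r1 Lf; rewrite -(LnormZ (Lfun_Sub r1 Lf) a). Qed.

Lemma LfunZ r f a : (1 <= r)%E -> f \in Lfun mu r ->
  (fun x => a * f x) \in Lfun mu r.
Proof.
move=> r1 Lf; apply/LfunP; split.
  by apply: measurable_funM => //; exact: Lfun_meas Lf.
by rewrite LnormZr// nrmE// -EFinM ltry.
Qed.

Lemma nrmZ r f a : (1 <= r)%E -> f \in Lfun mu r ->
  nrm r (fun x => a * f x) = `|a| * nrm r f.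
Proof. by move=> r1 Lf; rewrite /nrm LnormZr// nrmE. Qed.

Lemma LfunN r f : (1 <= r)%E -> f \in Lfun mu r -> (fun x => - f x) \in Lfun mu r.
Proof.
move=> r1 Lf; rewrite (_ : (fun x => - f x) = (fun x => -1 * f x)); first exact: LfunZ.
by apply/funext => x; rewrite mulN1r.
Qed.

Lemma nrmN r f : (1 <= r)%E -> f \in Lfun mu r -> nrm r (fun x => - f x) = nrm r f.
Proof.
move=> r1 Lf; rewrite (_ : (fun x => - f x) = (fun x => -1 * f x)).
  by rewrite nrmZ// normrN1 mul1r.
by apply/funext => x; rewrite mulN1r.
Qed.

Lemma LfunB r f g : (1 <= r)%E -> f \in Lfun mu r -> g \in Lfun mu r ->
  f \- g \in Lfun mu r.
Proof. by move=> r1 Lf Lg; apply: (LfunD r1 Lf); exact: LfunN. Qed.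

Lemma nrmB r f g : (1 <= r)%E -> f \in Lfun mu r -> g \in Lfun mu r ->
  nrm r (f \- g) <= nrm r f + nrm r g.
Proof.
move=> r1 Lf Lg; rewrite -(nrmN r1 Lg); apply: nrmD => //; exact: LfunN.
Qed.

Lemma nrm_distC r f g : (1 <= r)%E -> f \in Lfun mu r -> g \in Lfun mu r ->
  nrm r (f \- g) = nrm r (g \- f).
Proof.
move=> r1 Lf Lg; rewrite -(nrmN r1 (LfunB r1 Lg Lf)); congr nrm.
by apply/funext => x /=; rewrite opprB.
Qed.

Lemma nrm_dist_triangle r f g h : (1 <= r)%E ->
  f \in Lfun mu r -> g \in Lfun mu r -> h \in Lfun mu r ->
  nrm r (f \- h) <= nrm r (f \- g) + nrm r (g \- h).
Proof.
move=> r1 Lf Lg Lh; apply: le_trans (nrmD r1 (LfunB r1 Lf Lg) (LfunB r1 Lg Lh)).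
rewrite le_eqVlt; apply/orP; left; apply/eqP; congr nrm; apply/funext => x /=.
by rewrite addrA subrK.
Qed.

Lemma LfunC0 r : (0 < r)%E -> cst 0 \in Lfun mu r.
Proof.
move=> r0; apply/LfunP; split => //.
have -> : EFin \o cst 0%R = cst (0 : \bar R) by [].
by rewrite Lnorm0// gt_eqF.
Qed.

Lemma nrm0 r : (0 < r)%E -> nrm r (cst 0) = 0.
Proof.
move=> r0; rewrite /nrm; have -> : EFin \o cst 0%R = cst (0 : \bar R) by [].
by rewrite Lnorm0// gt_eqF.
Qed.

Lemma nrm_eq0 r f : (0 < r)%E -> f \in Lfun mu r -> nrm r f = 0 ->
  f = cst 0 %[ae mu].
Proof.
move=> r0 Lf nf0; have mf := Lfun_meas Lf.
have := @Lnorm_eq0_eq0 _ _ _ mu (EFin \o f) r _ r0.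
rewrite nrmE// nf0 => /(_ _ erefl) H.
have {}H := H ((measurable_EFinP setT f).2 mf).
by apply: (ae_mono H) => x /= /(_ I) [].
Qed.

Lemma ae0_nrm r f : (0 < r)%E -> measurable_fun [set: T] f ->
  f = cst 0 %[ae mu] -> nrm r f = 0.
Proof. by move=> r0 mf f0; rewrite -(nrm0 r0); apply: nrm_ae_eq. Qed.

Lemma Lfun_abs r f : (0 < r)%E -> f \in Lfun mu r -> (fun x => `|f x|) \in Lfun mu r.
Proof.
move=> r0 Lf; have mf := Lfun_meas Lf; apply: Lfun_ae_le Lf _ => //.
  exact: measurableT_comp.
by apply: nearW => x; rewrite normr_id.
Qed.

Lemma nrm_abs r f : (0 < r)%E -> f \in Lfun mu r -> nrm r (fun x => `|f x|) = nrm r f.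
Proof.
move=> r0 Lf; have mf := Lfun_meas Lf; apply/eqP; rewrite eq_le !nrm_ae_le//.
- exact: Lfun_abs.
- by apply: nearW => x; rewrite normr_id.
- exact: measurableT_comp.
- by apply: nearW => x; rewrite normr_id.
Qed.

Lemma Lfun1P f : f \in Lfun mu 1%E <-> mu.-integrable setT (EFin \o f).
Proof. exact: Lfun1_integrable. Qed.

Lemma nrm1E f : nrm 1%E f = \int[mu]_x `|f x|.
Proof. by rewrite /nrm Lnorm1. Qed.

Lemma le_norm_Rintegral f : f \in Lfun mu 1%E -> `|\int[mu]_x f x| <= nrm 1%E f.
Proof. by move=> /Lfun1P Lf; rewrite nrm1E; exact: le_normr_Rintegral. Qed.

Lemma RintD f g : f \in Lfun mu 1%E -> g \in Lfun mu 1%E ->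
  \int[mu]_x (f x + g x) = \int[mu]_x f x + \int[mu]_x g x.
Proof. by move=> /Lfun1P Lf /Lfun1P Lg; exact: RintegralD. Qed.

Lemma RintB f g : f \in Lfun mu 1%E -> g \in Lfun mu 1%E ->
  \int[mu]_x (f x - g x) = \int[mu]_x f x - \int[mu]_x g x.
Proof. by move=> /Lfun1P Lf /Lfun1P Lg; exact: RintegralB. Qed.

Lemma RintZ f a : f \in Lfun mu 1%E ->
  \int[mu]_x (a * f x) = a * \int[mu]_x f x.
Proof. by move=> /Lfun1P Lf; exact: RintegralZl. Qed.

Lemma RintN f : f \in Lfun mu 1%E -> \int[mu]_x (- f x) = - \int[mu]_x f x.
Proof.
move=> Lf; rewrite -mulN1r -RintZ//; apply: eq_Rintegral => x _.
by rewrite mulN1r.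
Qed.

Lemma Rint_ae_eq f g : measurable_fun [set: T] f -> measurable_fun [set: T] g ->
  f = g %[ae mu] -> \int[mu]_x f x = \int[mu]_x g x.
Proof.
move=> mf mg fg; congr fine; apply: ae_eq_integral => //.
- exact/measurable_EFinP.
- exact/measurable_EFinP.
- by apply: (ae_mono fg) => x /[apply] /= ->.
Qed.

(** The endpoint pairs are listed apart so that no inverse of +oo is ever taken; a single Hoelder
    inequality, [hoelderR], then serves finite exponents and the pair L^1, L^oo alike. *)
Definition conjp r r' := [/\ (1 <= r)%E, (1 <= r')%E &
  (exists a b : R, [/\ r = a%:E, r' = b%:E, 0 < a, 0 < b & a^-1 + b^-1 = 1])
  \/ (r = 1%E /\ r' = +oo%E) \/ (r = +oo%E /\ r' = 1%E)].

Lemma conjpC r r' : conjp r r' -> conjp r' r.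
Proof.
case=> r1 r1' H; split => //; case: H => [[a [b [-> -> a0 b0 ab]]]|[[-> ->]|[-> ->]]]; last 2 first.
- by right; right.
- by right; left.
- by left; exists b, a; split => //; rewrite addrC.
Qed.

Lemma Linfty_ae_bound f : f \in Lfun mu +oo%E ->
  {ae mu, forall x, `|f x| <= nrm +oo%E f}.
Proof.
move=> Lf; have := nrmE Lf; rewrite unlock.
(* For the zero measure the norm is 0 by definition, and every function vanishes almost
   everywhere. *)
case: ifPn => [_ H|]; last first.
  rewrite -leNgt => mu0 _.
  suff : f = cst 0 %[ae mu] by apply: filterS => x /(_ I) ->; rewrite normr0 nrm_ge0.
  by apply: ae_eq0 => //; apply/eqP; rewrite eq_le mu0/=.
have := ess_sup_ge mu (abse \o (EFin \o f)); rewrite H.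
by apply: filterS => x /=; rewrite lee_fin.
Qed.

Lemma ae_bound_Linfty f C : measurable_fun [set: T] f ->
  {ae mu, forall x, `|f x| <= C} -> 0 <= C -> f \in Lfun mu +oo%E /\ nrm +oo%E f <= C.
Proof.
move=> mf fC C0.
have H : ('N[mu]_+oo[EFin \o f] <= C%:E)%E.
  rewrite unlock; case: ifPn => // _; apply/ess_supP.
  by apply: (ae_mono fC) => x /=; rewrite lee_fin.
have Lf : f \in Lfun mu +oo%E by apply/LfunP; split=> //; apply: le_lt_trans H (ltry _).
by split=> //; rewrite -lee_fin -nrmE.
Qed.

Lemma hoelder_Linfty f g : f \in Lfun mu 1%E -> g \in Lfun mu +oo%E ->
  f \* g \in Lfun mu 1%E /\ nrm 1%E (f \* g) <= nrm 1%E f * nrm +oo%E g.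
Proof.
move=> Lf Lg; have mf := Lfun_meas Lf; have mg := Lfun_meas Lg.
have mfg : measurable_fun setT (f \* g) by exact: measurable_funM.
have Lh := LfunZ (nrm +oo%E g) (lexx _) Lf.
have aeh : {ae mu, forall x, `|(f \* g) x| <= `|nrm +oo%E g * f x|}.
  apply: (ae_mono (Linfty_ae_bound Lg)) => x gx.
  by rewrite /= !normrM mulrC (ger0_norm (nrm_ge0 _ _)) ler_wpM2r.
split; first exact: Lfun_ae_le Lh aeh.
apply: le_trans (nrm_ae_le _ mfg Lh aeh) _ => //.
by rewrite nrmZ// mulrC ger0_norm// nrm_ge0.
Qed.

Lemma hoelderR r r' f g : conjp r r' -> f \in Lfun mu r -> g \in Lfun mu r' ->
  f \* g \in Lfun mu 1%E /\ nrm 1%E (f \* g) <= nrm r f * nrm r' g.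
Proof.
case=> r1 r1' [[a [b [ra rb a0 b0 ab]]]|[[-> ->]|[-> ->]]] Lf Lg; last 2 first.
- exact: hoelder_Linfty.
- have [] := hoelder_Linfty Lg Lf; rewrite mulrC.
  by rewrite (_ : g \* f = f \* g)//; apply/funext => x /=; rewrite mulrC.
have mf := Lfun_meas Lf; have mg := Lfun_meas Lg.
have := hoelder mu mf mg a0 b0 ab; rewrite -ra -rb (nrmE Lf) (nrmE Lg) -EFinM => H.
have L : f \* g \in Lfun mu 1%E.
  by apply/LfunP; split; [exact: measurable_funM|apply: le_lt_trans H (ltry _)].
by split => //; rewrite -lee_fin -nrmE.
Qed.

Lemma hoelder_int r r' f g : conjp r r' -> f \in Lfun mu r -> g \in Lfun mu r' ->
  `|\int[mu]_x (f x * g x)| <= nrm r f * nrm r' g.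
Proof.
move=> rr Lf Lg; have [L le] := hoelderR rr Lf Lg.
exact: le_trans (le_norm_Rintegral L) le.
Qed.

End RealLebesgueNorms.

(** * Powers of norms, dominated convergence, inclusions on finite measure spaces *)

Section FiniteMeasureLp.
Context d (T : measurableType d) (R : realType).
Variable mu : {measure set T -> \bar R}.
Implicit Types (f g h : T -> R).

Lemma nrm_powR_e (r : R) h : 0 < r -> h \in Lfun mu r%:E ->
  (\int[mu]_x (`|h x| `^ r)%:E)%E = (nrm mu r%:E h `^ r)%:E.
Proof.
move=> r0 Lh; by rewrite -poweR_EFin -nrmE// poweR_Lnorm ?gt_eqF.
Qed.

Lemma nrm_powR (r : R) h : 0 < r -> h \in Lfun mu r%:E ->
  nrm mu r%:E h `^ r = \int[mu]_x (`|h x| `^ r).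
Proof. by move=> r0 Lh; rewrite /Rintegral nrm_powR_e. Qed.

Lemma Lfun_powRP (r : R) h : 0 < r -> measurable_fun [set: T] h ->
  (\int[mu]_x (`|h x| `^ r)%:E < +oo)%E -> h \in Lfun mu r%:E.
Proof.
move=> r0 mh H; apply/LfunP; split => //.
by rewrite unlock; apply: poweR_lty.
Qed.

Lemma nrm_le_powR (r : R) h C : 0 < r -> measurable_fun [set: T] h -> 0 <= C ->
  (\int[mu]_x (`|h x| `^ r)%:E <= (C `^ r)%:E)%E ->
  h \in Lfun mu r%:E /\ nrm mu r%:E h <= C.
Proof.
move=> r0 mh C0 H; have Lh : h \in Lfun mu r%:E.
  by apply: Lfun_powRP => //; apply: le_lt_trans H (ltry _).
split => //; rewrite leNgt; apply/negP => CN.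
move: H; rewrite nrm_powR_e// lee_fin leNgt => /negP; apply.
by apply: gt0_ltr_powR => //; rewrite nnegrE ?nrm_ge0.
Qed.

Lemma Lfun_scale1 (r : R) : 0 < r -> forall f g, f \in Lfun mu r%:E ->
  mu.-integrable [set: T] (fun x => (`|f x| `^ r)%:E).
Proof.
move=> r0 f g Lf; apply/integrableP; split.
  apply/measurable_EFinP.
  apply: (@measurableT_comp _ _ _ _ _ _ (fun x : R => x `^ r)); first exact: measurable_powR.
  by apply: measurableT_comp => //; exact: Lfun_meas Lf.
under eq_integral do rewrite /= ger0_norm ?powR_ge0//.
by rewrite nrm_powR_e// ltry.
Qed.

(** The dominated convergence theorem for |f_n - f|^r with majorant |2 g|^r; the bound |f| <= g
    comes from the pointwise limit. *)
Lemma dominated_nrm (r : R) (f_ : nat -> T -> R) f g : 1 <= r ->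
  (forall n, measurable_fun [set: T] (f_ n)) -> measurable_fun [set: T] f ->
  {ae mu, forall x, f_ n x @[n --> \oo] --> f x} ->
  g \in Lfun mu r%:E -> {ae mu, forall x, forall n, `|f_ n x| <= g x} ->
  f \in Lfun mu r%:E /\ nrm mu r%:E (f_ n \- f) @[n --> \oo] --> (0 : R).
Proof.
move=> r1 mf_ mf f_f Lg f_g; have r0 : 0 < r by exact: lt_le_trans r1.
have fg : {ae mu, forall x, `|f x| <= g x}.
  apply: filterS2 f_f f_g => x cf lef.
  have cn : (`|f_ n x| @[n --> \oo] --> `|f x|)%R by exact: cvg_norm.
  rewrite -(cvg_lim _ cn)//.
  by apply: limr_le; [apply/cvg_ex; eexists; exact: cn|exact: nearW].
have Lfn n : f_ n \in Lfun mu r%:E.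
  apply: Lfun_ae_le Lg _ => //; apply: (ae_mono f_g) => x /(_ n) H.
  exact: le_trans H (ler_norm _).
have Lf : f \in Lfun mu r%:E.
  apply: Lfun_ae_le Lg _ => //; apply: (ae_mono fg) => x H.
  exact: le_trans H (ler_norm _).
split => //.
have r1' : (1 <= r%:E)%E by rewrite lee_fin.
have Ld n := LfunB r1' (Lfn n) Lf.
have := @dominated_convergence _ _ _ mu setT measurableT
  (fun n x => (`|f_ n x - f x| `^ r)%:E) (cst 0%E)
  (fun x => (`|2 * g x| `^ r)%:E).
case.
- move=> n; apply/measurable_EFinP.
  apply: (@measurableT_comp _ _ _ _ _ _ (fun x : R => x `^ r)); first exact: measurable_powR.
  by apply: measurableT_comp => //; exact: measurable_funB.
- exact: measurable_cst.
- apply: (ae_mono f_f) => x cf _.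
  apply/fine_cvgP; split; first exact: nearW.
  apply/cvgr0Pnorm_lt => e e0.
  have : (f_ n x - f x) @[n --> \oo] --> 0 by rewrite -(subrr (f x)); apply: cvgB => //; exact: cvg_cst.
  (* The tolerance for t^r near 0 is met by taking its r-th root as tolerance for t. *)
  move/cvgr0Pnorm_lt => /(_ (e `^ r^-1)).
  rewrite powR_gt0// => /(_ isT); apply: filterS => n H.
  rewrite /= ger0_norm ?powR_ge0//.
  have -> : e = (e `^ r^-1) `^ r by rewrite -powRrM mulVf ?gt_eqF// powRr1// ltW.
  by apply: gt0_ltr_powR => //; rewrite nnegrE// powR_ge0.
- exact: (@Lfun_scale1 r r0 _ f (LfunZ 2 r1' Lg)).
- apply: filterS2 fg f_g => x fx fnx n _.
  rewrite /= lee_fin ger0_norm ?powR_ge0//.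
  apply: ge0_ler_powR; rewrite ?nnegrE ?(ltW r0)//.
  apply: le_trans (ler_normB _ _) _.
  rewrite (le_trans _ (ler_norm _))//.
  by have := fnx n; move: fx; lra.
move=> _ _; rewrite integral0 => /fine_cvgP[_ H].
apply/cvgr0Pnorm_lt => e e0.
move/cvgr0Pnorm_lt : H => /(_ (e `^ r)); rewrite powR_gt0// => /(_ isT).
apply: filterS => n /=.
have -> : fine (\int[mu]_x (`|f_ n x - f x| `^ r)%:E) = nrm mu r%:E (f_ n \- f) `^ r.
  by rewrite nrm_powR.
rewrite ger0_norm ?powR_ge0// ger0_norm ?nrm_ge0// => H.
rewrite ltNge; apply/negP => en.
move: H; rewrite ltNge => /negP; apply.
by apply: ge0_ler_powR; rewrite ?nnegrE ?nrm_ge0// ltW.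
Qed.

Hypothesis muT : (mu setT < +oo)%E.

Lemma muT_fin : mu [set: T] \is a fin_num.
Proof. by rewrite ge0_fin_numE. Qed.

Lemma bounded_Lfun (r : \bar R) f C : (1 <= r)%E -> measurable_fun [set: T] f ->
  {ae mu, forall x, `|f x| <= C} -> f \in Lfun mu r.
Proof.
move=> r1 mf fC; have r1y : (1 <= +oo :> \bar R)%E by rewrite leey.
apply: (Lfun_subset r1 r1y muT_fin (leey r)).
(* [C] may be negative, which an almost everywhere bound permits over a null space. *)
apply: (ae_bound_Linfty (C := Num.max C 0) mf _ _).1; last by rewrite le_max lexx orbT.
by apply: (ae_mono fC) => x H; rewrite le_max H.
Qed.

Lemma bounded_Lfun_all (r : \bar R) f C : (1 <= r)%E -> measurable_fun [set: T] f ->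
  (forall x, `|f x| <= C) -> f \in Lfun mu r.
Proof. by move=> r1 mf fC; apply: (bounded_Lfun r1 mf (C := C)); exact: nearW. Qed.

Lemma Lfun_sub1 (r : \bar R) f : (1 <= r)%E -> f \in Lfun mu r -> f \in Lfun mu 1%E.
Proof. by move=> r1; apply: Lfun_subset => //; exact: muT_fin. Qed.

Lemma Lfun_indic (r : \bar R) A : (1 <= r)%E -> measurable A ->
  (\1_A : T -> R) \in Lfun mu r.
Proof.
move=> r1 mA; apply: (@bounded_Lfun_all _ _ 1) => // x.
by rewrite indicE; case: (_ \in _); rewrite /= ?normr0 ?normr1.
Qed.

Lemma Rint_indic A f : measurable A ->
  \int[mu]_(x in A) f x = \int[mu]_x (f x * \1_A x).
Proof.
by move=> mA; rewrite Rintegral_mkcond patch_indic.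
Qed.

End FiniteMeasureLp.

(** Radon-Nikodym and Fubini ask for the structure of a finite measure, whereas the spaces here
    carry only the inequality [mu setT < +oo]. *)
Lemma finite_measure_repack d (T : measurableType d) (R : realType)
    (mu : {measure set T -> \bar R}) : (mu setT < +oo)%E ->
  exists fmu : {finite_measure set T -> \bar R}, (fmu : {measure set T -> \bar R}) = mu.
Proof.
move=> muT; have H : fin_num_fun mu by exact: lty_fin_num_fun.
pose H1 := isFinite.Build _ _ _ (Measure.sort mu) H.
have S2 : sigma_finite setT mu.
  by apply: fin_num_fun_sigma_finite => //; rewrite measure0.
have S := sfinite_measure_sigma_finite S2.
pose H2 := isSFinite.Build _ _ _ (Measure.sort mu) S.
pose H3 := isSigmaFinite.Build _ _ _ (Measure.sort mu) S2.
exists (HB.pack_for (FiniteMeasure.type T R) (Measure.sort mu) H1 H2 H3).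
exact: eq_measure.
Qed.

(** * Riesz representation on finite measure spaces *)

Section RieszRepresentation.
Import HBSimple HBNNSimple.
Context d (T : measurableType d) (R : realType).
Variable mu : {measure set T -> \bar R}.
Hypothesis muT : (mu setT < +oo)%E.
Implicit Types (f g h : T -> R).

Variables (r : R) (L : (T -> R) -> R) (C : R).
Hypothesis r1 : 1 <= r.
Hypothesis C0 : 0 <= C.
Hypothesis Llin : forall a f g, f \in Lfun mu r%:E -> g \in Lfun mu r%:E ->
  L (fun x => a * f x + g x) = a * L f + L g.
Hypothesis Lbnd : forall f, f \in Lfun mu r%:E -> `|L f| <= C * nrm mu r%:E f.

Let r1e : (1 <= r%:E)%E. Proof. by rewrite lee_fin. Qed.
Let r0e : (0 < r%:E)%E. Proof. by rewrite lte_fin (lt_le_trans _ r1). Qed.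

Let L0 : L (cst 0) = 0.
Proof.
have := Lbnd (LfunC0 mu r0e); rewrite nrm0// mulr0 => H.
by apply/eqP; rewrite -normr_le0.
Qed.

Let LD f g : f \in Lfun mu r%:E -> g \in Lfun mu r%:E -> L (f \+ g) = L f + L g.
Proof.
move=> Lf Lg; rewrite -[L f]mul1r -Llin//; congr L.
by apply/funext => x; rewrite mul1r.
Qed.

Let LB f g : f \in Lfun mu r%:E -> g \in Lfun mu r%:E -> L (f \- g) = L f - L g.
Proof.
move=> Lf Lg; rewrite addrC -mulN1r -Llin//; congr L.
by apply/funext => x; rewrite mulN1r addrC.
Qed.

Let LZ a f : f \in Lfun mu r%:E -> L (fun x => a * f x) = a * L f.
Proof.
move=> Lf; rewrite -[a * L f]addr0 -L0 -Llin//; last exact: LfunC0.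
by congr L; apply/funext => x; rewrite addr0.
Qed.

Lemma bounded_linear_cvg (f_ : nat -> T -> R) f : (forall n, f_ n \in Lfun mu r%:E) ->
  f \in Lfun mu r%:E -> nrm mu r%:E (f_ n \- f) @[n --> \oo] --> (0 : R) ->
  L (f_ n) @[n --> \oo] --> L f.
Proof.
move=> Lf_ Lf H; apply/cvgrPdistC_lt => e e0.
have C1 : 0 < C + 1 by rewrite ltr_wpDl.
move/cvgr0Pnorm_lt : H => /(_ (e / (C + 1))); rewrite divr_gt0// => /(_ isT).
apply: filterS => n; rewrite ger0_norm ?nrm_ge0// => H.
rewrite -LB//; apply: le_lt_trans (Lbnd (LfunB r1e (Lf_ n) Lf)) _.
move: H; rewrite ltr_pdivlMr// => H.
by apply: le_lt_trans H; rewrite mulrC ler_wpM2l ?nrm_ge0// lerDl ler01.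
Qed.

Let nu (A : set T) : \bar R := (L \1_A)%:E.

Let nu0 : nu set0 = 0%E.
Proof. by rewrite /nu indic0 L0. Qed.

Let nu_fin A : measurable A -> nu A \is a fin_num. Proof. by []. Qed.

Let Lind A : measurable A -> (\1_A : T -> R) \in Lfun mu r%:E.
Proof. exact: Lfun_indic. Qed.

Let nu_bigU (F : nat -> set T) n : (forall i, measurable (F i)) ->
  trivIset setT F -> (\sum_(0 <= i < n) nu (F i))%E = nu (\big[setU/set0]_(i < n) F i).
Proof.
move=> mF tF; elim: n => [|n IH]; first by rewrite big_ord0 big_geq// nu0.
rewrite big_nat_recr//= IH big_ord_recr/= /nu -EFinD -LD//; last 2 first.
- by apply: Lind; exact: bigsetU_measurable.
- exact: Lind.
congr (L _)%:E; apply/funext => x /=.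
have tF' : trivIset (fun k => xpredT k) F by apply: sub_trivIset tF.
have dis := trivIset_bigsetUI tF' (n := n) (m := n) isT (leqnn _). rewrite !indicE; have [xn|xn] := boolP (x \in F n).
  have -> : x \in \big[setU/set0]_(i < n) F i = false.
    apply/negbTE/negP; rewrite inE => H.
    suff : set0 x by []. by rewrite -dis; split => //; exact: set_mem.
  by rewrite add0r mem_set//; right; exact: set_mem.
rewrite addr0; congr (_%:R); apply: congr1; apply/idP/idP; rewrite !inE => H.
  by left.
by case: H => // H; move: xn; rewrite notin_setE.
Qed.

(** The indicators of the finite unions converge to that of the whole union in L^r, by domination
    with the constant 1, and L is continuous there. Finiteness of r and of the measure both
    enter. *)
Let nu_sigma : semi_sigma_additive nu.
Proof.
move=> F mF tF mUF; rewrite (_ : (fun n => _) =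
    (fun n => nu (\big[setU/set0]_(i < n) F i))); last first.
  by apply/funext => n; rewrite nu_bigU.
apply/fine_cvgP; split; first exact: nearW.
apply: bounded_linear_cvg.
- by move=> n; apply: Lind; exact: bigsetU_measurable.
- exact: Lind.
have m1 : (cst 1 : T -> R) \in Lfun mu r%:E.
  by apply: (@bounded_Lfun_all _ _ _ _ muT _ _ 1) => // x; rewrite normr1.
apply: (dominated_nrm _ _ _ _ m1 _).2 => //.
- by move=> n; apply: measurable_indic; exact: bigsetU_measurable.
- apply: nearW => x; have [[i _ Fix]|nU] := pselect ((\bigcup_n F n) x).
    apply: cvg_near_cst; exists i.+1 => // n /= lin.
    rewrite !indicE !mem_set//; first by exists i.
    by rewrite -bigcup_mkord; exists i.
  apply: cvg_near_cst; apply: nearW => n.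
  rewrite !indicE !memNset//; rewrite -bigcup_mkord => -[i _ Fix].
  by apply: nU; exists i.
- apply: nearW => x n; rewrite indicE.
  by case: (_ \in _); rewrite /= ?normr0 ?normr1.
Qed.

Let nu_charge : {charge set T -> \bar R} :=
  HB.pack nu (isCharge.Build _ _ _ nu nu0 nu_fin nu_sigma).

Let nu_dom : nu_charge `<< (mu : set T -> \bar R).
Proof.
move=> A nA B mB BA; have /= muB0 := nA B mB BA.
change ((L \1_B)%:E = 0%E); congr EFin; rewrite -L0.
have Z : nrm mu r%:E (\1_B \- cst 0 : T -> R) = 0.
  apply: ae0_nrm => //; first exact: measurable_funB.
  apply/ae_eqP; exists B; split => // x /= H; apply: contrapT => Bx; apply: H.
  by rewrite indicE memNset// subr0.
apply/eqP; rewrite -subr_eq0 -LB//; [|exact: Lind|exact: LfunC0].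
have := Lbnd (LfunB r1e (Lind mB) (LfunC0 mu r0e)).
by rewrite Z mulr0 normr_le0.
Qed.

(* h is the Radon-Nikodym derivative of the charge A |-> L 1_A. *)
Lemma riesz_bounded : exists2 h, h \in Lfun mu 1%E &
  forall f (M : R), measurable_fun [set: T] f -> (forall x, `|f x| <= M) ->
    L f = \int[mu]_x (f x * h x).
Proof.
have [fmu fmuE] := finite_measure_repack muT.
have fnu_dom : nu_charge `<< fmu by move: nu_dom; rewrite -fmuE.
pose h0 := Radon_Nikodym nu_charge fmu.
have h0fin x : h0 x \is a fin_num by exact: Radon_Nikodym_fin_num.
pose h := fine \o h0.
have h0E : EFin \o h = h0 by apply/funext => x; rewrite /= fineK.
have Lh : h \in Lfun mu 1%E.
  by apply/Lfun1P; rewrite h0E -fmuE; exact: Radon_Nikodym_integrable.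
exists h => //.
have mh := Lfun_meas Lh.
have Li A : measurable A -> L \1_A = \int[mu]_x (\1_A x * h x).
  move=> mA.
  have H : nu_charge A = (\int[mu]_(x in A) h0 x)%E.
    by rewrite -fmuE; exact: Radon_Nikodym_integral.
  have -> : L \1_A = fine (nu_charge A) by [].
  rewrite H -h0E -[fine _]/(\int[mu]_(x in A) h x) Rint_indic//.
  by apply: eq_Rintegral => x _; rewrite mulrC.
have Lmulh f (M : R) : measurable_fun [set: T] f -> (forall x, `|f x| <= M) ->
    f \* h \in Lfun mu 1%E.
  move=> mf fM; apply: (hoelderR (conjpC (r := 1%E) (r' := +oo%E) _) _ Lh).1.
    by split; rewrite ?leey//; right; left.
  by apply: (@bounded_Lfun_all _ _ _ _ muT _ _ M) => //; rewrite leey.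
(* Induction on a list of values. The memberships travel along because additivity of [L] and of the
   integral is available only inside the spaces. *)
have Lsum (g : {sfun T >-> R}) (s : seq R) :
    (fun x : T => \sum_(y <- s) y * (\1_(g @^-1` [set y]) x : R)) \in Lfun mu r%:E /\
    (fun x : T => (\sum_(y <- s) y * (\1_(g @^-1` [set y]) x : R)) * h x) \in Lfun mu 1%E /\
    L (fun x : T => \sum_(y <- s) y * (\1_(g @^-1` [set y]) x : R)) =
    \int[mu]_x ((\sum_(y <- s) y * (\1_(g @^-1` [set y]) x : R)) * h x).
  elim: s => [|y s [IH1 [IH2 IH3]]].
    rewrite (_ : (fun x : T => \sum_(y <- [::]) _) = cst 0); last first.
      by apply/funext => x; rewrite big_nil.
    split; first exact: LfunC0.
    rewrite (_ : (fun x : T => _) = cst 0); last first.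
      by apply/funext => x; rewrite big_nil mul0r.
    split; first exact: LfunC0.
    by rewrite L0 /Rintegral integral0.
  have mgy : measurable (g @^-1` [set y]) by exact: measurable_sfunP.
  have e1 : (fun x : T => \sum_(y0 <- y :: s) y0 * (\1_(g @^-1` [set y0]) x : R)) =
     (fun x : T => y * (\1_(g @^-1` [set y]) x : R) + \sum_(y <- s) y * (\1_(g @^-1` [set y]) x : R)).
    by apply/funext => x; rewrite big_cons.
  have L1 : (fun x : T => (\1_(g @^-1` [set y]) x : R) * h x) \in Lfun mu 1%E.
    apply: (Lmulh _ 1); first exact: measurable_indic.
    by move=> x; rewrite indicE; case: (_ \in _); rewrite /= ?normr0 ?normr1.
  have e2 : (fun x : T => (\sum_(y0 <- y :: s) y0 * (\1_(g @^-1` [set y0]) x : R)) * h x) =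
     (fun x : T => y * ((\1_(g @^-1` [set y]) x : R) * h x) +
               (\sum_(y <- s) y * (\1_(g @^-1` [set y]) x : R)) * h x).
    by apply/funext => x; rewrite big_cons mulrDl mulrA.
  rewrite e1; split; first by apply: LfunD => //; apply: LfunZ => //; exact: Lind.
  rewrite -e1 e2; split; first by apply: LfunD => //; exact: LfunZ.
  rewrite e1 Llin//; last exact: Lind.
  rewrite RintD//; last exact: LfunZ.
  by rewrite RintZ// IH3 Li.
have Lsf (g : {sfun T >-> R}) : L g = \int[mu]_x (g x * h x).
  have ge : (g : T -> R) = (fun x : T =>
     \sum_(y <- finmap.enum_fset (fset_set (range g))) y * (\1_(g @^-1` [set y]) x : R)).
    apply/funext => x; rewrite fimfunE fsbig_finite//.
  by rewrite ge (Lsum g _).2.2.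
(* Simple functions increase to f. The left side converges by continuity of L, the right side with
   majorant M |h|. Since h is so far only integrable, f has to be bounded. *)
have Lpos f (M : R) : measurable_fun [set: T] f -> (forall x, 0 <= f x <= M) ->
    L f = \int[mu]_x (f x * h x).
  move=> mf fM.
  have f0 x : setT x -> (0 <= (EFin \o f) x)%E by rewrite lee_fin; case/andP: (fM x).
  have mEf : measurable_fun setT (EFin \o f) by exact/measurable_EFinP.
  pose g n := nnsfun_approx measurableT mEf n.
  have gle n x : 0 <= g n x <= f x.
    apply/andP; split; first by [].
    by rewrite /g nnsfun_approxE -lee_fin; exact: (le_approx (f := EFin \o f)).
  have gcv x : g n x @[n --> \oo] --> f x.
    rewrite /g; under eq_fun do rewrite nnsfun_approxE.
    by apply: (cvg_approx (f := EFin \o f)) => //; rewrite ltry.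
  have M0 : forall x, `|f x| <= M by move=> x; case/andP: (fM x) => a b; rewrite ger0_norm.
  have gM n x : `|g n x| <= M.
    by case/andP: (gle n x) => a b; case/andP: (fM x) => _ c; rewrite ger0_norm// (le_trans b).
  have cM : (cst M : T -> R) \in Lfun mu r%:E.
    by apply: (@bounded_Lfun_all _ _ _ _ muT _ _ `|M|).
  have Lg n : (g n : T -> R) \in Lfun mu r%:E.
    exact: (@bounded_Lfun_all _ _ _ _ muT _ _ M).
  have Lf : f \in Lfun mu r%:E by apply: (@bounded_Lfun_all _ _ _ _ muT _ _ M).
  have c1 : L (g n) @[n --> \oo] --> L f.
    apply: bounded_linear_cvg => //; apply: (dominated_nrm r1 _ mf _ cM _).2 => //.
    - exact: nearW.
    - exact: nearW.
  have c2 : L (g n) @[n --> \oo] --> \int[mu]_x (f x * h x).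
    under eq_fun do rewrite Lsf.
    apply/cvgrPdistC_lt => e e0.
    have Mh : (fun x => M * `|h x|) \in Lfun mu 1%E.
      by apply: LfunZ => //; exact: Lfun_abs.
    have mgh n : measurable_fun [set: T] (g n \* h) by exact: measurable_funM.
    have ghcv : {ae mu, forall x, (g n \* h) x @[n --> \oo] --> (f \* h) x}.
      by apply: nearW => x /=; apply: cvgM => //; exact: cvg_cst.
    have ghle : {ae mu, forall x, forall n, `|(g n \* h) x| <= M * `|h x|}.
      by apply: nearW => x n /=; rewrite normrM ler_wpM2r.
    have := (dominated_nrm (lexx 1) mgh (measurable_funM mf mh) ghcv Mh ghle).2.
    move/cvgr0Pnorm_lt => /(_ _ e0); apply: filterS => n.
    rewrite ger0_norm ?nrm_ge0// => H.
    have Lgh := Lmulh _ _ (measurable_funPT (g n)) (gM n).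
    have Lfh := Lmulh _ _ mf M0.
    rewrite -RintB//; apply: le_lt_trans H.
    by apply: le_norm_Rintegral; apply: LfunB.
  exact: cvg_unique c1 c2.
move=> f M mf fM.
have mp : measurable_fun [set: T] (fun x => Num.max (f x) 0) by exact: measurable_maxr.
have mn : measurable_fun [set: T] (fun x => Num.max (- f x) 0).
  by apply: measurable_maxr => //; exact: measurableT_comp.
have bp x : 0 <= Num.max (f x) 0 <= M.
  rewrite le_max lexx orbT/= ge_max (le_trans (normr_ge0 _) (fM x)) andbT.
  exact: le_trans (ler_norm _) (fM x).
have bn x : 0 <= Num.max (- f x) 0 <= M.
  rewrite le_max lexx orbT/= ge_max (le_trans (normr_ge0 _) (fM x)) andbT.
  by rewrite (le_trans (ler_norm _))// normrN.
have nb (k : T -> R) : (forall x, 0 <= k x <= M) -> forall x, `|k x| <= M.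
  by move=> H x; case/andP: (H x) => a b; rewrite ger0_norm.
have fE : f = (fun x => Num.max (f x) 0) \- (fun x => Num.max (- f x) 0).
  apply/funext => x /=; have [fx|fx] := leP 0 (f x).
    by rewrite max_r ?subr0// oppr_le0.
  by rewrite max_l ?sub0r ?opprK// oppr_ge0 ltW.
rewrite {1}fE LB; last 2 first.
- by apply: (@bounded_Lfun_all _ _ _ _ muT _ _ M) => //; exact: nb.
- by apply: (@bounded_Lfun_all _ _ _ _ muT _ _ M) => //; exact: nb.
rewrite (Lpos _ M mp bp) (Lpos _ M mn bn) -RintB//; last 2 first.
- by apply: (Lmulh _ M) => //; exact: nb.
- by apply: (Lmulh _ M) => //; exact: nb.
by apply: eq_Rintegral => x _; rewrite -mulrBl {3}fE.
Qed.

End RieszRepresentation.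

(** * Fatou's lemma and completeness of L^r *)

Section LpLimits.
Context d (T : measurableType d) (R : realType).
Variable mu : {measure set T -> \bar R}.
Implicit Types (f g h : T -> R).

Lemma limn_einf_le_cst (u : (\bar R)^nat) l : (forall n, u n <= l)%E ->
  (limn_einf u <= l)%E.
Proof.
move=> ul; rewrite limn_einf_lim; apply: lime_le; first exact: is_cvg_einfs.
by apply: nearW => n; apply: le_trans (ul n); apply: ereal_inf_lbound; exists n => /=.
Qed.

(** Fatou's lemma for the r-th powers. A uniform norm bound puts a pointwise limit into L^r without
    any dominating function. *)
Lemma fatou_nrm (r : R) (f_ : nat -> T -> R) f C : 1 <= r ->
  (forall n, f_ n \in Lfun mu r%:E) -> measurable_fun [set: T] f ->
  {ae mu, forall x, f_ n x @[n --> \oo] --> f x} ->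
  (forall n, nrm mu r%:E (f_ n) <= C) ->
  f \in Lfun mu r%:E /\ nrm mu r%:E f <= C.
Proof.
move=> r1 Lf_ mf cf fC; have r0 : 0 < r by exact: lt_le_trans r1.
have C0 : 0 <= C by exact: le_trans (nrm_ge0 _ _ _) (fC 0%N).
have mpow g : measurable_fun [set: T] g ->
    measurable_fun [set: T] (fun x => (`|g x| `^ r)%:E).
  move=> mg; apply/measurable_EFinP.
  apply: (@measurableT_comp _ _ _ _ _ _ (fun x : R => x `^ r)); first exact: measurable_powR.
  exact: measurableT_comp.
have mf_ n := Lfun_meas (Lf_ n).
apply: nrm_le_powR => //.
have -> : (\int[mu]_x (`|f x| `^ r)%:E =
    \int[mu]_x limn_einf (fun n => (`|f_ n x| `^ r)%:E))%E.
  apply: ae_eq_integral => //.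
  - exact: mpow.
  - rewrite (_ : (fun x => _) = (fun x => - limn_esup (fun n => - (`|f_ n x| `^ r)%:E))%E); last first.
      apply/funext => x; have := limn_esupN (fun n => (`|f_ n x| `^ r)%:E).
      by rewrite /comp => ->; rewrite oppeK.
    apply: measurableT_comp => //.
    by apply: measurable_fun_limn_esup => n; apply: measurableT_comp => //; exact: mpow.
  apply/ae_eqP; apply: (ae_mono cf) => x cfx.
  apply/esym; apply: (cvg_limn_einf_sup _).1.
  apply/fine_cvgP; split; first exact: nearW.
  have cn : (`|f_ n x| @[n --> \oo] --> `|f x|) by exact: cvg_norm.
  (* The power function is differentiable, hence continuous, at positive arguments; at 0 the limit
     is checked by hand. *)
  have [fx0|fx0] := eqVneq (f x) 0.
    rewrite /= fx0 normr0 powR0 ?gt_eqF//; apply/cvgr0Pnorm_lt => e e0.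
    move: cn; rewrite fx0 normr0 => /cvgr0Pnorm_lt /(_ (e `^ r^-1)).
    rewrite powR_gt0// => /(_ isT); apply: filterS => n; rewrite normr_id => H /=.
    rewrite ger0_norm ?powR_ge0//.
    have -> : e = (e `^ r^-1) `^ r by rewrite -powRrM mulVf ?gt_eqF// powRr1// ltW.
    by apply: gt0_ltr_powR => //; rewrite nnegrE// powR_ge0.
  have fx1 : 0 < `|f x| by rewrite normr_gt0.
  apply: (cvg_comp (fun n => `|f_ n x|) (fun t => t `^ r) cn).
  have : derivable (@powR R ^~ r) `|f x| 1 by apply: derivable_powR; rewrite in_itv/= fx1.
  by move/derivable1_diffP/differentiable_continuous.
apply: le_trans (fatou _ _ _ _) _ => //.
- by move=> n; exact: mpow.
apply: limn_einf_le_cst => n; rewrite nrm_powR_e// lee_fin.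
by apply: ge0_ler_powR; rewrite ?nnegrE ?nrm_ge0// ltW.
Qed.

Lemma nrm_cvg_int (r r' : \bar R) (f_ : nat -> T -> R) f h : conjp r r' ->
  (forall n, f_ n \in Lfun mu r) -> f \in Lfun mu r -> h \in Lfun mu r' ->
  nrm mu r (f_ n \- f) @[n --> \oo] --> (0 : R) ->
  \int[mu]_x (f_ n x * h x) @[n --> \oo] --> \int[mu]_x (f x * h x).
Proof.
move=> rr Lf_ Lf Lh H; apply/cvgrPdistC_lt => e e0.
have r1 : (1 <= r)%E by case: rr.
have C1 : 0 < nrm mu r' h + 1 by rewrite ltr_wpDl ?nrm_ge0.
move/cvgr0Pnorm_lt : H => /(_ (e / (nrm mu r' h + 1))); rewrite divr_gt0// => /(_ isT).
apply: filterS => n; rewrite ger0_norm ?nrm_ge0// => H.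
rewrite -RintB; [|exact: (hoelderR rr (Lf_ n) Lh).1|exact: (hoelderR rr Lf Lh).1].
under eq_Rintegral do rewrite -mulrBl.
apply: le_lt_trans (hoelder_int rr (LfunB r1 (Lf_ n) Lf) Lh) _.
move: H; rewrite ltr_pdivlMr// => H.
by apply: le_lt_trans H; rewrite ler_wpM2l ?nrm_ge0// lerDl ler01.
Qed.

Lemma conjp_fin (r r' : R) : 1 < r -> r^-1 + r'^-1 = 1 -> conjp r%:E r'%:E /\ 1 < r'.
Proof.
move=> r1 rr'; have r0 : 0 < r by exact: lt_trans r1.
have r'V : r'^-1 = 1 - r^-1 by rewrite -rr' addrC addKr.
have rV1 : r^-1 < 1 by rewrite invf_lt1.
have rV0 : 0 < r^-1 by rewrite invr_gt0.
have r'0 : 0 < r' by rewrite -invr_gt0 r'V subr_gt0.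
have r'1 : 1 < r' by rewrite -invf_lt1// r'V ltrBlDr ltrDl.
split=> //; split; rewrite ?lee_fin ?ltW//; left; exists r, r'; split => //.
Qed.

Hypothesis muT : (mu setT < +oo)%E.

(** Hoelder against the constant 1. The case r = 1 comes first: its conjugate exponent is infinite,
    while (1 - r^-1)^-1 would evaluate to 0. *)
Lemma nrm1_le (r : R) : 1 <= r -> exists2 K : R, 0 <= K & forall g,
  g \in Lfun mu r%:E -> nrm mu 1%E g <= K * nrm mu r%:E g.
Proof.
rewrite le_eqVlt => /predU1P[<-|r1]; first by exists 1 => // g _; rewrite mul1r.
have [rr _] : conjp r%:E (1 - r^-1)^-1%:E /\ 1 < (1 - r^-1)^-1.
  by apply: conjp_fin => //; rewrite invrK addrC subrK.
have L1 : (cst 1 : T -> R) \in Lfun mu (1 - r^-1)^-1%:E.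
  by case: rr => _ r' _; apply: (@bounded_Lfun_all _ _ _ _ muT _ _ 1) => // x; rewrite normr1.
exists (nrm mu (1 - r^-1)^-1%:E (cst 1 : T -> R)); first exact: nrm_ge0.
move=> g Lg; have [_] := hoelderR rr Lg L1; rewrite [leRHS]mulrC.
by rewrite (_ : g \* cst 1 = g)//; apply/funext => x /=; rewrite mulr1.
Qed.

Lemma sum_half_le n : \sum_(k < n) (2^-1 : R) ^+ k <= 2.
Proof.
suff -> : \sum_(k < n) (2^-1 : R) ^+ k = 2 - 2 * 2^-1 ^+ n.
  by rewrite gerBl mulr_ge0// exprn_ge0.
elim: n => [|n IH]; first by rewrite big_ord0 expr0 mulr1 subrr.
rewrite big_ord_recr/= IH exprS; lra.
Qed.

(** Along a subsequence with increments below 2^-k the sum of the absolute increments has a finite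
    L^1 norm, hence is finite almost everywhere, and the subsequence converges there. Fatou carries
    the Cauchy estimates over to the limit. *)
Lemma Lp_complete (r : R) (f_ : nat -> T -> R) : 1 <= r ->
  (forall n, f_ n \in Lfun mu r%:E) ->
  (forall e, 0 < e -> exists N, forall m n, (N <= m)%N -> (N <= n)%N ->
    nrm mu r%:E (f_ m \- f_ n) <= e) ->
  exists2 f, f \in Lfun mu r%:E & nrm mu r%:E (f_ n \- f) @[n --> \oo] --> (0 : R).
Proof.
move=> r1 Lf_ cau; have r1e : (1 <= r%:E)%E by rewrite lee_fin.
have [K K0 HK] := nrm1_le r1.
have /choice[N HN] : forall k : nat, exists N, forall m n, (N <= m)%N -> (N <= n)%N ->
    nrm mu r%:E (f_ m \- f_ n) <= 2^-1 ^+ k by move=> k; apply: cau; rewrite exprn_gt0.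
(* Partial sums of the thresholds are monotone in k and dominate each [N k]. *)
pose phi k := (\sum_(i < k.+1) N i)%N.
have phiN k : (N k <= phi k)%N by rewrite /phi big_ord_recr leq_addl.
have phinc k j : (phi k <= phi (j + k))%N.
  elim: j => // j IH; apply: leq_trans IH _.
  by rewrite /phi addSn [leqRHS]big_ord_recr leq_addr.
pose D k x := `|f_ (phi k.+1) x - f_ (phi k) x|.
have LD k : D k \in Lfun mu r%:E.
  by apply: Lfun_abs => //; [rewrite lte_fin (lt_le_trans _ r1)|exact: LfunB].
have LD1 k : D k \in Lfun mu 1%E by exact: (Lfun_sub1 muT r1e).
have nD k : nrm mu 1%E (D k) <= K * 2^-1 ^+ k.
  apply: le_trans (HK _ (LD k)) _; rewrite ler_wpM2l//.
  rewrite [nrm _ _ _](nrm_abs _ (LfunB r1e (Lf_ (phi k.+1)) (Lf_ (phi k)))); last first.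
    by rewrite lte_fin (lt_le_trans _ r1).
  by apply: HN; rewrite ?phiN// (leq_trans (phiN k))// (phinc k 1%N).
pose G x := (\sum_(0 <= k <oo) (D k x)%:E)%E.
have mD k : measurable_fun [set: T] (fun x => (D k x)%:E).
  by apply/measurable_EFinP; exact: Lfun_meas (LD k).
have D0 k x : (0 <= (D k x)%:E)%E by rewrite lee_fin /D.
have GK : (\int[mu]_x G x <= (K * 2)%:E)%E.
  rewrite /G integral_nneseries//.
  apply: lime_le.
    by apply: is_cvg_nneseries => n _ _; exact: integral_ge0.
  apply: nearW => n; rewrite big_mkord.
  rewrite (_ : (\sum_(i < n) _)%E = (\sum_(i < n) nrm mu 1%E (D i))%:E); last first.
    rewrite -sumEFin; apply: eq_bigr => i _; rewrite -nrmE// Lnorm1.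
    by apply: eq_integral => x _; rewrite gee0_abs//; exact: D0.
  rewrite lee_fin; apply: le_trans (_ : \sum_(i < n) K * 2^-1 ^+ i <= _).
    by apply: ler_sum => i _.
  by rewrite -mulr_sumr ler_wpM2l// sum_half_le.
have mG : measurable_fun [set: T] G by exact: ge0_emeasurable_sum.
have G0 x : (0 <= G x)%E by exact: nneseries_ge0.
have iG : mu.-integrable setT G.
  apply/integrableP; split => //.
  under eq_integral do rewrite gee0_abs//.
  exact: le_lt_trans GK (ltry _).
(* The upper limit is measurable whether or not the sequence converges, and is the limit wherever it
   does. *)
pose f x := fine (limn_esup (fun k => (f_ (phi k) x)%:E)).
have mf : measurable_fun [set: T] f.
  apply: (measurableT_comp (fine_measurable measurableT)).
  apply: measurable_fun_limn_esup => n; apply/measurable_EFinP; exact: Lfun_meas (Lf_ _).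
have cf : {ae mu, forall x, f_ (phi k) x @[k --> \oo] --> f x}.
  apply: (ae_mono (integrable_ae measurableT iG)) => x /(_ I) Gfin.
  have cvd : cvgn (fun k => f_ (phi k) x).
    have ser : cvgn (series (telescope (fun k => f_ (phi k) x))).
      apply: normed_cvg; apply: nondecreasing_is_cvgn.
        apply/nondecreasing_seqP => n.
        by rewrite /normed_series_of /series/= big_nat_recr//= lerDl normr_ge0.
      exists (fine (G x)) => _ [n _ <-].
      rewrite -lee_fin fineK// /normed_series_of /series/= -sumEFin.
      exact: (@nneseries_lim_ge _ (fun k => (D k x)%:E) xpredT 0%N).
    rewrite (_ : (fun k => f_ (phi k) x) = (fun n => f_ (phi 0%N) x + series (telescope (fun k => f_ (phi k) x)) n)).
      by apply: is_cvgD => //; exact: is_cvg_cst.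
    by apply/funext => n; rewrite -(eq_sum_telescope (fun k => f_ (phi k) x)).
  have cE : ((f_ (phi k) x)%:E @[k --> \oo] --> (limn (fun k => f_ (phi k) x))%:E)%E.
    by apply: cvg_EFin => //; exact: nearW.
  by rewrite /f (cvg_limn_einf_sup cE).2.
exists f.
  have H := fatou_nrm r1 (f_ := fun k => f_ (phi k)) _ mf cf.
  apply: (H (nrm mu r%:E (f_ (phi 0%N)) + 1) _ _).1 => // n.
  rewrite -lerBlDl; apply: le_trans (_ : nrm mu r%:E (f_ (phi n) \- f_ (phi 0%N)) <= _).
    rewrite lerBlDr; apply: le_trans (nrmD r1e (LfunB r1e (Lf_ _) (Lf_ _)) (Lf_ (phi 0%N))).
    by rewrite le_eqVlt; apply/orP; left; apply/eqP; congr nrm; apply/funext => x /=; rewrite subrK.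
  rewrite -(expr0 (2^-1 : R)); apply: HN; rewrite ?phiN//.
  by rewrite (leq_trans (phiN 0%N))//; have := phinc 0%N n; rewrite addn0.
(* Fatou along the subsequence, shifted by k so that all its indices exceed [N k]. *)
have key k n : (N k <= n)%N -> nrm mu r%:E (f_ n \- f) <= 2^-1 ^+ k.
  move=> Nkn.
  apply: (fatou_nrm r1 (f_ := fun j => f_ n \- f_ (phi (j + k)%N)) _ _ _ _).2.
  - by move=> j; exact: LfunB.
  - by apply: measurable_funB => //; exact: Lfun_meas (Lf_ n).
  - apply: (ae_mono cf) => x cfx /=; apply: cvgB; first exact: cvg_cst.
    by move: cfx; rewrite -(cvg_shiftn k).
  - by move=> j; apply: HN => //; apply: leq_trans (phiN k) (phinc _ _).
apply/cvgr0Pnorm_le => e e0.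
have : (2^-1 : R) ^+ k @[k --> \oo] --> (0 : R).
  by apply: cvg_expr; rewrite ger0_norm// invf_lt1// ltr1n.
move/cvgr0Pnorm_le => /(_ _ e0) [k _ Hk].
exists (N k) => // n /= Nkn; rewrite ger0_norm ?nrm_ge0//.
apply: le_trans (key k n Nkn) _.
by have := Hk k (leqnn k); rewrite ger0_norm// exprn_ge0.
Qed.

End LpLimits.

Section RieszLp.
Context d (T : measurableType d) (R : realType).
Variable mu : {measure set T -> \bar R}.
Hypothesis muT : (mu setT < +oo)%E.
Implicit Types (f g h : T -> R).

Definition clamp (k : nat) (t : R) : R := Num.max (- k%:R) (Num.min t k%:R).

Lemma clamp_bound k t : `|clamp k t| <= k%:R.
Proof.
rewrite ler_norml /clamp le_max lexx/= ge_max ge_min lexx orbT andbT.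
by rewrite (le_trans _ (ler0n R k))// oppr_le0 ler0n.
Qed.

Lemma clamp_le k t : `|clamp k t| <= `|t|.
Proof.
have k0 : (0 : R) <= k%:R by [].
rewrite /clamp; case: (leP t k%:R) => tk; case: (leP (- k%:R) _) => kt.
- by [].
- have : t <= 0 by lra.
  move=> t0; rewrite normrN (ger0_norm k0) ler0_norm//; lra.
- rewrite (ger0_norm k0) ger0_norm//; lra.
- lra.
Qed.

Lemma clamp_cvg t : clamp k t @[k --> \oo] --> t.
Proof.
apply: cvg_near_cst; exists (Num.bound `|t|) => // k /= tk.
have : `|t| < k%:R.
  apply: lt_le_trans (archi_boundP (normr_ge0 _)) _; by rewrite ler_nat.
rewrite ltr_norml => /andP[a b]; rewrite /clamp min_l ?max_r//; exact: ltW.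
Qed.

Lemma measurable_clamp k f : measurable_fun [set: T] f ->
  measurable_fun [set: T] (fun x => clamp k (f x)).
Proof. by move=> mf; apply: measurable_maxr => //; exact: measurable_minr. Qed.

Lemma clamp_nrm_cvg (r : R) f : 1 <= r -> f \in Lfun mu r%:E ->
  nrm mu r%:E ((fun x => clamp k (f x)) \- f) @[k --> \oo] --> (0 : R).
Proof.
move=> r1 Lf; have mf := Lfun_meas Lf.
apply: (dominated_nrm r1 _ mf _ (g := fun x => `|f x|) _ _).2.
- by move=> k; exact: measurable_clamp.
- by apply: nearW => x; exact: clamp_cvg.
- by apply: Lfun_abs => //; rewrite lte_fin (lt_le_trans _ r1).
- by apply: nearW => x n; exact: clamp_le.
Qed.

(** Truncations of f converge to f in L^r, and both sides are continuous there once h lies in the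
    dual space. The dual integrability of h is what the two representation results below have to
    supply. *)
Lemma riesz_extend (r : R) (r' : \bar R) (L : (T -> R) -> R) C h : conjp r%:E r' ->
  0 <= C ->
  (forall a f g, f \in Lfun mu r%:E -> g \in Lfun mu r%:E ->
    L (fun x => a * f x + g x) = a * L f + L g) ->
  (forall f, f \in Lfun mu r%:E -> `|L f| <= C * nrm mu r%:E f) ->
  (forall f (M : R), measurable_fun [set: T] f -> (forall x, `|f x| <= M) ->
    L f = \int[mu]_x (f x * h x)) ->
  h \in Lfun mu r' ->
  forall f, f \in Lfun mu r%:E -> L f = \int[mu]_x (f x * h x).
Proof.
move=> rr C0 Llin Lbnd Lb Lh f Lf; have r1 : 1 <= r by case: rr; rewrite lee_fin.
have mf := Lfun_meas Lf.
have Lk k : (fun x => clamp k (f x)) \in Lfun mu r%:E.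
  apply: (@bounded_Lfun_all _ _ _ _ muT _ _ k%:R); rewrite ?lee_fin//.
    exact: measurable_clamp.
  by move=> x; exact: clamp_bound.
have c1 := bounded_linear_cvg r1 C0 Llin Lbnd Lk Lf (clamp_nrm_cvg r1 Lf).
have c2 := nrm_cvg_int rr Lk Lf Lh (clamp_nrm_cvg r1 Lf).
have E : (fun k => L (fun x => clamp k (f x))) = (fun k => \int[mu]_x (clamp k (f x) * h x)).
  apply/funext => k; apply: (Lb _ k%:R); first exact: measurable_clamp.
  by move=> x; exact: clamp_bound.
by rewrite E in c1; exact: cvg_unique c1 c2.
Qed.

(** Let A be the set where s h > C. Testing L on s 1_A shows that s h has integral at most C mu(A)
    over A, so the nonnegative function 1_A (s h - C) has integral 0. With s = 1 and s = -1 this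
    bounds |h| by C almost everywhere. *)
Lemma riesz_L1 (L : (T -> R) -> R) C : 0 <= C ->
  (forall a f g, f \in Lfun mu 1%E -> g \in Lfun mu 1%E ->
    L (fun x => a * f x + g x) = a * L f + L g) ->
  (forall f, f \in Lfun mu 1%E -> `|L f| <= C * nrm mu 1%E f) ->
  exists2 h, h \in Lfun mu +oo%E & forall f, f \in Lfun mu 1%E ->
    L f = \int[mu]_x (f x * h x).
Proof.
move=> C0 Llin Lbnd.
have [h Lh Hh] := riesz_bounded muT (lexx 1) C0 Llin Lbnd.
have mh := Lfun_meas Lh.
have half (s : R) : `|s| = 1 -> {ae mu, forall x, s * h x <= C}.
  move=> s1; pose A := [set x | C < s * h x].
  have mA : measurable A.
    rewrite -[A]setTI; apply: measurable_fun_ltr => //.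
    exact: measurable_funM.
  have m1 : measurable_fun [set: T] (fun x => s * \1_A x) by exact: measurable_funM.
  have b1 x : `|s * \1_A x| <= 1.
    by rewrite normrM s1 mul1r indicE; case: (_ \in _); rewrite /= ?normr0 ?normr1.
  have Ls1 : (fun x => s * \1_A x) \in Lfun mu 1%E.
    exact: (@bounded_Lfun_all _ _ _ _ muT _ _ 1).
  have H1 := Lbnd _ Ls1; rewrite (Hh _ 1)// in H1.
  have L1A := Lfun_indic muT (lexx 1%E) mA.
  have LhA : (fun x => \1_A x * (s * h x)) \in Lfun mu 1%E.
    rewrite (_ : (fun x => _) = (fun x => s * \1_A x) \* h); last first.
      by apply/funext => x /=; rewrite mulrCA mulrA.
    apply: (hoelderR (conjpC (r := 1%E) (r' := +oo%E) _) _ Lh).1.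
      by split; rewrite ?leey//; right; left.
    by apply: (@bounded_Lfun_all _ _ _ _ muT _ _ 1) => //; rewrite leey.
  pose k x := \1_A x * (s * h x - C).
  have k0 x : 0 <= k x.
    rewrite /k indicE; case: (boolP (x \in A)) => [|_]; last by rewrite mul0r.
    by rewrite inE /A/= => Ax; rewrite mul1r subr_ge0 ltW.
  have Lk : k \in Lfun mu 1%E.
    rewrite (_ : k = (fun x => \1_A x * (s * h x)) \- (fun x => C * \1_A x)).
      by apply: LfunB => //; exact: LfunZ.
    by apply/funext => x /=; rewrite /k mulrBr [X in _ - X]mulrC.
  have nk : nrm mu 1%E k = 0.
    apply/eqP; rewrite eq_le nrm_ge0 andbT nrm1E.
    under eq_Rintegral do rewrite ger0_norm//.
    rewrite (_ : (fun x => k x) = (fun x => \1_A x * (s * h x) - C * \1_A x)); last first.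
      by apply/funext => x /=; rewrite /k mulrBr [X in _ - X]mulrC.
    rewrite RintB//; last exact: LfunZ.
    rewrite RintZ// subr_le0.
    move: H1; rewrite nrmZ// s1 mul1r nrm1E.
    under [X in _ <= _ * X]eq_Rintegral do rewrite ger0_norm//.
    move=> H1; apply: le_trans H1; apply: le_trans (ler_norm _).
    by rewrite le_eqVlt; apply/orP; left; apply/eqP; apply: eq_Rintegral => x _; rewrite mulrCA mulrA.
  have /ae_eqP := nrm_eq0 (r := 1%E) lte01 Lk nk.
  move=> H; apply: (ae_mono H) => x /= kx; rewrite leNgt; apply/negP => Ax.
  move: kx; rewrite /k indicE mem_set// mul1r => /eqP; rewrite subr_eq0 => /eqP E.
  by rewrite E ltxx in Ax.
have hC : {ae mu, forall x, `|h x| <= C}.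
  have := half 1 (normr1 _); have := half (-1) (normrN1 _).
  by apply: filterS2 => x; rewrite mul1r mulN1r => a b; rewrite ler_norml lerNl a b.
have [Lhy _] := ae_bound_Linfty mh hC C0.
exists h => //; apply: (riesz_extend _ C0 Llin Lbnd Hh Lhy).
by split; rewrite ?leey//; right; left.
Qed.

(** The extremal function in Hoelder's inequality is sign(h) |h|^(r'-1). Replacing |h| by m =
    min(|h|, k) makes it bounded, with r-norm equal to the power r' - 1 of the r'-norm N of m. The
    bound on L then gives N^r' <= C N^(r'-1), so N <= C for every k, and Fatou lets k grow. *)
Lemma riesz_Lp (r r' : R) (L : (T -> R) -> R) C : 1 < r -> r^-1 + r'^-1 = 1 ->
  0 <= C ->
  (forall a f g, f \in Lfun mu r%:E -> g \in Lfun mu r%:E ->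
    L (fun x => a * f x + g x) = a * L f + L g) ->
  (forall f, f \in Lfun mu r%:E -> `|L f| <= C * nrm mu r%:E f) ->
  exists2 h, h \in Lfun mu r'%:E & forall f, f \in Lfun mu r%:E ->
    L f = \int[mu]_x (f x * h x).
Proof.
move=> r1 rr' C0 Llin Lbnd; have [rr r'1] := conjp_fin r1 rr'.
have [h Lh Hh] := riesz_bounded muT (ltW r1) C0 Llin Lbnd.
have mh := Lfun_meas Lh.
have r0 : 0 < r by exact: lt_trans r1.
have r'0 : 0 < r' by exact: lt_trans r'1.
have r'B : r' - 1 != 0 by rewrite subr_eq0 gt_eqF.
have eB : (r' - 1) * r = r'.
  have : r * r' * (r^-1 + r'^-1) = r * r' by rewrite rr' mulr1.
  by rewrite mulrDr mulrAC divff ?gt_eqF// mul1r mulfK ?gt_eqF// => H; rewrite mulrBl mul1r [r' * r]mulrC -H addrK.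
have rrV : r * r^-1 = 1 by rewrite divff// gt_eqF.
have r'rV : r' * r^-1 = r' - 1 by rewrite -[X in X * r^-1]eB mulfK// gt_eqF.
pose m k x := Num.min `|h x| k%:R.
(* The sign is produced by the positive and negative parts of h: at every point at least one of the
   two terms is a power of 0, which vanishes because r' - 1 is not 0. *)
pose s k x := Num.min (Num.max (h x) 0) k%:R `^ (r' - 1)
  - Num.min (Num.max (- h x) 0) k%:R `^ (r' - 1).
have mm k : measurable_fun [set: T] (m k).
  by apply: measurable_minr => //; exact: measurableT_comp.
have mpow (p : R) f : measurable_fun [set: T] f -> measurable_fun [set: T] (fun x => f x `^ p).
  move=> mf; apply: (@measurableT_comp _ _ _ _ _ _ (fun x : R => x `^ p)) => //.
have ms k : measurable_fun [set: T] (s k).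
  apply: measurable_funB; apply: mpow; apply: measurable_minr => //; apply: measurable_maxr => //.
  exact: measurableT_comp.
have m0 k x : 0 <= m k x by rewrite /m le_min normr_ge0/=.
have mk k x : m k x <= k%:R by rewrite /m ge_min lexx orbT.
have min0 (k : nat) : Num.min 0 k%:R `^ (r' - 1) = 0 :> R by rewrite min_l// powR0.
have sE k x : `|s k x| = m k x `^ (r' - 1) /\ s k x * h x = m k x `^ (r' - 1) * `|h x|.
  rewrite /s /m; have [hx|hx] := leP 0 (h x).
    rewrite (@max_r _ _ (- h x)) ?oppr_le0// min0 subr0 ger0_norm ?powR_ge0//.
    by rewrite (ger0_norm hx).
  rewrite (@max_l _ _ (- h x)) ?oppr_ge0 ?(ltW hx)// min0 sub0r normrN ger0_norm ?powR_ge0//.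
  by rewrite (ltr0_norm hx) mulrN mulNr.
have sb k x : `|s k x| <= k%:R `^ (r' - 1).
  rewrite (sE k x).1; apply: ge0_ler_powR; rewrite ?nnegrE ?subr_ge0 ?(ltW r'1)//.
have Ls k : s k \in Lfun mu r%:E.
  by apply: (@bounded_Lfun_all _ _ _ _ muT _ _ (k%:R `^ (r' - 1))); rewrite ?lee_fin ?(ltW r1).
have Lm k : m k \in Lfun mu r'%:E.
  apply: (@bounded_Lfun_all _ _ _ _ muT _ _ k%:R); rewrite ?lee_fin ?(ltW r'1)//.
  by move=> x; rewrite ger0_norm.
have nm k : nrm mu r'%:E (m k) <= C.
  have := Hh _ _ (ms k) (sb k) => Lsk.
  have iE : \int[mu]_x (`|m k x| `^ r') <= \int[mu]_x (s k x * h x).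
    apply: le_Rintegral => //.
    - exact: (Lfun_scale1 r'0 (m k) (Lm k)).
    - apply/Lfun1P; apply: (hoelderR (conjpC (r := 1%E) (r' := +oo%E) _) _ Lh).1.
        by split; rewrite ?leey//; right; left.
      by apply: (@bounded_Lfun_all _ _ _ _ muT _ _ (k%:R `^ (r' - 1))) => //; rewrite leey.
    - move=> x _; rewrite (sE k x).2 ger0_norm// -mulr_powRB1// mulrC.
      by rewrite ler_wpM2l ?powR_ge0// /m ge_min lexx.
  have nsE : nrm mu r%:E (s k) = nrm mu r'%:E (m k) `^ (r' - 1).
    have : nrm mu r%:E (s k) `^ r = nrm mu r'%:E (m k) `^ r'.
      rewrite (nrm_powR r0 (Ls k)) (nrm_powR r'0 (Lm k)); apply: eq_Rintegral => x _.
      by rewrite (sE k x).1 -powRrM eB ger0_norm.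
    move/(congr1 (fun t => t `^ r^-1)); rewrite -!powRrM rrV r'rV => <-.
    by rewrite powRr1// nrm_ge0.
  have H : nrm mu r'%:E (m k) `^ r' <= C * nrm mu r'%:E (m k) `^ (r' - 1).
    rewrite nrm_powR//; apply: le_trans iE _; rewrite -Lsk -nsE.
    exact: le_trans (ler_norm _) (Lbnd _ (Ls k)).
  have := nrm_ge0 mu r'%:E (m k); rewrite le_eqVlt => /predU1P[<-//|N0].
  by move: H; rewrite -mulr_powRB1 ?nrm_ge0// ler_pM2r// powR_gt0.
have Lh' : h \in Lfun mu r'%:E.
  have L' : (fun x => `|h x|) \in Lfun mu r'%:E.
    apply: (fatou_nrm (ltW r'1) Lm _ _ nm).1; first exact: measurableT_comp.
    apply: nearW => x; apply: cvg_near_cst; exists (Num.bound `|h x|) => // k /= tk.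
    rewrite /m min_l// ltW//.
    apply: lt_le_trans (archi_boundP (normr_ge0 _)) _; by rewrite ler_nat.
  by apply: Lfun_ae_le L' _ => //; apply: nearW => x; rewrite normr_id.
exists h => //; exact: (riesz_extend rr C0 Llin Lbnd Hh Lh').
Qed.

End RieszLp.

(** * Hahn-Banach separation *)

Section SublinearHahnBanach.
Context (R : realType) (V : lmodType R).
Implicit Types (p q : V -> R) (x y : V).

Variable S : V -> Prop.
Hypothesis S0 : S 0.
Hypothesis SD : forall x y, S x -> S y -> S (x + y).
Hypothesis SZ : forall (a : R) x, S x -> S (a *: x).

(* The values outside of S are forced to be 0 so that the pointwise order, to
   which Zorn's lemma is applied, is antisymmetric. *)
Definition sublinear p : Prop :=
  [/\ forall x, ~ S x -> p x = 0,
      forall x y, S x -> S y -> p (x + y) <= p x + p y &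
      forall (a : R) x, 0 <= a -> S x -> p (a *: x) = a * p x].

Let SN x : S x -> S (- x). Proof. by rewrite -scaleN1r; exact: SZ. Qed.

Lemma sublinear0 p : sublinear p -> p 0 = 0.
Proof. by case=> _ _ H; rewrite -(scale0r 0) H// mul0r. Qed.

Lemma sublinearN p x : sublinear p -> S x -> - p (- x) <= p x.
Proof.
move=> sp Sx; case: (sp) => _ H _; rewrite -subr_ge0 opprK -(sublinear0 sp) -(subrr x).
by apply: H => //; exact: SN.
Qed.

(** Zorn's lemma for the reversed pointwise order. The pointwise infimum of a chain is finite on S,
    since each member q satisfies q x >= - q (- x) >= - p (- x). *)
Lemma minimal_sublinear p : sublinear p -> exists q,
  [/\ sublinear q, forall x, q x <= p x &
      forall q', sublinear q' -> (forall x, q' x <= q x) -> q' = q].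
Proof.
move=> sp.
pose W := {q | sublinear q /\ forall x, q x <= p x}.
pose le (q1 q2 : W) : bool := `[< forall x, sval q2 x <= sval q1 x >].
have [||| |q Hq] := @Zorn W le.
- by move=> t; apply/asboolP.
- by move=> r s t /asboolP rs /asboolP st; apply/asboolP => x; exact: le_trans (st x) (rs x).
- move=> s t /asboolP st /asboolP ts; apply: eq_sig_hprop => [? ? ?|]; first exact: Prop_irrelevance.
  apply/funext => x.
  by apply/eqP; rewrite eq_le st ts.
- move=> A Atot.
  have [[q0 Aq0]|nA] := pselect (exists q : W, A q); last first.
    have wp : sublinear p /\ forall x, p x <= p x by split.
    exists (exist _ p wp) => s As; exfalso; apply: nA; by exists s.
  pose B x : set R := [set sval q x | q in A].
  have Blb (x : V) : S x -> lbound (B x) (- p (- x)).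
    move=> Sx _ [q Aq <-]; have [sq qp] := svalP q.
    by apply: le_trans (sublinearN sq Sx); rewrite lerN2.
  have B0 x : B x !=set0 by exists (sval q0 x), q0.
  have infle (x : V) (q : W) : S x -> A q -> inf (B x) <= sval q x.
    move=> Sx Aq; apply: inf_lbound; last by exists q.
    by exists (- p (- x)); exact: Blb.
  pose m x := if `[< S x >] then inf (B x) else 0.
  have mE x : S x -> m x = inf (B x) by move=> Sx; rewrite /m asboolT.
  have sm : sublinear m.
    split.
    - by move=> x nS; rewrite /m asboolF.
    - move=> x y Sx Sy; rewrite !mE//; last exact: SD.
      apply/ler_addgt0Pr => e e0; have e2 : 0 < e / 2 by rewrite divr_gt0.
      have hx : has_inf (B x) by split => //; exists (- p (- x)); exact: Blb.
      have hy : has_inf (B y) by split => //; exists (- p (- y)); exact: Blb.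
      have [_ [q1 Aq1 <-] H1] := inf_adherent e2 hx.
      have [_ [q2 Aq2 <-] H2] := inf_adherent e2 hy.
      (* Two nearly minimal members, one for x and one for y, are comparable; the smaller one serves
         both points. *)
      have [q Aq [L1 L2]] : exists2 q, A q & sval q x <= sval q1 x /\ sval q y <= sval q2 y.
        case: (Atot _ _ Aq1 Aq2) => /asboolP H; first by exists q2.
        by exists q1.
      have [[_ qD _] _] := svalP q.
      apply: le_trans (infle _ _ (SD Sx Sy) Aq) _; apply: le_trans (qD _ _ Sx Sy) _.
      lra.
    - move=> a x a0 Sx; rewrite !mE//; last exact: SZ.
      move: a0; rewrite le_eqVlt => /predU1P[<-|a0].
        rewrite mul0r; apply/eqP; rewrite eq_le; apply/andP; split.
          apply: le_trans (infle _ _ (SZ 0 Sx) Aq0) _.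
          by have [[_ _ ->]] := svalP q0; rewrite ?mul0r.
        apply: lb_le_inf => // _ [q Aq <-].
        by have [[_ _ ->]] := svalP q; rewrite ?mul0r.
      (* One inequality for all positive scalars suffices: used for a^-1 at the point a x it yields
         the reverse one. *)
      have key (b : R) z : 0 < b -> S z -> b * inf (B z) <= inf (B (b *: z)).
        move=> b0 Sz; apply: lb_le_inf => // _ [q Aq <-].
        have [[_ _ ->//]] := svalP q; last exact: ltW.
        by move=> _; rewrite ler_pM2l//; exact: infle.
      apply/eqP; rewrite eq_le key// andbT.
      have aV : 0 < a^-1 by rewrite invr_gt0.
      have := key _ _ aV (SZ a Sx); rewrite scalerA mulVf ?gt_eqF// scale1r.
      by rewrite ler_pdivrMl.
  have mp x : m x <= p x.
    have [Sx|nSx] := pselect (S x).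
      rewrite mE//; apply: le_trans (infle _ _ Sx Aq0) _.
      by have [_] := svalP q0.
    by rewrite /m asboolF//; case: sp => ->.
  exists (exist _ m (conj sm mp)) => s As; apply/asboolP => x /=.
  have [Sx|nSx] := pselect (S x); first by rewrite mE//; exact: infle.
  rewrite /m asboolF//; have [[H _ _] _] := svalP s; by rewrite H.
exists (sval q); have [sq qp] := svalP q; split => // q' sq' q'q.
have q'p x : q' x <= p x by exact: le_trans (q'q x) (qp x).
have : le q (exist _ q' (conj sq' q'p)) by apply/asboolP => x.
by move=> /Hq /(congr1 sval).
Qed.

(** For fixed y, the infimum over t >= 0 of q (z + t y) - t q y is again sublinear in z and lies
    below q, so by minimality it equals q. Its term t = 1 at z = x then reads q x + q y <= q (x +
    y). *)
Lemma minimal_sublinear_linear q : sublinear q ->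
  (forall q', sublinear q' -> (forall x, q' x <= q x) -> q' = q) ->
  forall (a : R) x y, S x -> S y -> q (a *: x + y) = a * q x + q y.
Proof.
move=> sq mq; have [q0 qD qZ] := sq.
have add x y : S x -> S y -> q (x + y) = q x + q y.
  move=> Sx Sy.
  pose B z : set R := [set q (z + t *: y) - t * q y | t in [set t : R | 0 <= t]].
  have Blb z : S z -> lbound (B z) (- q (- z)).
    move=> Sz _ [t /= t0 <-]; rewrite -qZ// lerBrDr.
    rewrite addrC -lerBrDr opprK addrC.
    have := qD (z + t *: y) (- z) (SD Sz (SZ t Sy)) (SN Sz).
    have -> : z + t *: y - z = t *: y by rewrite addrAC subrr add0r.
    by rewrite [X in _ <= X -> _]addrC.
  have B0 z : B z !=set0 by exists (q (z + 0 *: y) - 0 * q y); exists 0 => //=.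
  have infle z t : S z -> 0 <= t -> inf (B z) <= q (z + t *: y) - t * q y.
    move=> Sz t0; apply: inf_lbound; last by exists t.
    by exists (- q (- z)); exact: Blb.
  pose m z := if `[< S z >] then inf (B z) else 0.
  have mE z : S z -> m z = inf (B z) by move=> Sz; rewrite /m asboolT.
  have sm : sublinear m.
    split.
    - by move=> z nS; rewrite /m asboolF.
    - move=> u v Su Sv; rewrite !mE//; last exact: SD.
      apply/ler_addgt0Pr => e e0; have e2 : 0 < e / 2 by rewrite divr_gt0.
      have hu : has_inf (B u) by split => //; exists (- q (- u)); exact: Blb.
      have hv : has_inf (B v) by split => //; exists (- q (- v)); exact: Blb.
      have [_ [s /= s0 <-] H1] := inf_adherent e2 hu.
      have [_ [t /= t0 <-] H2] := inf_adherent e2 hv.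
      apply: le_trans (infle _ _ (SD Su Sv) (addr_ge0 s0 t0)) _.
      have := qD _ _ (SD Su (SZ s Sy)) (SD Sv (SZ t Sy)).
      rewrite addrACA -scalerDl mulrDl; lra.
    - move=> a u a0 Su; rewrite !mE//; last exact: SZ.
      move: a0; rewrite le_eqVlt => /predU1P[<-|a0].
        rewrite mul0r scale0r; apply/eqP; rewrite eq_le; apply/andP; split.
          apply: le_trans (infle _ _ S0 (lexx 0)) _.
          by rewrite scale0r addr0 mul0r subr0 (sublinear0 sq).
        apply: lb_le_inf => // _ [t /= t0 <-].
        by rewrite add0r qZ// subrr.
      have key (b : R) z : 0 < b -> S z -> b * inf (B z) <= inf (B (b *: z)).
        move=> b0 Sz; apply: lb_le_inf => // _ [t /= t0 <-].
        have tb0 : 0 <= t / b by rewrite divr_ge0// ltW.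
        have := infle _ _ Sz tb0; rewrite -(ler_pM2l b0) => H; apply: le_trans H _.
        have Szt : S (z + (t / b) *: y) by apply: SD => //; exact: SZ.
        rewrite mulrBr -(qZ b _ (ltW b0) Szt).
        rewrite scalerDr scalerA [b * (t / b)]mulrC divfK ?gt_eqF//.
        by rewrite mulrA [b * (t / b)]mulrC divfK ?gt_eqF.
      apply/eqP; rewrite eq_le key// andbT.
      have aV : 0 < a^-1 by rewrite invr_gt0.
      have := key _ _ aV (SZ a Su); rewrite scalerA mulVf ?gt_eqF// scale1r.
      by rewrite ler_pdivrMl.
  have mq' z : m z <= q z.
    have [Sz|nSz] := pselect (S z).
      rewrite mE//; apply: le_trans (infle _ _ Sz (lexx 0)) _.
      by rewrite scale0r addr0 mul0r subr0.
    by rewrite /m asboolF//; rewrite q0.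
  apply/eqP; rewrite eq_le qD//=.
  have := mq _ sm mq'; move/(congr1 (fun f => f x)); rewrite mE// => H.
  have := infle _ _ Sx ler01; rewrite H scale1r mul1r; lra.
have neg x : S x -> q (- x) = - q x.
  move=> Sx; apply/eqP; rewrite -subr_eq0 opprK -add//; last exact: SN.
  by rewrite addNr (sublinear0 sq).
move=> a x y Sx Sy; rewrite add//; last exact: SZ.
congr (_ + _); have [a0|a0] := leP 0 a; first exact: qZ.
rewrite -[a]opprK scaleNr neg; last exact: SZ.
by rewrite qZ ?oppr_ge0 ?(ltW a0)// -mulNr.
Qed.

(* Applied with p the distance to a subspace, which L then annihilates. *)
Lemma seminorm_separation p g : S g ->
  (forall x, S x -> 0 <= p x) ->
  (forall x y, S x -> S y -> p (x + y) <= p x + p y) ->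
  (forall (a : R) x, S x -> p (a *: x) = `|a| * p x) ->
  exists L : V -> R,
    [/\ forall (a : R) x y, S x -> S y -> L (a *: x + y) = a * L x + L y,
        forall x, S x -> `|L x| <= p x & p g <= L g].
Proof.
move=> Sg p0 pD pZ.
(* The infimum over t makes the majorant small in the direction - g: the term t = 1 at z = - g is -
   p g. A linear functional below it therefore takes a value of at least p g at g. *)
pose B z : set R := [set p (z + t *: g) - t * p g | t in [set t : R | 0 <= t]].
have Blb z : S z -> lbound (B z) (- p z).
  move=> Sz _ [t /= t0 <-]; rewrite lerBrDr addrC -lerBrDr opprK addrC.
  have := pD (z + t *: g) (- z) (SD Sz (SZ t Sg)) (SN Sz).
  have -> : z + t *: g - z = t *: g by rewrite addrAC subrr add0r.
  by rewrite pZ// (ger0_norm t0) -[- z]scaleN1r pZ// normrN1 mul1r [X in _ <= X -> _]addrC.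
have B0 z : B z !=set0 by exists (p (z + 0 *: g) - 0 * p g); exists 0 => //=.
have infle z t : S z -> 0 <= t -> inf (B z) <= p (z + t *: g) - t * p g.
  move=> Sz t0; apply: inf_lbound; last by exists t.
  by exists (- p z); exact: Blb.
pose m z := if `[< S z >] then inf (B z) else 0.
have mE z : S z -> m z = inf (B z) by move=> Sz; rewrite /m asboolT.
have sm : sublinear m.
  split.
  - by move=> z nS; rewrite /m asboolF.
  - move=> u v Su Sv; rewrite !mE//; last exact: SD.
    apply/ler_addgt0Pr => e e0; have e2 : 0 < e / 2 by rewrite divr_gt0.
    have hu : has_inf (B u) by split => //; exists (- p u); exact: Blb.
    have hv : has_inf (B v) by split => //; exists (- p v); exact: Blb.
    have [_ [s /= s0 <-] H1] := inf_adherent e2 hu.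
    have [_ [t /= t0 <-] H2] := inf_adherent e2 hv.
    apply: le_trans (infle _ _ (SD Su Sv) (addr_ge0 s0 t0)) _.
    have := pD _ _ (SD Su (SZ s Sg)) (SD Sv (SZ t Sg)).
    rewrite addrACA -scalerDl mulrDl; lra.
  - move=> a u a0 Su; rewrite !mE//; last exact: SZ.
    move: a0; rewrite le_eqVlt => /predU1P[<-|a0].
      rewrite mul0r scale0r; apply/eqP; rewrite eq_le; apply/andP; split.
        apply: le_trans (infle _ _ S0 (lexx 0)) _.
        by rewrite scale0r addr0 mul0r subr0 -(scale0r g) pZ// normr0 mul0r.
      apply: lb_le_inf => // _ [t /= t0 <-].
      by rewrite add0r pZ// ger0_norm// subrr.
    have key (b : R) z : 0 < b -> S z -> b * inf (B z) <= inf (B (b *: z)).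
      move=> b0 Sz; apply: lb_le_inf => // _ [t /= t0 <-].
      have tb0 : 0 <= t / b by rewrite divr_ge0// ltW.
      have := infle _ _ Sz tb0; rewrite -(ler_pM2l b0) => H; apply: le_trans H _.
      rewrite mulrBr -[X in X * p (_ + _)](gtr0_norm b0) -pZ//; last by apply: SD => //; exact: SZ.
      rewrite scalerDr scalerA [b * (t / b)]mulrC divfK ?gt_eqF//.
      by rewrite mulrA [b * (t / b)]mulrC divfK ?gt_eqF.
    apply/eqP; rewrite eq_le key// andbT.
    have aV : 0 < a^-1 by rewrite invr_gt0.
    have := key _ _ aV (SZ a Su); rewrite scalerA mulVf ?gt_eqF// scale1r.
    by rewrite ler_pdivrMl.
have mp z : S z -> m z <= p z.
  move=> Sz; rewrite mE//; apply: le_trans (infle _ _ Sz (lexx 0)) _.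
  by rewrite scale0r addr0 mul0r subr0.
have [q [sq qm mq]] := minimal_sublinear sm.
have ql := minimal_sublinear_linear sq mq.
have qN x : S x -> q (- x) = - q x.
  move=> Sx; have := ql (-1) x 0 Sx S0.
  by rewrite scaleN1r addr0 mulN1r (sublinear0 sq) addr0.
have qp x : S x -> q x <= p x by move=> Sx; exact: le_trans (qm x) (mp _ Sx).
exists q; split => //.
  move=> x Sx; rewrite ler_norml qp// andbT lerNl -qN//.
  apply: le_trans (qp _ (SN Sx)) _.
  by rewrite -scaleN1r pZ// normrN1 mul1r.
rewrite -[leLHS]opprK lerNl -qN//; apply: le_trans (qm _) _.
rewrite mE; last exact: SN.
apply: le_trans (infle _ _ (SN Sg) ler01) _.
by rewrite scale1r addNr -(scale0r g) pZ// normr0 !mul0r mul1r sub0r.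
Qed.

End SublinearHahnBanach.

(** * Integrals vanishing on a generating family of sets *)

Section VanishingIntegrals.
Context d (T : measurableType d) (R : realType).
Variable mu : {measure set T -> \bar R}.
Hypothesis muT : (mu setT < +oo)%E.

Lemma Lfun1_mul_indic (G : T -> R) A : measurable A -> G \in Lfun mu 1%E ->
  (fun x => G x * \1_A x) \in Lfun mu 1%E.
Proof.
move=> mA LG; have mG := Lfun_meas LG; apply: Lfun_ae_le LG _ => //.
  by apply: measurable_funM => //; exact: measurable_indic.
apply: nearW => x; rewrite normrM indicE.
by case: (_ \in _); rewrite /= ?normr0 ?normr1 ?mulr0 ?mulr1.
Qed.

Lemma indic_bigU_cvg (F : (set T)^nat) x :
  (\1_(\big[setU/set0]_(i < n) F i) x : R) @[n --> \oo] --> (\1_(\bigcup_n F n) x : R).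
Proof.
have [[i _ Fix]|nU] := pselect ((\bigcup_n F n) x).
  apply: cvg_near_cst; exists i.+1 => // n /= lin.
  rewrite !indicE !mem_set//; first by exists i.
  by rewrite -bigcup_mkord; exists i.
apply: cvg_near_cst; apply: nearW => n.
rewrite !indicE !memNset//; rewrite -bigcup_mkord => -[i _ Fix].
by apply: nU; exists i.
Qed.

Lemma indic_bigUE (F : (set T)^nat) n x : trivIset setT F ->
  (\1_(\big[setU/set0]_(i < n) F i) x : R) = \sum_(i < n) \1_(F i) x.
Proof.
move=> tF; elim: n => [|n IH]; first by rewrite !big_ord0 indic0.
rewrite !big_ord_recr/= -IH.
have tF' : trivIset (fun k => xpredT k) F by apply: sub_trivIset tF.
have dis := trivIset_bigsetUI tF' (n := n) (m := n) isT (leqnn _).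
rewrite !indicE; have [xn|xn] := boolP (x \in F n).
  have -> : x \in \big[setU/set0]_(i < n) F i = false.
    apply/negbTE/negP; rewrite inE => H.
    suff : set0 x by []. by rewrite -dis; split => //; exact: set_mem.
  by rewrite add0r mem_set//; right; exact: set_mem.
rewrite addr0; congr (_%:R); apply: congr1; apply/idP/idP; rewrite !inE => H.
  by case: H => // H; move: xn; rewrite notin_setE.
by left.
Qed.

(** The sets whose preimage has vanishing integral form a Dynkin class. Working with preimages under
    f lets the same argument run along each coordinate projection of the square. *)
Lemma dynkin_vanish d' (U : measurableType d') (f : T -> U) (C : set (set U))
    (G : T -> R) : measurable_fun [set: T] f ->
  @measurable _ U = <<s C >> -> setI_closed C -> G \in Lfun mu 1%E ->
  \int[mu]_x G x = 0 ->
  (forall A, C A -> \int[mu]_x (G x * \1_(f @^-1` A) x) = 0) ->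
  forall A, measurable A -> \int[mu]_x (G x * \1_(f @^-1` A) x) = 0.
Proof.
move=> mf mC CI LG G0 GC A mA.
have mfA B : measurable B -> measurable (f @^-1` B).
  by move=> mB; rewrite -[X in measurable X]setTI; exact: mf.
have LGi B : measurable B -> (fun x => G x * \1_(f @^-1` B) x) \in Lfun mu 1%E.
  by move=> mB; apply: Lfun1_mul_indic => //; exact: mfA.
move: (mA); rewrite mC => mA'.
apply: (dynkin_induction (P := fun A => \int[mu]_x (G x * \1_(f @^-1` A) x) = 0)
  mC CI _ GC _ _ mA').
- rewrite preimage_setT -[RHS]G0; apply: eq_Rintegral => x _.
  by rewrite indicT mulr1.
- move=> S mS PS; rewrite preimage_setC.
  under eq_Rintegral => x _.
    rewrite (_ : G x * _ = G x - G x * \1_(f @^-1` S) x); last first.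
      by rewrite indicC indicE; case: (_ \in _); rewrite /= ?mulr1 ?mulr0 ?subrr ?subr0.
    over.
  by rewrite RintB//; [rewrite G0 PS subr0|exact: LGi].
- move=> F mF tF PF.
  pose H n x := G x * \1_(\big[setU/set0]_(i < n) f @^-1` F i) x.
  have tfF : trivIset setT (fun i => f @^-1` F i).
    apply/trivIsetP => i j _ _ ij; rewrite -preimage_setI.
    by move/trivIsetP : tF => ->//; rewrite preimage_set0.
  have mH n : measurable (\big[setU/set0]_(i < n) f @^-1` F i).
    by apply: bigsetU_measurable => i _; exact: mfA.
  have LH n : H n \in Lfun mu 1%E by exact: Lfun1_mul_indic.
  have H0 n : \int[mu]_x H n x = 0.
    elim: n => [|n IH].
      rewrite -[RHS](_ : \int[mu]_x (cst 0 x : R) = 0); last by rewrite /Rintegral integral0.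
      by apply: eq_Rintegral => x _; rewrite /H big_ord0 indic0 mulr0.
    rewrite (_ : \int[mu]_x H n.+1 x = \int[mu]_x (H n x + G x * \1_(f @^-1` F n) x)).
      by rewrite RintD//; [rewrite IH PF addr0|exact: LGi].
    apply: eq_Rintegral => x _; rewrite /H !(indic_bigUE _ _ tfF) big_ord_recr/=.
    by rewrite mulrDr.
  rewrite preimage_bigcup.
  have mU : measurable (\bigcup_i f @^-1` F i).
    by apply: bigcup_measurable => i _; exact: mfA.
  have LU := Lfun1_mul_indic mU LG.
  have mG := Lfun_meas LG.
  have [_ c] : (fun x => G x * \1_(\bigcup_i f @^-1` F i) x) \in Lfun mu 1%:E /\
     nrm mu 1%:E (H n \- (fun x => G x * \1_(\bigcup_i f @^-1` F i) x)) @[n --> \oo] --> (0 : R).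
    apply: (dominated_nrm (g := fun x => `|G x|)) => //.
    - by move=> n; exact: Lfun_meas (LH n).
    - exact: Lfun_meas LU.
    - by apply: nearW => x; apply: cvgM; [exact: cvg_cst|exact: indic_bigU_cvg].
    - exact: Lfun_abs.
    - apply: nearW => x n; rewrite normrM indicE.
      by case: (_ \in _); rewrite /= ?normr0 ?normr1 ?mulr0 ?mulr1.
  have L1 : (cst 1 : T -> R) \in Lfun mu +oo%E.
    by apply: (@bounded_Lfun_all _ _ _ _ muT _ _ 1); rewrite ?leey// => x; rewrite normr1.
  have c11 : conjp (1 : \bar R)%E +oo%E by split; rewrite ?leey//; right; left.
  have := nrm_cvg_int c11 LH LU L1 c.
  rewrite (_ : (fun n => \int[mu]_x (H n x * cst 1 x)) = fun=> 0); last first.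
    by apply/funext => n; rewrite -[RHS](H0 n); apply: eq_Rintegral => x _; rewrite mulr1.
  move=> c2; have := cvg_unique _ c2 (cvg_cst (0 : R)).
  by move=> H'; rewrite -[RHS]H'//; apply: eq_Rintegral => x _; rewrite mulr1.
Qed.

Lemma vanish_ae (G : T -> R) : G \in Lfun mu 1%E ->
  (forall A, measurable A -> \int[mu]_x (G x * \1_A x) = 0) -> G = cst 0 %[ae mu].
Proof.
move=> LG H; have /Lfun1P iG := LG.
have : ae_eq mu setT (EFin \o G) (cst 0%E).
  apply: integral_ae_eq => //.
  move=> A _ mA; rewrite integral0.
  have iA : mu.-integrable A (EFin \o G) by exact: integrableS iG.
  have := H A mA; rewrite -Rint_indic// /Rintegral => Z.
  by rewrite -[LHS]fineK ?integral_fin_num// ?Z//; apply: integrable_fin_num.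
by apply: filterS => x /(_ I) [].
Qed.

End VanishingIntegrals.

(** * Smooth functions and the fundamental lemma *)

Section SmoothFunctions.
Context {R : realType}.
Implicit Types (f g : R -> R).

(** Peeling off the first derivative, rather than iterating up to the last one, makes the sum,
    product and chain rules provable by induction on k. *)
Fixpoint diff_upto (k : nat) f : Prop :=
  if k is k'.+1 then (forall x, derivable f x 1) /\ diff_upto k' (derive1 f) else True.

Lemma smooth1_diff_upto f : smooth1 f <-> forall k, diff_upto k f.
Proof.
split=> [sf k|H n].
  have : forall n, smooth1 (derive1n n f).
    by move=> n m x; rewrite /derive1n -iterD; exact: sf.
  move=> /(_ 0%N); rewrite derive1n0; clear sf; elim: k f => [//|k IH] f sf /=.
  split; first by move=> x; exact: (sf 0%N).
  apply: IH => n x; rewrite -derive1Sn; exact: sf.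
elim: n f H => [|n IH] f H x; first by have [] := H 1%N.
by rewrite derive1Sn; apply: IH => k; have [] := H k.+1.
Qed.

Lemma derive1D f g x : derivable f x 1 -> derivable g x 1 ->
  derive1 (f \+ g) x = derive1 f x + derive1 g x.
Proof. by move=> df dg; rewrite derive1E (deriveD df dg) -!derive1E. Qed.

Lemma derive1M f g x : derivable f x 1 -> derivable g x 1 ->
  derive1 (f \* g) x = f x * derive1 g x + derive1 f x * g x.
Proof.
by move=> df dg; rewrite derive1E (deriveM df dg) -!derive1E [X in _ + X]mulrC.
Qed.

Lemma derive1Z f a x : derivable f x 1 ->
  derive1 (fun y => a * f y) x = a * derive1 f x.
Proof. by move=> df; rewrite !derive1E; exact: deriveZ. Qed.

Lemma diff_uptoD k f g : diff_upto k f -> diff_upto k g -> diff_upto k (f \+ g).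
Proof.
elim: k f g => [//|k IH] f g [df Hf] [dg Hg]; split.
  by move=> x; apply: derivableD.
rewrite (_ : derive1 _ = derive1 f \+ derive1 g); first exact: IH.
by apply/funext => x; exact: derive1D.
Qed.

Lemma diff_uptoZ k a f : diff_upto k f -> diff_upto k (fun x => a * f x).
Proof.
elim: k f => [//|k IH] f [df Hf]; split.
  by move=> x; apply: derivableZ.
rewrite (_ : derive1 _ = (fun x => a * derive1 f x)); first exact: IH.
by apply/funext => x; exact: derive1Z.
Qed.

Lemma diff_uptoS k f : diff_upto k.+1 f -> diff_upto k f.
Proof. by elim: k f => [//|k IH] f [df Hf]; split => //; exact: IH. Qed.

Lemma diff_uptoM k f g : diff_upto k f -> diff_upto k g -> diff_upto k (f \* g).
Proof.
elim: k f g => [//|k IH] f g /[dup] Hf' [df Hf] /[dup] Hg' [dg Hg]; split.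
  by move=> x; apply: derivableM.
rewrite (_ : derive1 _ = (f \* derive1 g) \+ (derive1 f \* g)).
  by apply: diff_uptoD; apply: IH => //; exact: diff_uptoS.
by apply/funext => x; exact: derive1M.
Qed.

Lemma is_derive_affine f (s b x df : R) : is_derive (s * x + b : R) (1 : R) f df ->
  is_derive x (1 : R) (fun y => f (s * y + b)) (s * df).
Proof.
move=> H.
have H1 : is_derive x (1 : R) (fun y : R => s * y + b) s.
  have -> : (fun y : R => s * y + b) = (fun y => s *: id y) \+ cst b by apply/funext.
  by apply: is_derive_eq; rewrite addr0 scaler1.
have := @is_derive1_comp _ f (fun y => s * y + b) x _ _ H H1.
by rewrite /comp [_ * s]mulrC.
Qed.

Lemma diff_upto_affine k (s b : R) f : diff_upto k f -> diff_upto k (fun x => f (s * x + b)).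
Proof.
elim: k f => [//|k IH] f [df Hf].
have D (x : R) : is_derive x (1 : R) (fun y => f (s * y + b)) (s * derive1 f (s * x + b)).
  by apply: is_derive_affine; rewrite derive1E; exact/derivableP.
split=> [x|]; first by have [] := D x.
rewrite (_ : derive1 _ = (fun x => s * derive1 f (s * x + b))).
  by apply: diff_uptoZ; exact: IH.
by apply/funext => x; rewrite derive1E; have [_ ->] := D x.
Qed.

Lemma smooth1D f g : smooth1 f -> smooth1 g -> smooth1 (f \+ g).
Proof.
move=> /smooth1_diff_upto sf /smooth1_diff_upto sg; apply/smooth1_diff_upto => k.
exact: diff_uptoD.
Qed.

Lemma smooth1M f g : smooth1 f -> smooth1 g -> smooth1 (f \* g).
Proof.
move=> /smooth1_diff_upto sf /smooth1_diff_upto sg; apply/smooth1_diff_upto => k.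
exact: diff_uptoM.
Qed.

Lemma smooth1_affine s b f : smooth1 f -> smooth1 (fun x => f (s * x + b)).
Proof.
by move=> /smooth1_diff_upto sf; apply/smooth1_diff_upto => k; exact: diff_upto_affine.
Qed.

Lemma smooth1_derive f : smooth1 f -> smooth1 (derive1 f).
Proof. by move=> sf n x; rewrite -derive1Sn; exact: sf. Qed.

Lemma smooth1_derivable f x : smooth1 f -> derivable f x 1.
Proof. by move=> /(_ 0%N). Qed.

Lemma smooth1_continuous f : smooth1 f -> continuous f.
Proof.
move=> sf x; apply/differentiable_continuous/derivable1_diffP; exact: smooth1_derivable.
Qed.

(** The classical flat function exp(-c/t), multiplied by a polynomial in 1/t so that the family is
    closed under differentiation. *)
Definition exp_tail (c : R) (P : {poly R}) (t : R) : R :=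
  if 0 < t then P.[t^-1] * expR (- (c * t^-1)) else 0.

(** The inequality 1 + x <= e^x at x = c s / n, raised to the power n, bounds s^n e^(-c s) by (n /
    c)^n for n > 0; the coefficients of P are then summed. *)
Lemma poly_exp_bound (c : R) (P : {poly R}) : 0 < c ->
  exists2 K : R, 0 <= K & forall s, 0 <= s -> `|P.[s] * expR (- (c * s))| <= K.
Proof.
move=> c0.
have /choice[K HK] : forall n : nat, exists K : R,
    0 <= K /\ forall s : R, 0 <= s -> s ^+ n * expR (- (c * s)) <= K.
  case=> [|n].
    exists 1; split => // s s0; rewrite expr0 mul1r -expR0 ler_expR oppr_le0 mulr_ge0//.
    exact: ltW.
  have nc0 : 0 <= n.+1%:R / c by rewrite divr_ge0// ltW.
  exists ((n.+1%:R / c) ^+ n.+1); split; first by rewrite exprn_ge0.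
  move=> s s0; rewrite expRN ler_pdivrMr ?expR_gt0//.
  have -> : c * s = (c * s / n.+1%:R) * n.+1%:R by rewrite divfK// pnatr_eq0.
  rewrite expRM_natr -exprMn lerXn2r ?nnegrE ?(mulr_ge0 nc0) ?expR_ge0//.
  have := expR_ge1Dx (c * s / n.+1%:R).
  have e (N : R) : N != 0 -> s = N / c * (c * s / N).
    by move=> N0; field; rewrite N0 gt_eqF.
  move=> H; rewrite [leLHS](e n.+1%:R) ?pnatr_eq0// ler_wpM2l//.
  by apply: le_trans H; rewrite lerDr.
exists (\sum_(i < size P) `|P`_i| * K i).
  by apply: sumr_ge0 => i _; rewrite mulr_ge0//; case: (HK i).
move=> s s0; rewrite horner_coef mulr_suml; apply: le_trans (ler_norm_sum _ _ _) _.
apply: ler_sum => i _; rewrite -mulrA normrM ler_wpM2l//.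
rewrite ger0_norm ?mulr_ge0 ?exprn_ge0 ?expR_ge0//.
by case: (HK i) => _; apply.
Qed.

(** With s = 1/t, the derivative in t of P(s) e^(-c s) is s^2 (c P(s) - P'(s)) e^(-c s). *)
Definition exp_tail_deriv (c : R) (P : {poly R}) : {poly R} :=
  'X^2 * (c *: P - P^`()).

Lemma is_derive_exp_tail (c : R) (P : {poly R}) (t : R) : 0 < c ->
  is_derive t (1 : R) (exp_tail c P) (exp_tail c (exp_tail_deriv c P) t).
Proof.
move=> c0; have [t0|t0|<-] := ltgtP 0 t.
- have near0 : \forall z \near t, P.[z^-1] * expR (- (c * z^-1)) = exp_tail c P z.
    near=> z; rewrite /exp_tail ifT//; near: z; exact: lt_nbhsr.
  apply: (near_eq_is_derive near0).
  pose F s := P.[s] * expR (- (c * s)).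
  have HP s : is_derive s (1 : R) (horner P) (P^`()).[s].
    apply: DeriveDef; first exact: derivable_horner.
    by rewrite -derive1E -derivE.
  have HF s : is_derive s (1 : R) F (P^`().[s] * expR (- (c * s)) - c * (P.[s] * expR (- (c * s)))).
    have He : is_derive s (1 : R) (fun s => expR (- c * s + 0)) (- c * expR (- c * s + 0)).
      by apply: is_derive_affine; exact: is_derive_expR.
    have -> : F = horner P \* (fun s => expR (- c * s + 0)).
      by apply/funext => z; rewrite /F/= addr0 mulNr.
    apply: is_derive_eq; rewrite /= !addr0 !mulNr /GRing.scale/=; set E := expR _; ring.
  have HI : is_derive t (1 : R) (fun z : R => z^-1) (- t ^- 2).
    have tn0 : (idfun : R -> R) t != 0 by rewrite /= gt_eqF.
    have did : derivable (idfun : R -> R) t 1 by exact: derivable_id.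
    apply: DeriveDef; first exact: (derivableV (f := (idfun : R -> R)) tn0 did).
    have := deriveV (f := (idfun : R -> R)) tn0 did.
    by rewrite derive_id /GRing.scale/= mulr1.
  have H := is_derive1_comp (HF t^-1) HI.
  rewrite /exp_tail t0 /exp_tail_deriv !hornerE.
  by apply: is_derive_eq; rewrite -exprVn; set E := expR _; ring.
- have near0 : \forall z \near t, cst 0 z = exp_tail c P z.
    near=> z; rewrite /exp_tail ifF//; apply/negbTE; rewrite -leNgt; apply: ltW; near: z.
    exact: lt_nbhsl.
  rewrite {2}/exp_tail ifF; last by apply/negbTE; rewrite -leNgt ltW.
  by apply: (near_eq_is_derive near0); exact: is_derive_cst.
rewrite {2}/exp_tail ltxx.
(* For h > 0 the difference quotient at 0 is h times the function of the family with polynomial X^2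
   P, which is bounded by K; for h < 0 it is 0. *)
have [K K0 HK] := poly_exp_bound ('X^2 * P) c0.
have gen (z p E : R) : z != 0 -> z^-1 * (p * E) = z * (z^-1 ^+ 2 * p * E).
  by move=> z0; field.
have K1 : 0 < K + 1 by rewrite ltr_wpDl.
have cv : h^-1 *: (exp_tail c P (h *: 1 + 0) - exp_tail c P 0) @[h --> 0^'] --> (0 : R).
  apply/cvgr0Pnorm_lt => e e0.
  near=> h; rewrite addr0 {2}/exp_tail ltxx subr0 /exp_tail /GRing.scale/= mulr1.
  case: ifPn => h0; last by rewrite mulr0 normr0.
  have E : h^-1 * (P.[h^-1] * expR (- (c * h^-1))) =
      h * (('X^2 * P).[h^-1] * expR (- (c * h^-1))).
    by rewrite hornerM hornerXn gen// gt_eqF.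
  have hV : 0 <= h^-1 by rewrite invr_ge0 ltW.
  rewrite E normrM (gtr0_norm h0); apply: le_lt_trans (_ : h * (K + 1) < _).
    by rewrite ler_wpM2l ?(ltW h0)// (le_trans (HK _ hV))// lerDl.
  rewrite -ltr_pdivlMr//; apply: le_lt_trans (ler_norm _) _; near: h.
  by apply: dnbhs0_lt; rewrite divr_gt0.
apply: DeriveDef; last by apply/cvg_lim => //; exact: cv.
by apply/cvg_ex; exists 0; exact: cv.
Unshelve. all: by end_near. Qed.

Lemma smooth1_exp_tail (c : R) (P : {poly R}) : 0 < c -> smooth1 (exp_tail c P).
Proof.
move=> c0; apply/smooth1_diff_upto => k; elim: k P => [//|k IH] P; split.
  by move=> x; have [] := is_derive_exp_tail P x c0.
rewrite (_ : derive1 _ = exp_tail c (exp_tail_deriv c P)); first exact: IH.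
by apply/funext => x; rewrite derive1E; have [_ ->] := is_derive_exp_tail P x c0.
Qed.

(* A smooth function supported in [a + e, b - e] which tends to the indicator of
   ]a, b[ as e decreases to 0. *)
Definition bump (a b e : R) (x : R) : R :=
  exp_tail e 1 (x - (a + e)) * exp_tail e 1 ((b - e) - x).

Lemma smooth1_bump a b e : 0 < e -> smooth1 (bump a b e).
Proof.
move=> e0.
have -> : bump a b e = (fun x => exp_tail e 1 (1 * x + (- (a + e)))) \*
   (fun x => exp_tail e 1 (- 1 * x + (b - e))).
  by apply/funext => x; rewrite /bump/= mul1r mulN1r [- x + _]addrC.
by apply: smooth1M; apply: smooth1_affine; exact: smooth1_exp_tail.
Qed.

Lemma exp_tail1_ge0 (e : R) t : 0 <= exp_tail e 1 t.
Proof. by rewrite /exp_tail; case: ifP => // _; rewrite hornerE mul1r expR_ge0. Qed.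

Lemma exp_tail1_le1 (e : R) t : 0 < e -> exp_tail e 1 t <= 1.
Proof.
move=> e0; rewrite /exp_tail; case: ifP => // t0; rewrite hornerE mul1r -expR0 ler_expR.
by rewrite oppr_le0 mulr_ge0 ?invr_ge0 ?(ltW e0) ?(ltW t0).
Qed.

Lemma bump_ge0 a b e x : 0 <= bump a b e x.
Proof. by rewrite mulr_ge0// exp_tail1_ge0. Qed.

Lemma bump_le1 a b e x : 0 < e -> bump a b e x <= 1.
Proof. by move=> e0; rewrite mulr_ile1 ?exp_tail1_ge0 ?exp_tail1_le1. Qed.

Lemma bump_support a b e x : x \notin `[a + e, b - e] -> bump a b e x = 0.
Proof.
rewrite in_itv/= negb_and -!ltNge => /orP[xa|xb]; rewrite /bump /exp_tail.
  by rewrite ifF ?mul0r//; apply/negbTE; rewrite -leNgt subr_le0 ltW.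
by rewrite [X in _ * X]ifF ?mulr0//; apply/negbTE; rewrite -leNgt subr_le0 ltW.
Qed.

Lemma exp_tail1_cvg (u : nat -> R) (t : R) (e_ : nat -> R) : 0 < t ->
  u n @[n --> \oo] --> t -> e_ n @[n --> \oo] --> (0 : R) ->
  exp_tail (e_ n) 1 (u n) @[n --> \oo] --> (1 : R).
Proof.
move=> t0 ut e0.
have H : expR (- (e_ n * (u n)^-1)) @[n --> \oo] --> (1 : R).
  rewrite -expR0; apply: continuous_cvg; first exact: continuous_expR.
  rewrite -oppr0; apply: cvgN; rewrite -(mul0r t^-1); apply: cvgM => //.
  by apply: cvgV => //; rewrite gt_eqF.
apply: cvg_trans H; apply: near_eq_cvg; near=> n.
rewrite /exp_tail ifT ?hornerE ?mul1r//; near: n.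
by apply: (cvgr_gt t) => //.
Unshelve. all: by end_near. Qed.

Lemma bump_cvg (a b : R) (x : R) :
  bump a b n.+1%:R^-1 x @[n --> \oo] --> (\1_(`]a, b[%classic) x : R).
Proof.
have e0 : (n.+1%:R^-1 : R) @[n --> \oo] --> (0 : R) by exact: cvg_harmonic.
have [xab|xab] := boolP (x \in `]a, b[).
  rewrite indicE mem_set//; move: xab; rewrite in_itv/= => /andP[ax xb].
  rewrite [X in _ --> X](_ : _ = 1 * 1); last by rewrite mulr1.
  apply: cvgM.
    apply: (@exp_tail1_cvg _ (x - (a + 0))) => //; first by rewrite addr0 subr_gt0.
    by apply: cvgB; [exact: cvg_cst|apply: cvgD => //; exact: cvg_cst].
  apply: (@exp_tail1_cvg _ ((b - 0) - x)) => //; first by rewrite subr0 subr_gt0.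
  by apply: cvgB; [apply: cvgB => //; exact: cvg_cst|exact: cvg_cst].
rewrite indicE memNset; last by move=> /= H; move: xab; rewrite H.
apply: cvg_near_cst; apply: nearW => n; apply: bump_support.
apply: contra xab; rewrite !in_itv/= => /andP[H1 H2].
have n0 : (0 : R) < n.+1%:R^-1 by rewrite invr_gt0.
apply/andP; split.
  by apply: lt_le_trans H1; rewrite ltrDl.
by apply: le_lt_trans H2 _; rewrite ltrBlDr ltrDl.
Qed.

End SmoothFunctions.

(** * Lebesgue measure on the unit interval and the unit square *)

Section UnitDomains.
Context {R : realType}.
Notation lI := (@leb_I R).
Notation lO := (@leb_Omega R).
Notation lam := (@lebesgue_measure R).
Notation RT := (measurableTypeR R).

Lemma lam_I : lam unit_itv = 1%E.
Proof.
rewrite /unit_itv lebesgue_measure_itv/= lte_fin ltr01.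
by rewrite -EFinD subr0.
Qed.

Lemma leb_IT : lI setT = 1%E.
Proof. by rewrite -[LHS]/(lam (setT `&` unit_itv)) setTI lam_I. Qed.

Lemma leb_I_fin : (lI setT < +oo)%E.
Proof. by rewrite leb_IT ltry. Qed.

Lemma leb_OmegaX (A B : set RT) : measurable A -> measurable B ->
  lO (A `*` B) = (lI A * lI B)%E.
Proof.
move=> mA mB; rewrite -[LHS]/((lam \x lam)%E ((A `*` B) `&` (unit_itv `*` unit_itv))).
by rewrite -setXI product_measure1E//; apply: measurableI => //; exact: measurable_unit_itv.
Qed.

Lemma leb_OmegaT : lO setT = 1%E.
Proof. by rewrite -setXTT leb_OmegaX// leb_IT mule1. Qed.

Lemma leb_Omega_fin : (lO setT < +oo)%E.
Proof. by rewrite leb_OmegaT ltry. Qed.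

Lemma ae_unit_itv : {ae lI, forall x, unit_itv x}.
Proof.
exists (~` unit_itv); split => //; first by apply: measurableC; exact: measurable_unit_itv.
by rewrite -[LHS]/(lam (~` unit_itv `&` unit_itv)) setICl measure0.
Qed.

Lemma ae_Omega : {ae lO, forall x, Omega x}.
Proof.
exists (~` Omega); split => //; first by apply: measurableC; exact: measurable_Omega.
by rewrite -[LHS]/((lam \x lam)%E (~` Omega `&` Omega)) setICl measure0.
Qed.

Lemma ae_neq (b : R) : {ae lI, forall x, x != b}.
Proof.
exists [set b]; split => //.
- apply/eqP; rewrite eq_le measure_ge0 andbT -(lebesgue_measure_set1 b).
  rewrite -[leLHS]/(lam ([set b] `&` unit_itv)); apply: le_measure; rewrite ?inE//.
  by apply: measurableI => //; exact: measurable_unit_itv.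
- by move=> x /= /negP; rewrite negbK => /eqP.
Qed.

Lemma ae_fst (P : R -> Prop) : {ae lI, forall t, P t} -> {ae lO, forall x, P x.1}.
Proof.
case=> N [mN N0 PN]; exists (N `*` setT); split; first exact: measurableX.
  by rewrite leb_OmegaX// N0 mul0e.
by move=> [x y] /= nP; split => //; apply: PN.
Qed.

Lemma ae_snd (P : R -> Prop) : {ae lI, forall t, P t} -> {ae lO, forall x, P x.2}.
Proof.
case=> N [mN N0 PN]; exists (setT `*` N); split; first exact: measurableX.
  by rewrite leb_OmegaX// N0 mule0.
by move=> [x y] /= nP; split => //; apply: PN.
Qed.

Lemma int_leb_I (f : RT -> R) : measurable_fun [set: RT] f ->
  (\int[lI]_x (f x)%:E = \int[lam]_(x in unit_itv) (f x)%:E)%E.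
Proof.
move=> mf; have mI := @measurable_unit_itv R.
transitivity (\int[lI]_(x in unit_itv) (f x)%:E)%E; last first.
  apply: eq_measure_integral => A mA AI.
  by rewrite -[LHS]/(lam (A `&` unit_itv)) setIidl.
rewrite [RHS]integral_mkcond; apply: ae_eq_integral => //.
- exact/measurable_EFinP.
- apply/(measurable_restrictT _ _).1 => //; apply: measurable_funTS; exact/measurable_EFinP.
- apply/ae_eqP; apply: (ae_mono ae_unit_itv) => x Ix; rewrite /patch mem_set//.
Qed.

Lemma Rint_leb_I (f : RT -> R) : measurable_fun [set: RT] f ->
  \int[lI]_x f x = \int[lam]_(x in unit_itv) f x.
Proof. by move=> mf; rewrite /Rintegral int_leb_I. Qed.

End UnitDomains.

Section FundamentalLemma.
Context {R : realType}.
Notation lI := (@leb_I R).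
Notation lO := (@leb_Omega R).
Notation RT := (measurableTypeR R).
Implicit Types (phi psi : R -> R).

Lemma testfun1_bump (a b e : R) : 0 <= a -> b <= 1 -> 0 < e -> testfun1 (bump a b e).
Proof.
move=> a0 b1 e0; split; first exact: smooth1_bump.
exists `[a + e, b - e]%classic; split; first exact: segment_compact.
- move=> x /=; rewrite /unit_itv/= !in_itv/= => /andP[H1 H2].
  apply/andP; split; lra.
- by move=> x /= /negP; exact: bump_support.
Qed.

Lemma smooth1_measurable phi : smooth1 phi -> measurable_fun [set: RT] phi.
Proof. by move=> sphi; apply: continuous_measurable_fun; exact: smooth1_continuous. Qed.

Definition tensor phi psi (x : R * R) : R := phi x.1 * psi x.2.

Lemma partial_tensor phi psi i : smooth1 phi -> smooth1 psi ->
  (forall x, derivable (tensor phi psi) x (dir i)) /\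
  partial i (tensor phi psi) =
    if i == 0 then tensor (derive1 phi) psi else tensor phi (derive1 psi).
Proof.
move=> sphi spsi.
have D (x : R * R) : h^-1 *: ((tensor phi psi \o shift x) (h *: dir i) - tensor phi psi x)
     @[h --> (0:R)^'] --> (if i == 0 then tensor (derive1 phi) psi else tensor phi (derive1 psi)) x.
  have dphi : derivable phi x.1 1 by exact: smooth1_derivable.
  have dpsi : derivable psi x.2 1 by exact: smooth1_derivable.
  rewrite /dir; case: ifP => _.
  - rewrite (_ : (fun h => _) = (fun h : R => (h^-1 *: ((phi \o shift x.1) (h *: 1) - phi x.1)) * psi x.2)); last first.
      apply/funext => h; rewrite /tensor /= /GRing.scale/= mulr0 add0r.
      by rewrite -mulrBl mulrA.
    by apply: cvgM; [rewrite derive1E; exact: dphi|exact: cvg_cst].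
  - rewrite (_ : (fun h => _) = (fun h : R => phi x.1 * (h^-1 *: ((psi \o shift x.2) (h *: 1) - psi x.2)))); last first.
      apply/funext => h; rewrite /tensor /= /GRing.scale/= mulr0 add0r.
      by rewrite -mulrBr mulrCA.
    by apply: cvgM; [exact: cvg_cst|rewrite derive1E; exact: dpsi].
split=> [x|]; first by apply/cvg_ex; eexists; exact: D.
by apply/funext => x; apply/cvg_lim => //; exact: D.
Qed.

(** All iterated partial derivatives of a tensor product are tensor products of smooth factors, so
    regularity need only be checked for these. *)
Lemma smooth2_tensor phi psi : smooth1 phi -> smooth1 psi -> smooth2 (tensor phi psi).
Proof.
move=> sphi spsi s.
have [phi' [psi' [sphi' spsi' ->]]] : exists phi' psi',
    [/\ smooth1 phi', smooth1 psi' & foldr partial (tensor phi psi) s = tensor phi' psi'].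
  elim: s => [|i s [f [g [sf sg E]]]]; first by exists phi, psi.
  rewrite /= E (partial_tensor i sf sg).2; case: ifP => _.
    by exists (derive1 f), g; split; [exact: (smooth1_derive sf)|exact: sg|reflexivity].
  by exists f, (derive1 g); split; [exact: sf|exact: (smooth1_derive sg)|reflexivity].
split=> [x|x i]; last exact: (partial_tensor i sphi' spsi').1.
have cphi := smooth1_continuous sphi'; have cpsi := smooth1_continuous spsi'.
have c1 : {for x, continuous (phi' \o fst)}.
  by apply: (@continuous_comp _ _ _ fst phi' x); [exact: cvg_fst|exact: cphi].
have c2 : {for x, continuous (psi' \o snd)}.
  by apply: (@continuous_comp _ _ _ snd psi' x); [exact: cvg_snd|exact: cpsi].
exact: (cvgM c1 c2).
Qed.

Lemma testfun2_tensor phi psi : testfun1 phi -> testfun1 psi -> testfun2 (tensor phi psi).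
Proof.
case=> sphi [K [cK KI K0]] [spsi [L [cL LI L0]]]; split; first exact: smooth2_tensor.
exists (K `*` L); split; first exact: compact_setX.
- by move=> x [/KI ? /LI ?]; split.
- move=> [x y] /= nKL; rewrite /tensor/=; have [Kx|nKx] := pselect (K x).
    by rewrite L0 ?mulr0// => Ly; apply: nKL.
  by rewrite K0 ?mul0r.
Qed.

(** Half-open intervals are the generators used in Dynkin's lemma, while bumps inside (0,1)
    approximate open intervals contained in (0,1). The two kinds differ only at b and outside the
    domain. *)
Let oc_oo (a b x : R) : unit_itv x -> x != b ->
  \1_(`]a, b]%classic) x = \1_(`](Num.max a 0), (Num.min b 1)[%classic) x :> R.
Proof.
rewrite /unit_itv/= in_itv/= => /andP[x0 x1] xb.
rewrite !indicE; congr (_%:R); apply: congr1.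
apply/idP/idP; rewrite !inE/= !in_itv/= gt_max lt_min x0 x1 !andbT.
  by move=> /andP[-> xb']; rewrite lt_neqAle xb xb'.
by move=> /andP[-> /ltW].
Qed.

Let dominated_lim d (T : measurableType d) (mu : {measure set T -> \bar R})
    (G : T -> R) (f_ : nat -> T -> R) (f : T -> R) : (mu setT < +oo)%E ->
  G \in Lfun mu 1%E -> (forall n, measurable_fun [set: T] (f_ n)) ->
  measurable_fun [set: T] f -> (forall x, f_ n x @[n --> \oo] --> f x) ->
  (forall n x, `|f_ n x| <= 1) -> (forall n, \int[mu]_x (G x * f_ n x) = 0) ->
  \int[mu]_x (G x * f x) = 0.
Proof.
move=> muT LG mf_ mf f_f f_1 H; have mG := Lfun_meas LG.
have [LGf c] : (fun x => G x * f x) \in Lfun mu 1%:E /\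
    nrm mu 1%:E ((fun x => G x * f_ n x) \- (fun x => G x * f x)) @[n --> \oo] --> (0 : R).
  apply: (dominated_nrm (g := fun x => `|G x|)) => //.
  - by move=> n; exact: measurable_funM.
  - exact: measurable_funM.
  - by apply: nearW => x; apply: cvgM => //; exact: cvg_cst.
  - exact: Lfun_abs.
  - by apply: nearW => x n; rewrite normrM ler_piMr.
have L1 : (cst 1 : T -> R) \in Lfun mu +oo%E.
  by apply: (@bounded_Lfun_all _ _ _ _ muT _ _ 1); rewrite ?leey// => x; rewrite normr1.
have c11 : conjp (1 : \bar R)%E +oo%E by split; rewrite ?leey//; right; left.
have LGf_ n : (fun x => G x * f_ n x) \in Lfun mu 1%E.
  apply: Lfun_ae_le LG _ => //; first exact: measurable_funM.
  by apply: nearW => x; rewrite normrM ler_piMr.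
have := nrm_cvg_int c11 LGf_ LGf L1 c.
rewrite (_ : (fun n => \int[mu]_x (G x * f_ n x * cst 1 x)) = fun=> 0); last first.
  by apply/funext => n; rewrite -[RHS](H n); apply: eq_Rintegral => x _; rewrite mulr1.
move=> c2; have H' := cvg_unique _ c2 (cvg_cst (0 : R)).
by rewrite -[RHS]H'//; apply: eq_Rintegral => x _; rewrite mulr1.
Qed.

Let bump_norm (a b : R) n x : `|bump a b n.+1%:R^-1 x| <= 1.
Proof. by rewrite ger0_norm ?bump_ge0// bump_le1. Qed.

Let mbump (a b : R) n : measurable_fun [set: RT] (bump a b n.+1%:R^-1).
Proof. by apply: smooth1_measurable; apply: smooth1_bump; rewrite invr_gt0. Qed.

(** Bumps converge boundedly to indicators of open intervals; so integrals over half-open intervals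
    vanish, and Dynkin's lemma reaches all Borel sets. *)
Lemma testfun1_vanish (G : R -> R) : G \in Lfun lI 1%E ->
  (forall phi, testfun1 phi -> \int[lI]_x (G x * phi x) = 0) -> G = cst 0 %[ae lI].
Proof.
move=> LG H; have mG := Lfun_meas LG.
have Hoc A : ocitv A -> \int[lI]_x (G x * \1_A x) = 0.
  move=> [[a b] _ <-] /=.
  pose a' := Num.max a 0; pose b' := Num.min b 1.
  have -> : \int[lI]_x (G x * \1_(`]a, b]%classic) x) = \int[lI]_x (G x * \1_(`]a', b'[%classic) x).
    apply: Rint_ae_eq.
    - by apply: measurable_funM => //; exact: measurable_indic.
    - by apply: measurable_funM => //; exact: measurable_indic.
    apply/ae_eqP; apply: (ae_mono2 (ae_neq b) ae_unit_itv) => x xb Ix.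
    by rewrite oc_oo.
  apply: (dominated_lim leb_I_fin LG (mbump a' b')).
  - exact: measurable_indic.
  - by move=> x; exact: bump_cvg.
  - by move=> n x; exact: bump_norm.
  - move=> n; apply: H; apply: testfun1_bump; rewrite ?invr_gt0//.
      by rewrite /a' le_max lexx orbT.
    by rewrite /b' ge_min lexx orbT.
have I0 : \int[lI]_x G x = 0.
  rewrite -[RHS](Hoc `]0, 1]%classic); last by exists (0, 1).
  apply: Rint_ae_eq => //.
    by apply: measurable_funM => //; exact: measurable_indic.
  apply/ae_eqP; apply: (ae_mono ae_unit_itv) => x; rewrite /unit_itv/= in_itv/= => /andP[x0 x1].
  by rewrite indicE mem_set ?mulr1//= in_itv/= x0 ltW.
apply: (vanish_ae LG) => A mA.
exact: (dynkin_vanish leb_I_fin (@measurable_id _ _ setT) erefl (@ocitvI R) LG I0 Hoc mA).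
Qed.

Lemma testfun2_vanish (G : R * R -> R) : G \in Lfun lO 1%E ->
  (forall phi : R * R -> R, testfun2 phi -> \int[lO]_x (G x * phi x) = 0) -> G = cst 0 %[ae lO].
Proof.
move=> LG H; have mG := Lfun_meas LG.
have m1 (A : set RT) : measurable A -> measurable ((@fst RT RT) @^-1` A).
  by move=> mA; rewrite -[X in measurable X]setTI; exact: measurable_fst.
have m2 (A : set RT) : measurable A -> measurable ((@snd RT RT) @^-1` A).
  by move=> mA; rewrite -[X in measurable X]setTI; exact: measurable_snd.
have mi1 (A : set RT) : measurable A -> measurable_fun [set: RT * RT] (fun x => \1_A x.1 : R).
  by move=> mA; apply: (measurableT_comp _ measurable_fst); exact: measurable_indic.
have mi2 (A : set RT) : measurable A -> measurable_fun [set: RT * RT] (fun x => \1_A x.2 : R).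
  by move=> mA; apply: (measurableT_comp _ measurable_snd); exact: measurable_indic.
have i01 (A : set R) x : `|\1_A x : R| <= 1.
  by rewrite indicE; case: (_ \in _); rewrite /= ?normr0 ?normr1.
have LGi (A B : set RT) : measurable A -> measurable B ->
    (fun x => G x * (\1_A x.1 * \1_B x.2)) \in Lfun lO 1%E.
  move=> mA mB; apply: Lfun_ae_le LG _ => //.
    by apply: measurable_funM => //; apply: measurable_funM; [exact: mi1|exact: mi2].
  by apply: nearW => x; rewrite normrM ler_piMr// normrM mulr_ile1.
have Hoc A B : ocitv A -> ocitv B -> \int[lO]_x (G x * (\1_A x.1 * \1_B x.2)) = 0.
  move=> [[a b] _ <-] [[c d] _ <-] /=.
  pose a' := Num.max a 0; pose b' := Num.min b 1.
  pose c' := Num.max c 0; pose d' := Num.min d 1.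
  have -> : \int[lO]_x (G x * (\1_(`]a, b]%classic) x.1 * \1_(`]c, d]%classic) x.2)) =
      \int[lO]_x (G x * (\1_(`]a', b'[%classic) x.1 * \1_(`]c', d'[%classic) x.2)).
    apply: Rint_ae_eq.
    - by apply: Lfun_meas (LGi _ _ _ _).
    - by apply: Lfun_meas (LGi _ _ _ _).
    apply/ae_eqP; apply: (ae_mono3 (ae_fst (ae_neq b)) (ae_snd (ae_neq d)) ae_Omega).
    by move=> x xb xd [x1 x2]; rewrite !oc_oo.
  pose f_ n := tensor (bump a' b' n.+1%:R^-1) (bump c' d' n.+1%:R^-1).
  pose f (x : R * R) : R := \1_(`]a', b'[%classic) x.1 * \1_(`]c', d'[%classic) x.2.
  have DL := dominated_lim (mu := lO) (f_ := f_) (f := f) leb_Omega_fin LG.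
  apply: DL.
  - move=> n; apply: measurable_funM.
      by apply: (measurableT_comp _ measurable_fst); exact: mbump.
    by apply: (measurableT_comp _ measurable_snd); exact: mbump.
  - by apply: measurable_funM; [exact: mi1|exact: mi2].
  - by move=> x; apply: cvgM; exact: bump_cvg.
  - by move=> n x; rewrite normrM mulr_ile1// bump_norm.
  - by move=> n; apply: H; apply: testfun2_tensor; apply: testfun1_bump;
      rewrite ?invr_gt0// ?le_max ?lexx ?orbT// ge_min lexx orbT.
have oc01 : ocitv (`]0, 1]%classic : set R) by exists (0, 1).
have moc A : ocitv A -> measurable (A : set RT) by move=> oA; exact: sub_sigma_algebra.
have in01 (x : R) : unit_itv x -> \1_(`]0, 1]%classic) x = 1 :> R.
  rewrite /unit_itv/= in_itv/= => /andP[x0 x1].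
  by rewrite indicE mem_set //= in_itv/= x0 ltW.
(* One coordinate at a time: with the second side fixed, G 1_B(x_2) is the density for Dynkin's
   lemma along the first projection. [H2] treats the second coordinate, and a last application
   passes from rectangles to the product sigma-algebra. *)
have H1 A B : measurable (A : set RT) -> ocitv B -> \int[lO]_x (G x * (\1_A x.1 * \1_B x.2)) = 0.
  move=> mA oB; have mB := moc _ oB.
  have LGB : (fun x => G x * \1_B x.2) \in Lfun lO 1%E.
    apply: Lfun_ae_le LG _ => //; first by apply: measurable_funM => //; exact: mi2.
    by apply: nearW => x; rewrite normrM ler_piMr.
  have E (C : set R) x : G x * (\1_C x.1 * \1_B x.2) = G x * \1_B x.2 * \1_(fst @^-1` C) x :> R.
    by rewrite mulrA mulrAC.
  under eq_Rintegral do rewrite E.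
  apply: (dynkin_vanish leb_Omega_fin measurable_fst erefl (@ocitvI R) LGB) => //.
  - rewrite -[RHS](Hoc _ _ oc01 oB); apply: Rint_ae_eq.
    + exact: Lfun_meas LGB.
    + exact: Lfun_meas (LGi _ _ (moc _ oc01) mB).
    + by apply/ae_eqP; apply: (ae_mono ae_Omega) => x [x1 x2]; rewrite in01// mul1r.
  - by move=> C oC; rewrite -[RHS](Hoc _ _ oC oB); apply: eq_Rintegral => x _; rewrite E.
have H2 A B : measurable (A : set RT) -> measurable (B : set RT) ->
    \int[lO]_x (G x * (\1_A x.1 * \1_B x.2)) = 0.
  move=> mA mB.
  have LGA : (fun x => G x * \1_A x.1) \in Lfun lO 1%E.
    apply: Lfun_ae_le LG _ => //; first by apply: measurable_funM => //; exact: mi1.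
    by apply: nearW => x; rewrite normrM ler_piMr.
  have E (C : set R) x : G x * (\1_A x.1 * \1_C x.2) = G x * \1_A x.1 * \1_(snd @^-1` C) x :> R.
    by rewrite mulrA.
  under eq_Rintegral do rewrite E.
  apply: (dynkin_vanish leb_Omega_fin measurable_snd erefl (@ocitvI R) LGA) => //.
  - rewrite -[RHS](H1 _ _ mA oc01); apply: Rint_ae_eq.
    + exact: Lfun_meas LGA.
    + exact: Lfun_meas (LGi _ _ mA (moc _ oc01)).
    + by apply/ae_eqP; apply: (ae_mono ae_Omega) => x [x1 x2]; rewrite in01// mulr1.
  - by move=> C oC; rewrite -[RHS](H1 _ _ mA oC); apply: eq_Rintegral => x _; rewrite E.
apply: (vanish_ae LG) => A mA.
apply: (dynkin_vanish leb_Omega_fin (@measurable_id _ _ setT)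
  (measurable_prod_measurableType RT RT) _ LG _ _ mA).
- move=> _ _ [A1 mA1 [B1 mB1 <-]] [A2 mA2 [B2 mB2 <-]].
  exists (A1 `&` A2); first exact: measurableI.
  by exists (B1 `&` B2); [exact: measurableI|rewrite setXI].
- rewrite -[RHS](H2 setT setT)//; apply: eq_Rintegral => x _.
  by rewrite !indicT !mulr1.
- move=> _ [C mC [D mD <-]]; rewrite -[RHS](H2 C D)//; apply: eq_Rintegral => x _.
  by rewrite preimage_id !indicE in_setX; case: (_ \in _); case: (_ \in _); rewrite /= ?mulr1 ?mulr0.
Qed.

End FundamentalLemma.

(** * Fubini's theorem and the fundamental theorem of calculus on the unit domains *)

Section FubiniUnitSquare.
Context {R : realType}.
Notation lI := (@leb_I R).
Notation lO := (@leb_Omega R).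
Notation RT := (measurableTypeR R).

(** A restriction of a product measure is turned into a product of two finite measures, the form in
    which Fubini and Tonelli apply. *)
Lemma leb_Omega_prod : exists fI : {finite_measure set RT -> \bar R},
  (fI : {measure set RT -> \bar R}) = lI /\
  forall A : set (RT * RT), measurable A -> lO A = (fI \x fI)%E A.
Proof.
have [fI fE] := finite_measure_repack (@leb_I_fin R).
exists fI; split => // A mA; apply/esym.
apply: (product_measure_unique (m1 := fI) (m2 := fI)) => // C D mC mD.
by rewrite leb_OmegaX// -fE.
Qed.

Lemma tonelli1 (f : RT * RT -> \bar R) : measurable_fun [set: RT * RT] f ->
  (forall z, 0 <= f z)%E ->
  (\int[lO]_z f z = \int[lI]_x \int[lI]_y f (x, y))%E.
Proof.
move=> mf f0; have [fI [fE H]] := leb_Omega_prod.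
rewrite (@eq_measure_integral _ _ _ _ (fI \x fI)%E); last by move=> A mA _; exact: H.
by rewrite -fE; exact: fubini_tonelli1.
Qed.

Lemma tonelli2 (f : RT * RT -> \bar R) : measurable_fun [set: RT * RT] f ->
  (forall z, 0 <= f z)%E ->
  (\int[lO]_z f z = \int[lI]_y \int[lI]_x f (x, y))%E.
Proof.
move=> mf f0; have [fI [fE H]] := leb_Omega_prod.
rewrite (@eq_measure_integral _ _ _ _ (fI \x fI)%E); last by move=> A mA _; exact: H.
by rewrite -fE; exact: fubini_tonelli2.
Qed.

(** The inner real integrals apply [fine] pointwise. They agree with the extended ones only where a
    section is integrable, that is almost everywhere, so Fubini is used modulo null sets. *)
Lemma Rfubini (F : RT * RT -> R) : F \in Lfun lO 1%E ->
  \int[lI]_x \int[lI]_y F (x, y) = \int[lI]_y \int[lI]_x F (x, y).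
Proof.
move=> /Lfun1P iF; have [fI [fE H]] := leb_Omega_prod.
have mF : measurable_fun [set: RT * RT] (EFin \o F) by case/integrableP: iF.
have iF' : (fI \x fI)%E.-integrable setT (EFin \o F).
  apply/integrableP; split => //.
  rewrite (@eq_measure_integral _ _ _ _ lO); first by case/integrableP: iF.
  by move=> A mA _; rewrite H.
have F1 := ae_integrable1 iF'; have F2 := ae_integrable2 iF'.
have := Fubini iF'.
rewrite -fE /Rintegral => E; congr fine.
transitivity (\int[fI]_x \int[fI]_y (F (x, y))%:E)%E; last rewrite E.
  apply: ae_eq_integral => //.
  - apply/measurable_EFinP; apply: (measurableT_comp (fine_measurable measurableT)).
    exact: measurable_fubini_F iF'.
  - exact: measurable_fubini_F iF'.
  apply/ae_eqP; apply: (ae_mono F1) => x ix.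
  by rewrite /fubini_F fineK//; exact: integrable_fin_num.
apply/esym; apply: ae_eq_integral => //.
- apply/measurable_EFinP; apply: (measurableT_comp (fine_measurable measurableT)).
  exact: measurable_fubini_G iF'.
- exact: measurable_fubini_G iF'.
apply/ae_eqP; apply: (ae_mono F2) => x ix.
by rewrite /fubini_G fineK//; exact: integrable_fin_num.
Qed.

Lemma lI_cst (c : \bar R) : (\int[lI]_x c = c)%E.
Proof. by rewrite integral_cst// leb_IT mule1. Qed.

Lemma int_fst (h : RT -> \bar R) : measurable_fun [set: RT] h -> (forall x, 0 <= h x)%E ->
  (\int[lO]_z h z.1 = \int[lI]_x h x)%E.
Proof.
move=> mh h0; rewrite tonelli1//; last first.
  exact: (measurableT_comp mh measurable_fst).
by apply: eq_integral => x _ /=; rewrite lI_cst.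
Qed.

Lemma int_snd (h : RT -> \bar R) : measurable_fun [set: RT] h -> (forall x, 0 <= h x)%E ->
  (\int[lO]_z h z.2 = \int[lI]_x h x)%E.
Proof.
move=> mh h0; rewrite tonelli2//; last first.
  exact: (measurableT_comp mh measurable_snd).
by apply: eq_integral => x _ /=; rewrite lI_cst.
Qed.

Lemma measurable_pow (d : measure_display) (T : measurableType d) (r : R) (f : T -> R) :
  measurable_fun [set: T] f -> measurable_fun [set: T] (fun x => (`|f x| `^ r)%:E).
Proof.
move=> mf; apply/measurable_EFinP.
apply: (@measurableT_comp _ _ _ _ _ _ (fun x : R => x `^ r)); first exact: measurable_powR.
exact: measurableT_comp.
Qed.

Lemma Lfun_fst (r : R) (g : R -> R) : 0 < r -> g \in Lfun lI r%:E ->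
  (fun z : R * R => g z.1) \in Lfun lO r%:E /\
  nrm lO r%:E (fun z : R * R => g z.1) = nrm lI r%:E g.
Proof.
move=> r0 Lg; have mg := Lfun_meas Lg.
have mg1 : measurable_fun [set: RT * RT] (fun z : RT * RT => g z.1).
  exact: (measurableT_comp mg measurable_fst).
have E : (\int[lO]_z (`|g z.1| `^ r)%:E = \int[lI]_x (`|g x| `^ r)%:E)%E.
  apply: (int_fst (h := fun x => (`|g x| `^ r)%:E)); first exact: measurable_pow.
  by move=> x; rewrite lee_fin powR_ge0.
have L : (fun z : R * R => g z.1) \in Lfun lO r%:E.
  by apply: Lfun_powRP => //; rewrite E nrm_powR_e// ltry.
split => //.
have : nrm lO r%:E (fun z : R * R => g z.1) `^ r = nrm lI r%:E g `^ r.
  by rewrite (nrm_powR r0 L) (nrm_powR r0 Lg) /Rintegral E.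
move/(congr1 (fun t => t `^ r^-1)).
have rrV : r * r^-1 = 1 by rewrite divff// gt_eqF.
by rewrite -!powRrM rrV !powRr1// nrm_ge0.
Qed.

Lemma Lfun_snd (r : R) (g : R -> R) : 0 < r -> g \in Lfun lI r%:E ->
  (fun z : R * R => g z.2) \in Lfun lO r%:E /\
  nrm lO r%:E (fun z : R * R => g z.2) = nrm lI r%:E g.
Proof.
move=> r0 Lg; have mg := Lfun_meas Lg.
have mg1 : measurable_fun [set: RT * RT] (fun z : RT * RT => g z.2).
  exact: (measurableT_comp mg measurable_snd).
have E : (\int[lO]_z (`|g z.2| `^ r)%:E = \int[lI]_x (`|g x| `^ r)%:E)%E.
  apply: (int_snd (h := fun x => (`|g x| `^ r)%:E)); first exact: measurable_pow.
  by move=> x; rewrite lee_fin powR_ge0.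
have L : (fun z : R * R => g z.2) \in Lfun lO r%:E.
  by apply: Lfun_powRP => //; rewrite E nrm_powR_e// ltry.
split => //.
have : nrm lO r%:E (fun z : R * R => g z.2) `^ r = nrm lI r%:E g `^ r.
  by rewrite (nrm_powR r0 L) (nrm_powR r0 Lg) /Rintegral E.
move/(congr1 (fun t => t `^ r^-1)).
have rrV : r * r^-1 = 1 by rewrite divff// gt_eqF.
by rewrite -!powRrM rrV !powRr1// nrm_ge0.
Qed.

Lemma measurable_le2 : measurable_fun [set: RT * RT] (fun z : RT * RT => ((z.1 <= z.2)%R)%:R : R).
Proof.
pose A : set (RT * RT) := [set z | z.1 <= z.2].
have mA : measurable A.
  rewrite -[A]setTI; exact: measurable_fun_ler.
rewrite (_ : (fun z => _) = \1_A); first exact: measurable_indic.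
apply/funext => z; rewrite indicE; congr (_%:R); apply: congr1.
by apply/idP/idP; rewrite inE.
Qed.

Lemma measurable_le1 (x : R) : measurable_fun [set: RT] (fun t : RT => ((t <= x)%R)%:R : R).
Proof.
pose A : set RT := [set t | t <= x].
have mA : measurable A by rewrite -[A]setTI; apply: measurable_fun_ler.
rewrite (_ : (fun z => _) = \1_A); first exact: measurable_indic.
apply/funext => z; rewrite indicE; congr (_%:R); apply: congr1.
by apply/idP/idP; rewrite inE.
Qed.

Lemma continuous_Linfty (f : R -> R) : continuous f -> f \in Lfun lI +oo%E.
Proof.
move=> cf; have mf : measurable_fun [set: RT] f by exact: continuous_measurable_fun.
have : compact (f @` `[0, 1]).
  by apply: continuous_compact; [exact: continuous_subspaceT|exact: segment_compact].
move/compact_bounded => [M [_ HM]].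
apply: (ae_bound_Linfty (C := `|M| + 1) mf _ _).1; last by rewrite addr_ge0.
apply: (ae_mono ae_unit_itv) => x Ix; apply: (HM (`|M| + 1)).
  by rewrite (le_lt_trans (ler_norm _))// ltrDl.
exists x => //=; move: Ix; rewrite /unit_itv/= !in_itv/= => /andP[/ltW -> /ltW ->] //.
Qed.

Lemma continuous2_Linfty (f : R * R -> R) : continuous f ->
  measurable_fun [set: RT * RT] f -> f \in Lfun lO +oo%E.
Proof.
move=> cf mf.
have cK : compact (`[0, 1]%classic `*` `[0, 1]%classic : set (R * R)).
  by apply: compact_setX; exact: segment_compact.
have : compact (f @` (`[0, 1]%classic `*` `[0, 1]%classic)).
  by apply: continuous_compact => //; exact: continuous_subspaceT.
move/compact_bounded => [M [_ HM]].
apply: (ae_bound_Linfty (C := `|M| + 1) mf _ _).1; last by rewrite addr_ge0.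
apply: (ae_mono ae_Omega) => x [x1 x2]; apply: (HM (`|M| + 1)).
  by rewrite (le_lt_trans (ler_norm _))// ltrDl.
exists x => //=; split; [move: x1|move: x2];
  rewrite /unit_itv/= !in_itv/= => /andP[/ltW -> /ltW ->] //.
Qed.

Lemma FTC_lI (f : R -> R) (a b : R) : (forall x, derivable f x 1) ->
  continuous (derive1 f) -> 0 <= a -> a <= b -> b <= 1 ->
  \int[lI]_x (derive1 f x * \1_(`]a, b[%classic) x) = f b - f a.
Proof.
move=> df cdf a0; rewrite le_eqVlt => /predU1P[<-|ab] b1.
  rewrite subrr -[RHS](_ : \int[lI]_x (cst 0 x : R) = 0); last by rewrite /Rintegral integral0.
  apply: eq_Rintegral => x _; rewrite indicE memNset ?mulr0//= in_itv/= => /andP[ax xa].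
  by have := lt_trans ax xa; rewrite ltxx.
have mf' : measurable_fun [set: RT] (derive1 f) by exact: continuous_measurable_fun.
rewrite Rint_leb_I; last by apply: measurable_funM => //; exact: measurable_indic.
rewrite (_ : (fun x => _) = (derive1 f) \_ `]a, b[%classic); last first.
  by apply/funext => x; rewrite patch_indic.
rewrite -Rintegral_mkcondr (_ : unit_itv `&` `]a, b[%classic = `]a, b[%classic); last first.
  apply/seteqP; split => [x []//|x xab]; split => //.
  move: xab; rewrite /unit_itv/= !in_itv/= => /andP[ax xb].
  by rewrite (le_lt_trans a0 ax) (lt_le_trans xb b1).
rewrite /Rintegral integral_itv_bndo_bndc; last first.
  by apply: measurable_funTS; exact/measurable_EFinP.
rewrite integral_itv_obnd_cbnd; last first.
  by apply: measurable_funTS; exact/measurable_EFinP.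
have cf : continuous f.
  by move=> x; apply/differentiable_continuous/derivable1_diffP; exact: df.
have c1 : {within `[a, b], continuous (derive1 f)} by exact: continuous_subspaceT.
have c2 : derivable_oo_LRcontinuous f a b.
  split; [by move=> x _; exact: df| |].
  - by apply: cvg_at_right_filter; exact: cf.
  - by apply: cvg_at_left_filter; exact: cf.
by rewrite (continuous_FTC2 ab c1 c2 (fun x _ => erefl)).
Qed.

End FubiniUnitSquare.

(** * Sobolev spaces on the interval *)

Section WeakDerivative1.
Context {R : realType}.
Notation lI := (@leb_I R).
Notation lO := (@leb_Omega R).
Notation RT := (measurableTypeR R).
Implicit Types (f g h phi : R -> R).

Let c1y : conjp (1 : \bar R)%E +oo%E.
Proof. by split; rewrite ?leey//; right; left. Qed.

Let lIfin := @leb_I_fin R.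

Lemma testfun1_Linfty phi : testfun1 phi ->
  phi \in Lfun lI +oo%E /\ derive1 phi \in Lfun lI +oo%E.
Proof.
case=> sphi _; have sphi' := smooth1_derive sphi.
by split; apply: continuous_Linfty; exact: smooth1_continuous.
Qed.

Lemma Lfun1_mul f h : f \in Lfun lI 1%E -> h \in Lfun lI +oo%E ->
  (fun x => f x * h x) \in Lfun lI 1%E.
Proof. by move=> Lf Lh; exact: (hoelderR c1y Lf Lh).1. Qed.

Lemma is_wderiv_lin (a : R) f1 g1 f2 g2 : is_wderiv f1 g1 -> is_wderiv f2 g2 ->
  is_wderiv (fun x => a * f1 x + f2 x) (fun x => a * g1 x + g2 x).
Proof.
case=> Lf1 Lg1 H1 [Lf2 Lg2 H2]; split.
- by apply: LfunD => //; exact: LfunZ.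
- by apply: LfunD => //; exact: LfunZ.
move=> phi tphi; have [Lphi Ldphi] := testfun1_Linfty tphi.
have L1 := Lfun1_mul Lf1 Ldphi; have L2 := Lfun1_mul Lf2 Ldphi.
have L3 := Lfun1_mul Lg1 Lphi; have L4 := Lfun1_mul Lg2 Lphi.
transitivity (\int[lI]_x (a * (f1 x * derive1 phi x) + f2 x * derive1 phi x)).
  by apply: eq_Rintegral => x _; rewrite mulrDl mulrA.
rewrite RintD ?RintZ// ?H1// ?H2//; last exact: LfunZ.
transitivity (- \int[lI]_x (a * (g1 x * phi x) + g2 x * phi x)).
  rewrite RintD ?RintZ//; last exact: LfunZ.
  by rewrite mulrN -opprD.
by congr (- _); apply: eq_Rintegral => x _; rewrite mulrDl mulrA.
Qed.

Lemma is_wderiv_ae f f' g g' : measurable_fun [set: RT] f' -> measurable_fun [set: RT] g' ->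
  f = f' %[ae lI] -> g = g' %[ae lI] -> is_wderiv f g -> is_wderiv f' g'.
Proof.
move=> mf' mg' /ae_eqP ff /ae_eqP gg [Lf Lg H].
have ff' : f' = f %[ae lI] by apply/ae_eqP; apply: (ae_mono ff) => x ->.
have gg' : g' = g %[ae lI] by apply/ae_eqP; apply: (ae_mono gg) => x ->.
split.
- exact: Lfun_ae_eq Lf ff'.
- exact: Lfun_ae_eq Lg gg'.
move=> phi tphi; have [Lphi Ldphi] := testfun1_Linfty tphi.
have mphi := Lfun_meas Lphi; have mdphi := Lfun_meas Ldphi.
transitivity (\int[lI]_x (f x * derive1 phi x)).
  apply: Rint_ae_eq; first exact: measurable_funM.
    by apply: measurable_funM => //; exact: Lfun_meas Lf.
  by apply/ae_eqP; apply: (ae_mono ff) => x ->.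
rewrite H//; congr (- _); apply: Rint_ae_eq.
- by apply: measurable_funM => //; exact: Lfun_meas Lg.
- exact: measurable_funM.
- by apply/ae_eqP; apply: (ae_mono gg) => x ->.
Qed.

Lemma is_wderiv_unique f g1 g2 : is_wderiv f g1 -> is_wderiv f g2 -> g1 = g2 %[ae lI].
Proof.
case=> Lf Lg1 H1 [_ Lg2 H2].
have L : (g1 \- g2) \in Lfun lI 1%E by exact: LfunB.
suff : (g1 \- g2) = cst 0 %[ae lI].
  move/ae_eqP => H; apply/ae_eqP; apply: (ae_mono H) => x /= /eqP.
  by rewrite subr_eq0 => /eqP.
apply: (testfun1_vanish L) => phi tphi; have [Lphi _] := testfun1_Linfty tphi.
transitivity (\int[lI]_x (g1 x * phi x - g2 x * phi x)).
  by apply: eq_Rintegral => x _; rewrite /= mulrBl.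
rewrite RintB; [|exact: Lfun1_mul..].
by apply/eqP; rewrite subr_eq0 -eqr_opp -H1// -H2.
Qed.

Lemma wderivP f g : is_wderiv f g -> is_wderiv f (wderiv f).
Proof. by move=> fg; apply: xgetPex; exists g. Qed.

Lemma wderivE f g : is_wderiv f g -> wderiv f = g %[ae lI].
Proof. by move=> fg; exact: is_wderiv_unique (wderivP fg) fg. Qed.

(** Putting x into an indicator, not into the domain of integration, makes the integrand a function
    of (x, t) on a fixed space, ready for dominated convergence and Fubini. *)
Definition prim g (x : R) : R := \int[lI]_t (g t * ((t <= x)%R)%:R).

Lemma le01 (b : bool) : `|b%:R : R| <= 1.
Proof. by case: b; rewrite /= ?normr0 ?normr1. Qed.

Lemma Lfun1_mul_le g x : g \in Lfun lI 1%E -> (fun t => g t * ((t <= x)%R)%:R) \in Lfun lI 1%E.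
Proof.
move=> Lg; have mg := Lfun_meas Lg; apply: Lfun_ae_le Lg _ => //.
  by apply: measurable_funM => //; exact: measurable_le1.
by apply: nearW => t; rewrite normrM ler_piMr// le01.
Qed.

Lemma prim_lin (a : R) g1 g2 x : g1 \in Lfun lI 1%E -> g2 \in Lfun lI 1%E ->
  prim (fun t => a * g1 t + g2 t) x = a * prim g1 x + prim g2 x.
Proof.
move=> L1 L2; have L1' := Lfun1_mul_le x L1; have L2' := Lfun1_mul_le x L2.
rewrite -RintZ// -RintD//; last exact: LfunZ.
by apply: eq_Rintegral => t _; rewrite mulrDl mulrA.
Qed.

Lemma prim_bound g x : g \in Lfun lI 1%E -> `|prim g x| <= nrm lI 1%E g.
Proof.
move=> Lg; apply: le_trans (le_norm_Rintegral (Lfun1_mul_le x Lg)) _.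
apply: nrm_ae_le => //; first exact: Lfun_meas (Lfun1_mul_le x Lg).
by apply: nearW => t; rewrite normrM ler_piMr// le01.
Qed.

Lemma prim_ae_eq g1 g2 x : g1 \in Lfun lI 1%E -> g2 \in Lfun lI 1%E ->
  g1 = g2 %[ae lI] -> prim g1 x = prim g2 x.
Proof.
move=> L1 L2 /ae_eqP H; apply: Rint_ae_eq.
- exact: Lfun_meas (Lfun1_mul_le x L1).
- exact: Lfun_meas (Lfun1_mul_le x L2).
- by apply/ae_eqP; apply: (ae_mono H) => t ->.
Qed.

Lemma prim0 g : g \in Lfun lI 1%E -> prim g 0 = 0.
Proof.
move=> Lg; rewrite -[RHS](_ : \int[lI]_x (cst 0 x : R) = 0); last by rewrite /Rintegral integral0.
apply: Rint_ae_eq => //; first exact: Lfun_meas (Lfun1_mul_le 0 Lg).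
apply/ae_eqP; apply: (ae_mono ae_unit_itv) => t; rewrite /unit_itv/= in_itv/= => /andP[t0 _].
by rewrite leNgt t0 mulr0.
Qed.

Lemma prim1 g : g \in Lfun lI 1%E -> prim g 1 = \int[lI]_t g t.
Proof.
move=> Lg; apply: Rint_ae_eq; first exact: Lfun_meas (Lfun1_mul_le 1 Lg).
  exact: Lfun_meas Lg.
apply/ae_eqP; apply: (ae_mono ae_unit_itv) => t; rewrite /unit_itv/= in_itv/= => /andP[_ t0].
by rewrite ltW// mulr1.
Qed.

(** Along u n tending to x the indicators converge for all t other than x, and |g| dominates. *)
Lemma continuous_prim g : g \in Lfun lI 1%E -> continuous (prim g).
Proof.
move=> Lg x; apply/continuous_withinNx/cvgr_dnbhsP => u [_ ux].
have L1 : (cst 1 : RT -> R) \in Lfun lI +oo%E.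
  by apply: (@bounded_Lfun_all _ _ _ _ lIfin _ _ 1); rewrite ?leey// => t; rewrite normr1.
have dom (t : R) n : `|g t * ((t <= u n)%R)%:R| <= `|g t| by rewrite normrM ler_piMr// le01.
have H : {ae lI, forall t, g t * ((t <= u n)%R)%:R @[n --> \oo] --> g t * ((t <= x)%R)%:R}.
  apply: (ae_mono (ae_neq x)) => t tx; apply: cvgM; first exact: cvg_cst.
  apply: cvg_near_cst; move: tx; rewrite neq_lt => /orP[tx|tx].
    have H : \forall n \near \oo, t < u n by exact: cvgr_gt ux _ tx.
    apply: filterS H => n un.
    by rewrite (ltW un) (ltW tx).
  have H : \forall n \near \oo, u n < t by exact: cvgr_lt ux _ tx.
  apply: filterS H => n un.
  by rewrite !leNgt un tx.
have Dom : {ae lI, forall t n, `|g t * ((t <= u n)%R)%:R| <= `|g t|} by exact: nearW.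
have [_ c] := @dominated_nrm _ _ _ lI 1 (fun n t => g t * ((t <= u n)%R)%:R)
  (fun t => g t * ((t <= x)%R)%:R) (fun t => `|g t|) (lexx 1)
  (fun n => Lfun_meas (Lfun1_mul_le (u n) Lg)) (Lfun_meas (Lfun1_mul_le x Lg)) H
  (Lfun_abs lte01 Lg) Dom.
have := nrm_cvg_int c1y (fun n => Lfun1_mul_le (u n) Lg) (Lfun1_mul_le x Lg) L1 c.
have E y : \int[lI]_t (g t * ((t <= y)%R)%:R * cst 1 t) = prim g y.
  by apply: eq_Rintegral => t _; rewrite mulr1.
by rewrite E; under eq_fun do rewrite E.
Qed.

Lemma prim_Linfty g : g \in Lfun lI 1%E -> prim g \in Lfun lI +oo%E.
Proof. by move=> Lg; apply: continuous_Linfty; exact: continuous_prim. Qed.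

Lemma Linfty_Lfun (r : \bar R) h : (1 <= r)%E -> h \in Lfun lI +oo%E -> h \in Lfun lI r.
Proof.
move=> r1 Lh; apply: (bounded_Lfun lIfin r1 (Lfun_meas Lh)); exact: Linfty_ae_bound.
Qed.

(** Every real s is allowed, as needed under the integral in [is_wderiv_prim]. Clamping s to [0,1]
    does not change phi s, because phi vanishes outside (0,1). *)
Lemma testfun1_tail phi s : testfun1 phi ->
  \int[lI]_x (derive1 phi x * ((s <= x)%R)%:R) = - phi s.
Proof.
move=> tphi; have [sphi [K [_ KI phi0]]] := tphi; have sphi' := smooth1_derive sphi.
have phi1 : phi 1 = 0.
  by apply: phi0 => /KI; rewrite /unit_itv/= in_itv/= ltxx andbF.
have phiN x : x <= 0 \/ 1 <= x -> phi x = 0.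
  by move=> x01; apply: phi0 => /KI; rewrite /unit_itv/= in_itv/= => /andP[]; case: x01; lra.
have dphi x : derivable phi x 1 by exact: smooth1_derivable.
have cphi' := smooth1_continuous sphi'.
pose a := Num.max 0 (Num.min s 1).
have a0 : 0 <= a by rewrite /a le_max lexx.
have a1 : a <= 1 by rewrite /a ge_max ler01 ge_min lexx orbT.
have -> : phi s = phi a.
  rewrite /a; case: (leP s 1) => s1; last by rewrite max_r// !phiN//; right => //; exact: ltW.
  by case: (leP 0 s) => s0 //; rewrite !phiN//; left => //; exact: ltW.
have := FTC_lI dphi cphi' a0 a1 (lexx 1).
rewrite phi1 sub0r => <-; apply: Rint_ae_eq.
- apply: measurable_funM; first exact: smooth1_measurable.
  have : measurable_fun [set: RT * RT] (fun z : RT * RT => ((z.1 <= z.2)%R)%:R : R) := measurable_le2.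
  by move=> m2; exact: (measurableT_comp m2 (pair1_measurable s)).
- by apply: measurable_funM; [exact: smooth1_measurable|exact: measurable_indic].
apply/ae_eqP; apply: (ae_mono2 (ae_neq s) ae_unit_itv) => x xs.
rewrite /unit_itv/= in_itv/= => /andP[x0 x1]; congr (_ * _%:R); apply: congr1.
apply/idP/idP; rewrite inE/= in_itv/= x1 andbT.
  by rewrite /a gt_max x0/= gt_min lt_neqAle eq_sym xs => ->.
by rewrite /a gt_max x0/= gt_min (ltNge 1) (ltW x1) orbF; exact: ltW.
Qed.

(** Fubini on the triangle t <= x: integrating phi' over x > t first leaves - phi t. *)
Lemma is_wderiv_prim g : g \in Lfun lI 1%E -> is_wderiv (prim g) g.
Proof.
move=> Lg; split => //; first by apply: Linfty_Lfun => //; exact: prim_Linfty.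
move=> phi tphi; have [Lphi Ldphi] := testfun1_Linfty tphi.
have mphi := Lfun_meas Lphi; have mdphi := Lfun_meas Ldphi; have mg := Lfun_meas Lg.
pose F (z : R * R) := (g z.2 * ((z.2 <= z.1)%R)%:R) * derive1 phi z.1.
have mle : measurable_fun [set: RT * RT] (fun z : RT * RT => ((z.2 <= z.1)%R)%:R : R).
  exact: (measurableT_comp measurable_le2 (measurable_fun_pair measurable_snd measurable_fst)).
have LF : F \in Lfun lO 1%E.
  have Lg2 := (Lfun_snd ltr01 Lg).1.
  have Lk : (fun z : R * R => nrm lI +oo%E (derive1 phi) * g z.2) \in Lfun lO 1%E by exact: LfunZ.
  apply: Lfun_ae_le Lk _ => //.
    apply: measurable_funM; first by apply: measurable_funM => //; exact: Lfun_meas Lg2.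
    exact: (measurableT_comp mdphi measurable_fst).
  apply: (ae_mono (ae_fst (Linfty_ae_bound Ldphi))) => z Hz.
  rewrite !normrM (ger0_norm (nrm_ge0 _ _ _)) mulrC.
  by apply: ler_pM => //; rewrite ler_piMr// le01.
have E1 x : prim g x * derive1 phi x = \int[lI]_t F (x, t).
  rewrite mulrC -RintZ; last exact: Lfun1_mul_le.
  by apply: eq_Rintegral => t _; rewrite /F/= mulrC.
under eq_Rintegral do rewrite E1.
rewrite (Rfubini LF) -RintN; last exact: Lfun1_mul.
have mle2 (t : R) : measurable_fun [set: RT] (fun x : RT => ((t <= x)%R)%:R : R).
  exact: (measurableT_comp measurable_le2 (pair1_measurable t)).
have E2 t : \int[lI]_x F (x, t) = - (g t * phi t).
  rewrite -mulrN -(testfun1_tail t tphi) -RintZ; last first.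
    apply: (Lfun_ae_le (mu := lI) (g := derive1 phi)) => //; last 2 first.
      exact: Linfty_Lfun.
    2: exact: measurable_funM.
    by apply: nearW => x; rewrite normrM ler_piMr// le01.
  by apply: eq_Rintegral => x _; rewrite /F/= -mulrA [_%:R * _]mulrC.
by apply: eq_Rintegral => t _; exact: E2.
Qed.

End WeakDerivative1.

(** * Functions with zero boundary values as primitives of mean-zero functions *)

Section Sobolev1.
Context {R : realType}.
Notation lI := (@leb_I R).
Notation lO := (@leb_Omega R).
Notation RT := (measurableTypeR R).
Notation lam := (@lebesgue_measure R).
Implicit Types (f g h phi psi : R -> R).

Let c1y : conjp (1 : \bar R)%E +oo%E.
Proof. by split; rewrite ?leey//; right; left. Qed.

Let lIfin := @leb_I_fin R.

Lemma testfun1_lin (a : R) phi psi : testfun1 phi -> testfun1 psi ->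
  testfun1 (fun x => a * phi x + psi x).
Proof.
case=> sphi [K [cK KI K0]] [spsi [L [cL LI L0]]]; split.
  apply: smooth1D spsi.
  apply: (@smooth1M _ (fun=> a) phi _ sphi) => n x.
  suff H k : exists b : R, derive1n k (fun _ : R => a) = cst b.
    by have [b ->] := H n; exact: derivable_cst.
  elim: k => [|k [b IH]]; first by exists a.
  by exists 0; apply/funext => y; rewrite derive1nS IH derive1_cst.
exists (K `|` L); split; first exact: compactU.
- by move=> x [/KI|/LI].
- by move=> x /not_orP[/K0 -> /L0 ->]; rewrite mulr0 addr0.
Qed.

(** The primitive always vanishes to the left of the support; mean zero makes it vanish to the right
    as well. *)
Lemma testfun1_antideriv psi : testfun1 psi -> \int[lI]_x psi x = 0 ->
  testfun1 (prim psi) /\ derive1 (prim psi) = psi.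
Proof.
case=> spsi [K [cK KI K0]] I0.
have tpsi : testfun1 psi by split => //; exists K.
have [Lpsi _] := testfun1_Linfty tpsi.
have Lpsi1 : psi \in Lfun lI 1%E by exact: Linfty_Lfun.
have cpsi := smooth1_continuous spsi.
have mpsi := smooth1_measurable spsi.
have mI := @measurable_unit_itv R.
have K0' x : ~ unit_itv x -> psi x = 0 by move=> nI; apply: K0 => /KI.
(* As psi vanishes outside (0,1), this is an integral over a half-line for the full Lebesgue
   measure. The fundamental theorem then differentiates it at every real x, as [smooth1] demands. *)
have primE x : prim psi x = \int[lam]_(t in [set` Interval -oo%O (BRight x)]) psi t.
  rewrite /prim Rint_leb_I; last exact: Lfun_meas (Lfun1_mul_le x Lpsi1).
  rewrite Rintegral_mkcond [RHS]Rintegral_mkcond; apply: eq_Rintegral => t _.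
  rewrite !patchE; case: ifPn => [tI|/negP tI].
    case: ifPn => [|/negP]; rewrite inE/= in_itv/= => tx; first by rewrite tx mulr1.
    by rewrite (negbTE (introN idP tx)) mulr0.
  by case: ifP => // _; rewrite K0'// => It; apply: tI; rewrite inE.
have ipsi : lam.-integrable setT (EFin \o psi).
  have : lam.-integrable unit_itv (EFin \o psi).
    have /Lfun1P/integrableP[_ H] := Lpsi1.
    apply/integrableP; split.
      by apply/measurable_EFinP; exact: measurable_funTS.
    have mapsi : measurable_fun [set: RT] (fun x : RT => `|psi x|) by exact: measurableT_comp.
    by move: H; rewrite /= (int_leb_I mapsi).
  rewrite (integrable_mkcond _ mI); congr (_.-integrable _ _).
  apply/funext => x; rewrite patchE; case: ifPn => // /negP xI /=.
  by rewrite K0'// => Ix; apply: xI; rewrite inE.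
have D x : derivable (prim psi) x 1 /\ derive1 (prim psi) x = psi x.
  have := @continuous_FTC1 R psi -oo%O x (x + 1) _ _ _ (cpsi x).
  rewrite (_ : (fun x0 => _) = prim psi); last by apply/funext => y; rewrite primE.
  apply => //; first by rewrite ltrDl.
    by apply: integrableS ipsi.
  by rewrite ltNyr.
have dE : derive1 (prim psi) = psi by apply/funext => x; have [] := D x.
split => //; split.
  move=> [|n] x; first by have [] := D x.
  by rewrite derive1Sn dE; exact: spsi.
have [K00|/set0P[k0 Kk0]] := eqVneq K set0.
  exists set0; split => //; first exact: compact0.
  move=> x _; rewrite /prim -[RHS](_ : \int[lI]_x (cst 0 x : R) = 0).
    by apply: eq_Rintegral => t _; rewrite K0 ?mul0r// K00.
  by rewrite /Rintegral integral0.
have cid : {within K, continuous (@id R)} by apply: continuous_subspaceT => x; exact: cvg_id.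
(* The interval between the extreme points of K is the new support: for x outside it, the indicator
   [t <= x] is constant in t on K. *)
have [a aK amin] : exists2 a, a \in K & forall t, t \in K -> a <= t.
  by apply: (compact_EVT_min _ cK cid); exists k0.
have [b bK bmax] : exists2 b, b \in K & forall t, t \in K -> t <= b.
  by apply: (compact_EVT_max _ cK cid); exists k0.
exists `[a, b]%classic; split; first exact: segment_compact.
  move=> x /=; rewrite in_itv/= => /andP[ax xb].
  have := KI a (set_mem aK); have := KI b (set_mem bK).
  rewrite /unit_itv/= !in_itv/= => /andP[_ b1] /andP[a0 _].
  by rewrite (lt_le_trans a0 ax) (le_lt_trans xb b1).
move=> x /= /negP; rewrite in_itv/= negb_and -!ltNge => /orP[xa|bx].
  rewrite /prim -[RHS](_ : \int[lI]_x (cst 0 x : R) = 0); last by rewrite /Rintegral integral0.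
  apply: eq_Rintegral => t _; have [Kt|nKt] := pselect (K t); last by rewrite K0 ?mul0r.
  by rewrite leNgt (lt_le_trans xa) ?mulr0//; apply: amin; rewrite inE.
rewrite -[RHS]I0; apply: eq_Rintegral => t _.
have [Kt|nKt] := pselect (K t); last by rewrite K0 ?mul0r.
by rewrite (le_trans _ (ltW bx)) ?mulr1//; apply: bmax; rewrite inE.
Qed.

(* The du Bois-Reymond lemma: a test function of mean zero is the derivative of
   a test function, so d is orthogonal to all of these. *)
Lemma wderiv0_cst d : is_wderiv d (cst 0) -> exists C, d = cst C %[ae lI].
Proof.
case=> Ld _ H.
(* If every test function had mean zero, the constant 1 would be orthogonal to all of them and
   vanish almost everywhere. *)
have [beta0 [tbeta m0]] : exists beta0, testfun1 beta0 /\ \int[lI]_x beta0 x != 0.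
  apply/not_existsP => N.
  have L1 : (cst 1 : RT -> R) \in Lfun lI 1%E.
    by apply: (@bounded_Lfun_all _ _ _ _ lIfin _ _ 1) => // t; rewrite normr1.
  have /ae_eqP : (cst 1 : R -> R) = cst 0 %[ae lI].
    apply: testfun1_vanish => // phi tphi; apply/eqP; apply/negPn/negP => nz.
    apply: (N phi); split => //; apply: contra nz => /eqP <-; apply/eqP.
    by apply: eq_Rintegral => x _; rewrite mul1r.
  case=> A [mA A0 AE]; have : (lI setT <= lI A)%E.
    by apply: le_measure; rewrite ?inE// => x _; apply: AE => /= /eqP; rewrite oner_eq0.
  by rewrite A0 leb_IT lee_fin ler10.
set m := \int[lI]_x beta0 x in m0.
have [Lb _] := testfun1_Linfty tbeta.
exists ((\int[lI]_x (d x * beta0 x)) / m); set C := _ / m.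
have LC : (cst C : RT -> R) \in Lfun lI 1%E.
  by apply: (@bounded_Lfun_all _ _ _ _ lIfin _ _ `|C|).
have LdC : (d \- cst C) \in Lfun lI 1%E by exact: LfunB.
have /ae_eqP V : (d \- cst C) = cst 0 %[ae lI].
  apply: testfun1_vanish => // phi tphi; have [Lphi _] := testfun1_Linfty tphi.
  have Lphi1 := Linfty_Lfun (lexx 1%E) Lphi; have Lb1 := Linfty_Lfun (lexx 1%E) Lb.
  pose a := (\int[lI]_x phi x) / m.
  pose psi x := - a * beta0 x + phi x.
  have tpsi : testfun1 psi by exact: testfun1_lin.
  have I0 : \int[lI]_x psi x = 0.
    rewrite RintD ?RintZ//; last exact: LfunZ.
    by rewrite -/m /a mulNr divfK// addNr.
  have [tp dp] := testfun1_antideriv tpsi I0.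
  have := H _ tp; rewrite dp.
  have -> : \int[lI]_x (cst 0 x * prim psi x) = 0.
    rewrite -[RHS](_ : \int[lI]_x (cst 0 x : R) = 0); last by rewrite /Rintegral integral0.
    by apply: eq_Rintegral => x _; rewrite mul0r.
  have Ldb := Lfun1_mul Ld Lb; have Ldphi := Lfun1_mul Ld Lphi.
  have -> : \int[lI]_x (d x * psi x) = - a * \int[lI]_x (d x * beta0 x) + \int[lI]_x (d x * phi x).
    rewrite -RintZ// -RintD//; last exact: LfunZ.
    by apply: eq_Rintegral => x _; rewrite /psi; ring.
  move=> E; transitivity (\int[lI]_x (d x * phi x - C * phi x)).
    by apply: eq_Rintegral => x _; rewrite /= mulrBl.
  rewrite RintB//; last exact: LfunZ.
  rewrite RintZ//.
  move: E; rewrite oppr0 => E; rewrite -[RHS]E addrC; congr (_ + _).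
  by rewrite /a /C mulNr; congr (- _); rewrite mulrC mulrA mulrAC.
by apply/ae_eqP; apply: (ae_mono V) => x /eqP; rewrite /= subr_eq0 => /eqP.
Qed.

Lemma wderiv_Lfun (r : \bar R) f : (1 <= r)%E -> W1_I r f ->
  [/\ is_wderiv f (wderiv f) & wderiv f \in Lfun lI r].
Proof.
move=> r1 [Lf [g fg Lg]]; have w := wderivP fg; split => //.
have /ae_eqP E := wderivE fg; case: w => _ /Lfun_meas mw _.
have r0 : (0 < r)%E by exact: lt_le_trans r1.
by apply: (Lfun_ae_eq r0 mw Lg); apply/ae_eqP; apply: (ae_mono E).
Qed.

Lemma ae_itv_ex (P : R -> Prop) (a b : R) : {ae lI, forall x, P x} -> 0 <= a -> a < b -> b <= 1 ->
  exists2 x, a < x < b & P x.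
Proof.
case=> A [mA A0 AE] a0 ab b1; apply/not_exists2P => N.
have mab : measurable (`]a, b[%classic : set RT) by exact: measurable_itv.
have : (lI `]a, b[%classic <= lI A)%E.
  apply: le_measure; rewrite ?inE// => x /=; rewrite in_itv/= => abx; apply: AE => /= Px.
  by case: (N x) => // /(_ abx).
rewrite A0; apply/negP; rewrite -ltNge -[X in (_ < X)%E]/(lam (`]a, b[ `&` unit_itv)).
rewrite setIidl; first by rewrite lebesgue_measure_itv/= lte_fin ab -EFinB lte_fin subr_gt0.
move=> x /=; rewrite /unit_itv/= !in_itv/= => /andP[ax xb].
by rewrite (le_lt_trans a0 ax) (lt_le_trans xb b1).
Qed.

(** The endpoints are null, so their values come by continuity from zeros of k arbitrarily close to
    them. *)
Lemma continuous_within_ae0 (k : R -> R) : {within `[0, 1], continuous k} ->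
  k = cst 0 %[ae lI] -> k 0 = 0 /\ k 1 = 0.
Proof.
move=> ck /ae_eqP k0; have [_ c0 c1] := (continuous_within_itvP _ ltr01).1 ck.
split; apply/eqP/negP => /negP nz.
  have e0 : 0 < `|k 0| by rewrite normr_gt0.
  have /cvgrPdist_lt /(_ _ e0) [d /= d0 H] := c0.
  have dm : 0 < Num.min d 1 by rewrite lt_min d0 ltr01.
  have d1 : Num.min d 1 <= 1 by rewrite ge_min lexx orbT.
  have [x /andP[x0 xd] kx] := ae_itv_ex k0 (lexx 0) dm d1.
  have := H x; rewrite /= sub0r normrN gtr0_norm// kx subr0 ltxx => F; suff : false by [].
  by apply: F => //; move: xd; rewrite lt_min => /andP[].
have e0 : 0 < `|k 1| by rewrite normr_gt0.
have /cvgrPdist_lt /(_ _ e0) [d /= d0 H] := c1.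
have dm : Num.max (1 - d) 0 < 1 by rewrite gt_max ltr01 andbT; lra.
have d1 : 0 <= Num.max (1 - d) 0 by rewrite le_max lexx orbT.
have [x /andP[x0 xd] kx] := ae_itv_ex k0 d1 dm (lexx 1).
have := H x; rewrite /= gtr0_norm ?subr_gt0// kx subr0 ltxx => F; suff : false by [].
apply: F => //.
by move: x0; rewrite gt_max => /andP[? _]; lra.
Qed.

Lemma Rint_cst0 : \int[lI]_x (cst 0 x : R) = 0.
Proof. by rewrite /Rintegral integral0. Qed.

(** By du Bois-Reymond, f is a constant plus the primitive of its weak derivative. The boundary
    value at 0 kills the constant and the one at 1 the mean. With [W10_I_prim] as converse,
    [W10_I r] corresponds to the mean-zero functions of L^r. *)
Lemma W10_I_repr (r : \bar R) f : (1 <= r)%E -> W10_I r f ->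
  [/\ is_wderiv f (wderiv f), wderiv f \in Lfun lI r, \int[lI]_x wderiv f x = 0 &
      f = prim (wderiv f) %[ae lI]].
Proof.
move=> r1 [Wf [c [cc /ae_eqP cf c0 c1]]]; have [w Lw] := wderiv_Lfun r1 Wf.
have Lw1 : wderiv f \in Lfun lI 1%E by case: w.
have wp := is_wderiv_prim Lw1.
have [C /ae_eqP HC] : exists C, (f \- prim (wderiv f)) = cst C %[ae lI].
  apply: wderiv0_cst.
  have := is_wderiv_lin (- 1) wp w; congr is_wderiv; apply/funext => x /=.
    by rewrite mulN1r addrC.
  by rewrite mulN1r addNr.
pose k x := c x - prim (wderiv f) x - C.
have ck : {within `[0, 1], continuous k}.
  move=> x; apply: cvgB; last exact: cvg_cst.
  apply: cvgB; first exact: cc.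
  by apply: continuous_subspaceT; exact: continuous_prim.
have [k0 k1] : k 0 = 0 /\ k 1 = 0.
  apply: continuous_within_ae0 => //; apply/ae_eqP; apply: (ae_mono2 cf HC) => x; rewrite /k => -> /= ->.
  by rewrite subrr.
have C0 : C = 0 by move: k0; rewrite /k c0 prim0// subrr sub0r => /eqP; rewrite oppr_eq0 => /eqP.
split => //.
  move: k1; rewrite /k c1 prim1// C0 subr0 sub0r => /eqP; rewrite oppr_eq0 => /eqP.
  exact.
apply/ae_eqP; apply: (ae_mono HC) => x /= /eqP; rewrite C0 subr_eq0 => /eqP; exact.
Qed.

Lemma W10_I_prim (r : \bar R) g : (1 <= r)%E -> g \in Lfun lI r -> \int[lI]_x g x = 0 ->
  W10_I r (prim g) /\ wderiv (prim g) = g %[ae lI].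
Proof.
move=> r1 Lg I0; have Lg1 : g \in Lfun lI 1%E by exact: Lfun_sub1 r1 Lg.
have w := is_wderiv_prim Lg1; split; last exact: wderivE.
split; first split.
- by apply: Linfty_Lfun => //; exact: prim_Linfty.
- by exists g.
exists (prim g); split => //.
- by apply: continuous_subspaceT; exact: continuous_prim.
- by apply/ae_eqP; exact: nearW.
- exact: prim0.
- by rewrite prim1.
Qed.

Lemma W10_I_ae (r : \bar R) f f' : (1 <= r)%E -> measurable_fun [set: RT] f' ->
  f = f' %[ae lI] -> W10_I r f -> W10_I r f'.
Proof.
move=> r1 mf' /ae_eqP ff [[Lf [g fg Lg]] [c [cc /ae_eqP cf c0 c1]]].
have ff' : f' = f %[ae lI] by apply/ae_eqP; apply: (ae_mono ff) => x ->.
split; first split.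
- by apply: Lfun_ae_eq Lf ff' => //; exact: lt_le_trans r1.
- have mg : measurable_fun [set: RT] g by case: fg => _ /Lfun_meas.
  exists g => //; apply: is_wderiv_ae fg => //; last 2 first.
    exact/ae_eqP.
    by apply/ae_eqP; exact: nearW.
exists c; split => //; apply/ae_eqP; apply: (ae_mono2 cf ff) => x -> ->.
by [].
Qed.

Lemma W10_I_lin (r : \bar R) (a : R) f1 f2 : (1 <= r)%E -> W10_I r f1 -> W10_I r f2 ->
  W10_I r (fun x => a * f1 x + f2 x).
Proof.
move=> r1 [[Lf1 [g1 w1 Lg1]] [k1 [ck1 /ae_eqP kf1 k10 k11]]].
move=> [[Lf2 [g2 w2 Lg2]] [k2 [ck2 /ae_eqP kf2 k20 k21]]].
split; first split.
- by apply: LfunD => //; exact: LfunZ.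
- exists (fun x => a * g1 x + g2 x); first exact: is_wderiv_lin.
  by apply: LfunD => //; exact: LfunZ.
exists (fun x => a * k1 x + k2 x); split.
- move=> x; apply: cvgD; last exact: ck2.
  by apply: cvgM; [exact: cvg_cst|exact: ck1].
- by apply/ae_eqP; apply: (ae_mono2 kf1 kf2) => x -> ->.
- by rewrite k10 k20 mulr0 addr0.
- by rewrite k11 k21 mulr0 addr0.
Qed.

Lemma wderiv_lin (a : R) f1 g1 f2 g2 : is_wderiv f1 g1 -> is_wderiv f2 g2 ->
  wderiv (fun x => a * f1 x + f2 x) = (fun x => a * wderiv f1 x + wderiv f2 x) %[ae lI].
Proof.
by move=> w1 w2; apply: wderivE; apply: is_wderiv_lin; [exact: wderivP w1|exact: wderivP w2].
Qed.

Lemma wderiv_ae f f' g : measurable_fun [set: RT] f' -> f = f' %[ae lI] -> is_wderiv f g ->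
  wderiv f = wderiv f' %[ae lI].
Proof.
move=> mf' ff fg; have w := wderivP fg.
have mw : measurable_fun [set: RT] (wderiv f) by case: w => _ /Lfun_meas.
have /ae_eqP E : wderiv f' = wderiv f %[ae lI].
  by apply: wderivE; apply: is_wderiv_ae w => //; exact/ae_eqP/nearW.
by apply/ae_eqP; apply: (ae_mono E) => x ->.
Qed.

(** As g has mean zero, 1/2 may be subtracted from the indicator, which leaves a factor of modulus
    1/2. This is the source of |gamma| <= 1/2 for feasible gamma. *)
Lemma prim_half_bound g x : g \in Lfun lI 1%E -> \int[lI]_t g t = 0 ->
  `|prim g x| <= nrm lI 1%E g / 2.
Proof.
move=> Lg I0; have Lgx := Lfun1_mul_le x Lg.
have -> : prim g x = \int[lI]_t (g t * (((t <= x)%R)%:R - 2^-1)).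
  transitivity (\int[lI]_t (g t * ((t <= x)%R)%:R - 2^-1 * g t)).
    by rewrite RintB ?RintZ ?I0 ?mulr0 ?subr0//; exact: LfunZ.
  by apply: eq_Rintegral => t _; rewrite mulrBr [2^-1 * _]mulrC.
have Lh : (fun t => 2^-1 * g t) \in Lfun lI 1%E by exact: LfunZ.
have L : (fun t => g t * (((t <= x)%R)%:R - 2^-1)) \in Lfun lI 1%E.
  have := LfunB (lexx 1%E) Lgx Lh; congr (_ \in Lfun _ _).
  by apply/funext => t /=; rewrite mulrBr [2^-1 * _]mulrC.
apply: le_trans (le_norm_Rintegral L) _.
rewrite [leRHS]mulrC -[X in X * _]ger0_norm ?invr_ge0// -nrmZ//.
apply: nrm_ae_le => //; first exact: Lfun_meas L.
apply: nearW => t; rewrite normrM mulrC normrM ler_wpM2r//.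
rewrite [leRHS]ger0_norm ?invr_ge0//; case: (t <= x) => /=; rewrite ?sub0r ?normrN ger0_norm//; lra.
Qed.

Lemma nrm_cst (r : \bar R) (C : R) : (1 <= r)%E -> nrm lI r (cst C) = `|C|.
Proof.
have K1 : `|C| = nrm lI 1%E (cst C).
  by rewrite nrm1E /Rintegral /= lI_cst.
case: r => [r|_|//]; last first.
  have H : {ae lI, forall x, `|cst C x : R| <= `|C|} by exact: nearW.
  have [L le] := ae_bound_Linfty (measurable_cst C) H (normr_ge0 C).
  apply/eqP; rewrite eq_le le/= K1.
  have Lc1 : (cst C : RT -> R) \in Lfun lI 1%E by exact: Linfty_Lfun.
  rewrite nrm1E (_ : \int[lI]_x _ = `|C|); last by rewrite /Rintegral /= lI_cst.
  have B := Linfty_ae_bound L.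
  by have [x _ ] := ae_itv_ex B (lexx 0) ltr01 (lexx 1).
rewrite lee_fin => r1; have r0 := lt_le_trans ltr01 r1.
have L : (cst C : RT -> R) \in Lfun lI r%:E.
  by apply: (@bounded_Lfun_all _ _ _ _ lIfin _ _ `|C|).
rewrite -[LHS]powRr1 ?nrm_ge0// -[RHS]powRr1// -(@divff _ r) ?gt_eqF// !powRrM.
by rewrite nrm_powR// /Rintegral /= lI_cst.
Qed.

Lemma nrm_le_ae_bound (r : \bar R) f (C : R) : (1 <= r)%E -> measurable_fun [set: RT] f ->
  {ae lI, forall x, `|f x| <= C} -> 0 <= C -> nrm lI r f <= C.
Proof.
move=> r1 mf fC C0; rewrite -[leRHS]ger0_norm// -(nrm_cst C r1).
apply: nrm_ae_le => //; first exact: lt_le_trans r1.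
  by apply: (@bounded_Lfun_all _ _ _ _ lIfin _ _ `|C|).
by apply: (ae_mono fC) => x; rewrite [`|cst C x|]ger0_norm.
Qed.

(** Makes test functions admissible in the equation on Gamma, from which a control is recovered. The
    primitive of phi' is compared with phi on [0,1], which determines it almost everywhere. *)
Lemma testfun1_W10 (r : \bar R) phi : (1 <= r)%E -> testfun1 phi -> W10_I r phi.
Proof.
move=> r1 tphi; have [sphi [K [_ KI K0]]] := tphi.
have [Lphi Ldphi] := testfun1_Linfty tphi.
have Ldphi1 := Linfty_Lfun (lexx 1%E) Ldphi.
have phiN x : x <= 0 \/ 1 <= x -> phi x = 0.
  by move=> x01; apply: K0 => /KI; rewrite /unit_itv/= in_itv/= => /andP[]; case: x01; lra.
have dphi x : derivable phi x 1 by exact: smooth1_derivable.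
have cphi' := smooth1_continuous (smooth1_derive sphi).
have mphi' := smooth1_measurable (smooth1_derive sphi).
have E x : 0 <= x <= 1 -> prim (derive1 phi) x = phi x.
  move=> /andP[x0 x1]; have := FTC_lI dphi cphi' (lexx 0) x0 x1.
  rewrite (phiN 0) ?subr0; last by left.
  move=> <-; apply: Rint_ae_eq.
  - exact: Lfun_meas (Lfun1_mul_le x Ldphi1).
  - by apply: measurable_funM => //; exact: measurable_indic.
  apply/ae_eqP; apply: (ae_mono2 (ae_neq x) ae_unit_itv) => t tx.
  rewrite /unit_itv/= in_itv/= => /andP[t0 _]; congr (_ * _%:R); apply: congr1.
  by apply/idP/idP; rewrite inE/= in_itv/= t0/=; [rewrite lt_neqAle tx|exact: ltW].
apply: (@W10_I_ae _ (prim (derive1 phi))) => //; first exact: smooth1_measurable.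
  apply/ae_eqP; apply: (ae_mono ae_unit_itv) => x; rewrite /unit_itv/= in_itv/= => /andP[x0 x1].
  by rewrite E// !ltW.
apply: (W10_I_prim r1 _ _).1; first exact: Linfty_Lfun.
by rewrite -prim1// E ?ler01 ?lexx// phiN//; right.
Qed.

End Sobolev1.

(** * Sobolev spaces on the square *)

Section Square.
Context {R : realType}.
Notation lI := (@leb_I R).
Notation lO := (@leb_Omega R).
Notation RT := (measurableTypeR R).
Implicit Types (phi : R * R -> R).

Let c1y : conjp (1 : \bar R)%E +oo%E.
Proof. by split; rewrite ?leey//; right; left. Qed.

Let lIfin := @leb_I_fin R.
Let lOfin := @leb_Omega_fin R.

(** Bridges the product topology and the product sigma-algebra: an open set is the union of the
    countably many rational rectangles which it contains. [F] sends the other rectangles to the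
    empty set. *)
Lemma open2_measurable (U : set (R * R)) : open U -> measurable (U : set (RT * RT)).
Proof.
move=> oU.
pose rect (q : (rat * rat) * (rat * rat)) : set (RT * RT) :=
  (`]ratr q.1.1, ratr q.1.2[%classic : set RT) `*` (`]ratr q.2.1, ratr q.2.2[%classic : set RT).
pose F q := if pselect (rect q `<=` (U : set (RT * RT))) then rect q else set0.
have FE q : rect q `<=` (U : set (RT * RT)) -> F q = rect q.
  by move=> H; rewrite /F; case: (pselect _).
rewrite (_ : U = \bigcup_q F q); last first.
  apply/seteqP; split => [[x y] Uxy|x [q _]]; last by rewrite /F; case: pselect => // H /H.
  have [[A B]/= [/nbhs_ballP[e1 /= e10 HA] /nbhs_ballP[e2 /= e20 HB]] AB] : nbhs (x, y) U.
    exact: open_nbhs_nbhs.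
  have x1 : x - e1 < x by rewrite ltrBlDr ltrDl.
  have x2 : x < x + e1 by rewrite ltrDl.
  have y1 : y - e2 < y by rewrite ltrBlDr ltrDl.
  have y2 : y < y + e2 by rewrite ltrDl.
  have [q1 /andP[q1a q1b]] := rat_in_itvoo x1; have [q2 /andP[q2a q2b]] := rat_in_itvoo x2.
  have [q3 /andP[q3a q3b]] := rat_in_itvoo y1; have [q4 /andP[q4a q4b]] := rat_in_itvoo y2.
  exists ((q1, q2), (q3, q4)) => //; rewrite FE.
    by rewrite /rect; split => /=; rewrite in_itv/=; apply/andP.
  move=> [s t] [/=]; rewrite !in_itv/= => /andP[s1 s2] /andP[t1 t2].
  apply: AB; split => /=.
    apply: HA; rewrite /ball/= ltr_norml; apply/andP; split.
      by rewrite ltrNl opprB ltrBlDl (lt_trans s2).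
    by rewrite ltrBlDr -ltrBlDl (lt_trans _ s1)//.
  apply: HB; rewrite /ball/= ltr_norml; apply/andP; split.
    by rewrite ltrNl opprB ltrBlDl (lt_trans t2).
  by rewrite ltrBlDr -ltrBlDl (lt_trans _ t1)//.
apply: countable_bigcupT_measurable => [|q]; first exact: countableP.
have [H|H] := pselect (rect q `<=` (U : set (RT * RT))); last first.
  rewrite (_ : F q = set0); first exact: measurable0.
  by rewrite /F; case: (pselect _).
rewrite FE//; by apply: measurableX; exact: measurable_itv.
Qed.

Lemma continuous2_measurable (f : R * R -> R) : continuous f -> measurable_fun [set: RT * RT] (f : RT * RT -> R).
Proof.
move=> /continuousP cf; apply: (measurability _ (RGenOpens.measurableE R)).
move=> _ [_ [a [b ->] <-]]; rewrite setTI; apply: open2_measurable.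
exact/cf/interval_open.
Qed.

Lemma measurable_tonelli1 (f : RT * RT -> \bar R) : measurable_fun [set: RT * RT] f ->
  (forall z, 0 <= f z)%E -> measurable_fun [set: RT] (fun x => \int[lI]_y f (x, y))%E.
Proof.
move=> mf f0; have [fI [fE _]] := @leb_Omega_prod R.
by rewrite -fE; exact: (measurable_fun_fubini_tonelli_F f mf f0).
Qed.

Lemma smooth2_continuous phi : smooth2 phi -> continuous phi.
Proof. by move=> /(_ [::])[]. Qed.

Lemma smooth2_partial_continuous i phi : smooth2 phi -> continuous (partial i phi).
Proof. by move=> /(_ [:: i])[]. Qed.

Lemma smooth2_Linfty phi : smooth2 phi ->
  phi \in Lfun lO +oo%E /\ forall i, partial i phi \in Lfun lO +oo%E.
Proof.
move=> sphi; have c0 := smooth2_continuous sphi.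
have c1 i := @smooth2_partial_continuous i _ sphi.
split => [|i]; apply: continuous2_Linfty => //; exact: continuous2_measurable.
Qed.

Lemma Linfty_LfunO (r : \bar R) (h : R * R -> R) : (1 <= r)%E -> h \in Lfun lO +oo%E -> h \in Lfun lO r.
Proof.
move=> r1 Lh; apply: (bounded_Lfun lOfin r1 (Lfun_meas Lh)); exact: Linfty_ae_bound.
Qed.

Lemma LfunO1_mul (f h : R * R -> R) : f \in Lfun lO 1%E -> h \in Lfun lO +oo%E ->
  (fun x => f x * h x) \in Lfun lO 1%E.
Proof. by move=> Lf Lh; exact: (hoelderR c1y Lf Lh).1. Qed.

Lemma smooth2_lin (a : R) phi psi : smooth2 phi -> smooth2 psi ->
  smooth2 (fun x => a * phi x + psi x) /\
  forall i, partial i (fun x => a * phi x + psi x) =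
    (fun x => a * partial i phi x + partial i psi x).
Proof.
move=> sphi spsi.
have P i f g : (forall x, derivable f x (dir i)) -> (forall x, derivable g x (dir i)) ->
    partial i (fun x : R * R => a * f x + g x) = (fun x => a * partial i f x + partial i g x).
  move=> df dg; apply/funext => x; rewrite /partial -[LHS]/('D_(dir i) (a *: f + g) x).
  by rewrite deriveD//; [rewrite deriveZ|exact: derivableZ].
have F s : foldr partial (fun x => a * phi x + psi x) s =
    (fun x => a * foldr partial phi s x + foldr partial psi s x).
  elim: s => //= i s ->; apply: P => x.
    by have [_ d] := sphi s; exact: d.
  by have [_ d] := spsi s; exact: d.
split => [s|i]; last exact: (F [:: i]).
rewrite F; have [c1 d1] := sphi s; have [c2 d2] := spsi s; split.
  by move=> x; apply: cvgD; [apply: cvgM; [exact: cvg_cst|exact: c1]|exact: c2].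
move=> x i; rewrite -[X in derivable X]/(a *: foldr partial phi s + foldr partial psi s).
by apply: derivableD => //; exact: derivableZ.
Qed.

Lemma continuous_vert (f : R * R -> R) (a : R) : continuous f -> continuous (fun t => f (a, t)).
Proof.
move=> cf t; apply: continuous_comp; last exact: cf.
exact: (cvg_pair (cvg_cst a) cvg_id).
Qed.

Lemma continuous_horiz (f : R * R -> R) (b : R) : continuous f -> continuous (fun t => f (t, b)).
Proof.
move=> cf t; apply: continuous_comp; last exact: cf.
exact: (cvg_pair cvg_id (cvg_cst b)).
Qed.

Lemma smooth2_FTC phi (a b : R) : smooth2 phi -> 0 <= b <= 1 ->
  \int[lI]_t (partial 1 phi (a, t) * \1_(`]0, b[%classic) t) = phi (a, b) - phi (a, 0).
Proof.
move=> sphi /andP[b0 b1]; pose f t := phi (a, t).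
have E (t : R) : (fun h => h^-1 *: ((f \o shift t) (h *: 1) - f t)) =
    (fun h => h^-1 *: ((phi \o shift (a, t)) (h *: dir 1) - phi (a, t))).
  apply/funext => h; rewrite /f /dir /= /GRing.scale/=; congr (_ * (phi (_, _) - _)).
  by rewrite /scale_pair/= /GRing.scale/= mulr0 add0r.
have df t : derivable f t 1 by rewrite /derivable E; have [_] := sphi [::]; exact.
have dE : derive1 f = (fun t => partial 1 phi (a, t)).
  by apply/funext => t; rewrite derive1E /derive E.
have cf : continuous (derive1 f).
  by rewrite dE; apply: continuous_vert; exact: smooth2_partial_continuous.
by have := FTC_lI df cf (lexx 0) b0 b1; rewrite dE.
Qed.

Lemma LI_cst_fin (r : \bar R) (C : R) : (1 <= r)%E -> (cst C : RT -> R) \in Lfun lI r.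
Proof. by move=> r1; apply: (@bounded_Lfun_all _ _ _ _ lIfin _ _ `|C|). Qed.

Lemma nrm1_le_nrm (r : R) (g : R -> R) : 1 < r -> g \in Lfun lI r%:E -> nrm lI 1%E g <= nrm lI r%:E g.
Proof.
move=> r1 Lg.
have [rr r'1] : conjp r%:E (1 - r^-1)^-1%:E /\ 1 < (1 - r^-1)^-1.
  by apply: conjp_fin => //; rewrite invrK addrC subrK.
have r'e : (1 <= (1 - r^-1)^-1%:E)%E by rewrite lee_fin ltW.
have [_] := hoelderR rr Lg (LI_cst_fin 1 r'e).
rewrite nrm_cst// normr1 mulr1.
by congr (nrm _ _ _ <= _); apply/funext => x; rewrite /= mulr1.
Qed.

(** The difference phi(x_1, x_2) - phi(x_1, 0) is the integral of the second partial derivative over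
    a segment of length at most 1, hence bounded by its r-norm on the vertical line. Integration
    over the unit square keeps the constant 1. *)
Lemma poincare_smooth (r : R) phi : 1 < r -> smooth2 phi ->
  nrm lO r%:E phi <= nrm lI r%:E (fun t => phi (t, 0)) + nrm lO r%:E (partial 1 phi).
Proof.
move=> r1 sphi; have r0 := lt_trans ltr01 r1.
have re1 : (1 <= r%:E)%E by rewrite lee_fin ltW.
have cphi := smooth2_continuous sphi; have c1 := @smooth2_partial_continuous 1 _ sphi.
have [Lphi Lp] := smooth2_Linfty sphi.
have m1 : measurable_fun [set: RT * RT] (partial 1 phi) by exact: continuous2_measurable.
have Lb : (fun t => phi (t, 0)) \in Lfun lI r%:E.
  by apply: Linfty_Lfun => //; apply: continuous_Linfty; exact: continuous_horiz.
have [Lb1 nb1] := Lfun_fst r0 Lb.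
have Lphir := Linfty_LfunO re1 Lphi; have Lpr := Linfty_LfunO re1 (Lp 1).
pose D : R * R -> R := phi \- (fun z => phi (z.1, 0)).
have LD : D \in Lfun lO r%:E by exact: LfunB.
have {1}-> : phi = (fun z => phi (z.1, 0)) \+ D by apply/funext => z; rewrite /D/= addrC subrK.
apply: le_trans (nrmD re1 Lb1 LD) _; rewrite nb1 lerD2l.
have mD := Lfun_meas LD.
have mDr := measurable_pow r mD; have mpr := measurable_pow r m1.
have pw0 (f : R * R -> R) z : (0 <= (`|f z| `^ r)%:E)%E by rewrite lee_fin powR_ge0.
apply: (nrm_le_powR r0 mD (nrm_ge0 _ _ _) _).2.
have E1 := tonelli1 mDr (pw0 D).
have E2 := tonelli1 mpr (pw0 (partial 1 phi)).
rewrite -(nrm_powR_e r0 Lpr) E1 E2.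
have mD1 := measurable_tonelli1 mDr (pw0 D).
have mp1 := measurable_tonelli1 mpr (pw0 (partial 1 phi)).
apply: ge0_le_integral => [||||x _].
- exact: measurableT.
- by move=> x _; exact: integral_ge0.
- exact: mD1.
- exact: mp1.
 (* The inner bound is independent of y; on the unit interval it equals its own integral. *)
 rewrite -[leRHS]lI_cst.
have Lx : (fun t => partial 1 phi (x, t)) \in Lfun lI +oo%E.
  by apply: continuous_Linfty; exact: continuous_vert.
have Lxr := Linfty_Lfun re1 Lx.
have mDx : measurable_fun [set: RT] (fun y : RT => (`|D (x, y)| `^ r)%:E).
  exact: (measurableT_comp mDr (pair1_measurable x)).
apply: ae_ge0_le_integral.
- exact: measurableT.
- by move=> y _; exact: pw0.
- exact: mDx.
- by move=> y _; exact: integral_ge0.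
- exact: measurable_cst.
apply: (ae_mono ae_unit_itv) => y; rewrite /unit_itv/= in_itv/= => /andP[y0 y1] _.
rewrite (nrm_powR_e r0 Lxr) lee_fin ge0_ler_powR ?nnegrE ?nrm_ge0 ?(ltW r0)//.
apply: le_trans (nrm1_le_nrm r1 Lxr).
rewrite /D/= -(smooth2_FTC x sphi) ?(ltW y0) ?(ltW y1)//.
have Li : (fun t : RT => partial 1 phi (x, t) * \1_(`]0, y[%classic) t) \in Lfun lI 1%E.
  apply: Lfun1_mul; first exact: Linfty_Lfun.
  by apply: Lfun_indic => //; rewrite ?leey.
apply: le_trans (le_norm_Rintegral Li) _.
apply: nrm_ae_le => //; first exact: Lfun_meas Li.
  exact: Linfty_Lfun.
apply: nearW => t; rewrite normrM ler_piMr// ger0_norm indicE ?ler0n//.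
by case: (_ \in _).
Qed.

End Square.

(** * Weak gradients, zero traces and completeness on the square *)

Section WeakGradient.
Context {R : realType}.
Notation lI := (@leb_I R).
Notation lO := (@leb_Omega R).
Notation RT := (measurableTypeR R).
Implicit Types (f g phi : R * R -> R) (G : R * R -> 'cV[R]_2).

Let c1y : conjp (1 : \bar R)%E +oo%E.
Proof. by split; rewrite ?leey//; right; left. Qed.

Let lOfin := @leb_Omega_fin R.

Definition gr f (i : 'I_2) : R * R -> R := fun x => wgrad f x i 0.

Lemma Rint_cstO : \int[lO]_x (cst 0 x : R) = 0.
Proof. by rewrite /Rintegral integral0. Qed.

Lemma cV2P (a b : 'cV[R]_2) : a 0 0 = b 0 0 -> a 1 0 = b 1 0 -> a = b.
Proof.
move=> h0 h1; apply/matrixP => i j; rewrite (ord1 j).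
by case: i => [[|[|//]] Hi]; [rewrite (_ : Ordinal Hi = 0)|rewrite (_ : Ordinal Hi = 1)] => //; exact: val_inj.
Qed.

Lemma forall_ord2 (P : 'I_2 -> Prop) : P 0 -> P 1 -> forall i, P i.
Proof.
move=> P0 P1 [[|[|//]] Hi]; first by rewrite (_ : Ordinal Hi = 0)//; exact: val_inj.
by rewrite (_ : Ordinal Hi = 1)//; exact: val_inj.
Qed.

Lemma testfun2_Linfty phi : testfun2 phi ->
  phi \in Lfun lO +oo%E /\ forall i, partial i phi \in Lfun lO +oo%E.
Proof. by case=> sphi _; exact: smooth2_Linfty. Qed.

Lemma is_wgrad_unique f G1 G2 : is_wgrad f G1 -> is_wgrad f G2 ->
  {ae lO, forall x, G1 x = G2 x}.
Proof.
case=> Lf H1 [_ H2].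
have H i : {ae lO, forall x, G1 x i 0 = G2 x i 0}.
  have [L1 E1] := H1 i; have [L2 E2] := H2 i.
  have L : ((fun x => G1 x i 0) \- (fun x => G2 x i 0)) \in Lfun lO 1%E by exact: LfunB.
  suff /ae_eqP V : ((fun x => G1 x i 0) \- (fun x => G2 x i 0)) = cst 0 %[ae lO].
    by apply: (ae_mono V) => x /= /eqP; rewrite subr_eq0 => /eqP.
  apply: (testfun2_vanish L) => phi tphi; have [Lphi _] := testfun2_Linfty tphi.
  transitivity (\int[lO]_x (G1 x i 0 * phi x - G2 x i 0 * phi x)).
    by apply: eq_Rintegral => x _; rewrite /= mulrBl.
  have M1 := LfunO1_mul L1 Lphi; have M2 := LfunO1_mul L2 Lphi.
  rewrite RintB//.
  by apply/eqP; rewrite subr_eq0 -eqr_opp -E1// -E2.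
by apply: (ae_mono2 (H 0) (H 1)) => x; exact: cV2P.
Qed.

Lemma is_wgrad_lin (a : R) f1 G1 f2 G2 : is_wgrad f1 G1 -> is_wgrad f2 G2 ->
  is_wgrad (fun x => a * f1 x + f2 x) (fun x => a *: G1 x + G2 x).
Proof.
case=> Lf1 H1 [Lf2 H2]; split; first by apply: LfunD => //; exact: LfunZ.
move=> i; have [L1 E1] := H1 i; have [L2 E2] := H2 i.
have LE : (fun x => (a *: G1 x + G2 x) i 0) = (fun x => a * G1 x i 0) \+ (fun x => G2 x i 0).
  by apply/funext => x; rewrite !mxE.
split; first by rewrite LE; apply: LfunD => //; exact: LfunZ.
move=> phi tphi; have [Lphi Ldphi] := testfun2_Linfty tphi.
have M1 := LfunO1_mul Lf1 (Ldphi i); have M2 := LfunO1_mul Lf2 (Ldphi i).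
have M3 := LfunO1_mul L1 Lphi; have M4 := LfunO1_mul L2 Lphi.
have M1' := LfunZ a (lexx 1%E) M1; have M3' := LfunZ a (lexx 1%E) M3.
transitivity (\int[lO]_x (a * (f1 x * partial i phi x) + f2 x * partial i phi x)).
  by apply: eq_Rintegral => x _; rewrite mulrDl mulrA.
rewrite RintD ?RintZ ?E1 ?E2//.
transitivity (- \int[lO]_x (a * (G1 x i 0 * phi x) + G2 x i 0 * phi x)).
  by rewrite RintD ?RintZ// mulrN -opprD.
by congr (- _); apply: eq_Rintegral => x _; rewrite !mxE mulrDl mulrA.
Qed.

Lemma is_wgrad_ae f f' G G' : measurable_fun [set: RT * RT] (f' : RT * RT -> R) ->
  (forall i, measurable_fun [set: RT * RT] ((fun x => G' x i 0) : RT * RT -> R)) ->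
  f = f' %[ae lO] -> {ae lO, forall x, G x = G' x} -> is_wgrad f G -> is_wgrad f' G'.
Proof.
move=> mf' mG' /ae_eqP ff GG [Lf H]; split.
  by apply: (Lfun_ae_eq lte01 mf' Lf); apply/ae_eqP; apply: (ae_mono ff) => x ->.
move=> i; have [L E] := H i; split.
  by apply: (Lfun_ae_eq lte01 (mG' i) L); apply/ae_eqP; apply: (ae_mono GG) => x ->.
move=> phi tphi; have [Lphi Ldphi] := testfun2_Linfty tphi.
have mphi := Lfun_meas Lphi; have mdphi := Lfun_meas (Ldphi i).
have mf := Lfun_meas Lf; have mG := Lfun_meas L.
transitivity (\int[lO]_x (f x * partial i phi x)).
  apply: Rint_ae_eq; first exact: measurable_funM.
    exact: measurable_funM.
  by apply/ae_eqP; apply: (ae_mono ff) => x ->.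
rewrite E//; congr (- _); apply: Rint_ae_eq.
- exact: measurable_funM.
- by apply: measurable_funM => //; exact: mG'.
- by apply/ae_eqP; apply: (ae_mono GG) => x ->.
Qed.

Lemma wgradP f G : is_wgrad f G -> is_wgrad f (wgrad f).
Proof. by move=> fG; apply: xgetPex; exists G. Qed.

Lemma wgradE f G : is_wgrad f G -> {ae lO, forall x, wgrad f x = G x}.
Proof. by move=> fG; exact: is_wgrad_unique (wgradP fG) fG. Qed.

Lemma W1_Omega_gr (r : R) f : 1 <= r -> W1_Omega r f ->
  [/\ f \in Lfun lO r%:E, is_wgrad f (wgrad f) & forall i, gr f i \in Lfun lO r%:E].
Proof.
move=> r1 [Lf [G fG LG]]; have w := wgradP fG; split => // i.
have mw : measurable_fun [set: RT * RT] (gr f i : RT * RT -> R).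
  by case: w => _ /(_ i)[/Lfun_meas].
have r0 : (0 < r%:E)%E by rewrite lte_fin (lt_le_trans ltr01).
apply: (Lfun_ae_eq r0 mw (LG i)); apply/ae_eqP.
by apply: (ae_mono (wgradE fG)) => x; rewrite /gr => ->.
Qed.

Lemma gr_lin (a : R) f1 G1 f2 G2 i : is_wgrad f1 G1 -> is_wgrad f2 G2 ->
  gr (fun x => a * f1 x + f2 x) i = (fun x => a * gr f1 i x + gr f2 i x) %[ae lO].
Proof.
move=> /wgradP w1 /wgradP w2; apply/ae_eqP; apply: (ae_mono (wgradE (is_wgrad_lin a w1 w2))) => x.
by rewrite /gr => ->; rewrite !mxE.
Qed.

Lemma gr_ae f f' G i : measurable_fun [set: RT * RT] (f' : RT * RT -> R) ->
  f = f' %[ae lO] -> is_wgrad f G -> gr f' i = gr f i %[ae lO].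
Proof.
move=> mf' ff /wgradP w.
have mw j : measurable_fun [set: RT * RT] ((fun x => wgrad f x j 0) : RT * RT -> R).
  by case: w => _ /(_ j)[/Lfun_meas].
have refl : {ae lO, forall x, wgrad f x = wgrad f x} by exact: nearW.
have w' := is_wgrad_ae mf' mw ff refl w.
by apply/ae_eqP; apply: (ae_mono (wgradE w')) => x; rewrite /gr => ->.
Qed.

Lemma W1_Omega_lin (r a : R) f1 f2 : 1 <= r -> W1_Omega r f1 -> W1_Omega r f2 ->
  W1_Omega r (fun x => a * f1 x + f2 x).
Proof.
move=> r1; have r1e : (1 <= r%:E)%E by [].
move=> [Lf1 [G1 w1 LG1]] [Lf2 [G2 w2 LG2]]; split.
  by apply: LfunD => //; exact: LfunZ.
exists (fun x => a *: G1 x + G2 x); first exact: is_wgrad_lin.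
move=> i; rewrite (_ : (fun x => _) = (fun x => a * G1 x i 0) \+ (fun x => G2 x i 0)).
  by apply: LfunD => //; exact: LfunZ.
by apply/funext => x; rewrite !mxE.
Qed.

Definition bnd (r : R) phi : R :=
  nrm lI r%:E (fun t => phi (t, 0)) + nrm lI r%:E (fun t => phi (t, 1)) +
  (nrm lI r%:E (fun t => phi (0, t)) + nrm lI r%:E (fun t => phi (1, t))).

(** One tolerance replaces the three extended-real limits in [is_trace]. With it, stability of the
    zero trace under linear combinations and limits is an ordinary epsilon argument. *)
Definition approx (r : R) f (e : R) phi : Prop :=
  [/\ smooth2 phi, nrm lO r%:E (phi \- f) <= e,
      forall i, nrm lO r%:E (partial i phi \- gr f i) <= e & bnd r phi <= e].

Lemma bnd_ge0 r phi : 0 <= bnd r phi.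
Proof. by rewrite !addr_ge0// nrm_ge0. Qed.

Lemma smooth2_sides (r : R) phi : 1 <= r -> smooth2 phi -> forall c : R,
  (fun t => phi (t, c)) \in Lfun lI r%:E /\ (fun t => phi (c, t)) \in Lfun lI r%:E.
Proof.
move=> r1 sphi c; have r1e : (1 <= r%:E)%E by [].
have cphi := smooth2_continuous sphi.
split; apply: Linfty_Lfun => //; apply: continuous_Linfty.
- exact: continuous_horiz.
- exact: continuous_vert.
Qed.

Lemma bndE (r : R) phi : 1 <= r -> smooth2 phi ->
  (\sum_(s <- sides) 'N[lI]_r%:E[EFin \o (phi \- cst 0)%R \o s])%E = (bnd r phi)%:E.
Proof.
move=> r1 sphi; have L c := smooth2_sides r1 sphi c.
have -> : (phi \- cst 0)%R = phi by apply/funext => x /=; rewrite subr0.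
rewrite /sides !big_cons big_nil adde0.
rewrite /bnd !EFinD -(nrmE (L 0).1) -(nrmE (L 1).1) -(nrmE (L 0).2) -(nrmE (L 1).2).
by rewrite !addeA.
Qed.

Lemma nrm_cvg0_small (u : nat -> R) (e : R) : 0 < e -> u n @[n --> \oo] --> 0 ->
  \forall n \near \oo, u n <= e.
Proof.
move=> e0 /cvgrPdist_le /(_ _ e0); apply: filterS => n.
by rewrite sub0r normrN => /(le_trans (ler_norm _)).
Qed.

Lemma harmonic_cvg0 (u : nat -> R) : (forall n, 0 <= u n <= n.+1%:R^-1) -> u n @[n --> \oo] --> 0.
Proof.
move=> H; apply: (@squeeze_cvgr _ _ _ R (cst 0) (fun n => n.+1%:R^-1)).
- exact: nearW.
- exact: cvg_cst.
- exact: cvg_harmonic.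
Qed.

Lemma trace_approx (r : R) f : 1 <= r -> W1_Omega r f ->
  is_trace r f (cst 0) <-> forall e, 0 < e -> exists phi, approx r f e phi.
Proof.
move=> r1 Wf; have [Lf w Lgr] := W1_Omega_gr r1 Wf; have r1e : (1 <= r%:E)%E by [].
have L phi : smooth2 phi -> phi \- f \in Lfun lO r%:E /\
    forall i, (partial i phi \- gr f i) \in Lfun lO r%:E.
  move=> /smooth2_Linfty[L1 L2]; split => [|i]; apply: LfunB => //; exact: Linfty_LfunO.
split=> [[phi [sphi c0 c1 cb]] e e0|H].
  have a0 : \forall n \near \oo, nrm lO r%:E (phi n \- f) <= e.
    by have /fine_cvgP[_ c0'] := c0; apply: nrm_cvg0_small.
  have ai i : \forall n \near \oo, nrm lO r%:E (partial i (phi n) \- gr f i) <= e.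
    by have /fine_cvgP[_ c0'] := c1 i; apply: nrm_cvg0_small.
  have ab : \forall n \near \oo, bnd r (phi n) <= e.
    have /fine_cvgP[_ +] := cb => cb'; apply: nrm_cvg0_small => //; move: cb'.
    rewrite (_ : fine \o _ = (fun n => bnd r (phi n)))//.
    by apply/funext => n; rewrite /= bndE.
  have [a1 a2] := (ai 0, ai 1).
  near \oo => n; exists (phi n); split => //.
  - by near: n.
  - by apply: forall_ord2; near: n.
  - by near: n.
have /choice[phi Hphi] : forall n : nat, exists phi, approx r f n.+1%:R^-1 phi.
  by move=> n; apply: H; rewrite invr_gt0.
exists phi; split => [n||i|].
- by have [] := Hphi n.
- rewrite (_ : (fun n => _) = EFin \o (fun n => nrm lO r%:E (phi n \- f))); last first.
    by apply/funext => n; rewrite /= nrmE//; apply: (L _ _).1; have [] := Hphi n.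
  apply/fine_cvgP; split; first exact: nearW.
  by apply: harmonic_cvg0 => n /=; rewrite nrm_ge0/=; have [] := Hphi n.
- rewrite (_ : (fun n => _) = EFin \o (fun n => nrm lO r%:E (partial i (phi n) \- gr f i))); last first.
    by apply/funext => n; rewrite /= nrmE//; apply: (L _ _).2; have [] := Hphi n.
  apply/fine_cvgP; split; first exact: nearW.
  by apply: harmonic_cvg0 => n /=; rewrite nrm_ge0/=; have [_ _ ->] := Hphi n.
- rewrite (_ : (fun n => _) = EFin \o (fun n => bnd r (phi n))); last first.
    by apply/funext => n; rewrite bndE//; have [] := Hphi n.
  apply/fine_cvgP; split; first exact: nearW.
  by apply: harmonic_cvg0 => n /=; rewrite bnd_ge0/=; have [] := Hphi n.
Unshelve. all: by end_near.
Qed.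

Lemma W10_OmegaP (r : R) f : 1 <= r -> W10_Omega r f <->
  W1_Omega r f /\ forall e, 0 < e -> exists phi, approx r f e phi.
Proof. by move=> r1; split => -[W H]; split => //; apply/(trace_approx r1 W). Qed.

Lemma nrm_lin_le (d : measure_display) (T : measurableType d) (mu : measure T R) (r : \bar R) (a : R)
    (f g : T -> R) : (1 <= r)%E -> f \in Lfun mu r -> g \in Lfun mu r ->
  nrm mu r (fun x => a * f x + g x) <= `|a| * nrm mu r f + nrm mu r g.
Proof.
move=> r1 Lf Lg; have Laf := LfunZ a r1 Lf.
by apply: le_trans (nrmD r1 Laf Lg) _; rewrite nrmZ.
Qed.

Lemma W10_Omega_lin (r a : R) f1 f2 : 1 <= r -> W10_Omega r f1 -> W10_Omega r f2 ->
  W10_Omega r (fun x => a * f1 x + f2 x).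
Proof.
move=> r1 /(W10_OmegaP _ r1)[W1 A1] /(W10_OmegaP _ r1)[W2 A2].
have r1e : (1 <= r%:E)%E by [].
have W := W1_Omega_lin a r1 W1 W2.
have [Lf1 w1 Lgr1] := W1_Omega_gr r1 W1; have [Lf2 w2 Lgr2] := W1_Omega_gr r1 W2.
have [Lf w Lgr] := W1_Omega_gr r1 W.
apply/(W10_OmegaP _ r1); split; [exact: W|move=> e e0].
(* The factor a is absorbed into the tolerance of the first approximant; the added 1 covers a =
   0. *)
have e1 : 0 < e / 2 / (`|a| + 1) by rewrite !divr_gt0// ltr_wpDl.
have e2 : 0 < e / 2 by rewrite divr_gt0.
have K x y : x <= e / 2 / (`|a| + 1) -> y <= e / 2 -> `|a| * x + y <= e.
  move=> Hx Hy; rewrite [leRHS]splitr lerD//.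
  apply: le_trans (ler_wpM2l (normr_ge0 a) Hx) _.
  apply: (le_trans (y := (`|a| + 1) * (e / 2 / (`|a| + 1)))).
    by apply: (ler_wpM2r (ltW e1)); rewrite lerDl.
  by rewrite mulrC divfK// gt_eqF// ltr_wpDl.
have [phi1 [s1 a1 b1 c1]] := A1 _ e1; have [phi2 [s2 a2 b2 c2]] := A2 _ e2.
have [s12 p12] := smooth2_lin a s1 s2.
have [L1 L1'] := smooth2_Linfty s1; have [L2 L2'] := smooth2_Linfty s2.
have [L12 L12'] := smooth2_Linfty s12.
exists (fun x => a * phi1 x + phi2 x); split; [exact: s12| | |].
- have D1 := LfunB r1e (Linfty_LfunO r1e L1) Lf1; have D2 := LfunB r1e (Linfty_LfunO r1e L2) Lf2.
  rewrite (_ : _ \- _ = (fun x => a * (phi1 \- f1) x + (phi2 \- f2) x)); last first.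
    by apply/funext => x /=; ring.
  exact: le_trans (nrm_lin_le a r1e D1 D2) (K _ _ a1 a2).
- move=> i; have D1 := LfunB r1e (Linfty_LfunO r1e (L1' i)) (Lgr1 i).
  have D2 := LfunB r1e (Linfty_LfunO r1e (L2' i)) (Lgr2 i).
  have D12 := LfunB r1e (Linfty_LfunO r1e (L12' i)) (Lgr i).
  apply: le_trans (K _ _ (b1 i) (b2 i)).
  have D3 := LfunD r1e (LfunZ a r1e D1) D2.
  apply: le_trans (nrm_lin_le a r1e D1 D2); rewrite le_eqVlt; apply/orP; left; apply/eqP.
  have /ae_eqP gg := gr_lin a i w1 w2.
  apply: (nrm_ae_eq (lt_le_trans lte01 r1e) (Lfun_meas D12) (Lfun_meas D3)).
  by apply/ae_eqP; apply: (ae_mono gg) => x; rewrite p12 /= => ->; ring.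
- apply: le_trans (K _ _ c1 c2).
  have S1 c := smooth2_sides r1 s1 c; have S2 c := smooth2_sides r1 s2 c.
  have B0 := nrm_lin_le a r1e (S1 0).1 (S2 0).1; have B1 := nrm_lin_le a r1e (S1 1).1 (S2 1).1.
  have B2 := nrm_lin_le a r1e (S1 0).2 (S2 0).2; have B3 := nrm_lin_le a r1e (S1 1).2 (S2 1).2.
  apply: le_trans (lerD (lerD B0 B1) (lerD B2 B3)) _.
  rewrite /bnd le_eqVlt; apply/orP; left; apply/eqP; ring.
Qed.

(** The smooth inequality passes to f: a third of the tolerance goes to the function, to its
    derivative and to the boundary term each. *)
Lemma poincare (r : R) f : 1 < r -> W10_Omega r f -> nrm lO r%:E f <= nrm lO r%:E (gr f 1).
Proof.
move=> r1; have r1' := ltW r1; have r1e : (1 <= r%:E)%E by [].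
move=> /(W10_OmegaP _ r1')[W A]; have [Lf w Lgr] := W1_Omega_gr r1' W.
apply/ler_addgt0Pr => e e0; have e3 : 0 < e / 3 by rewrite divr_gt0.
have [phi [sphi H0 H1 Hb]] := A _ e3; have [L1 L2] := smooth2_Linfty sphi.
have Lphi := Linfty_LfunO r1e L1; have Ld := Linfty_LfunO r1e (L2 1).
have P := poincare_smooth r1 sphi.
have B : nrm lI r%:E (fun t => phi (t, 0)) <= e / 3.
  by apply: le_trans Hb; rewrite /bnd -addrA lerDl !addr_ge0// nrm_ge0.
have T1 : nrm lO r%:E f <= nrm lO r%:E (phi \- f) + nrm lO r%:E phi.
  have LB := LfunB r1e Lphi Lf; rewrite addrC.
  have := nrmB r1e Lphi LB; congr (nrm _ _ _ <= _ + _).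
  by apply/funext => x /=; ring.
have T2 : nrm lO r%:E (partial 1 phi) <= nrm lO r%:E (partial 1 phi \- gr f 1) + nrm lO r%:E (gr f 1).
  have LB := LfunB r1e Ld (Lgr 1).
  have := nrmD r1e LB (Lgr 1); congr (nrm _ _ _ <= _).
  by apply/funext => x /=; ring.
have := H1 1; lra.
Qed.

(** Convergence is assumed for gradients only; Poincare makes the functions themselves Cauchy.
    Hoelder passes the weak gradient identity to the limit, and smooth approximants of a late member
    of the sequence approximate the limit, which keeps the zero trace. *)
Lemma W10_Omega_complete (r : R) (y_ : nat -> R * R -> R) (G : 'I_2 -> R * R -> R) :
  1 < r -> (forall n, W10_Omega r (y_ n)) -> (forall i, G i \in Lfun lO r%:E) ->
  (forall i, nrm lO r%:E (gr (y_ n) i \- G i) @[n --> \oo] --> 0) ->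
  exists2 y, W10_Omega r y & forall i, gr y i = G i %[ae lO].
Proof.
move=> r1 Wy LG cG; have r1' := ltW r1; have r1e : (1 <= r%:E)%E by [].
have r0e : (0 < r%:E)%E by rewrite lte_fin (lt_trans ltr01).
have [rr r'1] : conjp r%:E (1 - r^-1)^-1%:E /\ 1 < (1 - r^-1)^-1.
  by apply: conjp_fin => //; rewrite invrK addrC subrK.
have r'e : (1 <= (1 - r^-1)^-1%:E)%E by rewrite lee_fin ltW.
have W n : W1_Omega r (y_ n) by case: (Wy n).
have Ly n : y_ n \in Lfun lO r%:E by have [] := W1_Omega_gr r1' (W n).
have wy n : is_wgrad (y_ n) (wgrad (y_ n)) by have [] := W1_Omega_gr r1' (W n).
have Lgr n i : gr (y_ n) i \in Lfun lO r%:E by have [] := W1_Omega_gr r1' (W n).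
have [y Ly0 cy] : exists2 y, y \in Lfun lO r%:E & nrm lO r%:E (y_ n \- y) @[n --> \oo] --> (0 : R).
  apply: (Lp_complete lOfin r1' Ly).
  move=> e e0; have e2 : 0 < e / 2 by rewrite divr_gt0.
  have [N _ HN] := nrm_cvg0_small e2 (cG 1).
  exists N => m n Nm Nn.
  have Wd := W10_Omega_lin (- 1) r1' (Wy n) (Wy m).
  have -> : y_ m \- y_ n = (fun x => - 1 * y_ n x + y_ m x).
    by apply/funext => x /=; ring.
  apply: le_trans (poincare r1 Wd) _.
  have [_ _ Lgd] := W1_Omega_gr r1' (W10_Omega_lin (- 1) r1' (Wy n) (Wy m)).1.
  have /ae_eqP gd := gr_lin (- 1) 1 (wy n) (wy m).
  have Lmn := LfunB r1e (Lgr m 1) (Lgr n 1).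
  have -> : nrm lO r%:E (gr (fun x => - 1 * y_ n x + y_ m x) 1) =
      nrm lO r%:E (gr (y_ m) 1 \- gr (y_ n) 1).
    apply: (nrm_ae_eq r0e (Lfun_meas (Lgd 1)) (Lfun_meas Lmn)).
    by apply/ae_eqP; apply: (ae_mono gd) => x /= ->; ring.
  apply: le_trans (nrm_dist_triangle r1e (Lgr m 1) (LG 1) (Lgr n 1)) _.
  rewrite (nrm_distC r1e (LG 1) (Lgr n 1)) [leRHS]splitr.
  by apply: lerD; apply: HN.
pose GG x : 'cV[R]_2 := \col_i G i x.
have GGE i : (fun x => GG x i 0) = G i by apply/funext => x; rewrite mxE.
have L1 (f : R * R -> R) : f \in Lfun lO r%:E -> f \in Lfun lO 1%E.
  exact: Lfun_sub1.
have wG : is_wgrad y GG.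
  split=> [|i]; first exact: L1.
  rewrite GGE; split; first exact: L1.
  move=> phi tphi; have [Lphi Ldphi] := testfun2_Linfty tphi.
  have c1 := nrm_cvg_int rr Ly Ly0 (Linfty_LfunO r'e (Ldphi i)) cy.
  have c2 := nrm_cvg_int rr (Lgr^~ i) (LG i) (Linfty_LfunO r'e Lphi) (cG i).
  transitivity (- \int[lO]_x (G i x * phi x)); last first.
    by congr (- _); apply: eq_Rintegral => x _; rewrite mxE.
  apply: (@cvg_unique _ _ _ _ _ _ c1) => //.
  have -> : (fun n => \int[lO]_x (y_ n x * partial i phi x)) =
      (fun n => - \int[lO]_x (gr (y_ n) i x * phi x)).
    by apply/funext => n; have [_ /(_ i)[_ /(_ _ tphi)]] := wy n.
  exact: cvgN.
have gE i : gr y i = G i %[ae lO].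
  by apply/ae_eqP; apply: (ae_mono (wgradE wG)) => x; rewrite /gr => ->; rewrite mxE.
have W1y : W1_Omega r y by split => //; exists GG => // i; rewrite GGE.
have [_ _ Lgry] := W1_Omega_gr r1' W1y.
exists y; last exact: gE.
apply/(W10_OmegaP _ r1'); split; [exact: W1y|move=> e e0].
have e2 : 0 < e / 2 by rewrite divr_gt0.
have N0 := nrm_cvg0_small e2 cy.
have N1 := nrm_cvg0_small e2 (cG 0); have N2 := nrm_cvg0_small e2 (cG 1).
near \oo => n.
have [phi [sphi H0 H1 Hb]] := ((W10_OmegaP (y_ n) r1').1 (Wy n)).2 _ e2.
have [Lp Lpd] := smooth2_Linfty sphi.
exists phi; split; [exact: sphi| | |].
- apply: le_trans (nrm_dist_triangle r1e (Linfty_LfunO r1e Lp) (Ly n) Ly0) _.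
  by rewrite [leRHS]splitr lerD//; near: n.
- move=> i; apply: le_trans (nrm_dist_triangle r1e (Linfty_LfunO r1e (Lpd i)) (Lgr n i) (Lgry i)) _.
  rewrite [leRHS]splitr lerD//.
  have -> : nrm lO r%:E (gr (y_ n) i \- gr y i) = nrm lO r%:E (gr (y_ n) i \- G i).
    have D1 := LfunB r1e (Lgr n i) (Lgry i); have D2 := LfunB r1e (Lgr n i) (LG i).
    apply: (nrm_ae_eq r0e (Lfun_meas D1) (Lfun_meas D2)).
    by move/ae_eqP: (gE i) => gE'; apply/ae_eqP; apply: (ae_mono gE') => x /= ->.
  by move: i; apply: forall_ord2; near: n.
- by apply: le_trans Hb _; rewrite ler_pdivrMr// ler_pMr// ler1n.
Unshelve. all: by end_near.
Qed.

End WeakGradient.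

(** * Density by duality *)

Section Separation.
Context d (T : measurableType d) {R : realType} (mu : {measure set T -> \bar R}).
Hypothesis muT_fin : (mu setT < +oo)%E.
Variables (r r' : R).
Hypotheses (r1 : 1 < r) (rr' : r^-1 + r'^-1 = 1).

Notation V := ((T -> R) * (T -> R))%type.
Implicit Types (x y z : V).

Let r1e : (1 <= r%:E)%E. Proof. by rewrite lee_fin ltW. Qed.

(** Vector fields are pairs of components, so that the ambient product of function spaces has the
    module structure required by the separation theorem. *)
Definition Lfun2 x := x.1 \in Lfun mu r%:E /\ x.2 \in Lfun mu r%:E.
Definition nrm2 x := nrm mu r%:E x.1 + nrm mu r%:E x.2.

Lemma nrm2_ge0 x : 0 <= nrm2 x. Proof. by rewrite addr_ge0 ?nrm_ge0. Qed.

Lemma Lfun2_0 : Lfun2 0.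
Proof. by split; apply: LfunC0; rewrite lte_fin (lt_trans ltr01). Qed.

Lemma nrm2_0 : nrm2 0 = 0.
Proof.
have r0 : (0 < r%:E)%E by rewrite lte_fin (lt_trans ltr01).
transitivity (nrm mu r%:E (cst 0 : T -> R) + nrm mu r%:E (cst 0 : T -> R)); first by [].
by rewrite nrm0// addr0.
Qed.

Lemma pair_funext x y : (forall t, x.1 t = y.1 t) -> (forall t, x.2 t = y.2 t) -> x = y.
Proof. by case: x y => [? ?] [? ?] /= H1 H2; congr (_, _); apply/funext. Qed.

Lemma Lfun2D x y : Lfun2 x -> Lfun2 y -> Lfun2 (x + y).
Proof. by case=> x1 x2 [y1 y2]; split; [exact: LfunD r1e x1 y1|exact: LfunD r1e x2 y2]. Qed.

Lemma Lfun2Z (a : R) x : Lfun2 x -> Lfun2 (a *: x).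
Proof. by case=> x1 x2; split; [exact: LfunZ a r1e x1|exact: LfunZ a r1e x2]. Qed.

Lemma Lfun2B x y : Lfun2 x -> Lfun2 y -> Lfun2 (x - y).
Proof. by case=> x1 x2 [y1 y2]; split; [exact: LfunB r1e x1 y1|exact: LfunB r1e x2 y2]. Qed.

Lemma nrm2D x y : Lfun2 x -> Lfun2 y -> nrm2 (x + y) <= nrm2 x + nrm2 y.
Proof.
case=> x1 x2 [y1 y2]; have := nrmD r1e x1 y1; have := nrmD r1e x2 y2.
by rewrite /nrm2 => H2 H1; rewrite addrACA lerD.
Qed.

Lemma nrm2Z (a : R) x : Lfun2 x -> nrm2 (a *: x) = `|a| * nrm2 x.
Proof.
case=> x1 x2; have := nrmZ a r1e x1; have := nrmZ a r1e x2.
by rewrite /nrm2 => H2 H1; rewrite mulrDr -H1 -H2.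
Qed.

Variable D : V -> Prop.
Hypotheses (D0 : D 0) (Dlin : forall (a : R) x y, D x -> D y -> D (a *: x + y)).
Hypothesis DL : forall x, D x -> Lfun2 x.

Definition dist2 x := inf [set nrm2 (x - y) | y in [set y | D y]].

Let hasinf x : has_inf [set nrm2 (x - y) | y in [set y | D y]].
Proof.
split; first by exists (nrm2 (x - 0)); exists 0.
by exists 0 => _ [y _ <-]; exact: nrm2_ge0.
Qed.

Lemma dist2_le x y : D y -> dist2 x <= nrm2 (x - y).
Proof. by move=> Dy; apply: ge_inf; [case: (hasinf x)|exists y]. Qed.

Lemma dist2_ge0 x : 0 <= dist2 x.
Proof. by apply: lb_le_inf; [case: (hasinf x)|move=> _ [y _ <-]; exact: nrm2_ge0]. Qed.

Lemma dist2_approx x (e : R) : 0 < e -> exists2 y, D y & nrm2 (x - y) < dist2 x + e.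
Proof. by move=> e0; have [_ [y Dy <-] H] := inf_adherent e0 (hasinf x); exists y. Qed.

Lemma dist2_le_nrm2 x : dist2 x <= nrm2 x.
Proof. by have := dist2_le x D0; rewrite subr0. Qed.

Lemma dist2D x y : Lfun2 x -> Lfun2 y -> dist2 (x + y) <= dist2 x + dist2 y.
Proof.
move=> Lx Ly; apply/ler_addgt0Pr => e e0; have e2 : 0 < e / 2 by rewrite divr_gt0.
have [x' Dx' Hx] := dist2_approx x e2; have [y' Dy' Hy] := dist2_approx y e2.
have := dist2_le (x + y) (Dlin 1 Dx' Dy'); rewrite scale1r => /le_trans; apply.
rewrite (_ : x + y - _ = (x - x') + (y - y')); last by rewrite opprD addrACA.
have := nrm2D (Lfun2B Lx (DL Dx')) (Lfun2B Ly (DL Dy')); lra.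
Qed.

Lemma dist2Z_le (a : R) x : Lfun2 x -> dist2 (a *: x) <= `|a| * dist2 x.
Proof.
move=> Lx; apply/ler_addgt0Pr => e e0.
have e1 : 0 < e / (`|a| + 1) by rewrite divr_gt0// ltr_wpDl.
have [y Dy H] := dist2_approx x e1.
have Day : D (a *: y) by have := Dlin a Dy D0; rewrite addr0.
apply: le_trans (dist2_le (a *: x) Day) _.
rewrite -scalerBr (nrm2Z a (Lfun2B Lx (DL Dy))).
apply: le_trans (ler_wpM2l (normr_ge0 a) (ltW H)) _.
rewrite mulrDr lerD2l; apply: (le_trans (y := (`|a| + 1) * (e / (`|a| + 1)))).
  by apply: (ler_wpM2r (ltW e1)); rewrite lerDl.
by rewrite mulrC divfK// gt_eqF// ltr_wpDl.
Qed.

Lemma dist2Z (a : R) x : Lfun2 x -> dist2 (a *: x) = `|a| * dist2 x.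
Proof.
move=> Lx; apply/eqP; rewrite eq_le dist2Z_le//=.
have [->|a0] := eqVneq a 0; first by rewrite normr0 mul0r dist2_ge0.
rewrite -ler_pdivlMl ?normr_gt0//.
have := dist2Z_le a^-1 (Lfun2Z a Lx).
by rewrite scalerA mulVf// scale1r normrV ?unitfE.
Qed.

Lemma dist2_D x : D x -> dist2 x = 0.
Proof.
move=> Dx; apply/eqP; rewrite eq_le dist2_ge0 andbT.
by have := dist2_le x Dx; rewrite subrr nrm2_0.
Qed.

(** Separation with respect to the distance to D gives a functional bounded by [nrm2], so Riesz
    represents each of its components in L^r'. It annihilates D, hence also x by hypothesis; but its
    value at x is at least the distance, which is therefore 0. *)
Lemma annihilator_dense x : Lfun2 x ->
  (forall h : V, h.1 \in Lfun mu r'%:E -> h.2 \in Lfun mu r'%:E ->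
     (forall y, D y -> \int[mu]_t (y.1 t * h.1 t) + \int[mu]_t (y.2 t * h.2 t) = 0) ->
     \int[mu]_t (x.1 t * h.1 t) + \int[mu]_t (x.2 t * h.2 t) = 0) ->
  forall e : R, 0 < e -> exists2 y, D y & nrm2 (x - y) <= e.
Proof.
move=> Lx H e e0.
have [L [Llin Lbnd Lx']] := @seminorm_separation R _ Lfun2 Lfun2_0 Lfun2D Lfun2Z dist2 x Lx
  (fun x _ => dist2_ge0 x) dist2D dist2Z.
have LD y : D y -> L y = 0.
  by move=> Dy; have := Lbnd y (DL Dy); rewrite dist2_D// normr_le0 => /eqP.
have L0 : (cst 0 : T -> R) \in Lfun mu r%:E by apply: LfunC0; rewrite lte_fin (lt_trans ltr01).
have nrm00 : nrm mu r%:E (cst 0 : T -> R) = 0.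
  by apply: ae0_nrm; [rewrite lte_fin (lt_trans ltr01)|exact: measurable_cst|exact: nearW].
have [h1 Lh1 Eh1] : exists2 h, h \in Lfun mu r'%:E &
    forall f, f \in Lfun mu r%:E -> L (f, cst 0) = \int[mu]_t (f t * h t).
  apply: (@riesz_Lp _ _ _ mu muT_fin r r' (fun f => L (f, cst 0)) 1 r1 rr' ler01).
    move=> a f g Lf Lg; rewrite -Llin; [|by split|by split].
    congr L; apply: pair_funext => t; first by [].
    by rewrite -[RHS]/(a * 0 + 0) mulr0 addr0.
  move=> f Lf; rewrite mul1r; have Lf0 : Lfun2 (f, cst 0) by split.
  apply: le_trans (Lbnd _ Lf0) _; apply: le_trans (dist2_le_nrm2 _) _.
  by rewrite /nrm2/= nrm00 addr0.
have [h2 Lh2 Eh2] : exists2 h, h \in Lfun mu r'%:E &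
    forall f, f \in Lfun mu r%:E -> L (cst 0, f) = \int[mu]_t (f t * h t).
  apply: (@riesz_Lp _ _ _ mu muT_fin r r' (fun f => L (cst 0, f)) 1 r1 rr' ler01).
    move=> a f g Lf Lg; rewrite -Llin; [|by split|by split].
    congr L; apply: pair_funext => t; last by [].
    by rewrite -[RHS]/(a * 0 + 0) mulr0 addr0.
  move=> f Lf; rewrite mul1r; have Lf0 : Lfun2 (cst 0, f) by split.
  apply: le_trans (Lbnd _ Lf0) _; apply: le_trans (dist2_le_nrm2 _) _.
  by rewrite /nrm2/= nrm00 add0r.
have LE y : Lfun2 y -> L y = \int[mu]_t (y.1 t * h1 t) + \int[mu]_t (y.2 t * h2 t).
  case: y => y1 y2 [/= Ly1 Ly2]; rewrite -Eh1// -Eh2//.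
  rewrite -[L (y1, cst 0)]mul1r -Llin; [|by split|by split].
  congr L; apply: pair_funext => t.
    by rewrite -[RHS]/(1 * y1 t + 0) mul1r addr0.
  by rewrite -[RHS]/(1 * 0 + y2 t) mulr0 add0r.
have x0 : L x = 0.
  rewrite LE//; apply: (H (h1, h2)) => //= y Dy; rewrite -LE ?LD//; exact: DL.
have [y Dy Hy] := dist2_approx x e0; exists y => //.
by apply: le_trans (ltW Hy) _; rewrite -lerBrDr subrr -x0.
Qed.

End Separation.

(** * Gradient seminorms and the bilinear form on the square *)

Section Gradients.
Context {R : realType}.
Notation lI := (@leb_I R).
Notation lO := (@leb_Omega R).
Notation RT := (measurableTypeR R).
Notation V := ((R * R -> R) * (R * R -> R))%type.
Implicit Types (f g phi y z : R * R -> R) (a b : 'cV[R]_2) (A : R * R -> 'M[R]_2).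

Let lOfin := @leb_Omega_fin R.

Lemma sum2 (U : nmodType) (F : 'I_2 -> U) : \sum_i F i = F 0 + F 1.
Proof.
rewrite big_ord_recl big_ord1; congr (F _ + F _); exact: val_inj.
Qed.

Lemma dotv2 a b : dotv a b = a 0 0 * b 0 0 + a 1 0 * b 1 0.
Proof. by rewrite /dotv sum2. Qed.

Lemma dotv_ge0 a : 0 <= dotv a a.
Proof. by rewrite dotv2 addr_ge0// -expr2 sqr_ge0. Qed.

Lemma enorm_ge0 a : 0 <= enorm a. Proof. exact: sqrtr_ge0. Qed.

Lemma enorm_comp a (i : 'I_2) : `|a i 0| <= enorm a.
Proof.
rewrite /enorm -sqrtr_sqr ler_sqrt ?dotv_ge0// dotv2 -!expr2.
by move: i; apply: forall_ord2; rewrite ?lerDl ?lerDr ?sqr_ge0.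
Qed.

Lemma enorm_le_add a : enorm a <= `|a 0 0| + `|a 1 0|.
Proof.
have s0 : 0 <= `|a 0 0| + `|a 1 0| by rewrite addr_ge0.
rewrite /enorm -(ger0_norm s0) -sqrtr_sqr ler_sqrt ?sqr_ge0// dotv2.
rewrite sqrrD !real_normK ?num_real// -!expr2 lerD2r lerDl mulrn_wge0//.
Qed.

Definition nrmg (r : R) f : R := nrm lO r%:E (enorm \o wgrad f).

Lemma enorm_gr_Lfun (r : R) f : 1 <= r -> (forall i, gr f i \in Lfun lO r%:E) ->
  enorm \o wgrad f \in Lfun lO r%:E.
Proof.
move=> r1 L; have r1e : (1 <= r%:E)%E by [].
have r0e : (0 < r%:E)%E by rewrite lte_fin (lt_le_trans ltr01).
have m (i : 'I_2) : measurable_fun [set: RT * RT] (gr f i : RT * RT -> R) := Lfun_meas (L i).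
have LA := LfunD r1e (Lfun_abs r0e (L 0)) (Lfun_abs r0e (L 1)).
apply: (Lfun_ae_le r0e _ LA).
  apply: (@measurableT_comp _ _ _ _ _ _ (@Num.sqrt R)).
    by apply: continuous_measurable_fun; exact: sqrt_continuous.
  rewrite (_ : (fun x => _) = (fun x => gr f 0 x * gr f 0 x + gr f 1 x * gr f 1 x)).
    by apply: measurable_funD; apply: measurable_funM; exact: m.
  by apply/funext => x; rewrite dotv2.
apply: nearW => x /=; rewrite (ger0_norm (enorm_ge0 _)) ger0_norm ?addr_ge0//.
exact: enorm_le_add.
Qed.

Lemma nrm_gr_le (r : R) f i : 1 <= r -> (forall i, gr f i \in Lfun lO r%:E) ->
  nrm lO r%:E (gr f i) <= nrmg r f.
Proof.
move=> r1 L; have r0e : (0 < r%:E)%E by rewrite lte_fin (lt_le_trans ltr01).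
apply: (nrm_ae_le r0e (Lfun_meas (L i)) (enorm_gr_Lfun r1 L)).
apply: nearW => x; rewrite [leRHS]ger0_norm ?enorm_ge0//; exact: enorm_comp.
Qed.

Lemma semi_OmegaE (r : R) f : 1 <= r -> W1_Omega r f -> semi_Omega r f = (nrmg r f)%:E.
Proof.
move=> r1 /(W1_Omega_gr r1)[_ _ L]; exact: nrmE (enorm_gr_Lfun r1 L).
Qed.

Lemma Lfun_Linfty_mul (r : \bar R) f h : (1 <= r)%E -> f \in Lfun lO r -> h \in Lfun lO +oo%E ->
  (fun x => h x * f x) \in Lfun lO r.
Proof.
move=> r1 Lf Lh; have r0 : (0 < r)%E by exact: lt_le_trans r1.
have m := measurable_funM (Lfun_meas Lh) (Lfun_meas Lf).
apply: (Lfun_ae_le r0 m (LfunZ (nrm lO +oo%E h) r1 Lf)).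
apply: (ae_mono (Linfty_ae_bound Lh)) => x Hx.
by rewrite !normrM (ger0_norm (nrm_ge0 _ _ _)) ler_wpM2r.
Qed.

Section Pairing.
Variables (r r' : R).
Hypotheses (r1 : 1 < r) (rr' : r^-1 + r'^-1 = 1).

Let rr : conjp r%:E r'%:E. Proof. exact: (conjp_fin r1 rr').1. Qed.
Let r'1 : 1 < r'. Proof. exact: (conjp_fin r1 rr').2. Qed.
Let r1e : (1 <= r%:E)%E. Proof. by rewrite lee_fin ltW. Qed.
Let r'1e : (1 <= r'%:E)%E. Proof. by rewrite lee_fin ltW. Qed.

Definition pairg (F : V) z : R :=
  \int[lO]_x (F.1 x * gr z 0 x) + \int[lO]_x (F.2 x * gr z 1 x).

Lemma pairg_int (F : V) z : Lfun2 lO r F -> (forall i, gr z i \in Lfun lO r'%:E) ->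
  (fun x => F.1 x * gr z 0 x) \in Lfun lO 1%E /\ (fun x => F.2 x * gr z 1 x) \in Lfun lO 1%E.
Proof. by case=> F1 F2 Lz; split; [exact: (hoelderR rr F1 (Lz 0)).1|exact: (hoelderR rr F2 (Lz 1)).1]. Qed.

Lemma pairg_lin (a : R) (F F' : V) z : Lfun2 lO r F -> Lfun2 lO r F' ->
  (forall i, gr z i \in Lfun lO r'%:E) ->
  pairg (a *: F + F') z = a * pairg F z + pairg F' z.
Proof.
move=> LF LF' Lz; have [I1 I2] := pairg_int LF Lz; have [I1' I2'] := pairg_int LF' Lz.
have E1 : \int[lO]_x ((a *: F + F').1 x * gr z 0 x) =
    a * \int[lO]_x (F.1 x * gr z 0 x) + \int[lO]_x (F'.1 x * gr z 0 x).
  have I3 := LfunZ a (lexx 1%E) I1; rewrite -RintZ// -RintD//.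
  by apply: eq_Rintegral => x _; rewrite -[_.1 x]/(a * F.1 x + F'.1 x) mulrDl mulrA.
have E2 : \int[lO]_x ((a *: F + F').2 x * gr z 1 x) =
    a * \int[lO]_x (F.2 x * gr z 1 x) + \int[lO]_x (F'.2 x * gr z 1 x).
  have I3 := LfunZ a (lexx 1%E) I2; rewrite -RintZ// -RintD//.
  by apply: eq_Rintegral => x _; rewrite -[_.2 x]/(a * F.2 x + F'.2 x) mulrDl mulrA.
by rewrite /pairg E1 E2; ring.
Qed.

Lemma pairg_le (F : V) z : Lfun2 lO r F -> (forall i, gr z i \in Lfun lO r'%:E) ->
  `|pairg F z| <= nrm2 lO r F * nrmg r' z.
Proof.
case=> F1 F2 Lz; apply: le_trans (ler_normD _ _) _; rewrite /nrm2 mulrDl.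
apply: lerD.
- apply: le_trans (hoelder_int rr F1 (Lz 0)) _.
  by rewrite ler_wpM2l ?nrm_ge0// nrm_gr_le// ltW.
- apply: le_trans (hoelder_int rr F2 (Lz 1)) _.
  by rewrite ler_wpM2l ?nrm_ge0// nrm_gr_le// ltW.
Qed.

Variable A : R * R -> 'M[R]_2.
Hypothesis LA : forall i j, (fun x => A x i j) \in Lfun lO +oo%E.

Lemma B_Omega_int y z i j : (forall i, gr y i \in Lfun lO r%:E) ->
  (forall i, gr z i \in Lfun lO r'%:E) ->
  (fun x => A x i j * gr z i x) \in Lfun lO r'%:E /\
  (fun x => gr y j x * (A x i j * gr z i x)) \in Lfun lO 1%E.
Proof.
move=> Ly Lz; have L := Lfun_Linfty_mul r'1e (Lz i) (LA i j).
by split => //; exact: (hoelderR rr (Ly j) L).1.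
Qed.

(** Grouped so that one partial derivative of y is paired with an L^r' function; Hoelder and L^r
    limits in y then apply entry by entry. *)
Definition B_term y z i j := \int[lO]_x (gr y j x * (A x i j * gr z i x)).

Lemma B_OmegaE y z : (forall i, gr y i \in Lfun lO r%:E) ->
  (forall i, gr z i \in Lfun lO r'%:E) ->
  B_Omega y z A = B_term y z 0 0 + B_term y z 0 1 + (B_term y z 1 0 + B_term y z 1 1).
Proof.
move=> Ly Lz; have I i j := (B_Omega_int i j Ly Lz).2.
have I0 := LfunD (lexx 1%E) (I 0 0) (I 0 1); have I1 := LfunD (lexx 1%E) (I 1 0) (I 1 1).
rewrite /B_term -(RintD (I 0 0) (I 0 1)) -(RintD (I 1 0) (I 1 1)) -(RintD I0 I1).
apply: eq_Rintegral => x _.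
by rewrite dotv2 !mxE !sum2 /gr/=; ring.
Qed.

Definition flux y : V := (fun x => A x 0 0 * gr y 0 x + A x 0 1 * gr y 1 x,
                          fun x => A x 1 0 * gr y 0 x + A x 1 1 * gr y 1 x).

Lemma flux_Lfun2 y : (forall i, gr y i \in Lfun lO r%:E) -> Lfun2 lO r (flux y).
Proof.
move=> Ly; have L i j := Lfun_Linfty_mul r1e (Ly j) (LA i j).
by split; [exact: LfunD r1e (L 0 0) (L 0 1)|exact: LfunD r1e (L 1 0) (L 1 1)].
Qed.

Lemma B_Omega_pairg y z : (forall i, gr y i \in Lfun lO r%:E) ->
  (forall i, gr z i \in Lfun lO r'%:E) -> B_Omega y z A = pairg (flux y) z.
Proof.
move=> Ly Lz; have [I1 I2] := pairg_int (flux_Lfun2 Ly) Lz.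
rewrite /pairg -RintD//; apply: eq_Rintegral => x _.
by rewrite dotv2 !mxE !sum2.
Qed.

Lemma B_Omega_linl (a : R) y1 y2 z : W1_Omega r y1 -> W1_Omega r y2 ->
  (forall i, gr z i \in Lfun lO r'%:E) ->
  B_Omega (fun x => a * y1 x + y2 x) z A = a * B_Omega y1 z A + B_Omega y2 z A.
Proof.
move=> W1 W2 Lz; have W := W1_Omega_lin a (ltW r1) W1 W2.
have [_ w1 L1] := W1_Omega_gr (ltW r1) W1; have [_ w2 L2] := W1_Omega_gr (ltW r1) W2.
have [_ _ L] := W1_Omega_gr (ltW r1) W.
have E i j : B_term (fun x => a * y1 x + y2 x) z i j = a * B_term y1 z i j + B_term y2 z i j; last first.
  have lin4 (b1 b2 b3 b4 c1 c2 c3 c4 : R) : (a * b1 + c1) + (a * b2 + c2) + ((a * b3 + c3) + (a * b4 + c4)) =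
      a * (b1 + b2 + (b3 + b4)) + (c1 + c2 + (c3 + c4)) by ring.
  apply: (etrans (B_OmegaE L Lz)); rewrite (E 0 0) (E 0 1) (E 1 0) (E 1 1).
  apply: (etrans (lin4 _ _ _ _ _ _ _ _)); congr (_ * _ + _); apply/esym.
    exact: B_OmegaE L1 Lz.
  exact: B_OmegaE L2 Lz.
rewrite /B_term; have I1 := (B_Omega_int i j L1 Lz).2; have I2 := (B_Omega_int i j L2 Lz).2.
have I := (B_Omega_int i j L Lz).2; have aI1 := LfunZ a (lexx 1%E) I1.
rewrite -(RintZ a I1) -(RintD aI1 I2); apply: Rint_ae_eq.
- exact: Lfun_meas I.
- exact: Lfun_meas (LfunD (lexx 1%E) aI1 I2).
have /ae_eqP g := gr_lin a j w1 w2; apply/ae_eqP; apply: (ae_mono g) => x ->; ring.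
Qed.

End Pairing.
End Gradients.

(** * The equation on Omega *)

Section SolveOmega.
Context {R : realType}.
Notation lO := (@leb_Omega R).
Notation RT := (measurableTypeR R).
Notation V := ((R * R -> R) * (R * R -> R))%type.
Implicit Types (y z : R * R -> R).

Variables (p q beta : R) (A : R * R -> 'M[R]_2).
Hypotheses (p1 : 1 < p) (pq : p^-1 + q^-1 = 1) (beta0 : 0 <= beta).
Hypothesis LA : forall i j, (fun x => A x i j) \in Lfun lO +oo%E.
Hypothesis symA : forall x i j, A x i j = A x j i.

(** The inf-sup condition as it is used: an estimate of the load by K gives one of the solution by
    beta K, with no supremum and no division by a seminorm that may vanish. *)
Definition infsup r r' := forall y K, W10_Omega r y -> 0 <= K ->
  (forall z, W10_Omega r' z -> B_Omega y z A <= K * nrmg r' z) -> nrmg r y <= beta * K.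

Hypotheses (isp : infsup p q) (isq : infsup q p).

Let pqc : conjp p%:E q%:E. Proof. exact: (conjp_fin p1 pq).1. Qed.
Let q1 : 1 < q. Proof. exact: (conjp_fin p1 pq).2. Qed.
Let qp : q^-1 + p^-1 = 1. Proof. by rewrite addrC. Qed.
Let p1e : (1 <= p%:E)%E. Proof. by rewrite lee_fin ltW. Qed.
Let q1e : (1 <= q%:E)%E. Proof. by rewrite lee_fin ltW. Qed.
Let lOfin := @leb_Omega_fin R.

Let grL r y i : 1 < r -> W10_Omega r y -> gr y i \in Lfun lO r%:E.
Proof. by move=> r1 [/(W1_Omega_gr (ltW r1))[]]. Qed.

(** The condition for the pair (q, p) bounds a first argument; symmetry of A makes it available for
    a test function z in second position. *)
Lemma B_Omega_sym y z : W10_Omega p y -> W10_Omega q z -> B_Omega z y A = B_Omega y z A.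
Proof.
move=> Wy Wz; have Ly i := grL i p1 Wy; have Lz i := grL i q1 Wz.
apply: (etrans (B_OmegaE q1 qp LA Lz Ly)); apply/esym; apply: (etrans (B_OmegaE p1 pq LA Ly Lz)).
have E i j : B_term A y z i j = B_term A z y j i.
  by apply: eq_Rintegral => x _; rewrite (symA x j i); ring.
by rewrite !E addrACA.
Qed.

(** The fields F whose load z -> integral of F . grad z is attained by the form. The equation on
    Omega asks this of - A grad v. *)
Definition represented (F : V) : Prop := Lfun2 lO p F /\
  exists2 y, W10_Omega p y & forall z, W10_Omega q z -> B_Omega y z A = pairg F z.

Lemma represented_lin (a : R) (F F' : V) : represented F -> represented F' ->
  represented (a *: F + F').
Proof.
case=> LF [y Wy Hy] [LF' [y' Wy' Hy']]; split.
  by apply: Lfun2D => //; exact: Lfun2Z.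
exists (fun x => a * y x + y' x); first exact: W10_Omega_lin (ltW p1) Wy Wy'.
move=> z Wz; have Lz i := grL i q1 Wz.
by rewrite (B_Omega_linl p1 pq LA a Wy.1 Wy'.1 Lz) (pairg_lin p1 pq) // Hy// Hy'.
Qed.

Lemma cst0_W10 (r : R) : 1 < r -> W10_Omega r (cst 0 : R * R -> R).
Proof.
move=> r1; have r1e : (1 <= r%:E)%E by rewrite lee_fin ltW.
have r0e : (0 < r%:E)%E by rewrite lte_fin (lt_trans ltr01).
have s0 : smooth2 (cst 0 : R * R -> R).
  move=> s; have -> : foldr partial (cst 0 : R * R -> R) s = cst 0.
    elim: s => //= i s ->; apply/funext => x.
    by rewrite /partial derive_cst.
  by split => [x|x i]; [exact: cvg_cst|exact: derivable_cst].
have p0 i : partial i (cst 0 : R * R -> R) = cst 0.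
  by apply/funext => x; rewrite /partial derive_cst.
have w0 : is_wgrad (cst 0 : R * R -> R) (cst 0).
  split; first exact: LfunC0.
  move=> i; have -> : (fun x => cst (0 : 'cV[R]_2) x i 0) = cst 0 :> (R * R -> R).
    by apply/funext => x; rewrite mxE.
  split; first exact: LfunC0.
  move=> phi _; rewrite -[LHS](_ : \int[lO]_x (cst 0 x : R) = _); last first.
    by apply: eq_Rintegral => x _; rewrite mul0r.
  rewrite -[X in - X](_ : \int[lO]_x (cst 0 x : R) = _); last first.
    by apply: eq_Rintegral => x _; rewrite mxE mul0r.
  by rewrite Rint_cstO oppr0.
have W0 : W1_Omega r (cst 0 : R * R -> R).
  split; first exact: LfunC0.
  exists (cst 0) => // i; rewrite (_ : (fun x => _) = cst 0); first exact: LfunC0.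
  by apply/funext => x; rewrite mxE.
apply/(W10_OmegaP _ (ltW r1)); split => // e e0; exists (cst 0); split => //.
- have -> : (cst 0 : R * R -> R) \- cst 0 = cst 0 by apply/funext => x /=; rewrite subr0.
  by rewrite nrm0// ltW.
- have [_ _ Lg] := W1_Omega_gr (ltW r1) W0.
  move=> i; rewrite p0.
  have L := LfunB r1e (LfunC0 lO r0e) (Lg i).
  rewrite (_ : nrm _ _ _ = 0) ?ltW//; apply: (ae0_nrm r0e (Lfun_meas L)).
  apply/ae_eqP; apply: (ae_mono (wgradE w0)) => x /=; rewrite /gr => ->.
  by rewrite mxE subrr.
- by rewrite /bnd !nrm0// !addr0 ltW.
Qed.

Lemma pairg0 z : pairg (0 : V) z = 0.
Proof.
rewrite /pairg -[RHS](addr0 0); congr (_ + _); rewrite -[RHS]Rint_cstO;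
  by apply: eq_Rintegral => x _; rewrite mul0r.
Qed.

Lemma B_Omega0 z : (forall i, gr z i \in Lfun lO q%:E) -> B_Omega (cst 0) z A = 0.
Proof.
move=> Lz; have W0 := cst0_W10 p1; have L0 i := grL i p1 W0.
have := B_Omega_linl p1 pq LA (- 1) W0.1 W0.1 Lz.
by rewrite (_ : (fun x => _) = cst 0) ?mulN1r ?addNr//; apply/funext => x /=; rewrite mulr0 addr0.
Qed.

Lemma nrm1_le_nrm2 r (F : V) : nrm lO r%:E F.1 <= nrm2 lO r F /\ nrm lO r%:E F.2 <= nrm2 lO r F.
Proof. by rewrite /nrm2 lerDl lerDr !nrm_ge0. Qed.

(** Differences of solutions solve the equation for differences of fields, so the inf-sup bound
    makes the gradients Cauchy; their limit is the gradient of some y by completeness, and both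
    sides of the equation pass to the limit by Hoelder. *)
Lemma represented_closed (F_ : nat -> V) (F : V) : (forall n, represented (F_ n)) ->
  Lfun2 lO p F -> nrm2 lO p (F_ n - F) @[n --> \oo] --> 0 -> represented F.
Proof.
move=> rep LF cF; split => //.
have LF_ n : Lfun2 lO p (F_ n) by case: (rep n).
have /choice[y_ Hy] : forall n, exists y, W10_Omega p y /\
    forall z, W10_Omega q z -> B_Omega y z A = pairg (F_ n) z.
  by move=> n; have [_ [y ? ?]] := rep n; exists y.
have Wy n : W10_Omega p (y_ n) by case: (Hy n).
have Ly n i := grL i p1 (Wy n).
have diff m n : nrmg p (fun x => - 1 * y_ n x + y_ m x) <= beta * nrm2 lO p (F_ m - F_ n).
  apply: isp; first exact: W10_Omega_lin (ltW p1) (Wy n) (Wy m).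
    exact: nrm2_ge0.
  move=> z Wz; have Lz i := grL i q1 Wz.
  rewrite (B_Omega_linl p1 pq LA (- 1) (Wy n).1 (Wy m).1 Lz) (Hy n).2// (Hy m).2//.
  rewrite -(pairg_lin p1 pq)// scaleN1r addrC.
  apply: le_trans (ler_norm _) _; apply: (pairg_le p1 pq) => //.
  have LB := Lfun2B p1 (LF_ m) (LF_ n); exact: LB.
have cau i e : 0 < e -> exists N, forall m n, (N <= m)%N -> (N <= n)%N ->
    nrm lO p%:E (gr (y_ m) i \- gr (y_ n) i) <= e.
  move=> e0; have b1 : 0 < beta + 1 by rewrite ltr_wpDl.
  have e2 : 0 < e / 2 / (beta + 1) by rewrite !divr_gt0.
  have [N _ HN] := nrm_cvg0_small e2 cF.
  exists N => m n Nm Nn.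
  have W := W10_Omega_lin (- 1) (ltW p1) (Wy n) (Wy m).
  have L j := grL j p1 W.
  have -> : nrm lO p%:E (gr (y_ m) i \- gr (y_ n) i) =
      nrm lO p%:E (gr (fun x => - 1 * y_ n x + y_ m x) i).
    have w1 n' : is_wgrad (y_ n') (wgrad (y_ n')) by have [] := W1_Omega_gr (ltW p1) (Wy n').1.
    have /ae_eqP g := gr_lin (- 1) i (w1 n) (w1 m).
    have LB := LfunB p1e (Ly m i) (Ly n i).
    apply: (nrm_ae_eq (lt_le_trans lte01 p1e) (Lfun_meas LB) (Lfun_meas (L i))).
    by apply/ae_eqP; apply: (ae_mono g) => x -> /=; ring.
  apply: le_trans (nrm_gr_le i (ltW p1) L) _; apply: le_trans (diff m n) _.
  have T : nrm2 lO p (F_ m - F_ n) <= e / (beta + 1).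
    have L1 := Lfun2B p1 (LF_ m) LF; have L2 := Lfun2B p1 (LF_ n) LF.
    have := nrm2D p1 L1 (Lfun2Z p1 (- 1) L2); rewrite (nrm2Z p1)// normrN normr1 mul1r scaleN1r.
    rewrite opprB addrA subrK => /le_trans; apply.
    rewrite (_ : e / (beta + 1) = e / 2 / (beta + 1) + e / 2 / (beta + 1)); last by field; rewrite gt_eqF.
    by apply: lerD; apply: HN.
  apply: le_trans (ler_wpM2l beta0 T) _.
  by rewrite mulrCA ler_piMr ?(ltW e0)// ler_pdivrMr// mul1r lerDl.
have cG i : exists G, G \in Lfun lO p%:E /\ nrm lO p%:E (gr (y_ n) i \- G) @[n --> \oo] --> (0 : R).
  by have [G LG cG] := Lp_complete lOfin (ltW p1) (Ly^~ i) (cau i); exists G.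
have /choice[G HG] := cG.
have [y W E] := W10_Omega_complete p1 Wy (fun i => (HG i).1) (fun i => (HG i).2).
exists y => // z Wz; have Lz i := grL i q1 Wz; have Lgy i := grL i p1 W.
have cP1 := nrm_cvg_int pqc (fun n => (LF_ n).1) LF.1 (Lz 0).
have cP2 := nrm_cvg_int pqc (fun n => (LF_ n).2) LF.2 (Lz 1).
have H1 : nrm lO p%:E ((F_ n).1 \- F.1) @[n --> \oo] --> (0 : R).
  apply: (@squeeze_cvgr _ _ _ R (cst 0) (fun n => nrm2 lO p (F_ n - F))) => //; last exact: cvg_cst.
  by apply: nearW => n; rewrite nrm_ge0/=; exact: (nrm1_le_nrm2 p (F_ n - F)).1.
have H2 : nrm lO p%:E ((F_ n).2 \- F.2) @[n --> \oo] --> (0 : R).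
  apply: (@squeeze_cvgr _ _ _ R (cst 0) (fun n => nrm2 lO p (F_ n - F))) => //; last exact: cvg_cst.
  by apply: nearW => n; rewrite nrm_ge0/=; exact: (nrm1_le_nrm2 p (F_ n - F)).2.
have cB : B_Omega (y_ n) z A @[n --> \oo] --> pairg F z.
  rewrite (_ : (fun n => _) = (fun n => pairg (F_ n) z)); last first.
    by apply/funext => n; rewrite (Hy n).2.
  exact: cvgD (cP1 H1) (cP2 H2).
apply: (@cvg_unique _ _ _ _ _ _ _ cB) => //.
have cI i j : B_term A (y_ n) z i j @[n --> \oo] --> B_term A y z i j.
  have [Lh _] := B_Omega_int p1 pq LA i j Lgy Lz.
  apply: (nrm_cvg_int pqc (Ly^~ j) (Lgy j) Lh).
  rewrite (_ : (fun n => _) = (fun n => nrm lO p%:E (gr (y_ n) j \- G j))); first exact: (HG j).2.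
  apply/funext => n.
  have D1 := LfunB p1e (Ly n j) (Lgy j); have D2 := LfunB p1e (Ly n j) (HG j).1.
  apply: (nrm_ae_eq (lt_le_trans lte01 p1e) (Lfun_meas D1) (Lfun_meas D2)).
  by have /ae_eqP Ej := E j; apply/ae_eqP; apply: (ae_mono Ej) => x /= ->.
have EB n := B_OmegaE p1 pq LA (Ly n) Lz.
rewrite (_ : (fun n => B_Omega (y_ n) z A) = (fun n => B_term A (y_ n) z 0 0 + B_term A (y_ n) z 0 1 +
  (B_term A (y_ n) z 1 0 + B_term A (y_ n) z 1 1))); last by apply/funext => n; exact: EB.
rewrite (B_OmegaE p1 pq LA Lgy Lz).
exact: cvgD (cvgD (cI 0 0) (cI 0 1)) (cvgD (cI 1 0) (cI 1 1)).
Qed.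

(* By duality the represented fields are dense. Let h annihilate them. Every F
   orthogonal to all gradients is represented (by 0), so h is orthogonal to all
   such F and hence, by duality once more, h = grad z; then B_Omega y z A = 0 for
   all y, and the inf-sup condition with exchanged exponents gives z = 0. *)
Lemma represented_all (F : V) : Lfun2 lO p F -> represented F.
Proof.
move=> LF.
(* Closedness upgrades density to equality, along fields at distance at most 1/(n+1). *)
suff dense e : 0 < e -> exists2 F', represented F' & nrm2 lO p (F - F') <= e.
  have /choice[F_ HF] : forall n : nat, exists F', represented F' /\ nrm2 lO p (F - F') <= n.+1%:R^-1.
    by move=> n; have [|F' ? ?] := dense n.+1%:R^-1; [rewrite invr_gt0|exists F'].
  apply: (@represented_closed F_) => // [n|]; first by case: (HF n).
  apply: harmonic_cvg0 => n; rewrite nrm2_ge0/= -opprB -scaleN1r (nrm2Z p1).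
    by rewrite normrN normr1 mul1r; case: (HF n).
  by apply: Lfun2B => //; case: (HF n) => -[].
apply: (annihilator_dense lOfin p1 pq) => //.
- split; first exact: Lfun2_0.
  exists (cst 0); first exact: cst0_W10.
  by move=> z Wz; rewrite pairg0 B_Omega0// => i; exact: grL Wz.
- by move=> a x y; exact: represented_lin.
- by move=> x [].
move=> h Lh1 Lh2 Hh.
have Lh : Lfun2 lO q h by split.
(* The second duality, with exponents exchanged. The subspace consists of pairs equal almost
   everywhere to a gradient, because [wgrad] of a sum is the sum of the gradients only up to a null
   set. *)
have dz e0 : 0 < e0 -> exists2 x : V, (Lfun2 lO q x /\ exists2 z, W10_Omega q z &
    gr z 0 = x.1 %[ae lO] /\ gr z 1 = x.2 %[ae lO]) & nrm2 lO q (h - x) <= e0.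
  apply: (annihilator_dense lOfin q1 qp) => //.
  - split; first exact: Lfun2_0.
    have W0 := cst0_W10 q1; exists (cst 0) => //.
    have w0 : is_wgrad (cst 0 : R * R -> R) (wgrad (cst 0)).
      by have [] := W1_Omega_gr (ltW q1) W0.1.
    have wl i := gr_lin (- 1) i w0 w0.
    have E : (fun x : R * R => - 1 * cst (0 : R) x + cst 0 x) = cst 0.
      by apply/funext => x /=; rewrite mulr0 addr0.
    have g i : gr (cst 0 : R * R -> R) i = cst 0 %[ae lO].
      have /ae_eqP := wl i; rewrite E => g; apply/ae_eqP; apply: (ae_mono g) => x ->.
      by rewrite mulN1r addNr.
    by split; exact: g.
  - move=> a x x' [Lx [z Wz [/ae_eqP z0 /ae_eqP z1]]] [Lx' [z' Wz' [/ae_eqP z0' /ae_eqP z1']]].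
    split; first by apply: Lfun2D => //; exact: Lfun2Z.
    exists (fun t => a * z t + z' t); first exact: W10_Omega_lin (ltW q1) Wz Wz'.
    have w : is_wgrad z (wgrad z) by have [] := W1_Omega_gr (ltW q1) Wz.1.
    have w' : is_wgrad z' (wgrad z') by have [] := W1_Omega_gr (ltW q1) Wz'.1.
    have /ae_eqP g0 := gr_lin a 0 w w'; have /ae_eqP g1 := gr_lin a 1 w w'.
    split; apply/ae_eqP.
    + by apply: (ae_mono3 g0 z0 z0') => t -> -> ->.
    + by apply: (ae_mono3 g1 z1 z1') => t -> -> ->.
  - by move=> x [].
  move=> n Ln1 Ln2 Hn.
  have Ln : Lfun2 lO p n by split.
  have rn : represented n.
    split => //; exists (cst 0); first exact: cst0_W10.
    move=> z Wz; have Lz i := grL i q1 Wz; rewrite B_Omega0//.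
    rewrite -[LHS](Hn (gr z 0, gr z 1)); last first.
      split; first by split; exact: Lz.
      by exists z => //; split; apply/ae_eqP; exact: nearW.
    by rewrite /pairg/=; congr (_ + _); apply: eq_Rintegral => x _; rewrite mulrC.
  rewrite -[RHS](Hh _ rn); congr (_ + _); apply: eq_Rintegral => x _; exact: mulrC.
have /choice[x_ Hx] : forall n : nat, exists x : V, [/\ Lfun2 lO q x, nrm2 lO q (h - x) <= n.+1%:R^-1 &
    exists z, [/\ W10_Omega q z, gr z 0 = x.1 %[ae lO] & gr z 1 = x.2 %[ae lO]]].
  move=> n; have [|x [Lx [z Wz [z0 z1]]] Hx] := dz n.+1%:R^-1; first by rewrite invr_gt0.
  by exists x; split => //; exists z.
have /choice[z_ Hz] : forall n, exists z, [/\ W10_Omega q z, gr z 0 = (x_ n).1 %[ae lO] & gr z 1 = (x_ n).2 %[ae lO]].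
  by move=> n; have [_ _ [z ?]] := Hx n; exists z.
have Wz n : W10_Omega q (z_ n) by case: (Hz n).
pose G (i : 'I_2) := if i == 0 then h.1 else h.2.
have LG i : G i \in Lfun lO q%:E by rewrite /G; case: ifP.
have cG i : nrm lO q%:E (gr (z_ n) i \- G i) @[n --> \oo] --> 0.
  apply: harmonic_cvg0 => n; rewrite nrm_ge0/=.
  have [[Lx1 Lx2] + _] := Hx n; apply: le_trans.
  have Lgz j := grL j q1 (Wz n).
  rewrite (nrm_distC q1e (Lgz i) (LG i)).
  have LB := LfunB q1e (LG i) (Lgz i).
  have [_ /ae_eqP z0 /ae_eqP z1] := Hz n.
  have [n1 n2] := nrm1_le_nrm2 q (h - x_ n).
  move: i LB; apply: forall_ord2 => LB; rewrite /G/= in LB *.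
  - apply: le_trans n1; rewrite le_eqVlt; apply/orP; left; apply/eqP.
    apply: (nrm_ae_eq (lt_le_trans lte01 q1e) (Lfun_meas LB) (Lfun_meas (LfunB q1e Lh1 Lx1))).
    by apply/ae_eqP; apply: (ae_mono z0) => t /= ->.
  - apply: le_trans n2; rewrite le_eqVlt; apply/orP; left; apply/eqP.
    apply: (nrm_ae_eq (lt_le_trans lte01 q1e) (Lfun_meas LB) (Lfun_meas (LfunB q1e Lh2 Lx2))).
    by apply/ae_eqP; apply: (ae_mono z1) => t /= ->.
have [z W E] := W10_Omega_complete q1 Wz LG cG.
have Lz i := grL i q1 W.
(* [B_Omega y z A] pairs A grad y, which is represented by y itself, with grad z = h, and h
   annihilates represented fields. *)
have z0 : nrmg q z <= beta * 0.
  apply: isq => // y Wy; have Ly i := grL i p1 Wy; rewrite mul0r (B_Omega_sym Wy W).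
  have Lf := flux_Lfun2 p1 LA Ly.
  have rf : represented (flux A y).
    split; first exact: Lf.
    by exists y => // z' Wz'; rewrite (B_Omega_pairg p1 pq LA Ly (fun i => grL i q1 Wz')).
  rewrite (B_Omega_pairg p1 pq LA Ly Lz) -(Hh _ rf) le_eqVlt; apply/orP; left; apply/eqP.
  have [I1 I2] := pairg_int p1 pq Lf Lz.
  have I3 := (hoelderR pqc Lf.1 Lh1).1; have I4 := (hoelderR pqc Lf.2 Lh2).1.
  rewrite /pairg; congr (_ + _); apply: Rint_ae_eq.
  - exact: Lfun_meas I1.
  - exact: Lfun_meas I3.
  - by have /ae_eqP E0 := E 0; apply/ae_eqP; apply: (ae_mono E0) => x ->.
  - exact: Lfun_meas I2.
  - exact: Lfun_meas I4.
  - by have /ae_eqP E0 := E 1; apply/ae_eqP; apply: (ae_mono E0) => x ->.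
have h0 i : G i = cst 0 %[ae lO].
  have q0e : (0 < q%:E)%E by rewrite lte_fin (lt_trans ltr01).
  have g0 : nrm lO q%:E (gr z i) = 0.
    by apply/eqP; rewrite eq_le nrm_ge0 andbT; apply: le_trans (nrm_gr_le i (ltW q1) Lz) _; rewrite mulr0 in z0.
  have /ae_eqP H := nrm_eq0 q0e (Lz i) g0; have /ae_eqP Ei := E i.
  by apply/ae_eqP; apply: (ae_mono2 H Ei) => x -> <-.
have I3 := (hoelderR pqc LF.1 Lh1).1; have I4 := (hoelderR pqc LF.2 Lh2).1.
rewrite -[RHS](addr0 0); congr (_ + _); rewrite -[RHS]Rint_cstO; apply: Rint_ae_eq.
- exact: Lfun_meas I3.
- exact: measurable_cst.
- by have /ae_eqP E0 := h0 0; apply/ae_eqP; apply: (ae_mono E0) => x; rewrite /G/= => ->; rewrite mulr0.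
- exact: Lfun_meas I4.
- exact: measurable_cst.
- by have /ae_eqP E0 := h0 1; apply/ae_eqP; apply: (ae_mono E0) => x; rewrite /G/= => ->; rewrite mulr0.
Qed.

(** The solution for the field - A grad v cancels the contribution of v. *)
Lemma solve_Omega v : W1_Omega p v -> exists2 y, W10_Omega p y &
  forall z, W10_Omega q z -> B_Omega (y \+ v) z A = 0.
Proof.
move=> Wv; have [_ wv Lv] := W1_Omega_gr (ltW p1) Wv.
have Lf := flux_Lfun2 p1 LA Lv.
have [_ [y Wy Hy]] := represented_all (Lfun2Z p1 (- 1) Lf).
exists y => // z Wz; have Lz i := grL i q1 Wz.
have := B_Omega_linl p1 pq LA 1 Wy.1 Wv Lz.
rewrite (_ : (fun x => _) = y \+ v); last by apply/funext => x /=; rewrite mul1r.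
move=> ->; rewrite Hy// (B_Omega_pairg p1 pq LA Lv Lz).
have L0 := @Lfun2_0 _ _ _ lO p p1.
have := pairg_lin p1 pq (- 1) Lf L0 Lz; rewrite addr0 => ->.
by rewrite pairg0; ring.
Qed.

End SolveOmega.

(** * Operator norms and bounds for the form *)

Section OperatorNorm.
Context {R : realType}.
Notation lO := (@leb_Omega R).
Notation RT := (measurableTypeR R).
Implicit Types (y z : R * R -> R) (a b : 'cV[R]_2) (M N : 'M[R]_2).

Lemma cauchy_schwarz2 (a0 a1 b0 b1 : R) :
  (a0 * b0 + a1 * b1) ^+ 2 <= (a0 * a0 + a1 * a1) * (b0 * b0 + b1 * b1).
Proof. by rewrite -subr_ge0 [leRHS](_ : _ = (a0 * b1 - a1 * b0) ^+ 2) ?sqr_ge0//; ring. Qed.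

Lemma dotv_le a b : `|dotv a b| <= enorm a * enorm b.
Proof.
rewrite /enorm -sqrtrM ?dotv_ge0// -sqrtr_sqr ler_sqrt; last by rewrite mulr_ge0 ?dotv_ge0.
by rewrite !dotv2; exact: cauchy_schwarz2.
Qed.

Lemma enorm_sqr a : enorm a ^+ 2 = dotv a a.
Proof. by rewrite sqr_sqrtr// dotv_ge0. Qed.

Lemma enormD a b : enorm (a + b) <= enorm a + enorm b.
Proof.
have s0 : 0 <= enorm a + enorm b by rewrite addr_ge0 ?enorm_ge0.
rewrite -(ler_pXn2r (_ : 0 < 2)%N) ?nnegrE ?enorm_ge0// sqrrD !enorm_sqr.
have := dotv_le a b; rewrite ler_norml => /andP[_].
rewrite !dotv2 !mxE => H; rewrite mulr2n; move: H.
set u := enorm a * enorm b; lra.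
Qed.

Lemma enormZ (c : R) a : enorm (c *: a) = `|c| * enorm a.
Proof.
rewrite /enorm (_ : dotv (c *: a) (c *: a) = c ^+ 2 * dotv a a).
  by rewrite sqrtrM ?sqr_ge0// sqrtr_sqr.
by rewrite !dotv2 !mxE; ring.
Qed.

Lemma enorm0 : enorm (0 : 'cV[R]_2) = 0.
Proof. by rewrite -(scale0r (0 : 'cV[R]_2)) enormZ normr0 mul0r. Qed.

Lemma enorm_eq0 a : enorm a = 0 -> a = 0.
Proof.
move=> a0; have H i : a i 0 = 0.
  by have := enorm_comp a i; rewrite a0 normr_le0 => /eqP.
by apply: cV2P; rewrite H mxE.
Qed.

(** A crude majorant of the operator norm: it shows that the supremum in [opnorm] is over a bounded
    set, and is what explicit matrix entries are estimated by. *)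
Definition mxsum M : R := `|M 0 0| + `|M 0 1| + (`|M 1 0| + `|M 1 1|).

Lemma enorm_mulmx_mxsum M a : enorm (M *m a) <= mxsum M * enorm a.
Proof.
apply: le_trans (enorm_le_add _) _; rewrite !mxE !sum2 /mxsum mulrDl !mulrDl.
have H0 := enorm_comp a 0; have H1 := enorm_comp a 1.
have K (c d : R) : `|d| <= enorm a -> `|c * d| <= `|c| * enorm a.
  by move=> H; rewrite normrM ler_wpM2l.
by apply: lerD; apply: le_trans (ler_normD _ _) _; apply: lerD; exact: K.
Qed.

Lemma opnorm_has_sup M : has_sup [set enorm (M *m a) | a in [set a | enorm a <= 1]].
Proof.
split; first by exists (enorm (M *m 0)); exists 0 => //=; rewrite enorm0.
exists (mxsum M) => _ [a /= a1 <-]; apply: le_trans (enorm_mulmx_mxsum M a) _.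
by rewrite ler_piMr// /mxsum !addr_ge0.
Qed.

Lemma opnorm_ge M a : enorm a <= 1 -> enorm (M *m a) <= opnorm M.
Proof. by move=> a1; apply: sup_ubound; [case: (opnorm_has_sup M)|exists a]. Qed.

Lemma opnorm_le M (K : R) : (forall a, enorm a <= 1 -> enorm (M *m a) <= K) -> opnorm M <= K.
Proof. by move=> H; apply: sup_le_ub; [case: (opnorm_has_sup M)|move=> _ [a /= a1 <-]; exact: H]. Qed.

Lemma opnorm_ge0 M : 0 <= opnorm M.
Proof. by apply: le_trans (opnorm_ge M (a := 0) _); rewrite ?enorm_ge0 ?enorm0. Qed.

Lemma opnormP M a : enorm (M *m a) <= opnorm M * enorm a.
Proof.
have [a0|a0] := eqVneq (enorm a) 0.
  by rewrite a0 mulr0 (enorm_eq0 a0) mulmx0 enorm0.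
have ap : 0 < enorm a by rewrite lt_neqAle eq_sym a0 enorm_ge0.
have := @opnorm_ge M ((enorm a)^-1 *: a) _.
rewrite -scalemxAr !enormZ gtr0_norm ?invr_gt0// mulVf// => /(_ (lexx _)).
by rewrite ler_pdivrMl// mulrC.
Qed.

Lemma opnormD M N : opnorm (M + N) <= opnorm M + opnorm N.
Proof.
apply: opnorm_le => a a1; rewrite mulmxDl; apply: le_trans (enormD _ _) _.
by apply: lerD; exact: opnorm_ge.
Qed.

Lemma opnormZ_le (c : R) M : opnorm (c *: M) <= `|c| * opnorm M.
Proof.
apply: opnorm_le => a a1; rewrite -scalemxAl enormZ ler_wpM2l//; exact: opnorm_ge.
Qed.

Lemma opnorm_mxsum M : opnorm M <= mxsum M.
Proof.
apply: opnorm_le => a a1; apply: le_trans (enorm_mulmx_mxsum M a) _.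
by rewrite ler_piMr// /mxsum !addr_ge0.
Qed.

Lemma opnorm_distC M N : opnorm (M - N) <= opnorm (N - M).
Proof.
rewrite -opprB -scaleN1r; apply: le_trans (opnormZ_le _ _) _.
by rewrite normrN normr1 mul1r.
Qed.

Lemma Linfty_mx_ge0 (M : R * R -> 'M[R]_2) : (0 <= Linfty_mx M)%E.
Proof. exact: Lnorm_ge0. Qed.

(** Stated for arbitrary fields, since [DA] is a chosen field whose measurability is unknown. *)
Lemma Linfty_mxP (M : R * R -> 'M[R]_2) (C : R) : 0 <= C ->
  (Linfty_mx M <= C%:E)%E <-> {ae lO, forall x, opnorm (M x) <= C}.
Proof.
move=> C0; rewrite /Linfty_mx unlock; case: ifPn => [_|]; last by rewrite leb_OmegaT lte_fin ltr01.
split => [H|H].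
  have H' := ess_sup_ge lO (abse \o (EFin \o (opnorm \o M))).
  apply: (ae_mono H') => x /= Hx; rewrite -lee_fin; apply: le_trans H.
  by rewrite -[X in (X%:E <= _)%E]ger0_norm ?opnorm_ge0.
apply/ess_supP; apply: (ae_mono H) => x /=.
by rewrite lee_fin ger0_norm ?opnorm_ge0.
Qed.

Lemma W1_enorm (r : R) f : 1 < r -> W1_Omega r f ->
  (forall i, gr f i \in Lfun lO r%:E) /\ enorm \o wgrad f \in Lfun lO r%:E.
Proof.
move=> r1 /(W1_Omega_gr (ltW r1))[_ _ L]; split => //.
exact: enorm_gr_Lfun (ltW r1) L.
Qed.

Lemma nrmg_ge0 (r : R) y : 0 <= nrmg r y. Proof. exact: nrm_ge0. Qed.

Lemma nrmg_lin (r a : R) y z : 1 < r -> W1_Omega r y -> W1_Omega r z ->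
  nrmg r (fun x => a * y x + z x) <= `|a| * nrmg r y + nrmg r z.
Proof.
move=> r1 Wy Wz; have W := W1_Omega_lin a (ltW r1) Wy Wz.
have r1e : (1 <= r%:E)%E by rewrite lee_fin ltW.
have r0e : (0 < r%:E)%E by rewrite lte_fin (lt_trans ltr01).
have [_ wy _] := W1_Omega_gr (ltW r1) Wy; have [_ wz _] := W1_Omega_gr (ltW r1) Wz.
have [_ Ly] := W1_enorm r1 Wy; have [_ Lz] := W1_enorm r1 Wz; have [_ L] := W1_enorm r1 W.
have := nrm_lin_le `|a| r1e Ly Lz; rewrite normr_id; apply: le_trans.
have LS := LfunD r1e (LfunZ `|a| r1e Ly) Lz.
apply: (nrm_ae_le r0e (Lfun_meas L) LS).
have w := wgradE (is_wgrad_lin a wy wz); apply: (ae_mono w) => x /= ->.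
rewrite (ger0_norm (enorm_ge0 _)) ger0_norm; last by rewrite addr_ge0 ?mulr_ge0 ?enorm_ge0.
by apply: le_trans (enormD _ _) _; rewrite enormZ.
Qed.

Lemma nrmg_add (r : R) y z : 1 < r -> W1_Omega r y -> W1_Omega r z ->
  nrmg r (y \+ z) <= nrmg r y + nrmg r z.
Proof.
move=> r1 Wy Wz; have := nrmg_lin 1 r1 Wy Wz; rewrite normr1 mul1r.
by rewrite (_ : (fun x => _) = y \+ z)//; apply/funext => x /=; rewrite mul1r.
Qed.

Section FormBounds.
Variables (r r' : R).
Hypotheses (r1 : 1 < r) (rr' : r^-1 + r'^-1 = 1).
Variables (y z : R * R -> R).
Hypotheses (Wy : W1_Omega r y) (Wz : W1_Omega r' z).
Implicit Types A : R * R -> 'M[R]_2.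

Let r'1 : 1 < r'. Proof. exact: (conjp_fin r1 rr').2. Qed.
Let rr : conjp r%:E r'%:E. Proof. exact: (conjp_fin r1 rr').1. Qed.
Let Ly : forall i, gr y i \in Lfun lO r%:E. Proof. exact: (W1_enorm r1 Wy).1. Qed.
Let Lz : forall i, gr z i \in Lfun lO r'%:E. Proof. exact: (W1_enorm r'1 Wz).1. Qed.

Definition entries A := forall i j, (fun x => A x i j) \in Lfun lO +oo%E.

Lemma B_Omega_integrand A : entries A ->
  (fun x => dotv (A x *m wgrad y x) (wgrad z x)) \in Lfun lO 1%E.
Proof.
move=> LA; have [I1 I2] := pairg_int r1 rr' (flux_Lfun2 r1 LA Ly) Lz.
have I12 := LfunD (lexx 1%E) I1 I2.
rewrite (_ : (fun x => dotv _ _) = (fun x => (flux A y).1 x * gr z 0 x) \+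
  (fun x => (flux A y).2 x * gr z 1 x)); first exact: I12.
apply/funext => x.
by rewrite dotv2 !mxE !sum2.
Qed.

Lemma B_Omega_le A (K : R) : entries A -> 0 <= K -> {ae lO, forall x, opnorm (A x) <= K} ->
  `|B_Omega y z A| <= K * nrmg r y * nrmg r' z.
Proof.
move=> LA K0 HK; have I := B_Omega_integrand LA.
apply: le_trans (le_norm_Rintegral I) _.
have [_ Ey] := W1_enorm r1 Wy; have [_ Ez] := W1_enorm r'1 Wz.
have [Lyz Hyz] := hoelderR rr Ey Ez.
rewrite -mulrA; apply: le_trans (ler_wpM2l K0 Hyz).
have E := nrmZ K (lexx 1%E) Lyz; rewrite (ger0_norm K0) in E; rewrite -E.
apply: (nrm_ae_le lte01 (Lfun_meas I) (LfunZ K (lexx 1%E) Lyz)).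
apply: (ae_mono HK) => x Hx.
rewrite [leRHS]ger0_norm; last by rewrite !mulr_ge0 ?enorm_ge0.
apply: le_trans (dotv_le _ _) _; rewrite /= mulrA.
apply: ler_wpM2r; first exact: enorm_ge0.
apply: le_trans (opnormP _ _) _; apply: ler_wpM2r => //; exact: enorm_ge0.
Qed.

Lemma B_Omega_subM A A' : entries A -> entries A' ->
  B_Omega y z A - B_Omega y z A' = B_Omega y z (fun x => A x - A' x).
Proof.
move=> LA LA'; have I := B_Omega_integrand LA; have I' := B_Omega_integrand LA'.
rewrite /B_Omega -(RintB I I'); apply: eq_Rintegral => x _.
by rewrite mulmxBl !dotv2 !mxE; ring.
Qed.

Lemma B_Omega_linr (a : R) z' A : entries A -> W1_Omega r' z' ->
  B_Omega y (fun x => a * z x + z' x) A = a * B_Omega y z A + B_Omega y z' A.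
Proof.
move=> LA Wz'; have W := W1_Omega_lin a (ltW r'1) Wz Wz'.
have [_ w _] := W1_Omega_gr (ltW r'1) Wz; have [_ w' _] := W1_Omega_gr (ltW r'1) Wz'.
have Lz' := (W1_enorm r'1 Wz').1; have L := (W1_enorm r'1 W).1.
have LF := flux_Lfun2 r1 LA Ly.
have [I1 I2] := pairg_int r1 rr' LF Lz; have [J1 J2] := pairg_int r1 rr' LF Lz'.
have [K1 K2] := pairg_int r1 rr' LF L.
have aI1 := LfunZ a (lexx 1%E) I1; have aI2 := LfunZ a (lexx 1%E) I2.
apply: (etrans (B_Omega_pairg r1 rr' LA Ly L)); apply/esym.
have EB := B_Omega_pairg r1 rr' LA Ly Lz; have EB' := B_Omega_pairg r1 rr' LA Ly Lz'.
transitivity (a * pairg (flux A y) z + pairg (flux A y) z').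
  exact: (f_equal2 (fun s t : R => a * s + t) EB EB').
rewrite /pairg mulrDr addrACA -(RintZ a I1) -(RintZ a I2) -(RintD aI1 J1) -(RintD aI2 J2).
apply: (f_equal2 (fun s t : R => s + t)).
  apply: Rint_ae_eq; [exact: Lfun_meas (LfunD (lexx 1%E) aI1 J1)|exact: Lfun_meas K1|].
  have /ae_eqP g := gr_lin a 0 w w'; apply/ae_eqP; apply: (ae_mono g) => x ->; ring.
apply: Rint_ae_eq; [exact: Lfun_meas (LfunD (lexx 1%E) aI2 J2)|exact: Lfun_meas K2|].
have /ae_eqP g := gr_lin a 1 w w'; apply/ae_eqP; apply: (ae_mono g) => x ->; ring.
Qed.

(** [E] is linear and respects equality only up to null sets, so the form has to be insensitive to
    them. *)
Lemma B_Omega_aer z' A : entries A -> W1_Omega r' z' -> z = z' %[ae lO] ->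
  B_Omega y z A = B_Omega y z' A.
Proof.
move=> LA Wz' zz; have Lz' := (W1_enorm r'1 Wz').1.
have [_ w _] := W1_Omega_gr (ltW r'1) Wz; have [Lz0 _ _] := W1_Omega_gr (ltW r'1) Wz'.
have LF := flux_Lfun2 r1 LA Ly.
have [I1 I2] := pairg_int r1 rr' LF Lz; have [J1 J2] := pairg_int r1 rr' LF Lz'.
apply: (etrans (B_Omega_pairg r1 rr' LA Ly Lz)); apply/esym.
apply: (etrans (B_Omega_pairg r1 rr' LA Ly Lz')).
have g i := gr_ae i (Lfun_meas Lz0) zz w.
apply: (f_equal2 (fun s t : R => s + t)).
  apply: Rint_ae_eq; [exact: Lfun_meas J1|exact: Lfun_meas I1|].
  by have /ae_eqP g0 := g 0; apply/ae_eqP; apply: (ae_mono g0) => x ->.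
apply: Rint_ae_eq; [exact: Lfun_meas J2|exact: Lfun_meas I2|].
by have /ae_eqP g0 := g 1; apply/ae_eqP; apply: (ae_mono g0) => x ->.
Qed.

End FormBounds.

End OperatorNorm.

(** * Lipschitz dependence of the coefficient field *)

Section CoefficientAlgebra.
Context {R : realType}.
Implicit Types (g d h e s t : R).

(** The matrix [coefA gam x] as a function of the two numbers g = gamma(x_1) and d = gamma'(x_1)
    x_2; estimates for it become calculus in two real variables. *)
Definition cA g d : 'M[R]_2 :=
  \matrix_(i, j) if i != j then - d else if i == 0 then 1 + g else (1 + d ^+ 2) / (1 + g).

(** The derivative of [cA] at (g, d) in the direction (h, e). *)
Definition dcA g d h e : 'M[R]_2 :=
  \matrix_(i, j) if i != j then - e else if i == 0 then h
                 else 2 * d * e / (1 + g) - (1 + d ^+ 2) * h / (1 + g) ^+ 2.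

Lemma mxsum_diag (M : 'M[R]_2) (K : R) : M 0 0 = 0 -> M 0 1 = 0 -> M 1 0 = 0 -> `|M 1 1| <= K -> mxsum M <= K.
Proof. by move=> H1 H2 H3; rewrite /mxsum H1 H2 H3 !normr0 !add0r. Qed.

Lemma quotient_remainder G d h e t : G != 0 -> G + t * h != 0 ->
  (1 + (d + t * e) ^+ 2) / (G + t * h) - (1 + d ^+ 2) / G
    - t * (2 * d * e / G - (1 + d ^+ 2) * h / G ^+ 2) =
  t ^+ 2 * ((1 + d ^+ 2) * h ^+ 2 / (G ^+ 2 * (G + t * h)) - 2 * d * e * h / (G * (G + t * h))
    + e ^+ 2 / (G + t * h)).
Proof. by move=> G0 G'0; field; rewrite G0 G'0. Qed.

Lemma norm_div_le (x y K c : R) : `|x| <= K -> 0 < c -> c <= y -> `|x / y| <= K / c.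
Proof.
move=> xK c0 cy; have y0 : 0 < y by exact: lt_le_trans cy.
rewrite normrM (@ger0_norm _ y^-1) ?invr_ge0 ?(ltW y0)//.
by apply: ler_pM => //; rewrite ?invr_ge0 ?(ltW y0)// lef_pV2.
Qed.

Lemma sqr_norm_le (x K : R) : `|x| <= K -> x ^+ 2 <= K ^+ 2.
Proof. by move=> H; rewrite -real_normK ?num_real// lerXn2r// nnegrE (le_trans _ H). Qed.

(** Only the lower right entry is not affine. The bound 1/4 on |t| H keeps its denominator 1 + g + t
    h above 1/4, and 52 = 32 + 16 + 4 collects the three terms of [quotient_remainder]. *)
Lemma dcA_remainder g d h e t (H : R) : t != 0 -> `|d| <= 1 -> 2^-1 <= 1 + g -> `|h| <= H -> `|e| <= H ->
  `|t| * H <= 4^-1 ->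
  mxsum (t^-1 *: (cA (g + t * h) (d + t * e) - cA g d) - dcA g d h e) <= 52 * `|t| * H ^+ 2.
Proof.
move=> t0 d1 g1 hH eH tH; have H0 : 0 <= H by exact: le_trans hH.
apply: mxsum_diag; rewrite ?mxE/=.
- by rewrite opprD addrA; field.
- by field.
- by field.
set G := 1 + g in g1 *.
have th : `|t * h| <= 4^-1 by rewrite normrM; apply: le_trans tH; rewrite ler_wpM2l.
have G0 : 0 < G by apply: lt_le_trans g1; rewrite invr_gt0.
have G' : 4^-1 <= G + t * h by move: th; rewrite ler_norml => /andP[th1 _]; lra.
have G'0 : 0 < G + t * h by apply: lt_le_trans G'; rewrite invr_gt0.
rewrite (addrA 1 g) -/G.
have := @quotient_remainder G d h e t (lt0r_neq0 G0) (lt0r_neq0 G'0).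
set X := _ - _ / G; set Y := 2 * d * e / G - _; set Z := (1 + d ^+ 2) * h ^+ 2 / _ - _ + _ => E.
have -> : t^-1 * X - Y = t * Z.
  have -> : X = t ^+ 2 * Z + t * Y by rewrite -E subrK.
  by field.
rewrite normrM mulrAC [leRHS]mulrC ler_wpM2l//.
have d2 : d ^+ 2 <= 1 by have := sqr_norm_le d1; rewrite expr1n.
have h2 := sqr_norm_le hH; have e2 := sqr_norm_le eH.
have G2 : 2^-1 * 2^-1 * 4^-1 <= G ^+ 2 * (G + t * h).
  by rewrite expr2; apply: ler_pM => //; rewrite ?invr_ge0 ?mulr_ge0 ?invr_ge0//; apply: ler_pM; rewrite ?invr_ge0.
have GG' : 2^-1 * 4^-1 <= G * (G + t * h) by apply: ler_pM => //; rewrite invr_ge0.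
have dp := sqr_ge0 d; have hp := sqr_ge0 h; have ep := sqr_ge0 e.
have T1 : `|(1 + d ^+ 2) * h ^+ 2 / (G ^+ 2 * (G + t * h))| <= (2 * H ^+ 2) / (2^-1 * 2^-1 * 4^-1).
  apply: norm_div_le G2; last by rewrite !mulr_gt0 ?invr_gt0.
  rewrite ger0_norm; last by rewrite mulr_ge0// addr_ge0.
  by apply: ler_pM => //; [rewrite addr_ge0|lra].
have T2 : `|2 * d * e * h / (G * (G + t * h))| <= (2 * H ^+ 2) / (2^-1 * 4^-1).
  apply: norm_div_le GG'; last by rewrite mulr_gt0 ?invr_gt0.
  rewrite !normrM ger0_norm// -!mulrA ler_wpM2l// expr2.
  rewrite -[leRHS]mul1r; apply: ler_pM; [by []|by rewrite mulr_ge0|by []|exact: ler_pM].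
have T3 : `|e ^+ 2 / (G + t * h)| <= H ^+ 2 / 4^-1.
  by apply: norm_div_le G' => //; rewrite ger0_norm.
rewrite /Z; apply: le_trans (ler_normD _ _) _; apply: le_trans (lerD (ler_normB _ _) (lexx _)) _.
apply: le_trans (lerD (lerD T1 T2) T3) _.
by rewrite le_eqVlt; apply/orP; left; apply/eqP; field.
Qed.

Lemma dcAZ g d h e (c : R) : dcA g d (c * h) (c * e) = c *: dcA g d h e.
Proof.
apply/matrixP => i j; rewrite !mxE; case: ifP => _; first by rewrite mulrN.
by case: ifP => _ //; rewrite mulrBr; congr (_ - _); ring.
Qed.

(** The derivative bound is asked only at the n nodes of the subdivision: in the application it
    holds almost everywhere for each node, and finitely many exceptional sets can be discarded. Each
    step of length 1/n costs K / n and a remainder 52 H^2 / n^2. *)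
Lemma cA_increment_le g d h e (H K : R) n : (0 < n)%N ->
  (forall s, 0 <= s <= 1 -> `|d + s * e| <= 1 /\ 2^-1 <= 1 + (g + s * h)) ->
  `|h| <= H -> `|e| <= H -> n%:R^-1 * H <= 4^-1 ->
  (forall k, (k < n)%N -> opnorm (dcA (g + k%:R / n%:R * h) (d + k%:R / n%:R * e) h e) <= K) ->
  opnorm (cA (g + h) (d + e) - cA g d) <= K + 52 * H ^+ 2 / n%:R.
Proof.
move=> n0 Hs hH eH nH HK; have n0' : (0 : R) < n%:R by rewrite ltr0n.
have H0 : 0 <= H by exact: le_trans hH.
pose c k := cA (g + k%:R / n%:R * h) (d + k%:R / n%:R * e).
have step k : (k < n)%N -> opnorm (c k.+1 - c k) <= (K + 52 * H ^+ 2 / n%:R) / n%:R.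
  move=> kn; have [|dk gk] := Hs (k%:R / n%:R).
    by rewrite divr_ge0//= ler_pdivrMr// mul1r ler_nat ltnW.
  set gk' := g + _ in gk; set dk' := d + _ in dk.
  have E : c k.+1 = cA (gk' + n%:R^-1 * h) (dk' + n%:R^-1 * e).
    have nE : k.+1%:R / n%:R = k%:R / n%:R + n%:R^-1 :> R by rewrite -natr1 mulrDl mul1r.
    by rewrite /c /gk' /dk' nE !mulrDl !addrA.
  have nV0 : (n%:R : R)^-1 != 0 by rewrite invr_eq0 gt_eqF.
  have nVn : `|(n%:R : R)^-1| = n%:R^-1 by rewrite ger0_norm// invr_ge0 ltW.
  have := @dcA_remainder gk' dk' h e n%:R^-1 H nV0 dk gk hH eH; rewrite nVn => /(_ nH) rem.
  have dK := HK k kn.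
  have -> : c k.+1 - c k = n%:R^-1 *: ((n%:R^-1)^-1 *: (c k.+1 - c k) - dcA gk' dk' h e)
      + n%:R^-1 *: dcA gk' dk' h e.
    by rewrite scalerBr scalerA mulfV// scale1r subrK.
  apply: le_trans (opnormD _ _) _.
  apply: le_trans (lerD (opnormZ_le _ _) (opnormZ_le _ _)) _; rewrite nVn -mulrDr mulrC.
  rewrite ler_pM2r ?invr_gt0// addrC; apply: lerD; first exact: dK.
  apply: le_trans (opnorm_mxsum _) _; rewrite E; apply: le_trans rem _.
  by rewrite mulrAC.
have tel m : (m <= n)%N -> opnorm (c m - c 0%N) <= m%:R * ((K + 52 * H ^+ 2 / n%:R) / n%:R).
  elim: m => [|m IH] mn.
    by rewrite subrr mul0r; apply: opnorm_le => a _; rewrite mul0mx enorm0.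
  rewrite -natr1 mulrDl mul1r [leRHS]addrC.
  rewrite (_ : c m.+1 - c 0%N = (c m.+1 - c m) + (c m - c 0%N)); last by rewrite addrA subrK.
  have s1 := step m mn; have s2 := IH (ltnW mn).
  exact: le_trans (opnormD _ _) (lerD s1 s2).
have := tel n (leqnn n).
have -> (x : R) : n%:R * (x / n%:R) = x by rewrite mulrC divfK// gt_eqF.
have -> : c n = cA (g + h) (d + e) by rewrite /c divff ?gt_eqF// !mul1r.
have -> : c 0%N = cA g d by rewrite /c !mul0r !addr0.
exact.
Qed.

End CoefficientAlgebra.

(** * The coefficient field of a feasible function and its derivative *)

Section CoefficientField.
Context {R : realType}.
Notation lI := (@leb_I R).
Notation lO := (@leb_Omega R).
Notation RT := (measurableTypeR R).
Implicit Types (gam h : R -> R).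

(** The inverse is written with powers of |x|, which are measurable; at x = 0 both sides are 0. *)
Lemma measurable_invr : measurable_fun [set: RT] (fun x : RT => (x : R)^-1).
Proof.
rewrite (_ : (fun x => _) = (fun x : RT => x * ((`|x| `^ (-1)) * (`|x| `^ (-1))))).
  have m : measurable_fun [set: RT] (fun x : RT => `|x| `^ (-1)).
    apply: (@measurableT_comp _ _ _ _ _ _ (fun x : R => x `^ (-1))); first exact: measurable_powR.
    exact: normr_measurable.
  by apply: measurable_funM => //; exact: measurable_funM.
apply/funext => x; have [->|x0] := eqVneq x 0; first by rewrite invr0 mul0r.
rewrite powR_inv1// -invfM -expr2 real_normK ?num_real// expr2 invfM mulrA divff// mul1r.
by [].
Qed.

Lemma W10_bounds h : W10_I +oo%E h ->
  {ae lI, forall x, `|h x| <= nrm lI +oo%E (wderiv h) / 2} /\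
  {ae lI, forall x, `|wderiv h x| <= nrm lI +oo%E (wderiv h)}.
Proof.
move=> W; have [w Lw I0 /ae_eqP E] := W10_I_repr (leey _) W.
have B := Linfty_ae_bound Lw; split => //.
have Lw1 : wderiv h \in Lfun lI 1%E by case: w.
apply: (ae_mono E) => x ->; apply: le_trans (prim_half_bound x Lw1 I0) _.
rewrite ler_pM2r ?invr_gt0//; apply: nrm_le_ae_bound => //; first exact: Lfun_meas Lw1.
exact: nrm_ge0.
Qed.

Lemma ae_abs_snd : {ae lO, forall x, 0 < x.2 < 1}.
Proof.
by apply: (ae_snd (P := fun t => 0 < t < 1)); apply: (ae_mono ae_unit_itv) => t; rewrite /unit_itv/= in_itv.
Qed.

Lemma norm_mul_snd (a b K : R) : `|a| <= K -> 0 < b < 1 -> `|a * b| <= K.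
Proof.
move=> aK /andP[b0 b1]; rewrite normrM (gtr0_norm b0).
by apply: le_trans aK; rewrite ler_piMr// ltW.
Qed.

Lemma W10_bounds2 h (K := nrm lI +oo%E (wderiv h)) : W10_I +oo%E h ->
  {ae lO, forall x, `|h x.1| <= K / 2 /\ `|wderiv h x.1 * x.2| <= K}.
Proof.
move=> /W10_bounds[/ae_fst b1 /ae_fst b2]; apply: (ae_mono3 b1 b2 ae_abs_snd) => x h1 h2 h3.
by split => //; exact: norm_mul_snd.
Qed.

Lemma feasible_nrm gam : feasible gam -> nrm lI +oo%E (wderiv gam) <= 1.
Proof.
move=> [W F]; have [w Lw _ _] := W10_I_repr (leey _) W.
exact: (ae_bound_Linfty (Lfun_meas Lw) F ler01).2.
Qed.

Lemma feasibleP gam : W10_I +oo%E gam -> nrm lI +oo%E (wderiv gam) <= 1 -> feasible gam.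
Proof.
move=> W H; split => //; have [_ b] := W10_bounds W.
by apply: (ae_mono b) => x /le_trans; exact.
Qed.

(** The first bound keeps the denominator 1 + gamma of [coefA] above 1/2. *)
Lemma feasible_bounds gam : feasible gam ->
  {ae lO, forall x, `|gam x.1| <= 2^-1 /\ `|wderiv gam x.1 * x.2| <= 1}.
Proof.
move=> F; have N := feasible_nrm F; have B := W10_bounds2 F.1.
apply: (ae_mono B) => x [h1 h2]; split; last exact: le_trans N.
by apply: le_trans h1 _; rewrite ler_pdivrMr// mulVf.
Qed.

Lemma W10_meas gam : W10_I +oo%E gam ->
  measurable_fun [set: RT] (gam : RT -> R) /\ measurable_fun [set: RT] (wderiv gam : RT -> R).
Proof.
move=> W; have [[Lg Lw _] _ _ _] := W10_I_repr (leey _) W.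
by split; [exact: Lfun_meas Lg|exact: Lfun_meas Lw].
Qed.

Lemma entries_coefA gam : feasible gam -> entries (coefA gam).
Proof.
move=> F; have [mg mw] := W10_meas F.1; have B := feasible_bounds F.
have m1 : measurable_fun [set: RT * RT] (fun x : RT * RT => gam x.1).
  exact: (measurableT_comp mg measurable_fst).
have m2 : measurable_fun [set: RT * RT] (fun x : RT * RT => wderiv gam x.1 * x.2).
  by apply: measurable_funM; [exact: (measurableT_comp mw measurable_fst)|exact: measurable_snd].
have bd (f : RT * RT -> R) (C : R) : measurable_fun [set: RT * RT] f -> {ae lO, forall x, `|f x| <= C} ->
    0 <= C -> f \in Lfun lO +oo%E.
  by move=> mf Hf C0; exact: (ae_bound_Linfty mf Hf C0).1.
have m1g : measurable_fun [set: RT * RT] (fun x : RT * RT => 1 + gam x.1).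
  by apply: measurable_funD => //; exact: measurable_cst.
have E00 : (fun x => coefA gam x 0 0) \in Lfun lO +oo%E.
  rewrite (_ : (fun x => _) = (fun x => 1 + gam x.1)); last by apply/funext => x; rewrite mxE.
  apply: (bd _ 2) => //; apply: (ae_mono B) => x [h1 _].
  by apply: le_trans (ler_normD _ _) _; rewrite normr1; lra.
have Eoff : (fun x : R * R => - (wderiv gam x.1 * x.2)) \in Lfun lO +oo%E.
  apply: (bd _ 1) => //; first exact: measurableT_comp.
  by apply: (ae_mono B) => x [_ h2]; rewrite normrN.
have E01 : (fun x => coefA gam x 0 1) \in Lfun lO +oo%E.
  by rewrite (_ : (fun x => _) = (fun x => - (wderiv gam x.1 * x.2)))//; apply/funext => x; rewrite mxE.
have E10 : (fun x => coefA gam x 1 0) \in Lfun lO +oo%E.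
  by rewrite (_ : (fun x => _) = (fun x => - (wderiv gam x.1 * x.2)))//; apply/funext => x; rewrite mxE.
have E11 : (fun x => coefA gam x 1 1) \in Lfun lO +oo%E.
  rewrite (_ : (fun x => _) = (fun x => (1 + (wderiv gam x.1 * x.2) ^+ 2) / (1 + gam x.1))); last first.
    by apply/funext => x; rewrite mxE.
  apply: (bd _ (2 / 2^-1)).
  - apply: measurable_funM; last exact: (measurableT_comp measurable_invr m1g).
    by apply: measurable_funD; [exact: measurable_cst|exact: measurable_funM].
  - apply: (ae_mono B) => x [h1 h2]; apply: norm_div_le.
    + rewrite ger0_norm; last by rewrite addr_ge0// sqr_ge0.
      by have := sqr_norm_le h2; rewrite expr1n; lra.
    + by rewrite invr_gt0.
    + by move: h1; rewrite ler_norml => /andP[]; lra.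
  - by rewrite divr_ge0// invr_ge0.
apply: forall_ord2; apply: forall_ord2 => //.
Qed.

Lemma coefA_sym gam x i j : coefA gam x i j = coefA gam x j i.
Proof. by rewrite !mxE eq_sym; case: eqP => //= ->. Qed.

Lemma W10_Z (r : \bar R) (a : R) h : (1 <= r)%E -> W10_I r h -> W10_I r (fun x => a * h x).
Proof.
move=> r1 W; have := W10_I_lin (a - 1) r1 W W.
by congr W10_I; apply/funext => x; ring.
Qed.

Lemma is_wderiv_Z (a : R) h g : is_wderiv h g -> is_wderiv (fun x => a * h x) (fun x => a * g x).
Proof.
move=> w; have := is_wderiv_lin (a - 1) w w.
by congr is_wderiv; apply/funext => x; ring.
Qed.

(** An explicit candidate for [DA gam h], which is itself a choice without a formula. *)
Definition dA_field gam h (x : R * R) : 'M[R]_2 :=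
  dcA (gam x.1) (wderiv gam x.1 * x.2) (h x.1) (wderiv h x.1 * x.2).

Lemma is_wderivW h : W10_I +oo%E h -> is_wderiv h (wderiv h).
Proof. by move=> W; have [] := W10_I_repr (leey _) W. Qed.

Lemma coefA_dirderiv gam h : feasible gam -> W10_I +oo%E h -> is_dirderiv coefA gam h (dA_field gam h).
Proof.
move=> F Wh; set H := nrm lI +oo%E (wderiv h).
have H0 : 0 <= H by exact: nrm_ge0.
have rem (t : R) : t != 0 -> `|t| * H <= 4^-1 ->
    (Linfty_mx (fun x => t^-1 *: (coefA (gam \+ t \*o h) x - coefA gam x) - dA_field gam h x)%R
     <= (52 * `|t| * H ^+ 2)%:E)%E.
  move=> t0 tH; apply/Linfty_mxP; first by rewrite !mulr_ge0// sqr_ge0.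
  have /ae_eqP /ae_fst wE := wderiv_lin t (is_wderivW Wh) (is_wderivW F.1).
  apply: (ae_mono3 (W10_bounds2 Wh) (feasible_bounds F) wE) => x [h1 h2] [g1 d1] wx.
  apply: le_trans (opnorm_mxsum _) _.
  have -> : coefA (gam \+ t \*o h) x =
      cA (gam x.1 + t * h x.1) (wderiv gam x.1 * x.2 + t * (wderiv h x.1 * x.2)).
    rewrite -[LHS]/(cA _ _); congr cA.
    rewrite (_ : gam \+ t \*o h = (fun x => t * h x + gam x)); last first.
      by apply/funext => s /=; rewrite addrC.
    by rewrite wx mulrDl mulrA addrC.
  apply: dcA_remainder => //.
    by move: g1; rewrite ler_norml => /andP[]; lra.
  by apply: le_trans h1 _; rewrite ler_pdivrMr// ler_peMr// ler1n.
rewrite /is_dirderiv.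
apply: (@squeeze_cvge _ _ _ R (cst 0%E) _ (fun t => (52 * `|t| * H ^+ 2)%:E)).
(* This radius keeps |t| H below 1/4, as the remainder estimate requires; H may be 0. *)
- have H1 : 0 < 4^-1 / (H + 1) by rewrite divr_gt0 ?invr_gt0// ltr_wpDl.
  near=> t; rewrite Linfty_mx_ge0/=; apply: rem.
    by near: t; exact: nbhs_dnbhs_neq.
  have tH1 : `|t| <= 4^-1 / (H + 1).
    near: t; apply: dnbhs0_le; exact: H1.
  apply: le_trans (ler_wpM2r H0 tH1) _.
  by rewrite -mulrA ler_piMr ?invr_ge0// mulrC ler_pdivrMr ?mul1r ?lerDl// ltr_wpDl.
- exact: cvg_cst.
- apply/fine_cvgP; split; first exact: nearW.
  have c : 52 * `|t| * H ^+ 2 @[t --> (0 : R)^'] --> 52 * `|0 : R| * H ^+ 2.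
    apply: cvgM; last exact: cvg_cst.
    apply: cvgM; first exact: cvg_cst.
    by apply: cvg_norm; exact: nbhs_dnbhs.
  by move: c; rewrite normr0 mulr0 mul0r.
Unshelve. all: by end_near.
Qed.

(* Without a direction of unit norm the suprema in A_bound would be -oo, and
   A_bound would not bound the coefficient field. *)
Lemma unit_direction : exists2 h : R -> R, W10_I +oo%E h & semi_I +oo%E h = 1%E.
Proof.
(* The derivative of a tent function: slope 1 up to the midpoint and -1 after it. *)
pose g (t : R) : R := 2 * ((t <= 2^-1)%R)%:R - 1.
have mg : measurable_fun [set: RT] (g : RT -> R).
  by apply: measurable_funB => //; apply: measurable_funM => //; exact: measurable_le1.
have g1 t : `|g t| = 1.
  rewrite /g; case: (t <= _) => /=; rewrite ?mulr0 ?sub0r ?normrN ?normr1// mulr1.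
  by rewrite ger0_norm; lra.
have gb : {ae lI, forall t, `|g t| <= 1} by apply: nearW => t; rewrite g1.
have [Lg Ng] := ae_bound_Linfty mg gb ler01.
have L1 : (cst 1 : RT -> R) \in Lfun lI 1%E by exact: LI_cst_fin.
have I0 : \int[lI]_t g t = 0.
  have L2 := Lfun1_mul_le 2^-1 L1.
  transitivity (\int[lI]_t (2 * (cst 1 t * ((t <= 2^-1)%R)%:R) - cst 1 t)).
    by apply: eq_Rintegral => t _; rewrite /g mul1r.
  have L3 := LfunZ 2 (lexx 1%E) L2; rewrite (RintB L3 L1) (RintZ _ L2).
  have -> : \int[lI]_x (cst 1 x : R) = 1 by rewrite /Rintegral /= lI_cst.
  have -> : \int[lI]_t (cst 1 t * ((t <= 2^-1)%R)%:R) = 2^-1; last by rewrite divff ?subrr.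
  have d1 (x : R) : derivable (@id R) x 1 by exact: derivable_id.
  have e1 : derive1 (@id R) = cst 1 by apply/funext => x; rewrite derive1_id.
  have c1 : continuous (derive1 (@id R)) by rewrite e1 => x; exact: cvg_cst.
  have h0 : (0 : R) <= 2^-1 by rewrite invr_ge0.
  have h1 : (2^-1 : R) <= 1 by rewrite invf_le1// ler1n.
  have := FTC_lI d1 c1 (lexx 0) h0 h1; rewrite subr0 e1 => EF; apply: (etrans _ EF).
  apply: Rint_ae_eq.
  - exact: Lfun_meas L2.
  - by apply: measurable_funM => //; exact: measurable_indic.
  apply/ae_eqP; apply: (ae_mono2 (ae_neq 2^-1) ae_unit_itv) => t tx.
  rewrite /unit_itv/= in_itv/= => /andP[t0 _]; congr (_ * _%:R); apply: congr1.
  by apply/idP/idP; rewrite inE/= in_itv/= t0/=; [rewrite lt_neqAle tx|exact: ltW].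
have [W /ae_eqP E] := W10_I_prim (leey _) Lg I0.
exists (prim g) => //; have [w Lw _ _] := W10_I_repr (leey _) W.
rewrite /semi_I nrmE//; congr (_%:E).
have -> : nrm lI +oo%E (wderiv (prim g)) = nrm lI +oo%E g.
  by apply: (nrm_ae_eq (ltry 0) (Lfun_meas Lw) mg); apply/ae_eqP; exact: E.
apply/eqP; rewrite eq_le Ng/=.
have <- : nrm lI 1%E g = 1.
  by rewrite nrm1E /Rintegral (eq_integral (cst 1%E)) /= ?lI_cst// => t _; rewrite g1.
apply: nrm_le_ae_bound => //; [exact: Linfty_ae_bound|exact: nrm_ge0].
Qed.

Lemma zero_feasible : feasible (prim (cst 0 : R -> R)).
Proof.
have L0 : (cst 0 : RT -> R) \in Lfun lI +oo%E by apply: LfunC0; rewrite ltry.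
have [W /ae_eqP E] := W10_I_prim (leey _) L0 Rint_cst0.
by split => //; apply: (ae_mono E) => x ->; rewrite normr0.
Qed.

Section Bound.
Variable C_A : R.
Hypothesis hA : A_bound C_A.

(** A summand in the extended reals is bounded by the sum once the other summands are nonnegative;
    both suprema are, as they dominate a norm at a unit direction. *)
Lemma A_bound_coef_DA gam : feasible gam -> (Linfty_mx (coefA gam) <= C_A%:E)%E /\
  forall h, W10_I +oo%E h -> semi_I +oo%E h = 1%E -> (Linfty_mx (DA gam h) <= C_A%:E)%E.
Proof.
move=> F; have := hA F; set a := Linfty_mx _; set B := ereal_sup _; set C := ereal_sup _ => H.
have [h0 Wh0 s0] := unit_direction.
have a0 : (0 <= a)%E by exact: Linfty_mx_ge0.
have hB h : W10_I +oo%E h -> semi_I +oo%E h = 1%E -> (Linfty_mx (DA gam h) <= B)%E.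
  by move=> Wh sh; apply: ereal_sup_ubound; exists h.
have B0 : (0 <= B)%E by apply: le_trans (hB _ Wh0 s0); exact: Linfty_mx_ge0.
have C0 : (0 <= C)%E.
  apply: (@le_trans _ _ (Linfty_mx (D2A gam h0 h0))); first exact: Linfty_mx_ge0.
  by apply: ereal_sup_ubound; exists h0, h0; split.
split.
  by apply: le_trans H; rewrite -addeA leeDl// adde_ge0.
move=> h Wh sh; apply: le_trans (hB h Wh sh) _; apply: le_trans H.
by rewrite -addeA addeCA leeDl// adde_ge0.
Qed.

Lemma C_A_ge0 : 0 <= C_A.
Proof.
have [H _] := A_bound_coef_DA zero_feasible.
by rewrite -lee_fin; apply: le_trans H; exact: Linfty_mx_ge0.
Qed.

Lemma coefA_opnorm gam : feasible gam -> {ae lO, forall x, opnorm (coefA gam x) <= C_A}.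
Proof. by move=> /A_bound_coef_DA[H _]; apply/Linfty_mxP => //; exact: C_A_ge0. Qed.

(* DA is a chosen derivative, known only as a limit in the L^oo norm; comparing it
   with dA_field through a difference quotient costs eps. *)
Lemma dA_field_unit gam h (eps : R) : feasible gam -> W10_I +oo%E h -> semi_I +oo%E h = 1%E ->
  0 < eps -> {ae lO, forall x, opnorm (dA_field gam h x) <= C_A + eps}.
Proof.
move=> F Wh sh e0; have dD := coefA_dirderiv F Wh.
have dDA : is_dirderiv coefA gam h (DA gam h).
  by rewrite /DA /dirderiv; apply: (@xgetPex _ (cst 0) [set D | is_dirderiv coefA gam h D]); exists (dA_field gam h).
have e2 : 0 < eps / 2 by rewrite divr_gt0.
have small D : is_dirderiv coefA gam h D -> \forall t \near (0 : R)^',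
    (Linfty_mx (fun x => t^-1 *: (coefA (gam \+ t \*o h) x - coefA gam x) - D x)%R <= (eps / 2)%:E)%E.
  rewrite /is_dirderiv => /fine_cvgP[fin /cvgrPdist_le /(_ _ e2) c].
  near=> t; have ft : Linfty_mx (fun x => t^-1 *: (coefA (gam \+ t \*o h) x - coefA gam x) - D x)%R \is a fin_num.
    by near: t.
  rewrite -(fineK ft) lee_fin; apply: le_trans (ler_norm _) _; rewrite -normrN -sub0r.
  by near: t.
have [t [s1 s2]] : exists t : R,
    (Linfty_mx (fun x => t^-1 *: (coefA (gam \+ t \*o h) x - coefA gam x) - dA_field gam h x)%R <= (eps / 2)%:E)%E /\
    (Linfty_mx (fun x => t^-1 *: (coefA (gam \+ t \*o h) x - coefA gam x) - DA gam h x)%R <= (eps / 2)%:E)%E.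
  have S1 := small _ dD; have S2 := small _ dDA.
  have [t [s1 s2]] := filter_ex (filterI S1 S2).
  by exists t; split; [exact: s1|exact: s2].
have b1 := (Linfty_mxP _ (ltW e2)).1 s1; have b2 := (Linfty_mxP _ (ltW e2)).1 s2.
have b3 := (Linfty_mxP _ C_A_ge0).1 ((A_bound_coef_DA F).2 h Wh sh).
apply: (ae_mono3 b1 b2 b3) => x; set X := t^-1 *: _ => h1 h2 h3.
rewrite (_ : dA_field gam h x = (dA_field gam h x - X) + ((X - DA gam h x) + DA gam h x)); last first.
  by rewrite subrK subrK.
apply: le_trans (opnormD _ _) _; have := opnormD (X - DA gam h x) (DA gam h x).
have := opnorm_distC (dA_field gam h x) X.
set o1 := opnorm (dA_field gam h x - X); set o2 := opnorm (_ + DA gam h x); lra.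
Unshelve. all: by end_near.
Qed.

(** [A_bound] concerns unit directions only; the explicit field is homogeneous in h, so the general
    case follows by rescaling. *)
Lemma dA_field_le gam h (eps : R) : feasible gam -> W10_I +oo%E h -> 0 < nrm lI +oo%E (wderiv h) ->
  0 < eps -> {ae lO, forall x, opnorm (dA_field gam h x) <= (C_A + eps) * nrm lI +oo%E (wderiv h)}.
Proof.
move=> F Wh; set H := nrm _ _ _ => H0 e0.
pose h1 := fun x => H^-1 * h x; have W1 := W10_Z H^-1 (leey _) Wh : W10_I +oo%E h1.
have /ae_eqP E := wderivE (is_wderiv_Z H^-1 (is_wderivW Wh)).
have [_ Lw _ _] := W10_I_repr (leey _) Wh; have [_ Lw1 _ _] := W10_I_repr (leey _) W1.
have s1 : semi_I +oo%E h1 = 1%E.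
  rewrite /semi_I nrmE//; congr (_%:E).
  have LZ := LfunZ H^-1 (leey _) Lw.
  have -> : nrm lI +oo%E (wderiv h1) = nrm lI +oo%E (fun x => H^-1 * wderiv h x).
    by apply: (nrm_ae_eq (ltry 0) (Lfun_meas Lw1) (Lfun_meas LZ)); apply/ae_eqP; exact: E.
  by rewrite (nrmZ _ (leey _) Lw) ger0_norm ?invr_ge0 ?(ltW H0)// mulVf ?gt_eqF.
have B := dA_field_unit F W1 s1 e0.
apply: (ae_mono2 B (ae_fst E)) => x Bx Ex.
have -> : dA_field gam h x = H *: dA_field gam h1 x.
  rewrite /dA_field -dcAZ Ex /h1; congr dcA; first by rewrite mulrA divff ?gt_eqF ?mul1r.
  by rewrite mulrA mulrA divff ?gt_eqF ?mul1r.
by apply: le_trans (opnormZ_le _ _) _; rewrite gtr0_norm// mulrC ler_pM2r.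
Qed.

(** The W^1_oo distance, a metric up to null sets on functions with zero boundary values. The
    difference has the shape of the linearity lemmas. *)
Definition wdist gam1 gam2 : R := nrm lI +oo%E (wderiv (fun x => - 1 * gam2 x + gam1 x)).

Lemma norm_convex_le (s a b c : R) : 0 <= s -> s <= 1 -> `|a| <= c -> `|b| <= c ->
  `|a + s * (b - a)| <= c.
Proof.
move=> s0 s1 ha hb; rewrite (_ : a + _ = (1 - s) * a + s * b); last by ring.
apply: le_trans (ler_normD _ _) _.
rewrite !normrM (ger0_norm s0) (ger0_norm (_ : 0 <= 1 - s)) ?subr_ge0//.
rewrite [leRHS](_ : c = (1 - s) * c + s * c); last by ring.
by apply: lerD; apply: ler_wpM2l; rewrite ?subr_ge0.
Qed.

(* The segment from gam2 to gam1 is cut into n steps, each controlled by dA_field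
   up to a remainder which is quadratic in 1 / n. *)
Lemma coefA_lipschitz gam1 gam2 (eps : R) : feasible gam1 -> feasible gam2 -> 0 < eps ->
  {ae lO, forall x, opnorm (coefA gam1 x - coefA gam2 x) <= (C_A + eps) * wdist gam1 gam2}.
Proof.
move=> F1 F2 e0; set H := wdist _ _; pose h := fun x => - 1 * gam2 x + gam1 x.
have Wh : W10_I +oo%E h := W10_I_lin (- 1) (leey _) F2.1 F1.1.
have H0 : 0 <= H by exact: nrm_ge0.
have /ae_eqP/ae_fst E := wderiv_lin (- 1) (is_wderivW F2.1) (is_wderivW F1.1).
have B1 := feasible_bounds F1; have B2 := feasible_bounds F2; have Bh := W10_bounds2 Wh.
have cE x : wderiv h x.1 = - 1 * wderiv gam2 x.1 + wderiv gam1 x.1 ->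
    coefA gam1 x = cA (gam2 x.1 + h x.1) (wderiv gam2 x.1 * x.2 + wderiv h x.1 * x.2).
  by move=> Ex; rewrite -[LHS]/(cA _ _) Ex; congr cA; rewrite /h; ring.
(* At distance 0 there is no direction to normalize, but then the two fields agree almost
   everywhere. *)
have [H00|Hn0] := eqVneq H 0.
  apply: (ae_mono2 Bh E) => x [h1 h2] Ex; move: h1 h2; rewrite -/(wdist gam1 gam2) -/H H00 mul0r.
  rewrite !normr_le0 => /eqP h1 /eqP h2; rewrite mulr0 (cE x Ex) h1 h2 !addr0 subrr.
  by apply: opnorm_le => a _; rewrite mul0mx enorm0.
have Hp : 0 < H by rewrite lt_neqAle eq_sym Hn0.
have e2 : 0 < eps / 2 by rewrite divr_gt0.
(* The term 4 H makes H / n at most 1/4; the term 104 H / eps makes the accumulated remainder 52 H^2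
   / n at most (eps / 2) H. *)
pose n := (Num.trunc (4 * H + 104 * H / eps)).+1.
have nb : 4 * H + 104 * H / eps < n%:R by rewrite /n; apply: truncnS_gt.
have n0 : (0 : R) < n%:R by rewrite ltr0n.
have q0 : 0 <= 104 * H / eps by rewrite divr_ge0 ?mulr_ge0// ltW.
pose gk (k : nat) x := (k%:R / n%:R) * h x + gam2 x.
have gkF k : (k <= n)%N -> feasible (gk k).
  move=> kn; have s0 : 0 <= k%:R / n%:R :> R by rewrite divr_ge0.
  have s1 : k%:R / n%:R <= 1 :> R by rewrite ler_pdivrMr// mul1r ler_nat.
  split; first exact: W10_I_lin (leey _) Wh F2.1.
  have /ae_eqP Ek := wderiv_lin (k%:R / n%:R) (is_wderivW Wh) (is_wderivW F2.1).
  have /ae_eqP E' := wderiv_lin (- 1) (is_wderivW F2.1) (is_wderivW F1.1).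
  apply: (ae_mono2 (ae_mono2 Ek E' (fun x a b => conj a b)) (ae_mono2 F1.2 F2.2 (fun x a b => conj a b))).
  move=> x [-> ->] [a1 a2].
  by rewrite addrC mulN1r [- _ + _]addrC; exact: norm_convex_le.
(* The nodes are feasible functions, so the derivative bound holds at each of them off a null set;
   these sets are united over k. *)
have all_k : {ae lO, forall x, forall k, (k < n)%N ->
    opnorm (dcA (gam2 x.1 + k%:R / n%:R * h x.1) (wderiv gam2 x.1 * x.2 + k%:R / n%:R * (wderiv h x.1 * x.2))
      (h x.1) (wderiv h x.1 * x.2)) <= (C_A + eps / 2) * H}.
  apply: ae_foralln => k; have [kn|kn] := ltnP k n; last by apply: nearW.
  have D := dA_field_le (gkF k (ltnW kn)) Wh Hp e2.
  have /ae_eqP/ae_fst Ek := wderiv_lin (k%:R / n%:R) (is_wderivW Wh) (is_wderivW F2.1).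
  apply: (ae_mono2 D Ek) => x Dx Ex _; move: Dx; rewrite /dA_field Ex /gk.
  by rewrite mulrDl mulrA [_ + gam2 _]addrC [_ + wderiv gam2 _ * _]addrC.
have B12 := ae_mono2 B1 B2 (fun x a b => conj a b).
have BhE := ae_mono2 Bh E (fun x a b => conj a b).
apply: (ae_mono3 B12 BhE all_k) => x [[g1 d1] [g2 d2]] [[h1 h2] Ex] Hk.
rewrite (cE x Ex).
apply: (le_trans (@cA_increment_le _ _ _ _ _ H ((C_A + eps / 2) * H) n _ _ _ _ _ Hk)) => //.
- move=> s /andP[s0 s1]; have hE : h x.1 = gam1 x.1 - gam2 x.1 by rewrite /h; ring.
  have eE : wderiv h x.1 * x.2 = wderiv gam1 x.1 * x.2 - wderiv gam2 x.1 * x.2 by rewrite Ex; ring.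
  rewrite hE eE; split; first exact: norm_convex_le.
  have := norm_convex_le s0 s1 g2 g1; rewrite ler_norml => /andP[+ _].
  by rewrite -(lerD2l 1); apply: le_trans; rewrite [X in X - _]splitr mul1r addrK.
- by apply: le_trans h1 _; rewrite -/(wdist gam1 gam2) -/H ler_pdivrMr// ler_peMr// ler1n.
- by rewrite mulrC ler_pdivrMr// mulrC ler_pdivlMr// mulrC; apply: le_trans (ltW nb); rewrite lerDl.
- have T : 52 * H ^+ 2 / n%:R <= eps / 2 * H.
    have {}nb : 104 * H <= n%:R * eps.
      by rewrite -ler_pdivrMr//; apply: le_trans (ltW nb); rewrite lerDr mulr_ge0.
    rewrite ler_pdivrMr//; apply: le_trans (_ : H / 2 * (104 * H) <= _); last first.
      by rewrite [leRHS](_ : _ = H / 2 * (n%:R * eps)); [rewrite ler_wpM2l// divr_ge0|ring].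
    by rewrite [leRHS](_ : _ = 52 * H ^+ 2)//; field.
  by rewrite [leRHS](_ : _ = (C_A + eps / 2) * H + eps / 2 * H) ?lerD2l//; field.
Qed.

End Bound.

End CoefficientField.

(** * Contractions of the feasible set *)

Section EssentiallyBounded.
Context {R : realType}.
Notation lI := (@leb_I R).
Notation lO := (@leb_Omega R).
Notation RT := (measurableTypeR R).
Implicit Types (gam h g zeta : R -> R).

(** Off a single null set the countably many bounds of |f_m - f_n| by its norm hold at once, so the
    sequence converges uniformly there. *)
Lemma Linfty_complete (f_ : nat -> R -> R) : (forall n, f_ n \in Lfun lI +oo%E) ->
  (forall e, 0 < e -> exists N, forall m n, (N <= m)%N -> (N <= n)%N ->
    nrm lI +oo%E (f_ m \- f_ n) <= e) ->
  exists2 f, f \in Lfun lI +oo%E & forall e, 0 < e -> exists N, forall n, (N <= n)%N ->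
    nrm lI +oo%E (f_ n \- f) <= e.
Proof.
move=> Lf cau; have y1 : (1 <= +oo :> \bar R)%E by rewrite leey.
have LB m n := LfunB y1 (Lf m) (Lf n).
have H : {ae lI, forall x, forall m n, `|f_ m x - f_ n x| <= nrm lI +oo%E (f_ m \- f_ n)}.
  by apply: ae_foralln => m; apply: ae_foralln => n; exact: Linfty_ae_bound (LB m n).
pose f x := fine (limn_esup (fun k => (f_ k x)%:E)).
have mf : measurable_fun [set: RT] (f : RT -> R).
  apply: (measurableT_comp (fine_measurable measurableT)).
  apply: measurable_fun_limn_esup => n; apply/measurable_EFinP; exact: Lfun_meas (Lf n).
have cf : {ae lI, forall x, f_ k x @[k --> \oo] --> f x}.
  apply: (ae_mono H) => x Hx.
  have cv : cvgn (fun k => f_ k x).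
    apply/cauchy_cvgP; apply: cauchy_exP => e e0.
    have e2 : 0 < e / 2 by rewrite divr_gt0.
    have [N HN] := cau _ e2; exists (f_ N x); exists N => // n /= Nn.
    rewrite /ball/=; apply: le_lt_trans (Hx N n) _; apply: le_lt_trans (HN N n (leqnn N) Nn) _.
    by rewrite ltr_pdivrMr// ltr_pMr// ltr1n.
  have cE : ((f_ k x)%:E @[k --> \oo] --> (limn (fun k => f_ k x))%:E)%E.
    by apply: cvg_EFin => //; exact: nearW.
  by rewrite /f (cvg_limn_einf_sup cE).2.
have B e N : (forall m n, (N <= m)%N -> (N <= n)%N -> nrm lI +oo%E (f_ m \- f_ n) <= e) ->
    forall n, (N <= n)%N -> {ae lI, forall x, `|f_ n x - f x| <= e}.
  move=> HN n Nn; apply: (ae_mono2 H cf) => x Hx cx.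
  have c : `|f_ n x - f_ k x| @[k --> \oo] --> `|f_ n x - f x|.
    by apply: cvg_norm; apply: cvgB => //; exact: cvg_cst.
  apply: (cvgr_to_le c); exists N => // k /= Nk.
  by apply: le_trans (Hx n k) _; exact: HN.
have [N1 HN1] := cau 1 ltr01.
have mB n := measurable_funB (Lfun_meas (Lf n)) mf.
have [LD _] := ae_bound_Linfty (mB N1) (B _ _ HN1 N1 (leqnn N1)) ler01.
exists f.
  rewrite (_ : f = f_ N1 \- (f_ N1 \- f)); first exact: LfunB.
  by apply/funext => x /=; ring.
move=> e e0; have [N HN] := cau e e0; exists N => n Nn.
exact: (ae_bound_Linfty (mB n) (B _ _ HN n Nn) (ltW e0)).2.
Qed.

Lemma wdistE gam1 gam2 : W10_I +oo%E gam1 -> W10_I +oo%E gam2 ->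
  wdist gam1 gam2 = nrm lI +oo%E (wderiv gam1 \- wderiv gam2).
Proof.
move=> W1 W2; have y1 : (1 <= +oo :> \bar R)%E by rewrite leey.
have [_ L1 _ _] := W10_I_repr y1 W1; have [_ L2 _ _] := W10_I_repr y1 W2.
have [_ L _ _] := W10_I_repr y1 (W10_I_lin (- 1) y1 W2 W1).
have LB := LfunB y1 L1 L2.
have /ae_eqP E := wderiv_lin (- 1) (is_wderivW W2) (is_wderivW W1).
apply: (nrm_ae_eq (ltry 0) (Lfun_meas L) (Lfun_meas LB)).
by apply/ae_eqP; apply: (ae_mono E) => x -> /=; ring.
Qed.

Lemma wdist_ge0 gam1 gam2 : 0 <= wdist gam1 gam2. Proof. exact: nrm_ge0. Qed.

Lemma wdistC gam1 gam2 : W10_I +oo%E gam1 -> W10_I +oo%E gam2 ->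
  wdist gam1 gam2 = wdist gam2 gam1.
Proof.
move=> W1 W2; have y1 : (1 <= +oo :> \bar R)%E by rewrite leey.
have [_ L1 _ _] := W10_I_repr y1 W1; have [_ L2 _ _] := W10_I_repr y1 W2.
by rewrite (wdistE W1 W2) (wdistE W2 W1) (nrm_distC y1 L1 L2).
Qed.

Lemma wdist_triangle gam2 gam1 gam3 : W10_I +oo%E gam1 -> W10_I +oo%E gam2 -> W10_I +oo%E gam3 ->
  wdist gam1 gam3 <= wdist gam1 gam2 + wdist gam2 gam3.
Proof.
move=> W1 W2 W3; have y1 : (1 <= +oo :> \bar R)%E by rewrite leey.
have [_ L1 _ _] := W10_I_repr y1 W1; have [_ L2 _ _] := W10_I_repr y1 W2.
have [_ L3 _ _] := W10_I_repr y1 W3.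
rewrite (wdistE W1 W3) (wdistE W1 W2) (wdistE W2 W3); exact: nrm_dist_triangle y1 L1 L2 L3.
Qed.

Lemma wdist0_wderiv gam1 gam2 : W10_I +oo%E gam1 -> W10_I +oo%E gam2 ->
  wdist gam1 gam2 = 0 -> wderiv gam1 = wderiv gam2 %[ae lI].
Proof.
move=> W1 W2; have y1 : (1 <= +oo :> \bar R)%E by rewrite leey.
have [_ L1 _ _] := W10_I_repr y1 W1; have [_ L2 _ _] := W10_I_repr y1 W2.
rewrite (wdistE W1 W2) => d0; have /ae_eqP H := nrm_eq0 (ltry 0) (LfunB y1 L1 L2) d0.
by apply/ae_eqP; apply: (ae_mono H) => x /= /eqP; rewrite subr_eq0 => /eqP.
Qed.

Lemma wdist0_ae gam1 gam2 : W10_I +oo%E gam1 -> W10_I +oo%E gam2 ->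
  wdist gam1 gam2 = 0 -> gam1 = gam2 %[ae lI].
Proof.
move=> W1 W2 d0; have y1 : (1 <= +oo :> \bar R)%E by rewrite leey.
have [[_ L1 _] _ _ /ae_eqP E1] := W10_I_repr y1 W1; have [[_ L2 _] _ _ /ae_eqP E2] := W10_I_repr y1 W2.
have E x := prim_ae_eq x L1 L2 (wdist0_wderiv W1 W2 d0).
by apply/ae_eqP; apply: (ae_mono2 E1 E2) => x -> ->.
Qed.

(** Mean zero and the bound 1 on derivatives survive limits in L^oo. Two consecutive members near
    the limit are what the fixed point argument compares through T. *)
Lemma feasible_complete (gam_ : nat -> R -> R) : (forall n, feasible (gam_ n)) ->
  (forall e, 0 < e -> exists N, forall m n, (N <= m)%N -> (N <= n)%N ->
    wdist (gam_ m) (gam_ n) <= e) ->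
  exists2 gam, feasible gam & forall e, 0 < e -> exists n, wdist (gam_ n) gam <= e /\
    wdist (gam_ n.+1) gam <= e.
Proof.
move=> F cau; have y1 : (1 <= +oo :> \bar R)%E by rewrite leey.
have L n : wderiv (gam_ n) \in Lfun lI +oo%E by have [] := W10_I_repr y1 (F n).1.
have I0 n : \int[lI]_x wderiv (gam_ n) x = 0 by have [] := W10_I_repr y1 (F n).1.
have [h Lh Hh] : exists2 f, f \in Lfun lI +oo%E & forall e, 0 < e -> exists N, forall n, (N <= n)%N ->
    nrm lI +oo%E (wderiv (gam_ n) \- f) <= e.
  apply: (Linfty_complete L) => e /cau[N HN]; exists N => m n Nm Nn.
  by rewrite -(wdistE (F m).1 (F n).1); exact: HN.
have Lh1 := Linfty_Lfun (lexx 1%E) Lh.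
have h0 : \int[lI]_x h x = 0.
  apply/eqP; rewrite -normr_le0; apply/ler_addgt0Pr => e e0; rewrite add0r.
  have [N /(_ N (leqnn N)) HN] := Hh e e0.
  have L1 := Linfty_Lfun (lexx 1%E) (L N).
  have -> : \int[lI]_x h x = - \int[lI]_x (wderiv (gam_ N) x - h x).
    by rewrite (RintB L1 Lh1) I0 sub0r opprK.
  rewrite normrN; have LB := LfunB (lexx 1%E) L1 Lh1.
  apply: le_trans (le_norm_Rintegral LB) _; apply: le_trans HN.
  have LBy := LfunB y1 (L N) Lh.
  apply: nrm_le_ae_bound => //; [exact: Lfun_meas LB|exact: Linfty_ae_bound LBy|exact: nrm_ge0].
have [W /ae_eqP E] := W10_I_prim y1 Lh h0.
have [_ Lw _ _] := W10_I_repr y1 W.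
have nE n : wdist (gam_ n) (prim h) = nrm lI +oo%E (wderiv (gam_ n) \- h).
  rewrite (wdistE (F n).1 W); have LB := LfunB y1 (L n) Lw; have LB' := LfunB y1 (L n) Lh.
  apply: (nrm_ae_eq (ltry 0) (Lfun_meas LB) (Lfun_meas LB')).
  by apply/ae_eqP; apply: (ae_mono E) => x /= ->.
have h1 : nrm lI +oo%E h <= 1.
  apply/ler_addgt0Pr => e e0; have [N /(_ N (leqnn N)) HN] := Hh e e0.
  have LB := LfunB y1 (L N) Lh.
  have -> : nrm lI +oo%E h = nrm lI +oo%E (wderiv (gam_ N) \- (wderiv (gam_ N) \- h)).
    by congr nrm; apply/funext => x /=; ring.
  by apply: le_trans (nrmB y1 (L N) LB) _; apply: lerD => //; exact: feasible_nrm.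
exists (prim h).
  apply: feasibleP => //; rewrite (nrm_ae_eq (ltry 0) (Lfun_meas Lw) (Lfun_meas Lh))//.
  exact/ae_eqP.
move=> e e0; have [N HN] := Hh e e0; exists N; rewrite !nE.
by split; apply: HN.
Qed.

(** Banach's theorem for a pseudometric on functions. T may depend on the representative, so the
    conclusion is distance 0 rather than equality. *)
Lemma feasible_fixpoint (T : (R -> R) -> R -> R) (k : R) : 0 <= k < 1 ->
  (forall gam, feasible gam -> feasible (T gam)) ->
  (forall gam1 gam2, feasible gam1 -> feasible gam2 ->
    wdist (T gam1) (T gam2) <= k * wdist gam1 gam2) ->
  exists2 gam, feasible gam & wdist (T gam) gam = 0.
Proof.
move=> /andP[k0 k1] FT cT; pose gn n := iter n T (prim (cst 0 : R -> R)).
have F n : feasible (gn n) by elim: n => [|n IH]; [exact: zero_feasible|exact: FT].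
have gnS n : gn n.+1 = T (gn n) by [].
clearbody gn; have k1' : 0 < 1 - k by rewrite subr_gt0.
set D := wdist (gn 1%N) (gn 0%N); have D0 : 0 <= D by exact: wdist_ge0.
have step n : wdist (gn n.+1) (gn n) <= k ^+ n * D.
  elim: n => [|n IH]; first by rewrite expr0 mul1r.
  rewrite (gnS n.+1) {2}(gnS n).
  by apply: le_trans (cT _ _ (F n.+1) (F n)) _; rewrite exprS -mulrA ler_wpM2l.
have far n j : wdist (gn (n + j)%N) (gn n) <= k ^+ n * D / (1 - k).
  suff : wdist (gn (n + j)%N) (gn n) <= k ^+ n * D * (1 - k ^+ j) / (1 - k).
    move/le_trans; apply; rewrite ler_pM2r ?invr_gt0// ler_piMr ?mulr_ge0 ?exprn_ge0//.
    by rewrite lerBlDr lerDl exprn_ge0.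
  elim: j => [|j IH].
    rewrite addn0 expr0 subrr mulr0 mul0r (wdistE (F n).1 (F n).1).
    have [_ /Lfun_meas L _ _] := W10_I_repr (leey _) (F n).1.
    rewrite (ae0_nrm (ltry 0) (measurable_funB L L))//.
    by apply/ae_eqP; apply: nearW => x /=; rewrite subrr.
  rewrite addnS; apply: le_trans (wdist_triangle (F (n + j).+1).1 (F (n + j)%N).1 (F n).1) _.
  apply: le_trans (lerD (step _) IH) _.
  rewrite exprD exprS le_eqVlt; apply/orP; left; apply/eqP; field.
  by rewrite gt_eqF.
have cau e : 0 < e -> exists N, forall m n, (N <= m)%N -> (N <= n)%N -> wdist (gn m) (gn n) <= e.
  move=> e0; have c : k ^+ n * D / (1 - k) @[n --> \oo] --> 0.
    have c0 : k ^+ n @[n --> \oo] --> 0 by apply: cvg_expr; rewrite ger0_norm.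
    have c1 : k ^+ n * (D / (1 - k)) @[n --> \oo] --> 0 * (D / (1 - k)).
      by apply: cvgM => //; exact: cvg_cst.
    rewrite mul0r in c1; rewrite (_ : (fun n => _) = (fun n => k ^+ n * (D / (1 - k))))//.
    by apply/funext => n; rewrite mulrA.
  have [N _ HN] := nrm_cvg0_small e0 c; exists N.
  have H n j : (N <= n)%N -> wdist (gn (n + j)%N) (gn n) <= e.
    by move=> Nn; apply: le_trans (far n j) (HN n Nn).
  move=> m n Nm Nn; have [mn|nm] := leqP m n.
    by rewrite (wdistC (F m).1 (F n).1) -(subnKC mn); exact: H.
  by rewrite -(subnKC (ltnW nm)); exact: H.
have [gam Fg Hg] := feasible_complete F cau.
exists gam => //; apply/eqP; rewrite eq_le wdist_ge0 andbT.
apply/ler_addgt0Pr => e e0; rewrite add0r; have e2 : 0 < e / 2 by rewrite divr_gt0.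
have [n [H1 H2]] := Hg _ e2.
apply: le_trans (wdist_triangle (FT _ Fg).1 (F n.+1).1 Fg.1) _.
rewrite [leRHS]splitr lerD//.
rewrite gnS; apply: le_trans (cT gam (gn n) Fg (F n)) _; rewrite (wdistC Fg.1 (F n).1).
apply: le_trans (ler_wpM2l k0 H1) _; by rewrite ler_piMl ?ltW.
Qed.

End EssentiallyBounded.

(** * Arithmetic of the constants *)

Section Constants.
Variable R : realType.
Implicit Types a b c d e C D Y Z : R.

(** Removes the eps which [coefA_lipschitz] adds to C_A. The factor D Y Z may vanish, hence the
    tolerance e / (D Y Z + 1). *)
Lemma le_eps_limit b C D Y Z : 0 <= D -> 0 <= Y -> 0 <= Z ->
  (forall e, 0 < e -> b <= (C + e) * D * Y * Z) -> b <= C * D * Y * Z.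
Proof.
move=> D0 Y0 Z0 H; have P0 : 0 <= D * Y * Z by rewrite !mulr_ge0.
have P1 : 0 < D * Y * Z + 1 by rewrite ltr_wpDl.
apply/ler_addgt0Pr => e e0; have e1 : 0 < e / (D * Y * Z + 1) by rewrite divr_gt0.
apply: le_trans (H _ e1) _.
have -> : (C + e / (D * Y * Z + 1)) * D * Y * Z = C * D * Y * Z + e * (D * Y * Z / (D * Y * Z + 1)).
  by ring.
by rewrite lerD2l ler_piMr ?(ltW e0)// ler_pdivrMr// mul1r lerDl.
Qed.

Lemma le_chain b C Y Z X N : 0 <= C -> 0 <= Y -> 0 <= Z -> b <= C * Y * Z -> Y <= X -> Z <= N ->
  b <= C * X * N.
Proof.
move=> C0 Y0 Z0 H YX ZN; apply: le_trans H _; apply: ler_pM => //; first exact: mulr_ge0.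
exact: ler_wpM2l.
Qed.

Lemma le_add_chain b c C D Y1 Y2 Z X1 X2 N : 0 <= C -> 0 <= D -> 0 <= Y1 -> 0 <= Y2 -> 0 <= Z ->
  `|b| <= C * Y1 * Z -> `|c| <= C * D * Y2 * Z -> Y1 <= X1 -> Y2 <= X2 -> Z <= N ->
  `|b + c| <= (C * X1 + C * D * X2) * N.
Proof.
move=> C0 D0 Y10 Y20 Z0 Hb Hc H1 H2 ZN; apply: le_trans (ler_normD _ _) _; rewrite mulrDl.
apply: lerD; first exact: le_chain Hb H1 ZN.
by apply: le_chain Hc H2 ZN => //; exact: mulr_ge0.
Qed.

Lemma lin_sub a b c d e : a * b + c - (a * d + e) = a * (b - d) + (c - e).
Proof. by ring. Qed.

Lemma sub_swap a b c d : a + b = c + d -> a - c = - (b - d).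
Proof. by move=> H; rewrite (_ : a = c + d - b); [ring|rewrite -H addrK]. Qed.

Lemma const1 a b c d e : a * (b * c) * (d * e) = d * a * b * c * e.
Proof. by ring. Qed.

(** The first summand is the change of y, the second the direct change of A; the second factor 1 +
    beta C_A arises from adding them. *)
Lemma const2 (C b D W N CE : R) :
  (C * (b * (C * D * ((1 + b * C) * W))) + C * D * ((1 + b * C) * W)) * (CE * N) =
  CE * C * (1 + b * C) ^+ 2 * W * D * N.
Proof. by ring. Qed.

End Constants.

(** * The state system *)

Section StateSystem.
Context {R : realType}.
Notation lI := (@leb_I R).
Notation lO := (@leb_Omega R).
Notation RT := (measurableTypeR R).
Implicit Types (gam h g zeta u : R -> R) (y z : R * R -> R).

Variables (kappa C_A alpha beta p q C_E : R).
Variables (E : (R -> R) -> R * R -> R) (v : R * R -> R).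
Hypotheses (kappa0 : 0 < kappa) (hA : A_bound C_A) (alpha0 : 0 < alpha) (beta0 : 0 < beta).
Hypothesis hGamma : infsup_Gamma kappa alpha.
Hypotheses (p1 : 1 < p) (pq : p^-1 + q^-1 = 1).
Hypothesis isp : forall gam, feasible gam -> infsup beta (coefA gam) p q.
Hypothesis isq : forall gam, feasible gam -> infsup beta (coefA gam) q p.
Hypotheses (hE : is_extension q C_E E) (hCE : 1 <= C_E) (hv : W1_Omega p v).

Let q1 : 1 < q. Proof. exact: (conjp_fin p1 pq).2. Qed.
Let CA0 : 0 <= C_A. Proof. exact: C_A_ge0 hA. Qed.
Let one_y : (1 <= +oo :> \bar R)%E. Proof. by rewrite leey. Qed.
Let CE0 : 0 <= C_E. Proof. exact: le_trans hCE. Qed.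

Let V := nrmg p v.
Let V0 : 0 <= V. Proof. exact: nrmg_ge0. Qed.

Let W10q z : W10_Omega q z -> W1_Omega q z. Proof. by case. Qed.
Let grq z : W1_Omega q z -> forall i, gr z i \in Lfun lO q%:E.
Proof. by move=> W; have [] := W1_Omega_gr (ltW q1) W. Qed.

Let ent gam : feasible gam -> entries (coefA gam). Proof. exact: entries_coefA. Qed.

Lemma W1_addv y : W1_Omega p y -> W1_Omega p (y \+ v).
Proof.
move=> W; have := W1_Omega_lin 1 (ltW p1) W hv.
by congr W1_Omega; apply/funext => x /=; rewrite mul1r.
Qed.

Definition Ostate gam y := W10_Omega p y /\
  forall z, W10_Omega q z -> B_Omega (y \+ v) z (coefA gam) = 0.

Lemma Ostate_ex gam : feasible gam -> exists y, Ostate gam y.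
Proof.
move=> F; have [y Wy Hy] := solve_Omega p1 pq (ltW beta0) (ent F) (coefA_sym gam) (isp F) (isq F) hv.
by exists y.
Qed.

Lemma B_coefA_le gam y z : feasible gam -> W1_Omega p y -> W1_Omega q z ->
  `|B_Omega y z (coefA gam)| <= C_A * nrmg p y * nrmg q z.
Proof. by move=> F Wy Wz; exact: (B_Omega_le p1 pq Wy Wz (ent F) CA0 (coefA_opnorm hA F)). Qed.

Lemma entries_sub gam1 gam2 : feasible gam1 -> feasible gam2 ->
  entries (fun x => coefA gam1 x - coefA gam2 x).
Proof.
move=> /ent L1 /ent L2 i j; have LB := LfunB one_y (L1 i j) (L2 i j).
rewrite (_ : (fun x => _) = (fun x => coefA gam1 x i j) \- (fun x => coefA gam2 x i j))//.
by apply/funext => x; rewrite [LHS]mxE; congr (_ + _); rewrite [LHS]mxE.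
Qed.

Lemma B_coefA_diff_le gam1 gam2 y z : feasible gam1 -> feasible gam2 -> W1_Omega p y -> W1_Omega q z ->
  `|B_Omega y z (coefA gam1) - B_Omega y z (coefA gam2)| <=
    C_A * wdist gam1 gam2 * nrmg p y * nrmg q z.
Proof.
move=> F1 F2 Wy Wz; have -> := B_Omega_subM p1 pq Wy Wz (ent F1) (ent F2).
apply: (le_eps_limit (wdist_ge0 _ _) (nrmg_ge0 _ _) (nrmg_ge0 _ _)) => e e0.
have K0 := mulr_ge0 (addr_ge0 CA0 (ltW e0)) (wdist_ge0 gam1 gam2).
exact: (B_Omega_le p1 pq Wy Wz (entries_sub F1 F2) K0 (coefA_lipschitz hA F1 F2 e0)).
Qed.

(** The equation says that y has the load - B(v, .), of size C_A |v|; the inf-sup condition gives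
    beta C_A |v|, and v itself adds |v|. *)
Lemma Ostate_le gam y : feasible gam -> Ostate gam y -> nrmg p (y \+ v) <= (1 + beta * C_A) * V.
Proof.
move=> F [Wy Hy]; have Wyv := W1_addv Wy.1.
have H : nrmg p y <= beta * (C_A * V).
  apply: (isp F Wy (mulr_ge0 CA0 V0)) => z Wz; have Wz1 := W10q Wz.
  have := B_Omega_linl p1 pq (ent F) (- 1) hv Wyv (grq Wz1).
  rewrite (_ : (fun x => _) = y); last by apply/funext => x /=; ring.
  move=> ->; rewrite (Hy z Wz) addr0 mulN1r; apply: le_trans (ler_norm _) _; rewrite normrN.
  exact: (B_coefA_le F hv Wz1).
apply: le_trans (nrmg_add p1 Wy.1 hv) _.
rewrite [leRHS](_ : _ = beta * (C_A * V) + V); first exact: (lerD H (lexx V)).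
ring.
Qed.

Definition ydiff y1 y2 : R * R -> R := fun x => - 1 * y2 x + y1 x.

Lemma B_ydiff y1 y2 z A : entries A -> W1_Omega p y1 -> W1_Omega p y2 -> W1_Omega q z ->
  B_Omega (ydiff y1 y2) z A = B_Omega (y1 \+ v) z A - B_Omega (y2 \+ v) z A.
Proof.
move=> LA W1 W2 Wz; have := B_Omega_linl p1 pq LA (- 1) (W1_addv W2) (W1_addv W1) (grq Wz).
rewrite (_ : (fun x => _) = ydiff y1 y2); last by apply/funext => x; rewrite /ydiff /=; ring.
by move=> ->; rewrite mulN1r addrC.
Qed.

(** In the form with A[gam1], the load of y1 - y2 is - B(y2 + v, .; A[gam1]). Subtracting the
    equation for y2 leaves only the difference of the coefficients, tested on y2 + v. *)
Lemma Ostate_diff gam1 gam2 y1 y2 : feasible gam1 -> feasible gam2 -> Ostate gam1 y1 -> Ostate gam2 y2 ->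
  nrmg p (ydiff y1 y2) <= beta * (C_A * wdist gam1 gam2 * ((1 + beta * C_A) * V)).
Proof.
move=> F1 F2 S1 S2; have [Wy1 H1] := S1; have [Wy2 H2] := S2.
have N2 := Ostate_le F2 S2.
have D0 := mulr_ge0 CA0 (wdist_ge0 gam1 gam2).
have K1 : 0 <= (1 + beta * C_A) * V := mulr_ge0 (addr_ge0 ler01 (mulr_ge0 (ltW beta0) CA0)) V0.
apply: (isp F1 (W10_Omega_lin (- 1) (ltW p1) Wy2 Wy1) (mulr_ge0 D0 K1)) => z Wz; have Wz1 := W10q Wz.
have E1 := B_ydiff (ent F1) Wy1.1 Wy2.1 Wz1; rewrite (H1 z Wz) sub0r in E1.
have H := B_coefA_diff_le F1 F2 (W1_addv Wy2.1) Wz1; rewrite (H2 z Wz) subr0 in H.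
apply: le_trans (ler_norm _) _; rewrite [X in `|X|]E1 normrN.
exact: (le_chain D0 (nrmg_ge0 _ _) (nrmg_ge0 _ _) H N2 (lexx _)).
Qed.

Lemma E_W1 zeta : W10_I 1%E zeta -> W1_Omega q (E zeta) /\ nrmg q (E zeta) <= C_E * nrm lI 1%E (wderiv zeta).
Proof.
move=> Wz; have [/(_ zeta Wz)[W _ H] _ _] := hE; split => //.
have [_ Lw _ _] := W10_I_repr (lexx 1%E) Wz.
by move: H; rewrite (semi_OmegaE (ltW q1) W) /semi_I (nrmE Lw) -EFinM lee_fin.
Qed.

Definition Gfun gam y zeta : R := B_Omega (y \+ v) (E zeta) (coefA gam).

Lemma Gfun_le gam y zeta : feasible gam -> Ostate gam y -> W10_I 1%E zeta ->
  `|Gfun gam y zeta| <= C_E * C_A * (1 + beta * C_A) * V * nrm lI 1%E (wderiv zeta).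
Proof.
move=> F S Wz; have [WE nE] := E_W1 Wz; have N := Ostate_le F S.
have H := B_coefA_le F (W1_addv S.1.1) WE.
have := le_chain CA0 (nrmg_ge0 _ _) (nrmg_ge0 _ _) H N nE.
by rewrite const1.
Qed.

Lemma Gfun_diff gam1 gam2 y1 y2 zeta : feasible gam1 -> feasible gam2 -> Ostate gam1 y1 -> Ostate gam2 y2 ->
  W10_I 1%E zeta -> `|Gfun gam1 y1 zeta - Gfun gam2 y2 zeta| <=
    C_E * C_A * (1 + beta * C_A) ^+ 2 * V * wdist gam1 gam2 * nrm lI 1%E (wderiv zeta).
Proof.
move=> F1 F2 S1 S2 Wz; have [WE nE] := E_W1 Wz; have N2 := Ostate_le F2 S2.
have Nd := Ostate_diff F1 F2 S1 S2.
have Wd : W1_Omega p (ydiff y1 y2) := W1_Omega_lin (- 1) (ltW p1) S2.1.1 S1.1.1.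
(* First y changes with A[gam1] kept, then A changes with y2 kept. *)
have -> : Gfun gam1 y1 zeta - Gfun gam2 y2 zeta = B_Omega (ydiff y1 y2) (E zeta) (coefA gam1) +
    (B_Omega (y2 \+ v) (E zeta) (coefA gam1) - B_Omega (y2 \+ v) (E zeta) (coefA gam2)).
  by rewrite (B_ydiff (ent F1) S1.1.1 S2.1.1 WE) addrA subrK.
have T1 := B_coefA_le F1 Wd WE; have T2 := B_coefA_diff_le F1 F2 (W1_addv S2.1.1) WE.
have := le_add_chain CA0 (wdist_ge0 _ _) (nrmg_ge0 _ _) (nrmg_ge0 _ _) (nrmg_ge0 _ _) T1 T2 Nd N2 nE.
by rewrite const2.
Qed.

Lemma infsup_GammaP gam (K : R) : W10_I +oo%E gam -> 0 <= K ->
  (forall zeta, W10_I 1%E zeta -> B_Gamma kappa gam zeta <= K * nrm lI 1%E (wderiv zeta)) ->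
  nrm lI +oo%E (wderiv gam) <= alpha * K.
Proof.
move=> W K0 H; have [_ Lw _ _] := W10_I_repr one_y W.
have := hGamma.1 gam W; rewrite /semi_I (nrmE Lw); move=> /le_trans Hs.
rewrite -lee_fin; apply: Hs; rewrite EFinM lee_wpmul2l ?lee_fin ?(ltW alpha0)//.
apply: ub_ereal_sup => _ [zeta [Wz _] <-]; rewrite lee_fin.
have := H zeta Wz; rewrite -/(nrm lI 1%E (wderiv zeta)); set N := nrm _ _ _ => HN.
(* For a vanishing seminorm the quotient is 0, because the inverse of 0 is 0. *)
have [N0|N0] := eqVneq N 0; first by rewrite N0 invr0 mulr0.
rewrite ler_pdivrMr// lt_neqAle eq_sym N0; exact: nrm_ge0.
Qed.

(** On the unit interval |zeta| is at most the L^1 norm of zeta', hence so is its L^2 norm. No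
    constant appears, which matches the radius theta1 / alpha of the controls. *)
Lemma u_int_le u zeta : u \in Lfun lI 2%:E -> W10_I 1%E zeta ->
  (fun x => u x * zeta x) \in Lfun lI 1%E /\
  `|\int[lI]_x (u x * zeta x)| <= nrm lI 2%:E u * nrm lI 1%E (wderiv zeta).
Proof.
move=> Lu Wz; have [[Lz Lw _] _ I0 /ae_eqP Ez] := W10_I_repr (lexx 1%E) Wz.
have N0 : 0 <= nrm lI 1%E (wderiv zeta) by exact: nrm_ge0.
have bz : {ae lI, forall x, `|zeta x| <= nrm lI 1%E (wderiv zeta)}.
  by apply: (ae_mono Ez) => x ->; exact: prim_bound.
have two1 : (1 <= 2%:E :> \bar R)%E by rewrite lee_fin ler1n.
have Lz2 : zeta \in Lfun lI 2%:E := bounded_Lfun (@leb_I_fin R) two1 (Lfun_meas Lz) bz.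
have c2 : conjp (2%:E : \bar R) 2%:E.
  have h2 : (2 : R)^-1 + 2^-1 = 1 by field.
  have l2 : (1 : R) < 2 by rewrite ltr1n.
  exact: (conjp_fin l2 h2).1.
have [L _] := hoelderR c2 Lu Lz2; split; first exact: L.
apply: le_trans (hoelder_int c2 Lu Lz2) _; rewrite ler_wpM2l ?nrm_ge0//.
exact: (nrm_le_ae_bound two1 (Lfun_meas Lz) bz).
Qed.

Definition Gload u gam y zeta : R := \int[lI]_x (u x * zeta x) - Gfun gam y zeta.

Section Load.
Variables (u gam : R -> R) (y : R * R -> R).
Hypotheses (Lu : u \in Lfun lI 2%:E) (F : feasible gam) (S : Ostate gam y).

Let K := nrm lI 2%:E u + C_E * C_A * (1 + beta * C_A) * V.

Lemma Gload_bound_ge0 : 0 <= K.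
Proof. by rewrite addr_ge0 ?nrm_ge0// !mulr_ge0// addr_ge0// mulr_ge0// ltW. Qed.

Lemma Gload_le zeta : W10_I 1%E zeta -> `|Gload u gam y zeta| <= K * nrm lI 1%E (wderiv zeta).
Proof.
move=> Wz; have [_ B1] := u_int_le Lu Wz; have B2 := Gfun_le F S Wz.
by apply: le_trans (ler_normB _ _) _; rewrite /K mulrDl; exact: lerD.
Qed.

Lemma Gload_lin (a : R) zeta1 zeta2 : W10_I 1%E zeta1 -> W10_I 1%E zeta2 ->
  Gload u gam y (fun t => a * zeta1 t + zeta2 t) = a * Gload u gam y zeta1 + Gload u gam y zeta2.
Proof.
move=> W1 W2; have W := W10_I_lin a (lexx 1%E) W1 W2.
have [WE1 _] := E_W1 W1; have [WE2 _] := E_W1 W2; have [WE _] := E_W1 W.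
have [_ _ Elin] := hE; have Eae := Elin a _ _ W1 W2.
have Wyv := W1_addv S.1.1.
have WL := W1_Omega_lin a (ltW q1) WE1 WE2.
have EG : Gfun gam y (fun t => a * zeta1 t + zeta2 t) = a * Gfun gam y zeta1 + Gfun gam y zeta2.
  apply: (etrans (B_Omega_aer p1 pq Wyv WE (ent F) WL Eae)).
  exact: (B_Omega_linr p1 pq Wyv WE1 a (ent F) WE2).
have [L1 _] := u_int_le Lu W1; have [L2 _] := u_int_le Lu W2.
have Ei : \int[lI]_x (u x * (a * zeta1 x + zeta2 x)) = a * \int[lI]_x (u x * zeta1 x) + \int[lI]_x (u x * zeta2 x).
  have aL1 := LfunZ a (lexx 1%E) L1; rewrite -(RintZ a L1) -(RintD aL1 L2).
  by apply: eq_Rintegral => x _; ring.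
by rewrite /Gload EG Ei; exact: lin_sub.
Qed.

Lemma Gload_ae zeta1 zeta2 : W10_I 1%E zeta1 -> W10_I 1%E zeta2 -> zeta1 = zeta2 %[ae lI] ->
  Gload u gam y zeta1 = Gload u gam y zeta2.
Proof.
move=> W1 W2 zz; have [WE1 _] := E_W1 W1; have [WE2 _] := E_W1 W2.
have [_ Eae _] := hE; have Wyv := W1_addv S.1.1.
have EG : Gfun gam y zeta1 = Gfun gam y zeta2.
  exact: (B_Omega_aer p1 pq Wyv WE1 (ent F) WE2 (Eae _ _ W1 W2 zz)).
rewrite /Gload EG; congr (_ - _); have [L1 _] := u_int_le Lu W1; have [L2 _] := u_int_le Lu W2.
apply: Rint_ae_eq; [exact: Lfun_meas L1|exact: Lfun_meas L2|].
by move/ae_eqP: zz => zz; apply/ae_eqP; apply: (ae_mono zz) => x ->.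
Qed.

(** The load is a functional of zeta', which ranges over mean-zero functions only. Subtracting the
    mean extends it to all of L^1 at the price of a factor 2 in its bound; Riesz gives h in L^oo,
    and gamma' = h / kappa. *)
Lemma solve_Gamma : exists2 gam', W10_I +oo%E gam' &
  forall zeta, W10_I 1%E zeta -> B_Gamma kappa gam' zeta = Gload u gam y zeta.
Proof.
have e1 := lexx (1 : \bar R)%E.
pose c (g : R -> R) := \int[lI]_t g t.
pose g0 (g : R -> R) := fun t => - c g * cst 1 t + g t.
have L1 : (cst 1 : RT -> R) \in Lfun lI 1%E by exact: LI_cst_fin.
have I1 : \int[lI]_x (cst 1 x : R) = 1 by rewrite /Rintegral /= lI_cst.
have Lg0 g : g \in Lfun lI 1%E -> g0 g \in Lfun lI 1%E.
  by move=> Lg; exact: LfunD e1 (LfunZ _ e1 L1) Lg.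
have Ig0 g : g \in Lfun lI 1%E -> \int[lI]_t g0 g t = 0.
  move=> Lg; have LZ := LfunZ (- c g) e1 L1.
  by rewrite (RintD LZ Lg) (RintZ _ L1) I1 mulr1 addNr.
have Wg g : g \in Lfun lI 1%E -> W10_I 1%E (prim (g0 g)) /\ wderiv (prim (g0 g)) = g0 g %[ae lI].
  by move=> Lg; exact: W10_I_prim e1 (Lg0 g Lg) (Ig0 g Lg).
have nw g : g \in Lfun lI 1%E -> nrm lI 1%E (wderiv (prim (g0 g))) = nrm lI 1%E (g0 g).
  move=> Lg; have [W Eg] := Wg g Lg; have [_ Lw _ _] := W10_I_repr e1 W.
  exact: (nrm_ae_eq lte01 (Lfun_meas Lw) (Lfun_meas (Lg0 g Lg)) Eg).
pose L g := Gload u gam y (prim (g0 g)).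
have Llin (a : R) g g' : g \in Lfun lI 1%E -> g' \in Lfun lI 1%E ->
    L (fun t => a * g t + g' t) = a * L g + L g'.
  move=> Lg Lg'; rewrite /L -Gload_lin; [|exact: (Wg g Lg).1|exact: (Wg g' Lg').1].
  congr (Gload _ _ _ _); apply/funext => x; rewrite -(prim_lin a x (Lg0 g Lg) (Lg0 g' Lg')).
  congr prim; apply/funext => t; have LZ := LfunZ a e1 Lg.
  by rewrite /g0 /c (RintD LZ Lg') (RintZ _ Lg); ring.
have Lbnd g : g \in Lfun lI 1%E -> `|L g| <= K * 2 * nrm lI 1%E g.
  move=> Lg; apply: le_trans (Gload_le (Wg g Lg).1) _; rewrite (nw g Lg) -mulrA.
  rewrite ler_wpM2l ?Gload_bound_ge0//.
  have LZ := LfunZ (- c g) e1 L1; apply: le_trans (nrmD e1 LZ Lg) _.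
  rewrite (nrmZ _ e1 L1) nrm_cst// normr1 mulr1 normrN mulr2n mulrDl mul1r lerD2r.
  exact: le_norm_Rintegral.
have K20 : 0 <= K * 2 by rewrite mulr_ge0// Gload_bound_ge0.
have [h Lh Eh] := riesz_L1 (@leb_I_fin R) K20 Llin Lbnd.
have Lh1 := Linfty_Lfun e1 Lh.
(* The extended functional kills constants, so h has mean zero and its primitive vanishes at both
   ends. *)
have Ih : \int[lI]_x h x = 0.
  transitivity (L (cst 1)); first by rewrite Eh//; apply: eq_Rintegral => x _; rewrite mul1r.
  apply/eqP; rewrite -normr_le0; apply: le_trans (Gload_le (Wg _ L1).1) _.
  rewrite (nw _ L1) (_ : g0 (cst 1) = cst 0) ?nrm0 ?mulr0//.
  by apply/funext => t; rewrite /g0 /c I1; rewrite /cst; ring.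
pose hk := fun x => kappa^-1 * h x.
have Lhk : hk \in Lfun lI +oo%E by exact: LfunZ _ one_y Lh.
have Ihk : \int[lI]_x hk x = 0 by rewrite (RintZ _ Lh1) Ih mulr0.
have [W Ew] := W10_I_prim one_y Lhk Ihk; have [_ Lw _ _] := W10_I_repr one_y W.
exists (prim hk) => // zeta Wz; have [_ Lz Iz Ez] := W10_I_repr e1 Wz.
have -> : B_Gamma kappa (prim hk) zeta = \int[lI]_x (wderiv zeta x * h x).
  have Lzh := Lfun1_mul Lz Lh; have LI : (fun x => kappa^-1 * (wderiv zeta x * h x)) \in Lfun lI 1%E.
    exact: LfunZ _ e1 Lzh.
  rewrite /B_Gamma (_ : \int[lI]_x (_ * _) = kappa^-1 * \int[lI]_x (wderiv zeta x * h x)).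
    by rewrite mulrA divff ?mul1r// gt_eqF.
  rewrite -(RintZ _ Lzh); apply: Rint_ae_eq.
  - have LL := Lfun1_mul Lz Lw; apply: measurable_funM; [exact: Lfun_meas Lw|exact: Lfun_meas Lz].
  - exact: Lfun_meas LI.
  - by move/ae_eqP: Ew => Ew; apply/ae_eqP; apply: (ae_mono Ew) => x ->; rewrite /hk; ring.
apply: (etrans (esym (Eh _ Lz))); rewrite /L; have [Wz' _] := Wg _ Lz; move: Wz'.
rewrite (_ : g0 (wderiv zeta) = wderiv zeta) => [Wz'|]; last first.
  by apply/funext => t; rewrite /g0 /c Iz oppr0 mul0r add0r.
apply: (Gload_ae Wz' Wz).
by move/ae_eqP: Ez => Ez; apply/ae_eqP; apply: (ae_mono Ez) => x ->.
Qed.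

End Load.

Lemma B_Gamma_int gam zeta : W10_I +oo%E gam -> W10_I 1%E zeta ->
  (fun x => wderiv gam x * wderiv zeta x) \in Lfun lI 1%E.
Proof.
move=> W Wz; have [_ Lw _ _] := W10_I_repr one_y W.
have [_ Lz _ _] := W10_I_repr (lexx 1%E) Wz; have L := Lfun1_mul Lz Lw.
by rewrite (_ : (fun x => _) = (fun x => wderiv zeta x * wderiv gam x))//; apply/funext => x; rewrite mulrC.
Qed.

Lemma B_Gamma_diff gam1 gam2 zeta : W10_I +oo%E gam1 -> W10_I +oo%E gam2 -> W10_I 1%E zeta ->
  B_Gamma kappa (fun x => - 1 * gam2 x + gam1 x) zeta = B_Gamma kappa gam1 zeta - B_Gamma kappa gam2 zeta.
Proof.
move=> W1 W2 Wz; have I1 := B_Gamma_int W1 Wz; have I2 := B_Gamma_int W2 Wz.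
have I := B_Gamma_int (W10_I_lin (- 1) one_y W2 W1) Wz; have IB := LfunB (lexx 1%E) I1 I2.
rewrite /B_Gamma -mulrBr; congr (_ * _); rewrite -(RintB I1 I2).
have /ae_eqP E' := wderiv_lin (- 1) (is_wderivW W2) (is_wderivW W1).
apply: Rint_ae_eq; [exact: Lfun_meas I|exact: Lfun_meas IB|].
by apply/ae_eqP; apply: (ae_mono E') => x -> /=; ring.
Qed.

Lemma B_Gamma_wdist0 gam1 gam2 zeta : W10_I +oo%E gam1 -> W10_I +oo%E gam2 -> W10_I 1%E zeta ->
  wdist gam1 gam2 = 0 -> B_Gamma kappa gam1 zeta = B_Gamma kappa gam2 zeta.
Proof.
move=> W1 W2 Wz d0; have /ae_eqP E' := wdist0_wderiv W1 W2 d0.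
have I1 := B_Gamma_int W1 Wz; have I2 := B_Gamma_int W2 Wz.
apply: (f_equal (fun s : R => kappa * s)).
apply: Rint_ae_eq; [exact: Lfun_meas I1|exact: Lfun_meas I2|].
by apply/ae_eqP; apply: (ae_mono E') => x ->.
Qed.

Definition contraction_const : R := alpha * (C_E * C_A * (1 + beta * C_A) ^+ 2 * V).

(** Coefficient and solution are kept apart so that one estimate serves twice: as the contraction
    property of T, and, with gam' = gam, as uniqueness of states. *)
Lemma Gamma_diff gam1 gam2 gam1' gam2' y1 y2 : feasible gam1 -> feasible gam2 ->
  Ostate gam1 y1 -> Ostate gam2 y2 -> W10_I +oo%E gam1' -> W10_I +oo%E gam2' ->
  (forall zeta, W10_I 1%E zeta -> B_Gamma kappa gam1' zeta + Gfun gam1 y1 zeta =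
                                  B_Gamma kappa gam2' zeta + Gfun gam2 y2 zeta) ->
  wdist gam1' gam2' <= contraction_const * wdist gam1 gam2.
Proof.
move=> F1 F2 S1 S2 W1 W2 H.
have K0 : 0 <= C_E * C_A * (1 + beta * C_A) ^+ 2 * V * wdist gam1 gam2.
  exact: (mulr_ge0 (mulr_ge0 (mulr_ge0 (mulr_ge0 CE0 CA0) (sqr_ge0 _)) V0) (wdist_ge0 _ _)).
rewrite /contraction_const -mulrA; apply: (infsup_GammaP (W10_I_lin (- 1) one_y W2 W1) K0) => zeta Wz.
have -> := B_Gamma_diff W1 W2 Wz.
have -> : B_Gamma kappa gam1' zeta - B_Gamma kappa gam2' zeta = - (Gfun gam1 y1 zeta - Gfun gam2 y2 zeta).
  exact: sub_swap (H zeta Wz).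
apply: le_trans (ler_norm _) _; rewrite normrN.
exact: Gfun_diff.
Qed.

(** The gradients agree by [Ostate_diff], and Poincare recovers the functions. *)
Lemma Ostate_unique gam1 gam2 y1 y2 : feasible gam1 -> feasible gam2 -> Ostate gam1 y1 -> Ostate gam2 y2 ->
  wdist gam1 gam2 = 0 -> y1 = y2 %[ae lO].
Proof.
move=> F1 F2 S1 S2 d0; have := Ostate_diff F1 F2 S1 S2; rewrite d0 mulr0 mul0r mulr0 => N.
have W := W10_Omega_lin (- 1) (ltW p1) S2.1 S1.1; have [L _ Lg] := W1_Omega_gr (ltW p1) W.1.
have n0 : nrm lO p%:E (ydiff y1 y2) = 0.
  apply/eqP; rewrite eq_le nrm_ge0 andbT; apply: le_trans (poincare p1 W) _.
  exact: le_trans (nrm_gr_le 1 (ltW p1) Lg) N.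
have p0 : (0 < p%:E)%E by rewrite lte_fin (lt_trans ltr01).
have /ae_eqP H := nrm_eq0 p0 L n0; apply/ae_eqP; apply: (ae_mono H) => x.
by rewrite /ydiff mulN1r addrC => /eqP; rewrite subr_eq0 => /eqP.
Qed.

Lemma is_stateP u gam y : is_state kappa p q E v u (gam, y) <->
  [/\ feasible gam, Ostate gam y & forall zeta, W10_I 1%E zeta ->
    B_Gamma kappa gam zeta + Gfun gam y zeta = \int[lI]_x (u x * zeta x)].
Proof. by split => [[F W O G]|[F [W O] G]]; split => //. Qed.

Section Control.
Hypothesis hk : contraction_const < 1.

Let k0 : 0 <= contraction_const.
Proof. exact: (mulr_ge0 (ltW alpha0) (mulr_ge0 (mulr_ge0 (mulr_ge0 CE0 CA0) (sqr_ge0 _)) V0)). Qed.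

Lemma state_ex u : u \in Lfun lI 2%:E ->
  alpha * (nrm lI 2%:E u + C_E * C_A * (1 + beta * C_A) * V) <= 1 ->
  exists gy, is_state kappa p q E v u gy.
Proof.
move=> Lu hself.
(* Made total by an arbitrary pair outside the feasible set, so that the axiom of choice yields T
   together with the y belonging to it. *)
have stepex gam : exists gy : (R -> R) * (R * R -> R), feasible gam -> [/\ feasible gy.1, Ostate gam gy.2 &
    forall zeta, W10_I 1%E zeta -> B_Gamma kappa gy.1 zeta + Gfun gam gy.2 zeta = \int[lI]_x (u x * zeta x)].
  have [F|nF] := pselect (feasible gam); last by exists (cst 0, cst 0).
  have [y S] := Ostate_ex F; have [gam' W H] := solve_Gamma Lu F S; exists (gam', y) => _ /=; split; [|exact: S|].
    apply: feasibleP => //; apply: le_trans hself.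
    apply: (infsup_GammaP W (Gload_bound_ge0 u)) => zeta Wz; rewrite (H zeta Wz).
    exact: le_trans (ler_norm _) (Gload_le Lu F S Wz).
  by move=> zeta Wz; rewrite (H zeta Wz) /Gload subrK.
have [T HT] := choice stepex.
have k01 : 0 <= contraction_const < 1 by rewrite k0 hk.
have FT gam : feasible gam -> feasible (T gam).1 by move=> /HT[].
have [gam F d0] : exists2 gam, feasible gam & wdist (T gam).1 gam = 0.
  apply: (feasible_fixpoint (T := fun gam => (T gam).1) k01 FT) => gam1 gam2 F1 F2.
  have [F1' S1 H1] := HT _ F1; have [F2' S2 H2] := HT _ F2.
  apply: (Gamma_diff F1 F2 S1 S2 F1'.1 F2'.1) => zeta Wz.
  exact: (etrans (H1 zeta Wz) (esym (H2 zeta Wz))).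
(* The fixed point is one only at distance 0; the form on Gamma sees nothing but the derivative, so
   the equation for T gam holds for gam. *)
have [F' S H] := HT _ F; exists (gam, (T gam).2); apply/is_stateP.
split; [exact: F|exact: S|move=> zeta Wz].
exact: (etrans (f_equal (fun s : R => s + Gfun gam (T gam).2 zeta)
  (esym (B_Gamma_wdist0 F'.1 F.1 Wz d0))) (H zeta Wz)).
Qed.

(** The controls enter through their functionals, so this gives uniqueness for one control and also
    independence of its representative. *)
Lemma state_unique u1 u2 gy1 gy2 : (forall zeta, W10_I 1%E zeta ->
    \int[lI]_x (u1 x * zeta x) = \int[lI]_x (u2 x * zeta x)) ->
  is_state kappa p q E v u1 gy1 -> is_state kappa p q E v u2 gy2 -> same_state gy1 gy2.
Proof.
case: gy1 gy2 => [gam1 y1] [gam2 y2] Hu /is_stateP[F1 S1 H1] /is_stateP[F2 S2 H2].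
have D : wdist gam1 gam2 <= contraction_const * wdist gam1 gam2.
  apply: (Gamma_diff F1 F2 S1 S2 F1.1 F2.1) => zeta Wz.
  exact: (etrans (H1 zeta Wz) (etrans (Hu zeta Wz) (esym (H2 zeta Wz)))).
have d0 : wdist gam1 gam2 = 0.
  apply/eqP; rewrite eq_le wdist_ge0 andbT leNgt; apply/negP => dp.
  by move: D; rewrite -[leLHS]mul1r ler_pM2r// leNgt hk.
by split; [exact: wdist0_ae F1.1 F2.1 d0|exact: Ostate_unique F1 F2 S1 S2 d0].
Qed.

Lemma wdist_ae0 gam1 gam2 : W10_I +oo%E gam1 -> W10_I +oo%E gam2 -> gam1 = gam2 %[ae lI] ->
  wdist gam1 gam2 = 0.
Proof.
move=> W1 W2 gg; have [m2 _] := W10_meas W2; have /ae_eqP E' := wderiv_ae m2 gg (is_wderivW W1).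
have [_ L1 _ _] := W10_I_repr one_y W1; have [_ L2 _ _] := W10_I_repr one_y W2.
rewrite (wdistE W1 W2) (ae0_nrm (ltry 0) (Lfun_meas (LfunB one_y L1 L2)))//.
by apply/ae_eqP; apply: (ae_mono E') => x /= ->; rewrite subrr.
Qed.

Lemma state_injective u1 u2 gy1 gy2 : u1 \in Lfun lI 2%:E -> u2 \in Lfun lI 2%:E ->
  is_state kappa p q E v u1 gy1 -> is_state kappa p q E v u2 gy2 -> same_state gy1 gy2 ->
  u1 = u2 %[ae lI].
Proof.
move=> Lu1 Lu2; case: gy1 gy2 => [gam1 y1] [gam2 y2] /is_stateP[F1 S1 H1] /is_stateP[F2 S2 H2] [/= gg _].
have d0 := wdist_ae0 F1.1 F2.1 gg.
have Hu zeta : W10_I 1%E zeta -> \int[lI]_x (u1 x * zeta x) = \int[lI]_x (u2 x * zeta x).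
  move=> Wz; have EB := B_Gamma_wdist0 F1.1 F2.1 Wz d0.
  (* The Lipschitz bound of the coupling term vanishes with the distance. *)
  have EG : Gfun gam1 y1 zeta = Gfun gam2 y2 zeta.
    have := Gfun_diff F1 F2 S1 S2 Wz; rewrite d0 mulr0 mul0r normr_le0 subr_eq0 => /eqP.
    exact.
  exact: (etrans (esym (H1 zeta Wz)) (etrans (f_equal2 +%R EB EG) (H2 zeta Wz))).
have two1 : (1 <= 2%:E :> \bar R)%E by rewrite lee_fin ler1n.
have L1 := Lfun_sub1 (@leb_I_fin R) two1 Lu1; have L2 := Lfun_sub1 (@leb_I_fin R) two1 Lu2.
have LB := LfunB (lexx 1%E) L1 L2.
have /ae_eqP H : (u1 \- u2) = cst 0 %[ae lI].
  apply: (testfun1_vanish LB) => phi tphi; have [Lphi _] := testfun1_Linfty tphi.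
  have M1 := Lfun1_mul L1 Lphi; have M2 := Lfun1_mul L2 Lphi.
  have -> : \int[lI]_x ((u1 \- u2) x * phi x) = \int[lI]_x (u1 x * phi x - u2 x * phi x).
    by apply: eq_Rintegral => x _; rewrite /= mulrBl.
  rewrite (RintB M1 M2) Hu ?subrr//; exact: (testfun1_W10 (lexx 1%E) tphi).
by apply/ae_eqP; apply: (ae_mono H) => x /= /eqP; rewrite subr_eq0 => /eqP.
Qed.

End Control.
End StateSystem.

(** * Passing to the working form of the hypotheses *)

Section Reduction.
Context {R : realType}.

Lemma infsup_OmegaP (Q P beta r r' : R) gam : infsup_Omega Q P beta -> 0 <= beta -> 1 < r ->
  Q < r < P -> r^-1 + r'^-1 = 1 -> feasible gam -> infsup beta (coefA gam) r r'.
Proof.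
move=> H b0 r1 QrP rr' F y K Wy K0 HB.
have := H r r' QrP rr' gam F y Wy; rewrite (semi_OmegaE (ltW r1) Wy.1) => /le_trans Hs.
rewrite -lee_fin; apply: Hs; rewrite EFinM; apply: lee_wpmul2l; first by rewrite lee_fin.
apply: ub_ereal_sup => _ [z [Wz _] <-]; rewrite lee_fin.
rewrite -[fine _]/(nrmg r' z); have := HB z Wz; have := nrmg_ge0 r' z.
move: (nrmg r' z) (B_Omega _ _ _) => N B N0 HN.
(* A quotient by a vanishing seminorm is 0, and K is nonnegative. *)
have [->|Nn0] := eqVneq N 0; first by rewrite invr0 mulr0.
by rewrite ler_pdivrMr// lt_neqAle eq_sym Nn0.
Qed.

(* For K = 0 the hypothesis reads V <= 0, since 0^-1 = 0. *)
Lemma mul_le_of_le_div (K c V : R) : 0 <= K -> 0 <= c -> V <= c * K^-1 -> K * V <= c.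
Proof.
move=> K0 c0 H; have [->|Kn0] := eqVneq K 0; first by rewrite mul0r.
by rewrite mulrC -ler_pdivlMr// lt_neqAle eq_sym Kn0.
Qed.

End Reduction.

Theorem corollary4p6 (R : realType)
    (kappa C_A alpha Q P beta p q C_E theta1 theta2 : R)
    (E : (R -> R) -> R * R -> R) (v : R * R -> R)
    (kappa_gt0 : 0 < kappa)
    (hA : A_bound C_A)
    (alpha_gt0 : 0 < alpha) (hGamma : infsup_Gamma kappa alpha)
    (hQ : Q < 2) (hP : 2 < P) (hQP : Q^-1 + P^-1 = 1)
    (beta_gt0 : 0 < beta) (hOmega : infsup_Omega Q P beta)
    (hp : 2 < p < P) (hq : q = p / (p - 1))
    (hE : is_extension q C_E E) (hCE : 1 <= C_E)
    (htheta1 : beta * C_A / (1 + beta * C_A) < theta1 < 1)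
    (htheta2 : 0 < theta2 < 1)
    (hv : W1_Omega p v) (v_neq0 : semi_Omega p v != 0%E)
    (hv1 : (semi_Omega p v <=
      ((1 - theta1) * (alpha * C_E * C_A * (1 + beta * C_A))^-1)%:E)%E)
    (hv2 : (semi_Omega p v <=
      ((1 - theta2) * (alpha * C_E * C_A * (1 + beta * C_A) ^+ 2)^-1)%:E)%E) :
  let U := controls theta1 alpha in
  let G_v := control_to_state kappa p q E v in
  [/\ forall u, U u ->
        exists2 gy, is_state kappa p q E v u gy &
          forall gy', is_state kappa p q E v u gy' -> same_state gy' gy,
      forall u, U u -> is_state kappa p q E v u (G_v u),
      forall u1 u2, U u1 -> U u2 ->
        u1 = u2 %[ae leb_I] -> same_state (G_v u1) (G_v u2) &
      forall u1 u2, U u1 -> U u2 ->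
        same_state (G_v u1) (G_v u2) -> u1 = u2 %[ae leb_I]].
Proof.
move=> U G_v.
have /andP[p2 pP] := hp; have /andP[t2 t21] := htheta2; have /andP[_ t11] := htheta1.
have p1 : 1 < p by apply: lt_trans p2; rewrite ltr1n.
have p0 : 0 < p by exact: lt_trans p1.
have P0 : 0 < P by apply: lt_trans hP.
have pq : p^-1 + q^-1 = 1.
  by rewrite hq invf_div mulrBl divff ?gt_eqF// mul1r addrC subrK.
have [_ q1] := conjp_fin p1 pq.
have Q0 : 0 < Q.
  rewrite -invr_gt0 (_ : Q^-1 = 1 - P^-1); last by rewrite -hQP addrK.
  by rewrite subr_gt0 invf_lt1// (lt_trans _ hP)// ltr1n.
have QpP : Q < p < P by rewrite pP (lt_trans hQ p2).
have q0 : 0 < q by exact: lt_trans q1.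
(* Conjugation reverses the order: 2 < p < P becomes Q < q < 2, so the inf-sup condition also covers
   the exponent q. *)
have q2 : q < 2.
  rewrite -ltf_pV2 ?posrE// (_ : q^-1 = 1 - p^-1); last by rewrite -pq addrC addKr.
  have : p^-1 < 2^-1 by rewrite ltf_pV2 ?posrE.
  lra.
have Qq : Q < q.
  rewrite -ltf_pV2 ?posrE// (_ : q^-1 = 1 - p^-1); last by rewrite -pq addrC addKr.
  rewrite (_ : Q^-1 = 1 - P^-1); last by rewrite -hQP addrK.
  have : P^-1 < p^-1 by rewrite ltf_pV2 ?posrE.
  lra.
have QqP : Q < q < P by rewrite Qq (lt_trans q2 hP).
have isp gam : feasible gam -> infsup beta (coefA gam) p q.
  exact: (infsup_OmegaP hOmega (ltW beta_gt0) p1 QpP pq).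
have qp : q^-1 + p^-1 = 1 by rewrite addrC.
have isq gam : feasible gam -> infsup beta (coefA gam) q p.
  exact: (infsup_OmegaP hOmega (ltW beta_gt0) q1 QqP qp).
have CA0 := C_A_ge0 hA; have CE0 : 0 <= C_E by exact: le_trans hCE.
have b0 : 0 <= 1 + beta * C_A by rewrite addr_ge0// mulr_ge0// ltW.
have aEA : 0 <= alpha * C_E * C_A by rewrite !mulr_ge0// ltW.
move: hv1 hv2; rewrite (semi_OmegaE (ltW p1) hv) !lee_fin => V1 V2.
have K1 : alpha * C_E * C_A * (1 + beta * C_A) * nrmg p v <= 1 - theta1.
  by apply: mul_le_of_le_div V1; [exact: mulr_ge0|rewrite subr_ge0 ltW].
have K2 : alpha * C_E * C_A * (1 + beta * C_A) ^+ 2 * nrmg p v <= 1 - theta2.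
  by apply: mul_le_of_le_div V2; [exact: mulr_ge0 (sqr_ge0 _)|rewrite subr_ge0 ltW].
(* Strictness comes from theta2 > 0. *)
have hk : contraction_const C_A alpha beta p C_E v < 1.
  rewrite /contraction_const; apply: (@le_lt_trans _ _ (1 - theta2)); last by rewrite ltrBlDr ltrDl.
  by apply: le_trans K2; rewrite !mulrA.
have UL u : U u -> u \in Lfun leb_I 2%:E by case.
have self u : U u -> alpha * (nrm leb_I 2%:E u + C_E * C_A * (1 + beta * C_A) * nrmg p v) <= 1.
  case=> Lu; rewrite (nrmE Lu) lte_fin => /ltW Hu.
  have H1 : alpha * nrm leb_I 2%:E u <= theta1.
    by move: Hu; rewrite ler_pdivlMr// mulrC.
  have := lerD H1 K1; rewrite [X in _ <= X]addrC subrK; apply: le_trans.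
  by rewrite mulrDr !mulrA.
have ex u : U u -> exists gy, is_state kappa p q E v u gy.
  move=> Uu; exact: (state_ex kappa_gt0 hA alpha_gt0 beta_gt0 hGamma p1 pq isp isq hE hCE hv hk (UL u Uu) (self u Uu)).
have uniq u1 u2 gy1 gy2 := @state_unique R kappa C_A alpha beta p q C_E E v hA alpha_gt0 beta_gt0
  hGamma p1 pq isp hE hCE hv hk u1 u2 gy1 gy2.
have GS u : U u -> is_state kappa p q E v u (G_v u).
  by move=> Uu; have [gy S] := ex u Uu; apply: (@xgetPex _ _ [set gy | is_state kappa p q E v u gy]); exists gy.
split=> [u Uu|//|u1 u2 U1 U2 uu|u1 u2 U1 U2 ss].
- exists (G_v u); first exact: GS.
  by move=> gy' S'; apply: uniq S' (GS u Uu).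
(* The choice behind [G_v] is made per function; it descends to classes because equal classes define
   the same functional. *)
- apply: (uniq u1 u2 _ _ _ (GS u1 U1) (GS u2 U2)) => zeta Wz.
  have [L1 _] := u_int_le (UL _ U1) Wz; have [L2 _] := u_int_le (UL _ U2) Wz.
  apply: Rint_ae_eq; [exact: Lfun_meas L1|exact: Lfun_meas L2|].
  by move/ae_eqP: uu => uu; apply/ae_eqP; apply: (ae_mono uu) => x ->.
- exact: (state_injective hA beta_gt0 p1 pq isp hE hv (UL _ U1) (UL _ U2) (GS u1 U1) (GS u2 U2) ss).
Qed.
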